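(* Let $n,k\in\mathbb N$ and consider the system $$\dot x=\tfrac1k x^{k+1},\qquad \dot y=Ay+xf(x,y),\qquad (x,y)\in\mathbb C\times\mathbb C^n,$$ with $f$ a $\mathbb C^n$-valued function that is analytic near the origin, and $A=\Lambda+\Xi$ in Jordan normal form, where: (1) $\Lambda=\operatorname{diag}(\lambda_1,\ldots,\lambda_n)$ with all $\lambda_i\in\mathbb C$ nonzero; (2) $\Xi=0$ if $n=1$; if $n\ge2$, $(\Xi)_{i,j}=0$ for $j\neq i+1$ and $(\Xi)_{i,i+1}=\xi_i\in\{0,1\}$, where $\xi_i=1$ implies $\lambda_{i+1}=\lambda_i$ ($i\in\{1,\ldots,n-1\}$). Let $C>0$ be arbitrary and put $$\mathcal R=\mathcal R(C):=\{(i,\mathbf j)\in\{1,\ldots,n\}\times\mathbb N_0^n:\ |\lambda_i-\langle\mathbf j,\lambda\rangle|\le C(1+|\mathbf j|)\}.$$ Let $\theta$ be a complex direction such that for some $\xi>0$ small enough $$\lambda_i-\langle\mathbf j,\lambda\rangle\notin S(k\theta,\xi)\qquad\forall (i,\mathbf j)\notin\mathcal R.$$ Then there exist $R>0$, $\nu>0$ and $\alpha>0$, all small enough, and two analytic $\mathbb C^n$-valued functions $\phi=\phi(x,z)$ and $g=g(x,z)$ such that: (i) $\phi$ and $g$ are $k$-sums (in the direction $\theta$) of formal series $\widehat\phi$ and $\widehat g$, respectively; (ii) $\phi$ and $g$ are defined for $x\in\omega_k(\nu,\theta,\alpha)$, $z\in B^n(R)$; (iii) $\phi$ and $g$ extend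 continuously to the closure of the domain in (ii); and the following hold: 1. $g=(g_1,\ldots,g_n)$ has a convergent power series expansion $$g_i(x,z)=\sum_{\mathbf j:\,(i,\mathbf j)\in\mathcal R}g_{i,\mathbf j}(x)z^{\mathbf j},\qquad x\in\omega_k(\nu,\theta,\alpha),\ z\in B^n(R),\ i\in\{1,\ldots,n\}.$$ 2. The $x$-fibered diffeomorphism $(x,z)\mapsto(x,y)$ defined by $y=z+x\phi(x,z)$ locally conjugates the given system with $$\dot x=\tfrac1k x^{k+1},\qquad \dot z=Az+xg(x,z).$$
   Context: Notation: $\mathbb N_0=\mathbb N\cup\{0\}$, $|\mathbf j|=j_1+\cdots+j_n$ for $\mathbf j\in\mathbb N_0^n$, $\langle\mathbf s,\mathbf m\rangle=\sum_i s_im_i$, $\lambda=(\lambda_1,\ldots,\lambda_n)$, $z^{\mathbf j}=z_1^{j_1}\cdots z_n^{j_n}$. $|z|=\max_i|z_i|$; $B^n(r)$ is the open ball of radius $r$ centered at $0$ in $\mathbb C^n$ for this norm, $B(r)=B^1(r)$. Sectors (arguments modulo $2\pi$): $S(\theta,\alpha)=\{x\in\mathbb C:\ |\operatorname{Arg}(x)-\theta|<\alpha/2\}$, and $\omega_k(\nu,\theta,\alpha)=B(\nu)\cap S(\theta,\alpha+\pi/k)$. $k$-summability. For a formal series $\widehat h(x,z)=\sum_{\ell\ge1}h_\ell(z)x^\ell$ with $h_\ell$ analytic and bounded on $B^n(r)$, $\widehat h$ is Gevrey-$\frac1k$ if there are $K,T>0$ with $\sup_{B^n(r)}|h_\ell|\le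 KT^{\ell-1}\Gamma(\ell/k)$ for all $\ell\ge1$. Its Borel transform of order $k$ is $\mathcal B_k(\widehat h)(w,z)=\sum_{\ell\ge1}\frac{h_\ell(z)}{\Gamma(\ell/k)}w^{\ell-1}$, which converges near $w=0$ when $\widehat h$ is Gevrey-$\frac1k$. If $H=\mathcal B_k(\widehat h)$ can be analytically continued to $(w,z)\in S(\theta,\alpha)\times B^n(r)$ for some $\alpha\in(0,\pi)$, and if there are $\mu,C'>0$ with $|H(w,z)e^{-\mu^k|w|^k}|\le C'$ there, then $\widehat h$ is called $k$-summable in the direction $\theta$, and its $k$-sum is $$\mathcal L_{\theta,k}(H)(x,z)=\int_0^{\theta\infty}H(w,z)e^{-w^k/x^k}\,k\,dw,$$ (integration along the ray $\operatorname{Arg}w=\theta$), together with its analytic continuation in $x$ obtained by rotating the ray inside the sector. For vector-valued series this is applied componentwise. A formal series $h_0(z)+\sum_{\ell\ge1}h_\ell(z)x^\ell$ with $h_0$ analytic is called $k$-summable in the direction $\theta$ if $\sum_{\ell\ge1}h_\ell(z)x^\ell$ is, and its $k$-sum is $h_0$ plus the $k$-sum of the latter. *)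

(* Defs.v *)
From HB Require Import structures.
From mathcomp Require Import all_boot all_order all_algebra finmap.
From mathcomp Require Import complex.
From mathcomp Require Import all_classical all_reals all_analysis.
From mathcomp.analysis.showcase Require Import summability.

Set Implicit Arguments.
Unset Strict Implicit.
Unset Printing Implicit Defensive.

Import Order.TTheory GRing.Theory Num.Theory.
Import numFieldNormedType.Exports.

Local Open Scope classical_set_scope.
Local Open Scope ring_scope.

(* Stating [R[i]] at type [numClosedFieldType] lets it inherit the canonical
   topology and normed module structure of a [numFieldType]. Norms take values
   in [Cx R] itself, so they are compared with real bounds through [RtoC]. *)
Definition Cx (R : realType) : numClosedFieldType := R[i].
Definition RtoC (R : realType) (x : R) : Cx R := real_complex R x.
Definition ReC (R : realType) (z : Cx R) : R := complex.Re z.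
Definition ImC (R : realType) (z : Cx R) : R := complex.Im z.
Definition cis (R : realType) (t : R) : Cx R := Complex (cos t) (sin t).
Definition cexp (R : realType) (z : Cx R) : Cx R :=
  RtoC (expR (ReC z)) * cis (ImC z).

Definition Gamma (R : realType) (s : R) : R :=
  \int[lebesgue_measure]_(t in `]0, +oo[) (t `^ (s - 1) * expR (- t)).

(* Integral over the half-line of a complex-valued function. *)
Definition cintegral (R : realType) (F : R -> Cx R) : Cx R :=
  Complex (\int[lebesgue_measure]_(s in `]0, +oo[) ReC (F s))
          (\int[lebesgue_measure]_(s in `]0, +oo[) ImC (F s)).

(* The library norm on column vectors is the maximum norm. *)
Definition Bn (R : realType) (n : nat) (r : R) : set 'cV[Cx R]_n :=
  [set z | `|z| < RtoC r].

(* Letting [t] range over the reals takes arguments modulo 2 pi;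
   the vertex 0, which has no argument, is excluded. *)
Definition sector (R : realType) (theta alpha : R) : set (Cx R) :=
  [set x | x != 0 /\ exists t : R, `|t - theta| < alpha / 2 /\ x = `|x| * cis t].

Definition omega (R : realType) (k : nat) (nu theta alpha : R) : set (Cx R) :=
  [set x | `|x| < RtoC nu /\ sector theta (alpha + pi / k%:R) x].

Notation mindex n := {ffun 'I_n -> nat}.

Definition mdeg (n : nat) (j : mindex n) : nat := (\sum_(i < n) j i)%N.
Definition monom (R : realType) (n : nat) (j : mindex n) (z : 'cV[Cx R]_n)
  : Cx R := \prod_(i < n) z i 0 ^+ j i.
Definition dotm (R : realType) (n : nat) (j : mindex n) (lam : 'rV[Cx R]_n)
  : Cx R := \sum_(i < n) (j i)%:R * lam 0 i.

(* Unconditional summation: limit of the finite partial sums along the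
   directed set of finite index sets. *)
Definition has_sum (R : realType) (W : normedModType (Cx R)) (I : choiceType)
  (a : I -> W) (s : W) : Prop := partial_sum a @ totally --> s.

(* Local expansion in powers around every point of [D], for a family [mono]
   of monomials on [V]. *)
Definition analytic_wrt (R : realType) (V W : normedModType (Cx R))
    (I : choiceType) (mono : I -> V -> Cx R) (D : set V) (F : V -> W) : Prop :=
  forall p, D p -> exists c : I -> W,
    \forall q \near p, has_sum (fun j => mono j (q - p) *: c j) (F q).

Definition analytic_z (R : realType) (n : nat) (W : normedModType (Cx R))
    (D : set 'cV[Cx R]_n) (F : 'cV[Cx R]_n -> W) : Prop :=
  analytic_wrt (@monom R n) D F.

Definition monom_xz (R : realType) (n : nat) (a : nat * mindex n)
    (p : Cx R * 'cV[Cx R]_n) : Cx R := p.1 ^+ a.1 * monom a.2 p.2.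

Definition analytic_xz (R : realType) (n : nat) (W : normedModType (Cx R))
    (D : set (Cx R * 'cV[Cx R]_n)) (F : Cx R * 'cV[Cx R]_n -> W) : Prop :=
  analytic_wrt (@monom_xz R n) D F.

(* A formal series is given by its coefficients [h l z], [h 0] being the
   constant term, which the next two definitions ignore. *)
Definition gevrey (R : realType) (n k : nat) (r : R)
    (h : nat -> 'cV[Cx R]_n -> Cx R) : Prop :=
  exists K T : R, [/\ 0 < K, 0 < T & forall l z, (0 < l)%N -> Bn r z ->
    `|h l z| <= RtoC (K * T ^+ l.-1 * Gamma (l%:R / k%:R))].

(* [H] continues the Borel transform of order [k] from the part of the sector
   near [w = 0]; the series below is indexed by [l.+1], [l >= 0]. *)
Definition borel_continuation (R : realType) (n k : nat)
    (r theta alpha : R) (h : nat -> 'cV[Cx R]_n -> Cx R)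
    (H : Cx R * 'cV[Cx R]_n -> Cx R) : Prop :=
  analytic_xz (sector theta alpha `*` Bn r) H /\
  exists2 rho : R, 0 < rho &
    forall w z, `|w| < RtoC rho -> sector theta alpha w -> Bn r z ->
      series (fun l => h l.+1 z / RtoC (Gamma (l.+1%:R / k%:R)) * w ^+ l)
        @ \oo --> H (w, z).

(* [H], [alpha], [mu] witness that [h] is [k]-summable in the direction
   [theta]. Boundedness of [h l] for [l >= 1] is part of [gevrey]. *)
Definition k_summable_with (R : realType) (n k : nat) (r theta : R)
    (h : nat -> 'cV[Cx R]_n -> Cx R) (alpha mu : R)
    (H : Cx R * 'cV[Cx R]_n -> Cx R) : Prop :=
  [/\ forall l, analytic_z (Bn r) (h l),
      gevrey k r h,
      0 < alpha < pi,
      borel_continuation k r theta alpha h H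
    & 0 < mu /\ exists2 C' : R, 0 < C' &
        forall w z, sector theta alpha w -> Bn r z ->
          `|H (w, z) * cexp (- (RtoC mu ^+ k * `|w| ^+ k))| <= RtoC C'].

(* Parametrized by [w = s e^(i t)], [s > 0]. *)
Definition laplace (R : realType) (n k : nat) (t : R)
    (H : Cx R * 'cV[Cx R]_n -> Cx R) (x : Cx R) (z : 'cV[Cx R]_n) : Cx R :=
  cintegral (fun s : R => let w := RtoC s * cis t in
    H (w, z) * cexp (- (w ^+ k / x ^+ k)) * k%:R * cis t).

(* Points [x] at which the growth of [H] makes the Laplace integral along
   [Arg w = t] converge: [mu ^ k < Re ((e^(i t) / x) ^ k)]. This condition alone
   is invariant under multiplying [x] by a [k]-th root of unity, so the
   component around the ray itself is selected. *)
Definition laplace_domain (R : realType) (k : nat) (mu t : R) : set (Cx R) :=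
  [set x | exists rho tau : R, [/\ 0 < rho, x = RtoC rho * cis tau,
     `|tau - t| < pi / (2 * k%:R)
   & (mu * rho) ^+ k < cos (k%:R * (tau - t))]].

(* [phi] is on [D `*` Bn r] the [k]-sum of [h 0 + \sum_(l >= 1) h l x^l]: every
   [x] in [D] is reached by some ray inside the sector, and all rays
   that reach it give the value of [phi]. *)
Definition is_ksum (R : realType) (n k : nat) (r theta : R) (D : set (Cx R))
    (h : nat -> 'cV[Cx R]_n -> Cx R) (phi : Cx R * 'cV[Cx R]_n -> Cx R)
    : Prop :=
  exists alpha mu H, k_summable_with k r theta h alpha mu H /\
    forall x, D x ->
      (exists2 t, `|t - theta| < alpha / 2 & laplace_domain k mu t x) /\
      (forall t z, `|t - theta| < alpha / 2 -> laplace_domain k mu t x ->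
        Bn r z -> phi (x, z) = h 0%N z + laplace k t H x z).

Definition is_ksum_vec (R : realType) (n m k : nat) (r theta : R)
    (D : set (Cx R)) (h : nat -> 'cV[Cx R]_n -> 'cV[Cx R]_m)
    (phi : Cx R * 'cV[Cx R]_n -> 'cV[Cx R]_m) : Prop :=
  forall i : 'I_m,
    is_ksum k r theta D (fun l z => h l z i 0) (fun p => phi p i 0).

Definition extends_to_closure (T U : topologicalType) (D : set T) (F : T -> U)
    : Prop :=
  exists2 G : T -> U, {within closure D, continuous G} &
    forall p, D p -> G p = F p.

Definition near_resonant (R : realType) (n : nat) (c : R)
    (lam : 'rV[Cx R]_n) : set ('I_n * mindex n) :=
  [set ij | `|lam 0 ij.1 - dotm ij.2 lam| <= RtoC (c * (1 + (mdeg ij.2)%:R))].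

(* The vector field x' = x^(k+1) / k, y' = A y + x f(x, y). *)
Definition vfield (R : realType) (n k : nat) (A : 'M[Cx R]_n)
    (f : Cx R * 'cV[Cx R]_n -> 'cV[Cx R]_n) (p : Cx R * 'cV[Cx R]_n)
    : Cx R * 'cV[Cx R]_n :=
  (k%:R^-1 * p.1 ^+ k.+1, A *m p.2 + p.1 *: f p).

Definition fibered (R : realType) (n : nat)
    (phi : Cx R * 'cV[Cx R]_n -> 'cV[Cx R]_n) (p : Cx R * 'cV[Cx R]_n)
    : Cx R * 'cV[Cx R]_n :=
  (p.1, p.2 + p.1 *: phi p).

Definition diffeo_on (R : realType) (n : nat) (D : set (Cx R * 'cV[Cx R]_n))
    (Phi : Cx R * 'cV[Cx R]_n -> Cx R * 'cV[Cx R]_n) : Prop :=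
  [/\ analytic_xz D Phi, open (Phi @` D)
    & exists2 Psi, analytic_xz (Phi @` D) Psi &
        forall p, D p -> Psi (Phi p) = p].

(* [Phi] carries the field [X] on [D] to the field [Y]. *)
Definition conjugates_on (R : realType) (n : nat)
    (D : set (Cx R * 'cV[Cx R]_n))
    (Phi X Y : Cx R * 'cV[Cx R]_n -> Cx R * 'cV[Cx R]_n) : Prop :=
  forall p, D p -> differentiable Phi p /\ 'd Phi p (X p) = Y (Phi p).

(* Main.v *)
Require Import Defs.
From HB Require Import structures.
From mathcomp Require Import all_boot all_order all_algebra finmap.
From mathcomp Require Import complex.
From mathcomp Require Import all_classical all_reals all_analysis.
From mathcomp.analysis.showcase Require Import summability.
From mathcomp Require Import measurable_realfun ring lra.

Set Implicit Arguments.
Unset Strict Implicit.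
Unset Printing Implicit Defensive.

Import Order.TTheory GRing.Theory Num.Theory.
Import numFieldNormedType.Exports.

Local Open Scope classical_set_scope.
Local Open Scope ring_scope.

(** Put [y = z + x phi] into the conjugacy equation and divide by [x]. In component [i] it reads: L
    phi_i + g_i = f_i(x, z + x phi) - (D phi_i . Xi z - (Xi phi)_i + x D phi_i . g + x^k phi_i / k).
    On the coefficient of z^j the operator L is (1/k) x^(k+1) d/dx - a, with a = lam_i - <j, lam>.
    The Borel transform of order k turns (1/k) x^(k+1) d/dx into multiplication by w^k, so L becomes
    multiplication by w^k - a, and by -a on the constant term in x. For a near-resonant (i, j) the
    right-hand side is simply assigned to g. Otherwise |a| > C (1 + |j|) and a avoids a sector
    around k theta, while w^k stays in a narrower sector or in a small disc. Hence |w^k - a| is at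
    least a constant times 1 + |j| ([pow_sub_ge], [nonresonance_constants]). Division by it is
    bounded and gains the factor 1 / (1 + |j|), which pays for the derivative in z ([SN_dz]). There
    are no small divisors left, and the equation becomes a bounded fixed-point problem for E = L phi
    + g.

    The coefficients live in an algebra of pairs (constant term, Borel transform). A Borel transform
    is majorised by a nondecreasing function of |w|, and its size is the integral of that majorant
    against k exp(-p s^k). The product is the convolution of order k. In the coordinates s^k = x^k +
    y^k the product of two half-line integrals is one half-line integral ([quadrant_wedge],
    [cint_quadrant]). Therefore the size is multiplicative ([lap_cmaj], [conv_maj]) and each Laplace
    integral along an admissible ray is a bounded character ([LA_conv], [bchiM]). With p = q^k the
    element x has size 1/q.

    The fixed point is built with a bookkeeping variable epsilon that marks every occurrence of the
    unknown. The recursion in the epsilon-degree always has a solution ([recursion_fixpoint]), and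
    its size stays bounded because a ball is mapped into itself ([SN_mainop]). Geometrically
    decreasing weights tame the nilpotent part Xi, and a large q tames all terms containing x
    ([weight_constants]). Setting epsilon to 1 and applying the Laplace character gives functions
    that satisfy the differential equation ([solution_transport]) and are k-sums ([val_ksum]). The
    inverse of the change of variables comes from the same recursion ([inverse_series]).

    Complex analysis is done with power series on discs. Cauchy estimates come from averages over
    roots of unity ([cauchy_estimate]). Independence of the ray holds because the Laplace integral
    is analytic in a complex scaling of the ray and constant for real scalings ([LA_local],
    [ray_indep]). *)

(** * Real-valued norms over the complex field *)

Section Norm.
Variable R : realType.
Local Notation C := (Cx R).

(** The library norm is an element of [Cx R]; its real part is the same number seen in [R], where
    order arguments and [lra] are available. [nmE] goes back. *)
Definition nm (W : normedZmodType C) (w : W) : R := complex.Re `|w|.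

Lemma RtoC_le (a b : R) : (RtoC a <= RtoC b) = (a <= b).
Proof. exact: lecR. Qed.

Lemma RtoC_lt (a b : R) : (RtoC a < RtoC b) = (a < b).
Proof. exact: ltcR. Qed.

Lemma RtoCD (a b : R) : RtoC (a + b) = RtoC a + RtoC b.
Proof. exact: rmorphD. Qed.

Lemma RtoCM (a b : R) : RtoC (a * b) = RtoC a * RtoC b.
Proof. exact: rmorphM. Qed.

Lemma RtoCX (a : R) m : RtoC (a ^+ m) = RtoC a ^+ m.
Proof. exact: rmorphXn. Qed.

Lemma RtoCV (a : R) : RtoC a^-1 = (RtoC a)^-1.
Proof. exact: fmorphV. Qed.

Lemma RtoC0 : RtoC 0 = 0 :> C.
Proof. exact: rmorph0. Qed.

Lemma RtoC1 : RtoC 1 = 1 :> C.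
Proof. exact: rmorph1. Qed.

Lemma RtoC_nat m : RtoC m%:R = m%:R :> C.
Proof. exact: rmorph_nat. Qed.

Lemma RtoC_inj : injective (@RtoC R).
Proof. exact: complexI. Qed.

Lemma RtoC_sum (I : Type) (r : seq I) (P : pred I) (F : I -> R) :
  RtoC (\sum_(i <- r | P i) F i) = \sum_(i <- r | P i) RtoC (F i).
Proof. exact: rmorph_sum. Qed.

Lemma nmE (W : normedZmodType C) (w : W) : `|w| = RtoC (nm w).
Proof. by rewrite /nm /RtoC RRe_real // ger0_real. Qed.

Lemma nm_ge0 (W : normedZmodType C) (w : W) : 0 <= nm w.
Proof. by rewrite -RtoC_le -nmE normr_ge0. Qed.

Lemma nm_le (W : normedZmodType C) (w : W) r : (`|w| <= RtoC r) = (nm w <= r).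
Proof. by rewrite nmE RtoC_le. Qed.

Lemma nm_lt (W : normedZmodType C) (w : W) r : (`|w| < RtoC r) = (nm w < r).
Proof. by rewrite nmE RtoC_lt. Qed.

Lemma nmD (W : normedZmodType C) (v w : W) : nm (v + w) <= nm v + nm w.
Proof. by rewrite -RtoC_le RtoCD -!nmE ler_normD. Qed.

Lemma nm0 (W : normedZmodType C) : nm (0 : W) = 0.
Proof. by rewrite /nm normr0. Qed.

Lemma nmN (W : normedZmodType C) (w : W) : nm (- w) = nm w.
Proof. by rewrite /nm normrN. Qed.

Lemma nmB (W : normedZmodType C) (v w : W) : nm (v - w) <= nm v + nm w.
Proof. by rewrite -(nmN w) nmD. Qed.

Lemma nm_distC (W : normedZmodType C) (v w : W) : nm (v - w) = nm (w - v).
Proof. by rewrite -nmN opprB. Qed.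

Lemma nm_eq0 (W : normedZmodType C) (w : W) : nm w <= 0 -> w = 0.
Proof.
move=> h; apply/eqP; rewrite -normr_eq0 nmE.
have -> : nm w = 0 by apply/eqP; rewrite eq_le h nm_ge0.
by rewrite RtoC0.
Qed.

Lemma nm_sum (W : normedZmodType C) (I : Type) (r : seq I) (P : pred I) (F : I -> W) :
  nm (\sum_(i <- r | P i) F i) <= \sum_(i <- r | P i) nm (F i).
Proof.
elim/big_rec2: _ => [|i a w _ h]; first by rewrite nm0.
exact: le_trans (nmD _ _) (lerD (lexx _) h).
Qed.

Lemma nmZ (W : normedModType C) (c : C) (w : W) : nm (c *: w) = nm c * nm w.
Proof. by apply: RtoC_inj; rewrite RtoCM -!nmE normrZ. Qed.

Lemma nmM (a b : C) : nm (a * b) = nm a * nm b.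
Proof. by apply: RtoC_inj; rewrite RtoCM -!nmE normrM. Qed.

Lemma nm1 : nm (1 : C) = 1.
Proof. by rewrite /nm normr1. Qed.

Lemma nmX (a : C) m : nm (a ^+ m) = nm a ^+ m.
Proof. by elim: m => [|m IH]; rewrite ?expr0 ?nm1 // !exprS nmM IH. Qed.

Lemma nmV (a : C) : nm a^-1 = (nm a)^-1.
Proof. by apply: RtoC_inj; rewrite RtoCV -!nmE normfV. Qed.

Lemma nm_RtoC (a : R) : nm (RtoC a) = `|a|.
Proof. by rewrite /nm normc_def /RtoC /= expr0n /= addr0 sqrtr_sqr. Qed.

Lemma nm_nat (m : nat) : nm (m%:R : C) = m%:R.
Proof. by rewrite -RtoC_nat nm_RtoC ger0_norm. Qed.

Lemma nm_prod (I : Type) (r : seq I) (P : pred I) (F : I -> C) :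
  nm (\prod_(i <- r | P i) F i) = \prod_(i <- r | P i) nm (F i).
Proof.
elim/big_rec2: _ => [|i x y _ <-]; first exact: nm1.
by rewrite nmM.
Qed.

Lemma nm_Re (z : C) : `|ReC z| <= nm z.
Proof. by rewrite -RtoC_le -nmE; exact: normc_ge_Re. Qed.

Lemma nm_Im (z : C) : `|ImC z| <= nm z.
Proof.
have -> : ImC z = ReC ('i%C * - z).
  by rewrite /ReC /ImC mulrC ReiNIm; case: z => a b /=; rewrite opprK.
apply: le_trans (nm_Re _) _; rewrite nmM nmN.
suff -> : nm ('i%C : C) = 1 by rewrite mul1r.
by rewrite /nm normc_def /= expr0n /= add0r expr1n sqrtr1.
Qed.

Lemma nm_ReIm (z : C) : nm z <= `|ReC z| + `|ImC z|.
Proof.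
have -> : z = RtoC (ReC z) + 'i%C * RtoC (ImC z) by exact: complexE.
have ni : nm ('i%C : C) = 1 by rewrite /nm normc_def /= expr0n /= add0r expr1n sqrtr1.
apply: le_trans (nmD _ _) _; rewrite nmM ni mul1r !nm_RtoC.
by rewrite -(complexE z).
Qed.

Lemma nm_sqr (z : C) : nm z ^+ 2 = ReC z ^+ 2 + ImC z ^+ 2.
Proof.
by apply: RtoC_inj; rewrite RtoCX -nmE -add_Re2_Im2.
Qed.

Lemma nm_cis (t : R) : nm (cis t) = 1.
Proof. by rewrite /nm normc_def /cis /= cos2Dsin2 sqrtr1. Qed.

Lemma cisD (s t : R) : cis (s + t) = cis s * cis t.
Proof. by rewrite /cis cosD sinD; apply/eqP; rewrite eq_complex /=; apply/andP; split; apply/eqP; ring. Qed.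

Lemma cis0 : cis 0 = 1 :> C.
Proof. by rewrite /cis cos0 sin0. Qed.

Lemma cis_neq0 (t : R) : cis t != 0.
Proof. by apply/eqP => h; have := nm_cis t; rewrite h nm0 => /esym/eqP; rewrite oner_eq0. Qed.

Lemma cisN (t : R) : cis (- t) = (cis t)^-1.
Proof.
apply: (mulfI (cis_neq0 t)); rewrite -cisD subrr cis0 divff //; exact: cis_neq0.
Qed.

Lemma cisX (t : R) m : cis t ^+ m = cis (m%:R * t).
Proof.
elim: m => [|m IH]; first by rewrite expr0 mul0r cis0.
by rewrite exprS IH -cisD -natr1; congr cis; ring.
Qed.

Lemma nm_gt0 (W : normedZmodType C) (w : W) : w != 0 -> 0 < nm w.
Proof. by move=> w0; rewrite lt_neqAle nm_ge0 andbT eq_sym; apply: contraNneq w0 => h; rewrite (@nm_eq0 _ w) // h. Qed.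

Lemma nbhs_nmP (W : normedModType C) (p : W) (P : set W) :
  nbhs p P <-> exists2 e : R, 0 < e & forall q, nm (q - p) < e -> P q.
Proof.
split=> [/nbhs_ballP[e /= e0 h]|[e e0 h]].
  have er : e = RtoC (complex.Re e) by rewrite /RtoC RRe_real // ger0_real // ltW.
  exists (complex.Re e); first by rewrite -RtoC_lt -er.
  by move=> q hq; apply: h; rewrite -ball_normE /= er distrC nm_lt.
apply/nbhs_ballP; exists (RtoC e) => /=; first by rewrite -RtoC0 RtoC_lt.
by move=> q; rewrite -ball_normE /= distrC nm_lt; exact: h.
Qed.

End Norm.

                           

(** * Unconditional sums and absolute summability *)

Section Sums.
Variable R : realType.
Local Notation C := (Cx R).

Lemma big_uniq_sub (V : nmodType) (I : eqType) (F : I -> V) (J J' : seq I) :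
  uniq J -> uniq J' -> {subset J <= J'} ->
  \sum_(i <- J') F i = \sum_(i <- J) F i + \sum_(i <- [seq i <- J' | i \notin J]) F i.
Proof.
move=> uJ uJ' JJ'; rewrite (bigID (mem J)) /= -big_filter -[X in _ + X = _]big_filter; congr (_ + _).
apply: perm_big; apply: uniq_perm => //; first exact: filter_uniq.
by move=> i; rewrite mem_filter; apply/andb_idr => /JJ'.
Qed.

Lemma ler_sum_sub (I : eqType) (F : I -> R) (J J' : seq I) :
  (forall i, 0 <= F i) -> uniq J -> uniq J' -> {subset J <= J'} ->
  \sum_(i <- J) F i <= \sum_(i <- J') F i.
Proof.
move=> F0 uJ uJ' JJ'; rewrite (big_uniq_sub F uJ uJ' JJ') lerDl.
by apply: sumr_ge0.
Qed.

(** Absolute summability as one bound on all finite subsums, so that estimates never mention the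
    value of an infinite sum. *)
Definition sbd (I : eqType) (a : I -> R) (M : R) :=
  forall J, uniq J -> \sum_(i <- J) a i <= M.

(** Epsilon form of convergence along finite index sets, with duplicate-free lists in place of
    finite sets; [hs_has_sum] identifies it with [has_sum]. *)
Definition hs (W : normedZmodType C) (I : choiceType) (a : I -> W) (s : W) :=
  forall e : R, 0 < e -> exists J : seq I, forall J', uniq J' ->
    {subset J <= J'} -> nm (\sum_(i <- J') a i - s) < e.

Lemma hs_has_sum (W : normedModType C) (I : choiceType) (a : I -> W) s :
  hs a s <-> has_sum a s.
Proof.
have E (J : {fset I}) : partial_sum a J = \sum_(i <- J) a i.
  by rewrite /partial_sum big_seq_fsetE.
split=> [h|h].
  have FF := @totally_filter I; apply/cvg_ballP => e e0.
  have er : e = RtoC (complex.Re e) by rewrite /RtoC RRe_real // ger0_real // ltW.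
  have [|J hJ] := h (complex.Re e); first by rewrite -RtoC_lt -er.
  exists [fset x in J]%fset => //= K /= /fsubsetP JK.
  rewrite -ball_normE /= er distrC nm_lt E; apply: hJ => // i iJ.
  by apply: JK; rewrite inE.
move=> e e0; have FF := @totally_filter I; have /cvg_ballP/(_ (RtoC e)) := h.
rewrite -[0]RtoC0 RtoC_lt => /(_ e0)[J _ hJ].
exists (enum_fset J) => J' uJ' JJ'.
have := hJ [fset x in J']%fset.
have JJ : (J `<=` [fset x in J'])%fset by apply/fsubsetP => i /JJ'; rewrite inE.
move=> /(_ JJ); rewrite -ball_normE /= distrC nm_lt E.
suff -> : \sum_(i <- [fset x in J']%fset) a i = \sum_(i <- J') a i by [].
apply: perm_big; apply: uniq_perm => //= i.
by rewrite inE.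
Qed.

Lemma hs_uniq (W : normedZmodType C) (I : choiceType) (a : I -> W) s t :
  hs a s -> hs a t -> s = t.
Proof.
move=> hs1 ht1; apply/eqP; rewrite -subr_eq0; apply/eqP/nm_eq0.
apply/ler_addgt0Pr => e e0; rewrite add0r.
have e2 : 0 < e / 2 by rewrite divr_gt0.
have [J1 h1] := hs1 _ e2; have [J2 h2] := ht1 _ e2.
have uJ : uniq (undup (J1 ++ J2)) by exact: undup_uniq.
have /h1 {}h1 := uJ; have /h2 {}h2 := uJ.
have s1 : {subset J1 <= undup (J1 ++ J2)}.
  by move=> i; rewrite mem_undup mem_cat => ->.
have s2 : {subset J2 <= undup (J1 ++ J2)}.
  by move=> i; rewrite mem_undup mem_cat => ->; rewrite orbT.
have := h1 s1; have := h2 s2.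
set S := \sum_(_ <- _) _ => a1 a2.
have -> : s - t = - (S - s) + (S - t) by rewrite opprB addrA subrK.
apply: le_trans (nmD _ _) _; rewrite nmN; lra.
Qed.

Lemma eq_hs (W : normedZmodType C) (I : choiceType) (a b : I -> W) s :
  a =1 b -> hs a s -> hs b s.
Proof.
move=> ab h e /h[J hJ]; exists J => J' uJ' /(hJ _ uJ').
by rewrite (eq_bigr b).
Qed.

Lemma hs0 (W : normedZmodType C) (I : choiceType) : hs (fun _ : I => 0 : W) 0.
Proof. by move=> e e0; exists [::] => J' _ _; rewrite big1 // subr0 nm0. Qed.

Lemma hs_add (W : normedZmodType C) (I : choiceType) (a b : I -> W) s t :
  hs a s -> hs b t -> hs (fun i => a i + b i) (s + t).
Proof.
move=> ha hb e e0; have e2 : 0 < e / 2 by rewrite divr_gt0.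
have [J1 h1] := ha _ e2; have [J2 h2] := hb _ e2.
exists (J1 ++ J2) => J' uJ' JJ'; rewrite big_split /= opprD addrACA.
have := h1 _ uJ'; have := h2 _ uJ' => a1 a2.
apply: le_lt_trans (nmD _ _) _.
have {}a1 : nm (\sum_(i <- J') b i - t) < e / 2.
  by apply: a1 => i iJ; apply: JJ'; rewrite mem_cat iJ orbT.
have {}a2 : nm (\sum_(i <- J') a i - s) < e / 2.
  by apply: a2 => i iJ; apply: JJ'; rewrite mem_cat iJ.
lra.
Qed.

Lemma hs_lin (V W : normedZmodType C) (I : choiceType) (L : {additive V -> W}) (K : R)
    (a : I -> V) s :
  (forall v, nm (L v) <= K * nm v) -> hs a s -> hs (fun i => L (a i)) (L s).
Proof.
move=> hL ha e e0.
have K0 : 0 < `|K| + 1 by rewrite ltr_wpDl.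
have [|J hJ] := ha (e / (`|K| + 1)); first by rewrite divr_gt0.
exists J => J' uJ' /(hJ _ uJ') h; rewrite -raddf_sum -raddfB.
apply: le_lt_trans (hL _) _.
have : nm (\sum_(i <- J') a i - s) * (`|K| + 1) < e by rewrite -ltr_pdivlMr.
apply: le_lt_trans; rewrite mulrC ler_wpM2l ?nm_ge0 //.
by apply: le_trans (ler_norm _) _; rewrite lerDl.
Qed.

Lemma hs_Ml (I : choiceType) (c : C) (a : I -> C) s :
  hs a s -> hs (fun i => c * a i) (c * s).
Proof.
by move=> h; apply: (@hs_lin _ _ _ (GRing.mull_fun c idfun) (nm c) a s) => // v; rewrite /= nmM.
Qed.

Lemma hs_Z (W : normedModType C) (I : choiceType) (a : I -> C) s (w : W) :
  hs a s -> hs (fun i => a i *: w) (s *: w).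
Proof.
move=> ha e e0; have K0 : 0 < nm w + 1 by rewrite ltr_wpDl ?nm_ge0.
have [|J hJ] := ha (e / (nm w + 1)); first by rewrite divr_gt0.
exists J => J' uJ' /(hJ _ uJ') h; rewrite -scaler_suml -scalerBl nmZ.
move: h; rewrite ltr_pdivlMr //; apply: le_lt_trans.
by rewrite ler_wpM2l ?nm_ge0 // lerDl.
Qed.

Lemma hs_sum (W : normedZmodType C) (I : choiceType) (T : Type) (r : seq T)
    (a : T -> I -> W) (s : T -> W) :
  (forall t, hs (a t) (s t)) ->
  hs (fun i => \sum_(t <- r) a t i) (\sum_(t <- r) s t).
Proof.
move=> h; elim: r => [|t r IH].
  by rewrite big_nil; apply: eq_hs (hs0 _ _) => i; rewrite big_nil.
rewrite big_cons; apply: eq_hs (hs_add (h t) IH) => i.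
by rewrite big_cons.
Qed.

Lemma hs_fin (W : normedZmodType C) (I : choiceType) (J : seq I) (a : I -> W) :
  uniq J -> (forall i, i \notin J -> a i = 0) -> hs a (\sum_(i <- J) a i).
Proof.
move=> uJ h e e0; exists J => J' uJ' JJ'.
rewrite (big_uniq_sub a uJ uJ' JJ') addrC addKr big1_seq ?nm0 // => i.
by rewrite mem_filter => /andP[_ /andP[/h]].
Qed.

Lemma hs_delta (W : normedZmodType C) (I : choiceType) (i0 : I) (w : W) :
  hs (fun i => if i == i0 then w else 0) w.
Proof.
have := @hs_fin W I [:: i0] (fun i => if i == i0 then w else 0) isT.
rewrite big_seq1 eqxx; apply=> i; rewrite inE; by case: eqP.
Qed.

Lemma sbd_ge0 (I : eqType) (a : I -> R) M : sbd a M -> 0 <= M.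
Proof. by move=> /(_ [::] isT); rewrite big_nil. Qed.

Lemma sbd_le (I : eqType) (a b : I -> R) M N :
  (forall i, a i <= b i) -> M <= N -> sbd b M -> sbd a N.
Proof.
move=> ab MN h J /h/le_trans h1; apply: le_trans (h1 _ MN).
exact: ler_sum.
Qed.

Lemma sbd_term (I : eqType) (a : I -> R) M i : sbd a M -> a i <= M.
Proof. by move=> /(_ [:: i] isT); rewrite big_seq1. Qed.

Lemma sbdD (I : eqType) (a b : I -> R) M N :
  sbd a M -> sbd b N -> sbd (fun i => a i + b i) (M + N).
Proof. by move=> ha hb J uJ; rewrite big_split lerD ?ha ?hb. Qed.

Lemma sbdZ (I : eqType) (a : I -> R) c M :
  0 <= c -> sbd a M -> sbd (fun i => c * a i) (c * M).
Proof. by move=> c0 ha J uJ; rewrite -mulr_sumr ler_wpM2l ?ha. Qed.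

Lemma sbd_sum (I : eqType) (T : Type) (r : seq T) (a : T -> I -> R) (M : T -> R) :
  (forall t, sbd (a t) (M t)) ->
  sbd (fun i => \sum_(t <- r) a t i) (\sum_(t <- r) M t).
Proof.
move=> h J uJ; rewrite exchange_big /=.
by apply: ler_sum => t _; exact: h.
Qed.

(** The finite subsums have a supremum; a list coming within [e] of it leaves at most [e] for any
    list disjoint from it. *)
Lemma sbd_tail (I : eqType) (a : I -> R) M e : (forall i, 0 <= a i) ->
  sbd a M -> 0 < e -> exists2 J : seq I, uniq J & forall J', uniq J' ->
    (forall i, i \in J' -> i \notin J) -> \sum_(i <- J') a i <= e.
Proof.
move=> a0 ha e0.
pose S := [set x | exists2 J : seq I, uniq J & x = \sum_(i <- J) a i].
have S0 : has_sup S.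
  split; first by exists (\sum_(i <- [::]) a i); exists [::].
  by exists M => x [J uJ ->]; exact: ha.
have [x [J uJ ->] hx] := sup_adherent e0 S0.
exists J => // J' uJ' JJ'.
have : \sum_(i <- J ++ J') a i <= sup S.
  apply: sup_upper_bound => //; exists (J ++ J') => //.
  rewrite cat_uniq uJ uJ' andbT /=; apply/hasPn => i; exact: JJ'.
rewrite big_cat /=; lra.
Qed.

Lemma hs_ex_ge0 (I : choiceType) (a : I -> R) M : (forall i, 0 <= a i) ->
  sbd a M -> exists s : R, hs (fun i => RtoC (a i)) (RtoC s).
Proof.
move=> a0 ha.
pose S := [set x | exists2 J : seq I, uniq J & x = \sum_(i <- J) a i].
have S0 : has_sup S.
  split; first by exists (\sum_(i <- [::]) a i); exists [::].
  by exists M => x [J uJ ->]; exact: ha.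
exists (sup S) => e e0.
have [x [J uJ ->] hx] := sup_adherent e0 S0.
exists J => J' uJ' JJ'.
rewrite -RtoC_sum (_ : _ - _ = RtoC (\sum_(i <- J') a i - sup S)); last first.
  by rewrite /RtoC rmorphB.
have le1 := ler_sum_sub a0 uJ uJ' JJ'.
have le2 : \sum_(i <- J') a i <= sup S.
  by apply: sup_upper_bound => //; exists J'.
rewrite nm_RtoC ler0_norm; lra.
Qed.

Lemma hs_le (W : normedZmodType C) (I : choiceType) (a : I -> W) s M :
  hs a s -> sbd (fun i => nm (a i)) M -> nm s <= M.
Proof.
move=> h hM; apply/ler_addgt0Pr => e e0.
have [J hJ] := h _ e0.
have /hJ := undup_uniq J.
have sJ : {subset J <= undup J} by move=> i; rewrite mem_undup.
move=> /(_ sJ); set S := \sum_(_ <- _) _ => h1.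
have -> : s = S - (S - s) by rewrite opprB addrC subrK.
apply: le_trans (nmB _ _) _; apply: lerD; last exact: ltW.
by apply: le_trans (nm_sum _ _ _) _; exact: hM (undup_uniq _).
Qed.

(** Completeness: the positive and negative parts of [ReC] and [ImC] are nonnegative families
    bounded by [nm], and each of them sums to the supremum of its finite subsums. *)
Lemma hs_ex (I : choiceType) (a : I -> C) M :
  sbd (fun i => nm (a i)) M -> exists2 s, hs a s & nm s <= M.
Proof.
move=> h.
have P (p : C -> R) : (forall z, `|p z| <= nm z) ->
    exists s : C, hs (fun i => RtoC (p (a i))) s.
  move=> hp.
  have [||s1 h1] := @hs_ex_ge0 I (fun i => Num.max (p (a i)) 0) M.
  - by move=> i; rewrite le_max lexx orbT.
  - apply: sbd_le (lexx _) h => i; rewrite ge_max nm_ge0 andbT.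
    by apply: le_trans (hp _); exact: ler_norm.
  have [||s2 h2] := @hs_ex_ge0 I (fun i => Num.max (- p (a i)) 0) M.
  - by move=> i; rewrite le_max lexx orbT.
  - apply: sbd_le (lexx _) h => i; rewrite ge_max nm_ge0 andbT.
    by apply: le_trans (hp _); rewrite -normrN; exact: ler_norm.
  exists (RtoC s1 + (-1) * RtoC s2).
  apply: eq_hs (hs_add h1 (hs_Ml (-1) h2)) => i.
  rewrite mulN1r; have <- : RtoC (Num.max (p (a i)) 0 - Num.max (- p (a i)) 0) =
     RtoC (Num.max (p (a i)) 0) - RtoC (Num.max (- p (a i)) 0) by exact: rmorphB.
  congr RtoC; case: (lerP 0 (p (a i))) => h3.
    by rewrite [X in _ - X]max_r ?oppr_le0 // subr0.
  by rewrite [X in _ - X]max_l ?sub0r ?opprK // oppr_ge0 ltW.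
have [s1 h1] := P (@ReC R) (@nm_Re R).
have [s2 h2] := P (@ImC R) (@nm_Im R).
have hh : hs a (s1 + 'i%C * s2).
  apply: eq_hs (hs_add h1 (hs_Ml 'i%C h2)) => i.
  by rewrite [RHS]complexE.
by exists (s1 + 'i%C * s2) => //; exact: hs_le hh h.
Qed.

(** Over the complex numbers unconditional convergence forces absolute convergence, so bounds can be
    read off any convergent expansion. *)
Lemma hs_sbd (I : choiceType) (a : I -> C) s :
  hs a s -> exists M, sbd (fun i => nm (a i)) M.
Proof.
move=> h; have [J0 hJ0] := h 1 ltr01.
pose J := undup J0.
have uJ : uniq J by exact: undup_uniq.
have J0J : {subset J0 <= J} by move=> i; rewrite mem_undup.
(* Two finite sums containing [J0] are both within 1 of [s], so a sum over a list disjoint from [J]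
   is at most 2. Separating the signs of one real coordinate gives 4 per coordinate, hence 8 in
   total. *)
have D (K : seq I) : uniq K -> (forall i, i \in K -> i \notin J) ->
    nm (\sum_(i <- K) a i) <= 2.
  move=> uK dK.
  have u : uniq (J ++ K).
    rewrite cat_uniq uJ uK andbT /=; apply/hasPn => i; exact: dK.
  have h1 : nm (\sum_(i <- J ++ K) a i - s) < 1.
    by apply: hJ0 => // i /J0J; rewrite mem_cat => ->.
  have h2 : nm (\sum_(i <- J) a i - s) < 1 by exact: hJ0.
  have -> : \sum_(i <- K) a i = (\sum_(i <- J ++ K) a i - s) - (\sum_(i <- J) a i - s).
    by rewrite big_cat /= opprB addrA subrK addrC addKr.
  by apply: le_trans (nmB _ _) _; lra.
have P (p : {additive C -> R}) (K : seq I) : (forall z, `|p z| <= nm z) ->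
   uniq K -> (forall i, i \in K -> i \notin J) -> \sum_(i <- K) `|p (a i)| <= 4.
  move=> hp uK dK.
  rewrite (bigID (fun i => 0 <= p (a i))) /=.
  have A1 : \sum_(i <- K | 0 <= p (a i)) `|p (a i)| <= 2.
    rewrite (eq_bigr (fun i => p (a i))); last by move=> i /ger0_norm.
    rewrite -raddf_sum; apply: le_trans (ler_norm _) _; apply: le_trans (hp _) _.
    rewrite -big_filter; apply: D; first exact: filter_uniq.
    by move=> i; rewrite mem_filter => /andP[_ /dK].
  have A2 : \sum_(i <- K | ~~ (0 <= p (a i))) `|p (a i)| <= 2.
    rewrite (eq_bigr (fun i => - p (a i))); last first.
      by move=> i; rewrite -ltNge => /ltW/ler0_norm.
    rewrite sumrN -raddf_sum; apply: le_trans (ler_norm _) _.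
    rewrite normrN; apply: le_trans (hp _) _.
    rewrite -big_filter; apply: D; first exact: filter_uniq.
    by move=> i; rewrite mem_filter => /andP[_ /dK].
  lra.
exists (\sum_(i <- J) nm (a i) + 8) => K uK.
rewrite (bigID (mem J)) /= -big_filter -[X in _ + X <= _]big_filter; apply: lerD.
  apply: ler_sum_sub => //; first by move=> i; exact: nm_ge0.
    exact: filter_uniq.
  by move=> i; rewrite mem_filter => /andP[].
set K' := [seq i <- K | _].
have uK' : uniq K' by exact: filter_uniq.
have dK' : forall i, i \in K' -> i \notin J by move=> i; rewrite mem_filter => /andP[].
apply: le_trans (_ : \sum_(i <- K') (`|ReC (a i)| + `|ImC (a i)|) <= _).
  by apply: ler_sum => i _; exact: nm_ReIm.
rewrite big_split /=.
have r1 := P (@complex.Re R : {additive Cx R -> R}) K' (@nm_Re R) uK' dK'.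
have r2 := P (@complex.Im R : {additive Cx R -> R}) K' (@nm_Im R) uK' dK'.
rewrite (_ : 8 = 4 + 4); last by lra.
exact: lerD r1 r2.
Qed.

End Sums.

(** * Regrouping, products and reindexing of sums *)

Section Fubini.
Variable R : realType.
Local Notation C := (Cx R).

Lemma hs_mask_sum (W : normedZmodType C) (T T' : choiceType) (pi : T -> T') (a : T -> W)
    (b : T' -> W) (J' : seq T') : uniq J' ->
  (forall t', hs (fun t => if pi t == t' then a t else 0) (b t')) ->
  hs (fun t => if pi t \in J' then a t else 0) (\sum_(t' <- J') b t').
Proof.
move=> uJ' h; apply: eq_hs (hs_sum J' h) => t.
rewrite -big_mkcond /=; case: ifPn => tJ.
  rewrite -big_filter (_ : [seq _ <- _ | _] = [:: pi t]) ?big_seq1 //.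
  apply: perm_small_eq => //; apply: uniq_perm => //; first exact: filter_uniq.
  by move=> t'; rewrite mem_filter inE eq_sym; apply/andb_idr => /eqP <-.
rewrite big1_seq // => t' /andP[/eqP <-]; by rewrite (negbTE tJ).
Qed.

(** Summation by blocks: up to a small tail the family lives on a finite list [J], and once [J']
    contains the images of [J] the blocks over [J'] contain all of [J]. *)
Lemma hs_fiber (W : normedZmodType C) (T T' : choiceType) (pi : T -> T') (a : T -> W) s
    (b : T' -> W) M :
  sbd (fun t => nm (a t)) M -> hs a s ->
  (forall t', hs (fun t => if pi t == t' then a t else 0) (b t')) -> hs b s.
Proof.
move=> hM ha hb e e0.
have e4 : 0 < e / 4 by rewrite divr_gt0.
have [J1 uJ1 h1] := sbd_tail (fun t => nm_ge0 (a t)) hM e4.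
have [J2 h2] := ha _ e4.
pose J := undup (J1 ++ J2).
have uJ : uniq J by exact: undup_uniq.
have s1 : {subset J1 <= J} by move=> i; rewrite mem_undup mem_cat => ->.
have s2 : {subset J2 <= J} by move=> i; rewrite mem_undup mem_cat => ->; rewrite orbT.
exists (map pi J) => J' uJ' JJ'.
have [K0 hK0] := hs_mask_sum uJ' hb e4.
pose K := undup (J ++ K0).
have uK : uniq K by exact: undup_uniq.
have sJ : {subset J <= K} by move=> i iJ; rewrite mem_undup mem_cat iJ.
have sK : {subset K0 <= K} by move=> i; rewrite mem_undup mem_cat => ->; rewrite orbT.
have := hK0 _ uK sK.
rewrite (big_uniq_sub _ uJ uK sJ).
have -> : \sum_(i <- J) (if pi i \in J' then a i else 0) = \sum_(i <- J) a i.
  rewrite big_seq [RHS]big_seq; apply: eq_bigr => i iJ.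
  by rewrite JJ' // map_f.
have tl : nm (\sum_(i <- [seq i <- K | i \notin J]) (if pi i \in J' then a i else 0)) <= e / 4.
  apply: le_trans (nm_sum _ _ _) _.
  apply: le_trans (_ : \sum_(i <- [seq i <- K | i \notin J]) nm (a i) <= _).
    by apply: ler_sum => i _; case: ifP => // _; rewrite nm0 nm_ge0.
  apply: h1; first exact: filter_uniq.
  by move=> i; rewrite mem_filter => /andP[+ _]; apply: contraNN; exact: s1.
have := h2 _ uJ s2; move: tl.
set A := \sum_(i <- J) _; set B := \sum_(i <- _) (if _ then _ else _); set D := \sum_(_ <- J') _.
move=> x1 x2 x3.
have -> : D - s = - (A + B - D) + (B + (A - s)).
  by rewrite opprB (addrA B) (addrC B) addrA subrK.
apply: le_lt_trans (nmD _ _) _; rewrite nmN.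
have := nmD B (A - s); lra.
Qed.

(** Each block is only required to be reached up to [e] by a finite sum in its fibre; the error is
    spread evenly over the finitely many blocks of [J']. *)
Lemma sbd_fiber (T T' : eqType) (pi : T -> T') (a : T -> R) (c : T' -> R) M :
  (forall t, 0 <= a t) -> sbd a M ->
  (forall t' e, 0 < e -> exists2 J, uniq J & c t' <= \sum_(t <- J | pi t == t') a t + e) ->
  sbd c M.
Proof.
move=> a0 ha h J' uJ'; apply/ler_addgt0Pr => e e0.
have N0 : 0 < (size J').+1%:R :> R by rewrite ltr0n.
have e1 : 0 < e / (size J').+1%:R by rewrite divr_gt0.
pose Jt t' := proj1_sig (cid2 (h t' _ e1)).
have hJt t' : uniq (Jt t') /\ c t' <= \sum_(t <- Jt t' | pi t == t') a t + e / (size J').+1%:R.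
  by rewrite /Jt; case: cid2.
pose K := undup (flatten (map Jt J')).
have uK : uniq K by exact: undup_uniq.
apply: le_trans (_ : \sum_(t' <- J') (\sum_(t <- K | pi t == t') a t + e / (size J').+1%:R) <= _).
  rewrite big_seq [leRHS]big_seq; apply: ler_sum => t' tJ.
  apply: le_trans (hJt t').2 _; rewrite lerD2r big_mkcond [leRHS]big_mkcond /=.
  apply: ler_sum_sub => //; first by move=> i; case: ifP.
  - exact: (hJt t').1.
  - move=> i ii; rewrite mem_undup; apply/flattenP; exists (Jt t') => //.
    exact: map_f.
rewrite big_split /=; apply: lerD.
  rewrite (exchange_big_dep xpredT) //=.
  apply: le_trans (ha _ uK); apply: ler_sum => t _.
  rewrite -big_filter; case: (boolP (pi t \in J')) => tJ.
    rewrite (_ : [seq _ <- _ | _] = [:: pi t]) ?big_seq1 //.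
    apply: perm_small_eq => //; apply: uniq_perm => //; first exact: filter_uniq.
    by move=> t'; rewrite mem_filter inE eq_sym; apply/andb_idr => /eqP <-.
  rewrite big1_seq // => t'; rewrite mem_filter => /andP[_ /andP[/eqP <-]].
  by rewrite (negbTE tJ).
rewrite big_const_seq count_predT iter_addr addr0 -[X in X <= _]mulr_natl.
rewrite mulrA ler_pdivrMr // mulrC ler_wpM2l ?(ltW e0) //.
by rewrite ler_nat.
Qed.

Lemma preim_seq (T T' : eqType) (f : T -> T') (J' : seq T') : injective f ->
  exists2 J : seq T, uniq J & forall t, (t \in J) = (f t \in J').
Proof.
move=> fi; elim: J' => [|t' J' [J uJ hJ]]; first by exists [::].
case: (pselect (exists t, f t = t')) => [[t ft]|nt].
  exists (undup (t :: J)) => [|u]; first exact: undup_uniq.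
  by rewrite mem_undup !inE hJ -ft (inj_eq fi).
exists J => // t; rewrite inE hJ; case: eqP => //= ft.
by case: nt; exists t.
Qed.

(** Reindexing along an injection whose range carries all nonzero terms; it serves for every shift
    of indices (powers of [x], derivatives, epsilon). *)
Lemma hs_inj (W : normedZmodType C) (T T' : choiceType) (f : T -> T') (a : T' -> W) s :
  injective f -> (forall t', (forall t, f t <> t') -> a t' = 0) ->
  hs a s <-> hs (fun t => a (f t)) s.
Proof.
move=> fi a0.
have E (J' : seq T') (J : seq T) : uniq J' -> uniq J -> (forall t, (t \in J) = (f t \in J')) ->
    \sum_(t <- J) a (f t) = \sum_(t' <- J') a t'.
  move=> uJ' uJ hJ; rewrite -(big_map f xpredT a).
  have um : uniq (map f J) by rewrite map_inj_uniq.
  rewrite (big_uniq_sub a um uJ'); last first.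
    by move=> t' /mapP[t tJ ->]; rewrite -hJ.
  rewrite [X in _ + X]big1_seq ?addr0 // => t'; rewrite mem_filter => /andP[_ /andP[tn tJ']].
  apply: a0 => t ft; case/negP: tn; apply/mapP; exists t => //.
  by rewrite hJ ft.
split=> h e e0; have [J hJ] := h _ e0.
  have [K uK hK] := preim_seq J fi.
  exists K => K' uK' KK'.
  pose J' := undup (map f K' ++ J).
  have uJ' : uniq J' by exact: undup_uniq.
  have := hJ J' uJ'; rewrite -(E J' K') //.
    by apply=> i iJ; rewrite mem_undup mem_cat iJ orbT.
  move=> t; rewrite mem_undup mem_cat mem_map //.
  by apply/esym/orb_idr; rewrite -hK; exact: KK'.
exists (map f J) => K' uK' KK'.
have [K uK hK] := preim_seq K' fi.
rewrite -(E K' K) //; apply: hJ => // t tJ.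
by rewrite hK KK' // map_f.
Qed.

Lemma sbd_inj (T T' : eqType) (f : T -> T') (a : T' -> R) M :
  injective f -> sbd a M -> sbd (fun t => a (f t)) M.
Proof.
move=> fi h J uJ; rewrite -(big_map f xpredT a); apply: h.
by rewrite map_inj_uniq.
Qed.

Lemma sbd_pair (T1 T2 : eqType) (a : T1 * T2 -> R) (m : T1 -> R) M :
  (forall t, 0 <= a t) -> (forall t1, sbd (fun t2 => a (t1, t2)) (m t1)) -> sbd m M -> sbd a M.
Proof.
move=> a0 h hM J uJ.
pose J1 := undup (map fst J); pose J2 := undup (map snd J).
apply: le_trans (_ : \sum_(t <- allpairs pair J1 J2) a t <= _).
  apply: ler_sum_sub => //.
    by rewrite allpairs_uniq ?undup_uniq // => -[? ?] [? ?] _ _ [-> ->].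
  move=> [x y] xy; apply/allpairsP; exists (x, y).
  split=> //=; rewrite mem_undup; apply/mapP; by exists (x, y).
rewrite big_allpairs; apply: le_trans (hM _ (undup_uniq (map fst J))).
by apply: ler_sum => t1 _; apply: h; exact: undup_uniq.
Qed.

Lemma sbd_swap (T1 T2 : eqType) (a : T1 * T2 -> R) M :
  sbd a M -> sbd (fun t => a (t.2, t.1)) M.
Proof. by move=> h; apply: (@sbd_inj _ _ (fun t => (t.2, t.1))) h => -[? ?] [? ?] [-> ->]. Qed.

Lemma sbd_prod (T1 T2 : eqType) (a : T1 -> R) (b : T2 -> R) M N :
  (forall t, 0 <= a t) -> (forall t, 0 <= b t) -> sbd a M -> sbd b N ->
  sbd (fun t => a t.1 * b t.2) (M * N).
Proof.
move=> a0 b0 ha hb.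
apply: (@sbd_pair _ _ _ (fun t1 => a t1 * N)) => [t|t1|]; first exact: mulr_ge0.
  exact: (sbdZ (a0 t1) hb).
move=> J uJ; rewrite -mulr_suml; apply: ler_wpM2r; first exact: sbd_ge0 hb.
exact: ha.
Qed.

Lemma hs_pair (T1 T2 : choiceType) (a : T1 * T2 -> C) s (b : T1 -> C) M :
  sbd (fun t => nm (a t)) M -> hs a s ->
  (forall t1, hs (fun t2 => a (t1, t2)) (b t1)) -> hs b s.
Proof.
move=> hM ha hb; apply: (@hs_fiber _ _ _ fst _ _ _ _ hM ha) => t1.
apply/(@hs_inj _ _ _ (fun t2 => (t1, t2))) => [x y [] //|[x y] /= xy|/=].
  by case: eqP => // ex; case: (xy y); rewrite ex.
by rewrite eqxx; exact: hb.
Qed.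

(** Fubini for double series; it turns sums of expansions into one expansion and evaluates
    compositions. *)
Lemma hs_pair_swap (T1 T2 : choiceType) (a : T1 * T2 -> C) (b : T1 -> C) (c : T2 -> C) s M :
  sbd (fun t => nm (a t)) M ->
  (forall t1, hs (fun t2 => a (t1, t2)) (b t1)) ->
  (forall t2, hs (fun t1 => a (t1, t2)) (c t2)) -> hs b s -> hs c s.
Proof.
move=> hM hb hc hbs.
have [s' hs' _] := hs_ex hM.
rewrite (hs_uniq hbs (hs_pair hM hs' hb)).
have ha2 : hs (fun t => a (t.2, t.1)) s'.
  apply/(@hs_inj _ _ _ (fun t => (t.2, t.1))) => [[x y] [x' y'] [-> ->] //|[x y] h|].
    by case: (h (y, x)).
  by apply: eq_hs hs' => -[].
exact: (hs_pair (sbd_swap hM) ha2 hc).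
Qed.

Lemma hs_prod (T1 T2 : choiceType) (a : T1 -> C) (b : T2 -> C) s t :
  hs a s -> hs b t -> hs (fun u => a u.1 * b u.2) (s * t).
Proof.
move=> ha hb.
have [M hM] := hs_sbd ha; have [N hN] := hs_sbd hb.
have hMN : sbd (fun u => nm (a u.1 * b u.2)) (M * N).
  apply: sbd_le (lexx _) (sbd_prod _ _ hM hN) => [u|?|?]; rewrite ?nmM //; exact: nm_ge0.
have [S hS _] := hs_ex hMN.
suff -> : s * t = S by [].
have h1 : hs (fun x => a x * t) S by apply: (hs_pair hMN hS) => x /=; exact: hs_Ml.
apply: hs_uniq h1; rewrite mulrC.
by apply: eq_hs (hs_Ml t ha) => i; rewrite mulrC.
Qed.

Lemma hs_series (W : normedModType C) (a : nat -> W) s : hs a s -> series a @ \oo --> s.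
Proof.
move=> h; apply/cvg_ballP => e e0.
have er : e = RtoC (complex.Re e) by rewrite /RtoC RRe_real // ger0_real // ltW.
have [|J hJ] := h (complex.Re e); first by rewrite -RtoC_lt -er.
exists (\max_(j <- J) j).+1 => // N /= hN.
rewrite -ball_normE /= er distrC nm_lt /series /=.
apply: hJ; first exact: iota_uniq.
move=> j jJ; rewrite mem_index_iota /=; apply: leq_ltn_trans hN.
by rewrite (big_rem j) //= leq_maxl.
Qed.

Lemma hs_col n m (I : choiceType) (a : I -> 'M[C]_(n, m)) (s : 'M[C]_(n, m)) :
  (forall i j, hs (fun t => a t i j) (s i j)) -> hs a s.
Proof.
move=> h; rewrite (matrix_sum_delta s).
apply: eq_hs (hs_sum _ (fun i => hs_sum _ (fun j => hs_Z (delta_mx i j) (h i j)))) => t.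
by rewrite -matrix_sum_delta.
Qed.

Lemma nm_mx_entry n m (x : 'M[C]_(n, m)) i j : nm (x i j) <= nm x.
Proof.
rewrite -RtoC_le -!nmE [leRHS]/Num.norm /= mx_normE -[leLHS]nngE num_le.
exact: (le_bigmax _ _ (i, j)).
Qed.

Lemma nm_mx_le n m (x : 'M[C]_(n, m)) r :
  0 <= r -> (forall i j, nm (x i j) <= r) -> nm x <= r.
Proof.
move=> r0 h; rewrite -nm_le.
have [->|x0] := eqVneq `|x| 0; first by rewrite -RtoC0 RtoC_le.
have [[i j] hi] := mx_norm_neq0 x0.
by rewrite [leLHS]/Num.norm /= hi nm_le; exact: h.
Qed.

Lemma nm_mx_lt n m (x : 'M[C]_(n, m)) r :
  0 < r -> (forall i j, nm (x i j) < r) -> nm x < r.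
Proof.
move=> r0 h; rewrite -nm_lt.
have [->|x0] := eqVneq `|x| 0; first by rewrite -RtoC0 RtoC_lt.
have [[i j] hi] := mx_norm_neq0 x0.
by rewrite [ltLHS]/Num.norm /= hi nm_lt; exact: h.
Qed.

Lemma hs_entry n m (I : choiceType) (a : I -> 'M[C]_(n, m)) (s : 'M[C]_(n, m)) i j :
  hs a s -> hs (fun t => a t i j) (s i j).
Proof.
move=> h e /h[J hJ]; exists J => J' uJ' /(hJ _ uJ'); apply: le_lt_trans.
have -> : \sum_(t <- J') a t i j - s i j = (\sum_(t <- J') a t - s) i j.
  by rewrite !mxE summxE.
exact: nm_mx_entry.
Qed.

Lemma nm_pair (V W : normedModType C) (x : V * W) : nm x = Num.max (nm x.1) (nm x.2).
Proof.
have E : `|x| = Num.max `|x.1| `|x.2| by [].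
apply: RtoC_inj; rewrite -(nmE x) E !nmE.
case: (lerP (nm x.1) (nm x.2)) => h; first by rewrite max_r // RtoC_le.
by rewrite max_l // RtoC_le ltW.
Qed.

Lemma hs_cons (V W : normedModType C) (I : choiceType) (a : I -> V * W) (s : V * W) :
  hs (fun t => (a t).1) s.1 -> hs (fun t => (a t).2) s.2 -> hs a s.
Proof.
move=> h1 h2 e e0; have [J1 hJ1] := h1 _ e0; have [J2 hJ2] := h2 _ e0.
exists (J1 ++ J2) => J' uJ' JJ'.
have E1 : (\sum_(t <- J') a t - s).1 = \sum_(t <- J') (a t).1 - s.1.
  by rewrite /= (big_morph fst (op1 := +%R) (id1 := 0)).
have E2 : (\sum_(t <- J') a t - s).2 = \sum_(t <- J') (a t).2 - s.2.
  by rewrite /= (big_morph snd (op1 := +%R) (id1 := 0)).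
rewrite nm_pair E1 E2 gt_max; apply/andP; split.
  by apply: hJ1 => // i iJ; apply: JJ'; rewrite mem_cat iJ.
by apply: hJ2 => // i iJ; apply: JJ'; rewrite mem_cat iJ orbT.
Qed.

End Fubini.

                     

(** * Power series on discs, Cauchy estimates, analyticity *)

Section PowerSeries.
Variable R : realType.
Local Notation C := (Cx R).

Lemma sbd_geom (rho : R) : 0 <= rho < 1 -> sbd (fun m : nat => rho ^+ m) (1 - rho)^-1.
Proof.
move=> /andP[r0 r1] J uJ.
have d0 : 0 < 1 - rho by rewrite subr_gt0.
apply: le_trans (_ : \sum_(m <- index_iota 0 (\max_(j <- J) j).+1) rho ^+ m <= _).
  apply: ler_sum_sub => //; [by move=> i; exact: exprn_ge0|exact: iota_uniq|].
  by move=> j jJ; rewrite mem_index_iota /= ltnS (big_rem j) //= leq_maxl.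
rewrite big_mkord -[leRHS]mul1r ler_pdivlMr // mulrC -opprB mulNr -subrX1 opprB.
by rewrite gerBl exprn_ge0.
Qed.

Lemma hs_geom (z : C) : nm z < 1 -> hs (fun m => z ^+ m) (1 - z)^-1.
Proof.
move=> z1.
have b : sbd (fun m => nm (z ^+ m)) (1 - nm z)^-1.
  apply: sbd_le (lexx _) (@sbd_geom (nm z) _) => [m|]; first by rewrite nmX.
  by rewrite nm_ge0.
have [s h _] := hs_ex b.
have h0 := hs_delta 0%N (1 : C).
have h1 : hs (fun m => if m is m'.+1 then z * z ^+ m' else 0) (z * s).
  apply/(@hs_inj _ _ _ _ S) => [x y [] //|[//|m] /(_ m) //|].
  exact: hs_Ml.
have h2 : hs (fun m => z ^+ m) (1 + z * s).
  apply: eq_hs (hs_add h0 h1) => -[|m] /=; first by rewrite addr0.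
  by rewrite add0r -exprS.
have e := hs_uniq h h2.
have nz : 1 - z != 0.
  by rewrite subr_eq0; apply: contraTneq z1 => <-; rewrite nm1 ltxx.
suff -> : (1 - z)^-1 = s by [].
apply: (mulfI nz); rewrite divff // mulrBl mul1r {1}e addrK //.
Qed.

Lemma hs_cauchy (a b : nat -> C) s t : hs a s -> hs b t ->
  hs (fun m => \sum_(i < m.+1) a i * b (m - i)%N) (s * t).
Proof.
move=> ha hb.
have [M hM] := hs_sbd ha; have [N hN] := hs_sbd hb.
have hMN : sbd (fun u => nm (a u.1 * b u.2)) (M * N).
  apply: sbd_le (lexx _) (sbd_prod _ _ hM hN) => [u|?|?]; rewrite ?nmM //; exact: nm_ge0.
apply: (@hs_fiber _ _ _ _ (fun u : nat * nat => u.1 + u.2)%N _ _ _ _ hMN (hs_prod ha hb)) => m.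
pose J := [seq (i, m - i)%N | i <- iota 0 m.+1].
have uJ : uniq J by rewrite map_inj_uniq ?iota_uniq // => x y [].
pose G u := if (u.1 + u.2 == m)%N then a u.1 * b u.2 else 0.
rewrite (_ : \sum_(i < m.+1) _ = \sum_(u <- J) G u).
  apply: hs_fin => // -[i j] ij; rewrite /G /=; case: eqP => // e.
  case/negP: ij; apply/mapP; exists i; last by rewrite -e addKn.
  by rewrite mem_iota -e /= add0n ltnS leq_addr.
rewrite big_map -[iota 0 m.+1]/(index_iota 0 m.+1) big_mkord; apply: eq_bigr => i _.
by rewrite /G /= subnKC ?eqxx // -ltnS.
Qed.

Definition pser (w0 : C) (r : R) (F : C -> C) (c : nat -> C) :=
  forall h, nm h < r -> hs (fun m => c m * h ^+ m) (F (w0 + h)).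

Lemma pser_sbd w0 r F c rho : pser w0 r F c -> 0 <= rho < r ->
  exists M, sbd (fun m => nm (c m) * rho ^+ m) M.
Proof.
move=> h /andP[r0 rr].
have [|M hM] := hs_sbd (h (RtoC rho) _); first by rewrite nm_RtoC ger0_norm.
exists M; apply: sbd_le (lexx _) hM => m.
by rewrite nmM nmX nm_RtoC ger0_norm.
Qed.

Lemma pser_ext w0 r F G c : (forall w, nm (w - w0) < r -> F w = G w) ->
  pser w0 r F c -> pser w0 r G c.
Proof.
move=> e h x xr; rewrite -e; first exact: h.
by rewrite addrC addKr.
Qed.

Lemma pser_cst w0 r a : pser w0 r (fun _ => a) (fun m => if m == 0%N then a else 0).
Proof.
move=> h hr; apply: eq_hs (hs_delta 0%N a) => -[|m]; rewrite ?mulr1 //=.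
by rewrite mul0r.
Qed.

Lemma pser_id w0 r : pser w0 r id (fun m => if m is m'.+1 then if m' is 0%N then 1 else 0 else w0).
Proof.
move=> h hr; apply: eq_hs (hs_add (hs_delta 0%N w0) (hs_delta 1%N h)) => -[|[|m]] /=.
- by rewrite addr0 mulr1.
- by rewrite add0r mul1r.
by rewrite add0r mul0r.
Qed.

Lemma pser_add w0 r F G c d : pser w0 r F c -> pser w0 r G d ->
  pser w0 r (fun w => F w + G w) (fun m => c m + d m).
Proof.
by move=> hF hG h hr; apply: eq_hs (hs_add (hF h hr) (hG h hr)) => m; rewrite mulrDl.
Qed.

Lemma pser_Z w0 r F c a : pser w0 r F c ->
  pser w0 r (fun w => a * F w) (fun m => a * c m).
Proof.
by move=> hF h hr; apply: eq_hs (hs_Ml a (hF h hr)) => m; rewrite mulrA.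
Qed.

Lemma pser_mul w0 r F G c d : pser w0 r F c -> pser w0 r G d ->
  pser w0 r (fun w => F w * G w) (fun m => \sum_(i < m.+1) c i * d (m - i)%N).
Proof.
move=> hF hG h hr; apply: eq_hs (hs_cauchy (hF h hr) (hG h hr)) => m.
rewrite mulr_suml; apply: eq_bigr => i _; rewrite mulrACA -exprD subnKC //.
by rewrite -ltnS.
Qed.

Lemma pser_scale w0 r F c (s : C) : pser (s * w0) (nm s * r) F c -> s != 0 ->
  pser w0 r (fun w => F (s * w)) (fun m => c m * s ^+ m).
Proof.
move=> hF s0 h hr; rewrite mulrDr.
have sh : nm (s * h) < nm s * r by rewrite nmM ltr_pM2l // nm_gt0.
apply: eq_hs (hF _ sh) => m.
by rewrite exprMn mulrA.
Qed.

(** Terms of index at least [m] carry the factor [(nm h / rho) ^+ m] against a series that converges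
    absolutely at radius [rho]. *)
Lemma pser_rem w0 r F c m rho : pser w0 r F c -> 0 < rho < r ->
  exists2 K, 0 <= K & forall h, nm h <= rho ->
    nm (F (w0 + h) - \sum_(l < m) c l * h ^+ l) <= K * nm h ^+ m.
Proof.
move=> hF /andP[r0 rr].
have [|M hM] := pser_sbd hF (rho := rho); first by rewrite ltW.
exists (M / rho ^+ m) => [|h hr].
  by rewrite divr_ge0 ?(sbd_ge0 hM) // exprn_ge0 ?ltW.
have hh : nm h < r by exact: le_lt_trans rr.
have h1 := hF _ hh.
have h2 : hs (fun l => if (l < m)%N then - (c l * h ^+ l) else 0) (- \sum_(l < m) c l * h ^+ l).
  rewrite -(big_mkord xpredT (fun l => c l * h ^+ l)) -sumrN.
  pose G l := if (l < m)%N then - (c l * h ^+ l) else 0.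
  rewrite (_ : \sum_(_ <= _ < _) _ = \sum_(l <- index_iota 0 m) G l).
    apply: hs_fin; first exact: iota_uniq.
    by move=> l; rewrite mem_index_iota /= /G; case: ifP.
  rewrite !big_mkord; apply: eq_bigr => l _; by rewrite /G ltn_ord.
apply: (hs_le (hs_add h1 h2)).
apply: sbd_le _ _ (sbdZ (c := (nm h / rho) ^+ m) _ hM).
- move=> l; case: ltnP => lm.
    by rewrite subrr nm0 !mulr_ge0 ?exprn_ge0 ?divr_ge0 ?nm_ge0 // ltW.
  rewrite addr0 nmM nmX mulrCA ler_wpM2l ?nm_ge0 //.
  rewrite -{1}(subnKC lm) exprD expr_div_n -[in leRHS](subnKC lm) exprD.
  rewrite mulrA divfK ?expf_neq0 ?gt_eqF //.
  by apply: ler_wpM2l; rewrite ?exprn_ge0 ?nm_ge0 // lerXn2r ?nnegrE ?nm_ge0 // ltW.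
- by rewrite expr_div_n [leRHS]mulrAC mulrC mulrA.
- by rewrite exprn_ge0 // divr_ge0 ?nm_ge0 // ltW.
Qed.

Lemma cis_neq1 (d N : nat) : (0 < d < N)%N -> cis (2 * pi * d%:R / N%:R) != 1 :> C.
Proof.
move=> /andP[d0 dN]; apply/eqP => e.
have N0 : 0 < N%:R :> R by rewrite ltr0n (leq_ltn_trans _ dN).
have dN0 : 0 < d%:R / N%:R :> R by rewrite divr_gt0 // ltr0n.
have dN1 : d%:R / N%:R < 1 :> R by rewrite ltr_pdivrMr // mul1r ltr_nat.
have e2 : 2 * pi * d%:R / N%:R = pi * (d%:R / N%:R) + pi * (d%:R / N%:R) :> R by ring.
have : cos (2 * pi * d%:R / N%:R : R) = 1 by move: e => [].
rewrite e2 cosD; set y := pi * (d%:R / N%:R) => h.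
have sy : 0 < sin y.
  apply: sin_gt0_pi; rewrite /y mulr_gt0 ?pi_gt0 //=.
  by rewrite -[ltRHS]mulr1 ltr_pM2l ?pi_gt0.
have := cos2Dsin2 y; nra.
Qed.

Lemma cis_2pi_nat (d : nat) : cis (2 * pi * d%:R) = 1 :> C.
Proof.
rewrite (_ : 2 * pi * d%:R = d%:R * (2 * pi)); last by rewrite mulrC.
rewrite -cisX; have -> : cis (2 * pi) = 1 :> C.
  rewrite (_ : 2 * pi = 0 + pi *+ 2 :> R); last by rewrite add0r mulr_natl.
  by rewrite /cis cosD2pi sinD2pi cos0 sin0.
by rewrite expr1n.
Qed.

Lemma cis_sum0 (d N : nat) : (0 < d < N)%N ->
  \sum_(q < N) cis (2 * pi * d%:R / N%:R) ^+ q = 0 :> C.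
Proof.
move=> dN; have N0 : N%:R != 0 :> R.
  by rewrite pnatr_eq0 -lt0n; case/andP: dN => _; exact: leq_ltn_trans.
have := subrX1 (cis (2 * pi * d%:R / N%:R) : C) N.
rewrite cisX (_ : N%:R * _ = 2 * pi * d%:R); last by rewrite mulrC divfK.
rewrite cis_2pi_nat subrr => /esym/eqP; rewrite mulf_eq0 subr_eq0.
by rewrite (negbTE (cis_neq1 dN)) /= => /eqP.
Qed.

Lemma cis_sum0' (l m N : nat) : (l < N)%N -> (m < N)%N -> l != m ->
  \sum_(q < N) cis (2 * pi * l%:R / N%:R) ^+ q / cis (2 * pi * m%:R / N%:R) ^+ q = 0 :> C.
Proof.
wlog : l m / (m < l)%N => [H lN mN lm|ml lN mN _].
  have [ml|ml|e] := ltngtP m l; [exact: H| |by rewrite e eqxx in lm].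
  (* Complex conjugation exchanges the two characters. *)
  have := H m l ml mN lN; rewrite eq_sym => /(_ lm) h.
  have := congr1 conjc h; rewrite rmorph_sum rmorph0 /= => h'; rewrite -[RHS]h'.
  apply: eq_bigr => q _; rewrite !cisX -!cisN -!cisD /cis /=.
  by rewrite -opprB cosN sinN.
rewrite -{}[RHS](@cis_sum0 (l - m) N); last first.
  by rewrite subn_gt0 ml /=; apply: leq_ltn_trans lN; rewrite leq_subr.
apply: eq_bigr => q _; rewrite !cisX -cisN -cisD natrB 1?ltnW //; congr cis; ring.
Qed.

(** Averaging [F] over the [N]-th roots of unity on the circle of radius [rho], twisted by the
    [m]-th character, isolates [c m] up to aliasing terms of index at least [N], and these fall into
    the tail of the series. *)
Lemma cauchy_estimate w0 r F c M m : pser w0 r F c -> 0 < r ->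
  (forall h, nm h < r -> nm (F (w0 + h)) <= M) -> nm (c m) * r ^+ m <= M.
Proof.
move=> hF r0 hM.
have M0 : 0 <= M by apply: le_trans (hM 0 _); rewrite ?nm_ge0 // nm0.
have key rho : 0 <= rho < r -> nm (c m) * rho ^+ m <= M.
  move=> rr; have /andP[rho0 rhor] := rr.
  apply/ler_addgt0Pr => e e0.
  have [K hK] := pser_sbd hF rr.
  have [|J uJ hJ] := sbd_tail _ hK e0.
    by move=> l; rewrite mulr_ge0 ?nm_ge0 // exprn_ge0.
  (* [N] exceeds [m] and every index of [J]: below [N] only the index [m] survives by orthogonality,
     and the indices from [N] on avoid [J], hence contribute at most [e]. *)
  pose N := (maxn m (\max_(j <- J) j)).+1.
  have N0 : N%:R != 0 :> R by rewrite pnatr_eq0.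
  have NC : N%:R != 0 :> C by rewrite pnatr_eq0.
  pose z (l : nat) : C := cis (2 * pi * l%:R / N%:R).
  have nz l q : nm (z l ^+ q) = 1 by rewrite nmX nm_cis expr1n.
  have zq q : nm (RtoC rho * z 1%N ^+ q) < r by rewrite nmM nz mulr1 nm_RtoC ger0_norm.
  have zE (l q : nat) : (z 1%N ^+ q) ^+ l = z l ^+ q.
    by rewrite -exprM mulnC exprM; congr (_ ^+ q); rewrite /z cisX; congr cis; ring.
  have h1 : hs (fun l => N%:R^-1 * \sum_(q < N) (z m ^+ q)^-1 * (c l * (RtoC rho * z 1%N ^+ q) ^+ l))
      (N%:R^-1 * \sum_(q < N) (z m ^+ q)^-1 * F (w0 + RtoC rho * z 1%N ^+ q)).
    by apply: hs_Ml; apply: hs_sum => q; apply: hs_Ml; apply: hF.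
  set S := N%:R^-1 * _ in h1.
  have nS : nm S <= M.
    rewrite /S nmM nmV nm_nat mulrC ler_pdivrMr ?ltr0n //.
    apply: le_trans (nm_sum _ _ _) _.
    apply: le_trans (_ : \sum_(q < N) M <= _).
      by apply: ler_sum => q _; rewrite nmM nmV nz invr1 mul1r hM.
    by rewrite sumr_const card_ord mulr_natr.
  have h2 := hs_add h1 (hs_delta m (- (c m * RtoC rho ^+ m))).
  have h3 : nm (S - c m * RtoC rho ^+ m) <= e.
    apply: (hs_le h2).
    have h4 (l : nat) : N%:R^-1 * (\sum_(q < N) (z m ^+ q)^-1 * (c l * (RtoC rho * z 1%N ^+ q) ^+ l)) =
        c l * RtoC rho ^+ l * (N%:R^-1 * \sum_(q < N) z l ^+ q / z m ^+ q).
      rewrite mulrCA; congr (_ * _); rewrite mulr_sumr; apply: eq_bigr => q _.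
      rewrite exprMn zE; ring.
    have hb l : nm (N%:R^-1 * (\sum_(q < N) (z m ^+ q)^-1 * (c l * (RtoC rho * z 1%N ^+ q) ^+ l)) +
        (if l == m then - (c m * RtoC rho ^+ m) else 0)) <=
        if (l < N)%N then 0 else nm (c l) * rho ^+ l.
      rewrite h4; case: ltnP => lN.
        have [->|lm] := eqVneq l m.
          rewrite (eq_bigr (fun=> 1)); last first.
            by move=> q _; rewrite divff // expf_neq0 // cis_neq0.
          by rewrite sumr_const card_ord mulVf // mulr1 subrr nm0.
        by rewrite cis_sum0' // ?mulr0 ?addr0 ?nm0 // ltnS leq_maxl.
      rewrite ifF; last by apply/negbTE; rewrite gtn_eqF // (leq_trans _ lN) // ltnS leq_maxl.
      rewrite addr0 nmM nmM nmX nm_RtoC ger0_norm //.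
      rewrite -[leRHS]mulr1 ler_wpM2l ?mulr_ge0 ?nm_ge0 ?exprn_ge0 //.
      rewrite nmM nmV nm_nat mulrC ler_pdivrMr ?ltr0n // mul1r.
      apply: le_trans (nm_sum _ _ _) _.
      rewrite (eq_bigr (fun=> 1)); last by move=> q _; rewrite nmM nmV !nz invr1 mulr1.
      by rewrite sumr_const card_ord.
    move=> J' uJ'; apply: le_trans (ler_sum _ (fun l _ => hb l)) _.
    rewrite (bigID (fun l => (l < N)%N)) /= big1 ?add0r; last by move=> l ->.
    rewrite (eq_bigr (fun l => nm (c l) * rho ^+ l)); last by move=> l /negbTE ->.
    rewrite -big_filter; apply: hJ; first exact: filter_uniq.
    move=> l; rewrite mem_filter -leqNgt => /andP[Nl _]; apply: contraTN Nl => lJ.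
    by rewrite -ltnNge ltnS (leq_trans _ (leq_maxr _ _)) // (big_rem l) //= leq_maxl.
  have -> : nm (c m) * rho ^+ m = nm (c m * RtoC rho ^+ m).
    by rewrite nmM nmX nm_RtoC ger0_norm.
  rewrite (_ : c m * _ = S - (S - c m * RtoC rho ^+ m)); last by rewrite opprB addrC subrK.
  by apply: le_trans (nmB _ _) _; exact: lerD.
(* In degree 0 the radius [rho = 0] already gives the claim; in positive degree [rho] tends to [r]
   from the left. *)
case: m key => [|m] key.
  by rewrite expr0; have := key 0; rewrite expr0 lexx r0; apply.
rewrite leNgt; apply/negP => h.
have cm : 0 < nm (c m.+1).
  rewrite lt_neqAle nm_ge0 andbT; apply: contraTneq h => <-; by rewrite mul0r -leNgt.
have cont : (fun rho : R => nm (c m.+1) * rho ^+ m.+1) @ r^'- --> nm (c m.+1) * r ^+ m.+1.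
  apply: cvgM; first exact: cvg_cst.
  by apply: cvg_at_left_filter; exact: exprn_continuous.
have : \forall rho \near r^'-, M < nm (c m.+1) * rho ^+ m.+1.
  by apply: (cvgr_gt _ cont).
move=> near1; have near2 : \forall rho \near r^'-, 0 <= rho < r.
  near=> rho; apply/andP; split; last by near: rho; exact: nbhs_left_lt.
  by near: rho; exact: nbhs_left_ge.
have [rho [h1 h2]] := filter_ex (filterI near1 near2).
by have := key _ h2; rewrite leNgt h1.
Unshelve. all: by end_near.
Qed.

Lemma pser_term_bound w0 r F c M h m : pser w0 r F c -> 0 < r ->
  (forall h, nm h < r -> nm (F (w0 + h)) <= M) ->
  nm (c m * h ^+ m) <= M * (nm h / r) ^+ m.
Proof.
move=> hF r0 hM; have ce := cauchy_estimate m hF r0 hM.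
rewrite nmM nmX expr_div_n mulrA [leRHS]mulrAC.
rewrite ler_wpM2r ?exprn_ge0 ?nm_ge0 //.
by rewrite ler_pdivlMr ?exprn_gt0.
Qed.

Lemma pser_bound_ge0 r (w0 : C) (F : C -> C) M : 0 < r ->
  (forall h, nm h < r -> nm (F (w0 + h)) <= M) -> 0 <= M.
Proof. by move=> r0 hM; apply: le_trans (hM 0 _); rewrite ?nm_ge0 // nm0. Qed.

Lemma sbd_term_geom (I : choiceType) w0 r (F : I -> C -> C) c (M : I -> R) N h : 0 < r ->
  (forall t, pser w0 r (F t) (c t)) ->
  (forall t h, nm h < r -> nm (F t (w0 + h)) <= M t) -> sbd M N -> nm h < r ->
  sbd (fun u : I * nat => nm (c u.1 u.2 * h ^+ u.2)) (N * (1 - nm h / r)^-1).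
Proof.
move=> r0 hF hM hN hr.
have g : 0 <= nm h / r < 1.
  by rewrite divr_ge0 ?nm_ge0 ?(ltW r0) //= ltr_pdivrMr // mul1r.
have M0 t : 0 <= M t by exact: pser_bound_ge0 r0 (hM t).
apply: sbd_le (lexx _) (sbd_prod M0 _ hN (sbd_geom g)) => [u|m]; last first.
  by rewrite exprn_ge0 //; case/andP: g.
exact: pser_term_bound (hF _) r0 (hM _).
Qed.

(** Weierstrass' theorem with an explicit disc: Cauchy estimates make the double family in [(t, m)]
    absolutely summable, so both orders of summation agree. *)
Lemma pser_sum (I : choiceType) w0 r (F : I -> C -> C) c (M : I -> R) N G d : 0 < r ->
  (forall t, pser w0 r (F t) (c t)) ->
  (forall t h, nm h < r -> nm (F t (w0 + h)) <= M t) -> sbd M N ->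
  (forall h, nm h < r -> hs (fun t => F t (w0 + h)) (G (w0 + h))) ->
  (forall m, hs (fun t => c t m) (d m)) -> pser w0 r G d.
Proof.
move=> r0 hF hM hN hG hd h hr.
have hb := sbd_term_geom r0 hF hM hN hr.
apply: (hs_pair_swap hb) (hG h hr) => [t|m] /=; first exact: hF.
by rewrite mulrC; apply: eq_hs (hs_Ml (h ^+ m) (hd m)) => t; rewrite mulrC.
Qed.

Lemma coef_sbd (I : choiceType) w0 r (F : I -> C -> C) c (M : I -> R) N m : 0 < r ->
  (forall t, pser w0 r (F t) (c t)) ->
  (forall t h, nm h < r -> nm (F t (w0 + h)) <= M t) -> sbd M N ->
  sbd (fun t => nm (c t m)) (r ^- m * N).
Proof.
move=> r0 hF hM hN.
apply: sbd_le (lexx _) (sbdZ _ hN) => [t|]; last by rewrite invr_ge0 exprn_ge0 // ltW.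
rewrite mulrC ler_pdivlMr ?exprn_gt0 //; exact: cauchy_estimate m (hF t) r0 (hM t).
Qed.

(** Analyticity with the radius built in: every disc inside [Om] carries one expansion valid on all
    of that disc. Sums, products, inverses and integrals preserve this form, so discs of convergence
    never have to be enlarged. *)
Definition anl (Om : set C) (F : C -> C) := forall w0 r, 0 < r ->
  (forall w, nm (w - w0) < r -> Om w) -> exists c, pser w0 r F c.

Lemma anl_ext (Om : set C) F G : (forall w, Om w -> F w = G w) -> anl Om F -> anl Om G.
Proof.
move=> e h w0 r r0 H; have [c hc] := h _ _ r0 H.
by exists c; apply: pser_ext hc => w /H/e.
Qed.

Lemma anl_cst Om a : anl Om (fun _ => a).
Proof. by move=> w0 r _ _; eexists; exact: pser_cst. Qed.

Lemma anl_id Om : anl Om id.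
Proof. by move=> w0 r _ _; eexists; exact: pser_id. Qed.

Lemma anl_add Om F G : anl Om F -> anl Om G -> anl Om (fun w => F w + G w).
Proof.
move=> hF hG w0 r r0 H; have [c hc] := hF _ _ r0 H; have [d hd] := hG _ _ r0 H.
by eexists; exact: pser_add hc hd.
Qed.

Lemma anl_mul Om F G : anl Om F -> anl Om G -> anl Om (fun w => F w * G w).
Proof.
move=> hF hG w0 r r0 H; have [c hc] := hF _ _ r0 H; have [d hd] := hG _ _ r0 H.
by eexists; exact: pser_mul hc hd.
Qed.

Lemma anl_Z Om a F : anl Om F -> anl Om (fun w => a * F w).
Proof. by move=> hF; apply: anl_mul hF; exact: anl_cst. Qed.

Lemma anl_exp Om F m : anl Om F -> anl Om (fun w => F w ^+ m).
Proof.
move=> hF; elim: m => [|m IH]; first exact: anl_cst.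
by apply: anl_ext (anl_mul hF IH) => w _; rewrite exprS.
Qed.

(** A geometric series: a disc inside [Om] misses [a], so its radius is at most the distance from
    its centre to [a]. *)
Lemma anl_inv Om a : ~ Om a -> anl Om (fun w => (w - a)^-1).
Proof.
move=> na w0 r r0 H.
have ra : r <= nm (a - w0).
  by rewrite leNgt; apply/negP => /H.
have na0 : w0 - a != 0.
  apply: contraTneq ra => e; rewrite -ltNge.
  by rewrite -opprB e oppr0 nm0.
exists (fun m => (-1) ^+ m * (w0 - a)^-1 ^+ m.+1) => h hr.
have h1 : nm (- (h / (w0 - a))) < 1.
  rewrite nmN nmM nmV ltr_pdivrMr ?nm_gt0 // mul1r nm_distC.
  exact: lt_le_trans ra.
have E : (w0 + h - a)^-1 = (w0 - a)^-1 * (1 - - (h / (w0 - a)))^-1.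
  rewrite -invfM; congr (_^-1); rewrite opprK mulrDr mulr1 mulrCA divff // mulr1.
  by rewrite addrAC.
rewrite E; apply: eq_hs (hs_Ml _ (hs_geom h1)) => m.
by rewrite [(- (h / _)) ^+ m]exprNn exprMn exprS; ring.
Qed.

Lemma anl_sum (I : choiceType) (Om : set C) (F : I -> C -> C) (M : I -> R) N G :
  (forall t, anl Om (F t)) ->
  (forall t w, Om w -> nm (F t w) <= M t) -> sbd M N ->
  (forall w, Om w -> hs (F^~ w) (G w)) -> anl Om G.
Proof.
move=> hF hM hN hG w0 r r0 H.
have H' h : nm h < r -> Om (w0 + h) by move=> hr; apply: H; rewrite addrC addKr.
pose c t := proj1_sig (cid (hF t w0 r r0 H)).
have hc t : pser w0 r (F t) (c t) by rewrite /c; case: cid.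
have hM' t h : nm h < r -> nm (F t (w0 + h)) <= M t by move=> /H'; exact: hM.
pose d m := proj1_sig (cid2 (hs_ex (coef_sbd m r0 hc hM' hN))).
have hd m : hs (fun t => c t m) (d m) by rewrite /d; case: cid2.
exists d; apply: (pser_sum r0 hc hM' hN) => // h /H'; exact: hG.
Qed.

Lemma anl_scale (Om Om' : set C) (s : C) F : (forall w, Om' w -> Om (s * w)) ->
  anl Om F -> anl Om' (fun w => F (s * w)).
Proof.
move=> sOm hF; have [->|s0] := eqVneq s 0.
  by apply: (@anl_ext _ (fun=> F 0) _ _ (@anl_cst Om' (F 0))) => w _; rewrite mul0r.
move=> w0 r r0 H; have [||c hc] := hF (s * w0) (nm s * r).
- by rewrite mulr_gt0 // nm_gt0.
- move=> w hw; rewrite -[w](mulVKf s0); apply/sOm/H.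
  by rewrite -[w0](mulKf s0) -mulrBr nmM nmV mulrC ltr_pdivrMr ?nm_gt0 // [r * _]mulrC.
by eexists; exact: pser_scale hc s0.
Qed.

                                                                          
                                                                               
(** Agreement on a one-sided real segment suffices: the first coefficients that differ would
    dominate both Taylor remainders as the real step tends to 0. *)
Lemma pser_unique w0 r F G c d : 0 < r -> pser w0 r F c -> pser w0 r G d ->
  (forall h : R, 0 < h < r -> F (w0 + RtoC h) = G (w0 + RtoC h)) -> forall m, c m = d m.
Proof.
move=> r0 hF hG FG m.
elim/ltn_ind: m => m IH.
have rr : 0 < r / 2 < r by rewrite divr_gt0 //= ltr_pdivrMr // ltr_pMr // ltr1n.
have [K1 K10 h1] := pser_rem m.+1 hF rr.
have [K2 K20 h2] := pser_rem m.+1 hG rr.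
apply/eqP; rewrite -subr_eq0; apply/eqP/nm_eq0/ler_addgt0Pr => e e0; rewrite add0r.
have K0 : 0 < K1 + K2 + 1 by rewrite ltr_wpDl // addr_ge0.
pose h := Num.min (r / 2) (e / (K1 + K2 + 1)).
have h0 : 0 < h by rewrite lt_min; case/andP: rr => -> _; rewrite divr_gt0.
have hr : h <= r / 2 by rewrite ge_min lexx.
have nh : nm (RtoC h) = h by rewrite nm_RtoC ger0_norm // ltW.
have := h1 (RtoC h); have := h2 (RtoC h).
rewrite nh => /(_ hr) a2 /(_ hr) a1.
have e1 : F (w0 + RtoC h) = G (w0 + RtoC h).
  by apply: FG; rewrite h0 (le_lt_trans hr) //; case/andP: rr.
have : nm ((c m - d m) * RtoC h ^+ m) <= (K1 + K2) * h ^+ m.+1.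
  rewrite (_ : _ * _ = (G (w0 + RtoC h) - \sum_(l < m.+1) d l * RtoC h ^+ l) -
      (F (w0 + RtoC h) - \sum_(l < m.+1) c l * RtoC h ^+ l)); last first.
    rewrite !big_ord_recr /= e1.
    rewrite (_ : \sum_(l < m) c l * _ = \sum_(l < m) d l * RtoC h ^+ l); last first.
      by apply: eq_bigr => l _; rewrite IH.
    by rewrite mulrBl; ring.
  by apply: le_trans (nmB _ _) _; rewrite mulrDl [leRHS]addrC lerD.
have hm : 0 < h ^+ m by exact: exprn_gt0.
rewrite nmM nmX nh exprSr [h ^+ m * h]mulrC mulrA ler_pM2r // => /le_trans; apply.
apply: le_trans (_ : (K1 + K2 + 1) * h <= _).
  by rewrite ler_wpM2r ?(ltW h0) // lerDl.
by rewrite mulrC -ler_pdivlMr // ge_min lexx orbT.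
Qed.

Lemma hs_nat0 (c : nat -> C) : hs (fun m => c m * 0 ^+ m) (c 0%N).
Proof.
apply: eq_hs (hs_delta 0%N (c 0%N)) => -[|m] /=; first by rewrite mulr1.
by rewrite expr0n mulr0.
Qed.

Lemma pser_at0 w0 r F c : 0 < r -> pser w0 r F c -> F w0 = c 0%N.
Proof.
move=> r0 hF; have h0 : nm (0 : C) < r by rewrite nm0.
have := hF 0 h0; rewrite addr0 => h1; exact: hs_uniq h1 (hs_nat0 c).
Qed.

Lemma pser_const w0 r F c a : 0 < r -> pser w0 r F c ->
  (forall h : R, 0 < h < r -> F (w0 + RtoC h) = a) -> forall h, nm h < r -> F (w0 + h) = a.
Proof.
move=> r0 hF Fa h hr.
have E := pser_unique r0 hF (@pser_cst w0 r a) Fa.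
apply: (hs_uniq (hF h hr)).
by apply: (eq_hs _ (@pser_cst w0 r a h hr)) => m; rewrite E.
Qed.

End PowerSeries.

(** * The complex exponential as a power series *)

Section Exponential.
Variable R : realType.
Local Notation C := (Cx R).

Lemma hs_lim_real (a : nat -> R) s l :
  hs (fun m => RtoC (a m)) s -> series a @ \oo --> l -> s = RtoC l.
Proof.
move=> ha hl; apply/eqP; rewrite -subr_eq0; apply/eqP/nm_eq0/ler_addgt0Pr => e e0.
rewrite add0r; have e2 : 0 < e / 2 by rewrite divr_gt0.
have [J hJ] := ha _ e2.
have /cvgrPdist_lt/(_ _ e2)[N _ hN] := hl.
pose K := maxn N (\max_(j <- J) j).+1.
have := hN K; rewrite /= leq_maxl => /(_ isT) h1.
have h2 : nm (\sum_(i <- index_iota 0 K) RtoC (a i) - s) < e / 2.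
  apply: hJ; first exact: iota_uniq.
  move=> j jJ; rewrite mem_index_iota /= (leq_trans _ (leq_maxr _ _)) // ltnS.
  by rewrite (big_rem j) //= leq_maxl.
rewrite -RtoC_sum in h2.
rewrite (_ : s - RtoC l = - (RtoC (\sum_(i <- index_iota 0 K) a i) - s) - RtoC (l - series a K)).
  apply: le_trans (nmB _ _) _; rewrite nmN nm_RtoC; rewrite [leRHS](splitr e).
  by apply: lerD; exact: ltW.
rewrite /RtoC rmorphB /= /series /= -/(RtoC _); ring.
Qed.

Lemma sbd_exp (a : R) : 0 <= a -> sbd (fun m : nat => a ^+ m / m`!%:R) (expR a).
Proof.
move=> a0 J uJ.
apply: le_trans (_ : \sum_(m <- index_iota 0 (\max_(j <- J) j).+1) a ^+ m / m`!%:R <= _).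
  apply: ler_sum_sub => //; [|exact: iota_uniq|].
    by move=> i; rewrite divr_ge0 ?exprn_ge0.
  by move=> j jJ; rewrite mem_index_iota /= ltnS (big_rem j) //= leq_maxl.
rewrite /expR; apply: (nondecreasing_cvgn_le _ (is_cvg_series_exp_coeff a)).
apply/nondecreasing_seqP => m; rewrite /series /= big_nat_recr //= lerDl.
by rewrite /exp_coeff /= divr_ge0 ?exprn_ge0.
Qed.

Lemma sbd_cexp (z : C) : sbd (fun m : nat => nm (z ^+ m / m`!%:R)) (expR (nm z)).
Proof.
by apply: sbd_le (lexx _) (sbd_exp (nm_ge0 z)) => m; rewrite nmM nmX nmV nm_nat.
Qed.

Let E (z : C) : C := proj1_sig (cid2 (hs_ex (sbd_cexp z))).
Let hsE (z : C) : hs (fun m : nat => z ^+ m / m`!%:R) (E z).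
Proof. by rewrite /E; case: cid2. Qed.

Let ED (z w : C) : E (z + w) = E z * E w.
Proof.
apply: (hs_uniq (hsE _)); apply: eq_hs (hs_cauchy (hsE z) (hsE w)) => m.
rewrite (addrC z) exprDn mulr_suml; apply: eq_bigr => i _.
have im : (i <= m)%N by rewrite -ltnS.
have f0 (l : nat) : l`!%:R != 0 :> C by rewrite pnatr_eq0 -lt0n fact_gt0.
rewrite -mulr_natr.
have : 'C(m, i)%:R * (i`!%:R * (m - i)`!%:R) = m`!%:R :> C by rewrite -!natrM bin_fact.
move=> <-; have b0 : 'C(m, i)%:R != 0 :> C by rewrite pnatr_eq0 -lt0n bin_gt0.
by field; rewrite b0 !f0.
Qed.

Let EiR (x : R) : E (RtoC x) = RtoC (expR x).
Proof.
apply: hs_lim_real (is_cvg_series_exp_coeff x).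
apply: eq_hs (hsE _) => m.
by rewrite /exp_coeff /= RtoCM RtoCX RtoCV RtoC_nat.
Qed.

Lemma cos_sin_coeff (y : R) (m : nat) :
  ('i%C * RtoC y) ^+ m / m`!%:R = RtoC (cos_coeff y m) + 'i%C * RtoC (sin_coeff y m).
Proof.
rewrite /cos_coeff /sin_coeff /= !RtoCM !RtoCX !RtoCV !RtoC_nat exprMn.
have i2 : 'i%C ^+ 2 = -1 :> C by exact: sqr_i.
have N1 : RtoC (-1) = -1 :> C by rewrite /RtoC rmorphN1.
rewrite N1 -{1}(odd_double_half m) -muln2 mulnC exprD exprM i2.
case: (boolP (odd m)) => om /=.
  have -> : (m.-1)./2 = m./2.
    by case: m om => // m /= /negbTE om; rewrite uphalf_half om add0n.
  ring.
ring.
Qed.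

(** The sum [E] of the exponential series is multiplicative, so the real and the imaginary axis can
    be treated apart; there the terms are those of [expR], [cos] and [sin]. *)
Lemma hs_cexp (z : C) : hs (fun m : nat => z ^+ m / m`!%:R) (cexp z).
Proof.
suff -> : cexp z = E z by exact: hsE.
rewrite [in RHS](complexE z) -/(RtoC _) -/(RtoC (complex.Im z)) ED EiR.
congr (_ * _); apply/esym.
have [|s1 h1 _] := @hs_ex _ _ (fun m => RtoC (cos_coeff (ImC z) m)) (expR `|ImC z|).
  apply: sbd_le (lexx _) (sbd_exp (normr_ge0 _)) => m.
  rewrite nm_RtoC /cos_coeff /= !normrM normfV !normr_nat [ `|_ ^+ m| ]normrX.
  rewrite ler_wpM2r ?invr_ge0 // ler_piMl ?exprn_ge0 //.
  by rewrite -?exprnP normrX normrN1 expr1n mulr1 -[leRHS]/(1%:R) ler_nat; case: odd.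
have [|s2 h2 _] := @hs_ex _ _ (fun m => RtoC (sin_coeff (ImC z) m)) (expR `|ImC z|).
  apply: sbd_le (lexx _) (sbd_exp (normr_ge0 _)) => m.
  rewrite nm_RtoC /sin_coeff /= !normrM normfV !normr_nat [ `|_ ^+ m| ]normrX.
  rewrite ler_wpM2r ?invr_ge0 // ler_piMl ?exprn_ge0 //.
  by rewrite -?exprnP normrX normrN1 expr1n mulr1 -[leRHS]/(1%:R) ler_nat; case: odd.
apply: (hs_uniq (hsE _)).
have e1 : s1 = RtoC (cos (ImC z)).
  by rewrite cos.unlock; apply: hs_lim_real h1 _; exact: is_cvg_series_cos_coeff.
have e2 : s2 = RtoC (sin (ImC z)).
  by rewrite sin.unlock; apply: hs_lim_real h2 _; exact: is_cvg_series_sin_coeff.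
rewrite (_ : cis _ = s1 + 'i%C * s2).
  by apply: eq_hs (hs_add h1 (hs_Ml 'i%C h2)) => m; rewrite cos_sin_coeff.
by rewrite e1 e2 /cis [LHS]complexE.
Qed.

Lemma cexpD (z w : C) : cexp (z + w) = cexp z * cexp w.
Proof.
rewrite /cexp (_ : ReC (z + w) = ReC z + ReC w); last by case: z; case: w.
rewrite (_ : ImC (z + w) = ImC z + ImC w); last by case: z; case: w.
by rewrite expRD RtoCM cisD mulrACA.
Qed.

Lemma nm_cexp (z : C) : nm (cexp z) = expR (ReC z).
Proof. by rewrite /cexp nmM nm_cis mulr1 nm_RtoC ger0_norm // expR_ge0. Qed.

(** The bound [B] makes the exponential series of [a * G w] normally convergent on [Om]. *)
Lemma anl_cexp (Om : set C) a G B : anl Om G -> (forall w, Om w -> nm (G w) <= B) ->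
  anl Om (fun w => cexp (a * G w)).
Proof.
move=> hG hB.
(* A negative [B] contradicts the bound at the centre of any disc inside [Om]. *)
have [B0|B0] := leP 0 B; last first.
  move=> w0 r r0 H; exfalso.
  have /hB : Om w0 by apply: H; rewrite subrr nm0.
  by move=> /(le_trans (nm_ge0 _)); rewrite leNgt B0.
apply: (@anl_sum _ nat _ (fun m w => (a * G w) ^+ m / m`!%:R) _ _ _ _ _
   (sbd_exp (mulr_ge0 (nm_ge0 a) B0))) => [m|m w Ow|w Ow].
- by apply: anl_mul; [apply: anl_exp; exact: anl_Z | exact: anl_cst].
- rewrite nmM nmV nm_nat nmX ler_wpM2r ?invr_ge0 //.
  rewrite lerXn2r ?nnegrE ?nm_ge0 ?mulr_ge0 ?nm_ge0 //.
  by rewrite nmM ler_wpM2l ?nm_ge0 ?hB.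
exact: hs_cexp.
Qed.

End Exponential.

                                       

(** * Dominated integration of complex functions *)

Section ComplexIntegral.
Variable R : realType.
Local Notation C := (Cx R).
Local Notation leb := (@lebesgue_measure R).
Variable D : set R.
Hypothesis mD : measurable D.

Definition mfunC (F : R -> C) :=
  measurable_fun D (fun s => ReC (F s)) /\ measurable_fun D (fun s => ImC (F s)).

(** The dominating [g] is part of the predicate because norm bounds, dominated convergence and
    analyticity in a parameter all reuse it. *)
Definition itg (F : R -> C) (g : R -> R) :=
  [/\ mfunC F, leb.-integrable D (EFin \o g) & forall s, D s -> nm (F s) <= g s].

Definition cint (F : R -> C) : C :=
  Complex (\int[leb]_(s in D) ReC (F s)) (\int[leb]_(s in D) ImC (F s)).

Lemma ReCD (z w : C) : ReC (z + w) = ReC z + ReC w. Proof. by case: z; case: w. Qed.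
Lemma ImCD (z w : C) : ImC (z + w) = ImC z + ImC w. Proof. by case: z; case: w. Qed.
Lemma ReCM (z w : C) : ReC (z * w) = ReC z * ReC w - ImC z * ImC w.
Proof. by case: z; case: w. Qed.
Lemma ImCM (z w : C) : ImC (z * w) = ReC z * ImC w + ImC z * ReC w.
Proof. by case: z; case: w. Qed.

Lemma mfunC_cst a : mfunC (fun _ => a).
Proof. by split; exact: measurable_cst. Qed.

Lemma mfunCD F G : mfunC F -> mfunC G -> mfunC (fun s => F s + G s).
Proof.
move=> [a b] [c d]; split.
  by under eq_fun do rewrite ReCD; exact: measurable_funD.
by under eq_fun do rewrite ImCD; exact: measurable_funD.
Qed.

Lemma mfunCM F G : mfunC F -> mfunC G -> mfunC (fun s => F s * G s).
Proof.
move=> [a b] [c d]; split.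
  by under eq_fun do rewrite ReCM; apply: measurable_funB; exact: measurable_funM.
by under eq_fun do rewrite ImCM; apply: measurable_funD; exact: measurable_funM.
Qed.

Lemma mfunC_real (f : R -> R) : measurable_fun D f -> mfunC (fun s => RtoC (f s)).
Proof. by move=> h; split => //=; exact: measurable_cst. Qed.

Lemma mfunC_sum (T : Type) (r : seq T) (F : T -> R -> C) :
  (forall t, mfunC (F t)) -> mfunC (fun s => \sum_(t <- r) F t s).
Proof.
move=> h; elim: r => [|t r IH].
  by under [X in mfunC X]eq_fun do rewrite big_nil; exact: mfunC_cst.
by under [X in mfunC X]eq_fun do rewrite big_cons; exact: mfunCD.
Qed.

Lemma mfunC_ext F G : (forall s, D s -> F s = G s) -> mfunC F -> mfunC G.
Proof.
move=> e [a b]; split.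
  by apply: eq_measurable_fun a => s; rewrite inE => /e ->.
by apply: eq_measurable_fun b => s; rewrite inE => /e ->.
Qed.

Lemma measurable_nm F : mfunC F -> measurable_fun D (fun s => nm (F s)).
Proof.
move=> [a b]; have E s : nm (F s) = Num.sqrt (ReC (F s) ^+ 2 + ImC (F s) ^+ 2).
  by rewrite -nm_sqr sqrtr_sqr ger0_norm // nm_ge0.
under eq_fun do rewrite E.
apply: (@measurableT_comp _ _ _ _ _ _ (@Num.sqrt R)).
  by apply: continuous_measurable_fun; exact: sqrt_continuous.
by apply: measurable_funD; exact: measurable_funX.
Qed.

Lemma mfunC_lim (F : nat -> R -> C) G : (forall m, mfunC (F m)) ->
  (forall s, D s -> (fun m => nm (F m s - G s)) @ \oo --> (0 : R)) -> mfunC G.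
Proof.
move=> mF h; split.
  apply: (@measurable_fun_cvg _ _ R D (fun m s => ReC (F m s))) => [m|s Ds]; first by case: (mF m).
  apply/cvgrPdist_le => e e0; have /cvgrPdist_le/(_ _ e0) := h s Ds.
  apply: filterS => m; rewrite sub0r normrN ger0_norm ?nm_ge0 //.
  by apply: le_trans; rewrite distrC; have := nm_Re (F m s - G s); case: (F m s); case: (G s).
apply: (@measurable_fun_cvg _ _ R D (fun m s => ImC (F m s))) => [m|s Ds]; first by case: (mF m).
apply/cvgrPdist_le => e e0; have /cvgrPdist_le/(_ _ e0) := h s Ds.
apply: filterS => m; rewrite sub0r normrN ger0_norm ?nm_ge0 //.
by apply: le_trans; rewrite distrC; have := nm_Im (F m s - G s); case: (F m s); case: (G s).
Qed.

Lemma itg_Re F g : itg F g -> leb.-integrable D (EFin \o (fun s => ReC (F s))).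
Proof.
move=> [[a b] ig h]; apply: le_integrable ig => //.
  exact/measurable_EFinP.
move=> s Ds /=; rewrite lee_fin; apply: le_trans (nm_Re _) _.
by apply: le_trans (h _ Ds) _; exact: ler_norm.
Qed.

Lemma itg_Im F g : itg F g -> leb.-integrable D (EFin \o (fun s => ImC (F s))).
Proof.
move=> [[a b] ig h]; apply: le_integrable ig => //.
  exact/measurable_EFinP.
move=> s Ds /=; rewrite lee_fin; apply: le_trans (nm_Im _) _.
by apply: le_trans (h _ Ds) _; exact: ler_norm.
Qed.

Lemma itg_nm F g : itg F g -> leb.-integrable D (EFin \o (fun s => nm (F s))).
Proof.
move=> [mF ig h]; apply: le_integrable ig => //.
  by apply/measurable_EFinP; exact: measurable_nm.
move=> s Ds /=; rewrite lee_fin ger0_norm ?nm_ge0 //.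
by apply: le_trans (h _ Ds) _; exact: ler_norm.
Qed.

Lemma eq_cint F G : (forall s, D s -> F s = G s) -> cint F = cint G.
Proof.
move=> e; congr Complex; apply: eq_Rintegral => s; rewrite inE => Ds; by rewrite e.
Qed.

Lemma cintD F G f g : itg F f -> itg G g -> cint (fun s => F s + G s) = cint F + cint G.
Proof.
move=> hF hG; apply/eqP; rewrite eq_complex /=; apply/andP; split; apply/eqP.
  rewrite -RintegralD //; [|exact: itg_Re hF|exact: itg_Re hG].
  by apply: eq_Rintegral => s _; rewrite ReCD.
rewrite -RintegralD //; [|exact: itg_Im hF|exact: itg_Im hG].
by apply: eq_Rintegral => s _; rewrite ImCD.
Qed.

Lemma cintZ a F f : itg F f -> cint (fun s => a * F s) = a * cint F.
Proof.
move=> hF; have hr := itg_Re hF; have hi := itg_Im hF.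
have i1 (b : R) : leb.-integrable D (EFin \o (fun s => b * ReC (F s))).
  rewrite (_ : _ \o _ = fun s => (b%:E * (EFin \o (fun s => ReC (F s))) s)%E) //.
  exact: integrableZl.
have i2 (b : R) : leb.-integrable D (EFin \o (fun s => b * ImC (F s))).
  rewrite (_ : _ \o _ = fun s => (b%:E * (EFin \o (fun s => ImC (F s))) s)%E) //.
  exact: integrableZl.
case: a => u v; apply/eqP; rewrite eq_complex /=; apply/andP; split; apply/eqP.
  rewrite -!RintegralZl // -RintegralB //.
  by apply: eq_Rintegral => s _; rewrite ReCM.
rewrite -!RintegralZl // -RintegralD //.
by apply: eq_Rintegral => s _; rewrite ImCM.
Qed.

Lemma itgD F G f g : itg F f -> itg G g ->
  itg (fun s => F s + G s) (fun s => f s + g s).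
Proof.
move=> [a b c] [d e h]; split; first exact: mfunCD.
  rewrite (_ : _ \o _ = (EFin \o f) \+ (EFin \o g))%E //.
  exact: integrableD.
by move=> s Ds; apply: le_trans (nmD _ _) _; rewrite lerD ?c ?h.
Qed.

Lemma integrableZ (f : R -> R) (b : R) : leb.-integrable D (EFin \o f) ->
  leb.-integrable D (EFin \o (fun s => b * f s)).
Proof.
move=> h; rewrite (_ : _ \o _ = fun s => (b%:E * (EFin \o f) s)%E) //.
exact: integrableZl.
Qed.

Lemma itgZ a F f : itg F f -> itg (fun s => a * F s) (fun s => nm a * f s).
Proof.
move=> [x b c]; split; first by apply: mfunCM => //; exact: mfunC_cst.
  exact: integrableZ.
by move=> s Ds; rewrite nmM ler_wpM2l ?nm_ge0 ?c.
Qed.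

Lemma itg0 : itg (fun _ => 0) (fun _ => 0).
Proof.
split; [exact: mfunC_cst| |by move=> s _; rewrite nm0].
exact: integrable0.
Qed.

Lemma cint0 : cint (fun _ => 0) = 0.
Proof. by rewrite /cint /= /Rintegral integral0. Qed.

Lemma cint_sum (T : Type) (r : seq T) (F : T -> R -> C) (g : T -> R -> R) :
  (forall t, itg (F t) (g t)) ->
  cint (fun s => \sum_(t <- r) F t s) = \sum_(t <- r) cint (F t) /\
  itg (fun s => \sum_(t <- r) F t s) (fun s => \sum_(t <- r) g t s).
Proof.
move=> h; elim: r => [|t r [IH1 IH2]].
  rewrite big_nil; split.
    by under [X in cint X]eq_fun do rewrite big_nil; exact: cint0.
  under [X in itg X _]eq_fun do rewrite big_nil.
  by under [X in itg _ X]eq_fun do rewrite big_nil; exact: itg0.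
rewrite big_cons -IH1 -(cintD (h t) IH2); split.
  by apply: eq_cint => s _; rewrite big_cons.
under [X in itg X _]eq_fun do rewrite big_cons.
by under [X in itg _ X]eq_fun do rewrite big_cons; exact: itgD.
Qed.

                                                             
(** Rotating by the unimodular [u] that makes [u * z] equal to [nm z] reduces the inequality to one
    between real integrals. *)
Lemma nm_cint F g : itg F g -> nm (cint F) <= \int[leb]_(s in D) nm (F s).
Proof.
move=> hF; set z := cint F.
have [->|z0] := eqVneq z 0.
  by rewrite nm0; apply: Rintegral_ge0 => s _; exact: nm_ge0.
have nz : 0 < nm z by exact: nm_gt0.
pose u := RtoC (nm z)^-1 * conjc z.
have E : u * z = RtoC (nm z).
  rewrite /u -mulrA [conjc z * z]mulrC.
  have -> : z * conjc z = RtoC (nm z ^+ 2).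
    by rewrite -sqr_normc nmE RtoCX.
  by rewrite -RtoCM expr2 mulKf // gt_eqF.
have nu : nm u = 1.
  rewrite /u nmM nm_RtoC ger0_norm ?invr_ge0 ?nm_ge0 //.
  have -> : nm (conjc z) = nm z by rewrite /nm normcJ.
  by rewrite mulVf // gt_eqF.
have hu := itgZ u hF.
have -> : nm z = ReC (cint (fun s => u * F s)) by rewrite (cintZ _ hF) -/z E.
rewrite /=; apply: le_Rintegral => //; [exact: itg_Re hu|exact: itg_nm hF|].
move=> s Ds; apply: le_trans (ler_norm _) _; apply: le_trans (nm_Re _) _.
by rewrite nmM nu mul1r.
Qed.

Lemma nm_cint_le F g : itg F g -> nm (cint F) <= \int[leb]_(s in D) g s.
Proof.
move=> hF; apply: le_trans (nm_cint hF) _; case: (hF) => _ ig h.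
by apply: le_Rintegral => //; exact: itg_nm hF.
Qed.

Lemma itg_le F f g : itg F f -> leb.-integrable D (EFin \o g) ->
  (forall s, D s -> nm (F s) <= g s) -> itg F g.
Proof. by move=> [mF _ _] ig h; split. Qed.

Lemma itg_ext F G f g : (forall s, D s -> F s = G s) -> (forall s, D s -> f s = g s) ->
  itg F f -> itg G g.
Proof.
move=> e1 e2 [a b c]; split; first exact: mfunC_ext a.
  by apply: eq_integrable b => // s; rewrite inE /= => /e2 ->.
by move=> s Ds; rewrite -e1 // -e2 // c.
Qed.

Lemma cint_dct (F : nat -> R -> C) G g : (forall m, itg (F m) g) -> mfunC G ->
  (forall s, D s -> (fun m => nm (F m s - G s)) @ \oo --> (0 : R)) ->
  itg G g /\ (fun m => nm (cint (F m) - cint G)) @ \oo --> (0 : R).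
Proof.
move=> hF mG h.
have [_ ig _] := hF 0%N.
have Gg s : D s -> nm (G s) <= g s.
  move=> Ds; apply/ler_addgt0Pr => e e0.
  have /cvgrPdist_le/(_ _ e0)[N _ hN] := h s Ds.
  have := hN N (leqnn N); rewrite sub0r normrN ger0_norm ?nm_ge0 // => h1.
  have -> : G s = F N s - (F N s - G s) by rewrite opprB addrC subrK.
  by apply: le_trans (nmB _ _) _; apply: lerD => //; case: (hF N) => _ _; apply.
have hG : itg G g by [].
split=> //.
have hd m : itg (fun s => F m s - G s) (fun s => g s + g s).
  have := itgD (hF m) (itgZ (-1) hG); rewrite nmN nm1 => h1.
  apply: itg_ext h1 => s _; first by rewrite mulN1r.
  by rewrite mul1r.
have E m : nm (cint (F m) - cint G) <= \int[leb]_(s in D) nm (F m s - G s).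
  rewrite -mulN1r -(cintZ (-1) hG) -(cintD (hF m) (itgZ (-1) hG)).
  rewrite (@eq_cint _ (fun s => F m s - G s)); last by move=> s _; rewrite mulN1r.
  exact: nm_cint (hd m).
have := @dominated_convergence _ _ R leb D mD
  (fun m s => (nm (F m s - G s))%:E) (fun _ => 0%E) (fun s => (g s + g s)%:E).
case.
- move=> m; apply/measurable_EFinP; apply: measurable_nm.
  by case: (hd m).
- exact: measurable_cst.
- apply: aeW => s Ds; apply/fine_cvgP; split; first exact: nearW.
  exact: h s Ds.
- by have [_ + _] := hd 0%N.
- apply: aeW => s m Ds; rewrite /= lee_fin ger0_norm ?nm_ge0 //.
  by have [_ _ /(_ s Ds)] := hd m.
move=> _ + _; rewrite /=.
under eq_cvg do under eq_integral do rewrite subr0 ger0_norm ?nm_ge0 //.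
move=> cv; apply: (@squeeze_cvgr _ _ _ _ (fun=> 0) (fun m => \int[leb]_(s in D) nm (F m s - G s))).
- by apply: nearW => m; rewrite nm_ge0 E.
- exact: cvg_cst.
- exact: (fine_cvg cv).
Qed.

                                                                                                
(** Each coefficient is a pointwise limit of measurable difference quotients built from the previous
    coefficients, along steps [h N] tending to 0. *)
Lemma mfunC_coef (K : C -> R -> C) (w0 : C) (r : R) (c : R -> nat -> C) : 0 < r ->
  (forall s, D s -> pser w0 r (K^~ s) (c s)) ->
  (forall h, nm h < r -> mfunC (K (w0 + h))) -> forall m, mfunC (fun s => c s m).
Proof.
move=> r0 hK mK; elim/ltn_ind => m IH.
(* [N.+2] keeps every step within [r / 2], where the remainder bound applies. *)
pose h (N : nat) : C := RtoC (r / N.+2%:R).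
have hr N : nm (h N) = r / N.+2%:R by rewrite nm_RtoC ger0_norm // divr_ge0 ?ltW.
have h2 N : nm (h N) <= r / 2.
  by rewrite hr ler_pM2l // lef_pV2 ?posrE ?ltr0n // ler_nat.
have r2 : 0 < r / 2 < r by rewrite divr_gt0 //= ltr_pdivrMr // ltr_pMr // ltr1n.
have hlt N : nm (h N) < r by apply: le_lt_trans (h2 N) _; case/andP: r2.
have hN0 N : 0 < nm (h N) by rewrite hr divr_gt0.
apply: (@mfunC_lim (fun N s => (h N)^-1 ^+ m * (K (w0 + h N) s + (-1) * \sum_(l < m) c s l * h N ^+ l))).
  move=> N; apply: mfunCM; first exact: mfunC_cst.
  apply: mfunCD; first exact: mK (hlt N).
  apply: mfunCM; first exact: mfunC_cst.
  by apply: mfunC_sum => l; apply: mfunCM; [exact: IH | exact: mfunC_cst].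
move=> s Ds; have [B B0 hB] := pser_rem m.+1 (hK s Ds) r2.
apply/cvgrPdist_le => e e0.
near=> N; rewrite sub0r normrN ger0_norm ?nm_ge0 //.
have := hB (h N) (h2 N); rewrite big_ord_recr /=.
set S := \sum_(l < m) _; set k := K _ _ => h1.
have hm0 : h N ^+ m != 0.
  by rewrite expf_neq0 //; apply: contraTneq (hN0 N) => ->; rewrite nm0 ltxx.
have -> : (h N)^-1 ^+ m * (k + -1 * S) - c s m = (h N ^+ m)^-1 * (k - (S + c s m * h N ^+ m)).
  by rewrite exprVn mulN1r opprD addrA [RHS]mulrDr; congr (_ + _); rewrite mulrN mulrC mulfK.
rewrite nmM nmV nmX mulrC ler_pdivrMr ?exprn_gt0 //.
apply: le_trans h1 _; rewrite exprS mulrA ler_wpM2r ?exprn_ge0 ?nm_ge0 //.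
rewrite hr mulrA ler_pdivrMr ?ltr0n //.
have : B * r / e <= N%:R by near: N; exact: nbhs_infty_ger.
rewrite ler_pdivrMr // => /le_trans; apply.
by rewrite mulrC ler_wpM2l ?(ltW e0) // ler_nat -addn2 leq_addr.
Unshelve. all: by end_near.
Qed.

(** Termwise integration. Countability of [I] replaces the net of finite sums by the sequence over
    [E N], to which dominated convergence applies. *)
Lemma cint_hs (I : countType) (F : I -> R -> C) (G : R -> C) (g : R -> R) :
  (forall i, mfunC (F i)) -> leb.-integrable D (EFin \o g) ->
  (forall s, D s -> sbd (fun i => nm (F i s)) (g s)) ->
  (forall s, D s -> hs (F^~ s) (G s)) ->
  itg G g /\ hs (fun i => cint (F i)) (cint G).
Proof.
move=> mF ig hg hG.
have iF i : itg (F i) g by split=> // s /hg/sbd_term; exact.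
have sumF (J : seq I) (u : I -> C) : uniq J -> (forall i, nm (u i) = 1) ->
    itg (fun s => \sum_(i <- J) u i * F i s) g.
  move=> uJ hu; have [_ h] := cint_sum J (fun i => itgZ (u i) (iF i)).
  apply: (itg_le h) => // s Ds; apply: le_trans (nm_sum _ _ _) _.
  rewrite (eq_bigr (fun i => nm (F i s))); last by move=> i _; rewrite nmM hu mul1r.
  exact: hg.
have sb : sbd (fun i => nm (cint (F i))) (\int[leb]_(s in D) g s).
  move=> J uJ.
  (* The phases [u i] align the integrals: the sum of their norms becomes the integral of one finite
     sum, which [g] dominates. *)
  pose u i : C := if cint (F i) == 0 then 1 else RtoC (nm (cint (F i))) / cint (F i).
  have nu i : nm (u i) = 1.
    rewrite /u; case: eqVneq => [_|n0]; first exact: nm1.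
    by rewrite nmM nmV nm_RtoC ger0_norm ?nm_ge0 // divff // gt_eqF // nm_gt0.
  have uE i : u i * cint (F i) = RtoC (nm (cint (F i))).
    by rewrite /u; case: eqVneq => [->|n0]; rewrite ?nm0 ?RtoC0 ?mulr0 // divfK.
  have h0 : 0 <= \sum_(i <- J) nm (cint (F i)) by apply: sumr_ge0 => i _; exact: nm_ge0.
  rewrite -(ger0_norm h0) -nm_RtoC RtoC_sum.
  rewrite (eq_bigr (fun i => cint (fun s => u i * F i s))); last first.
    by move=> i _; rewrite (cintZ _ (iF i)) uE.
  rewrite -(cint_sum J (fun i => itgZ (u i) (iF i))).1.
  exact: nm_cint_le (sumF J u uJ nu).
have [S hS _] := hs_ex sb.
pose E N : seq I := pmap (@choice.pickle_inv I) (iota 0 N).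
have uE N : uniq (E N).
  by apply: pmap_uniq (iota_uniq 0 N); exact: choice.pickle_invK.
have mE N i : (i \in E N) = (choice.pickle i < N)%N.
  rewrite -[RHS](mem_iota 0 N) mem_pmap; apply/mapP/idP => [[m mN e]|h].
    have := choice.pickle_invK (T := I) m; rewrite -e /= => ->.
    exact: mN.
  by exists (choice.pickle i) => //; rewrite choice.pickleK_inv.
have cov (J : seq I) : exists N0, forall N, (N0 <= N)%N -> {subset J <= E N}.
  exists (\max_(i <- J) choice.pickle i).+1 => N hN i iJ; rewrite mE.
  by apply: leq_trans hN; rewrite ltnS (big_rem i) //= leq_maxl.
have F1 N : itg (fun s => \sum_(i <- E N) F i s) g.
  have := sumF (E N) (fun=> 1) (uE N) (fun=> nm1 R).
  by apply: itg_ext => // s _; apply: eq_bigr => i _; rewrite mul1r.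
have mG : mfunC G.
  apply: (@mfunC_lim (fun N s => \sum_(i <- E N) F i s)) => [N|s Ds]; first by case: (F1 N).
  apply/cvgrPdist_le => e e0; have [J hJ] := hG s Ds _ e0.
  have [N0 hN0] := cov J; exists N0 => // N /= /hN0 JN.
  by rewrite sub0r normrN ger0_norm ?nm_ge0 // ltW // hJ.
have [|iG lim1] := @cint_dct (fun N s => \sum_(i <- E N) F i s) G g F1 mG.
  move=> s Ds; apply/cvgrPdist_le => e e0; have [J hJ] := hG s Ds _ e0.
  have [N0 hN0] := cov J; exists N0 => // N /= /hN0 JN.
  by rewrite sub0r normrN ger0_norm ?nm_ge0 // ltW // hJ.
split=> //; suff -> : cint G = S by [].
apply/eqP; rewrite -subr_eq0; apply/eqP/nm_eq0/ler_addgt0Pr => e e0; rewrite add0r.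
have e2 : 0 < e / 2 by rewrite divr_gt0.
have /cvgrPdist_le/(_ _ e2)[N1 _ hN1] := lim1.
have [J hJ] := hS _ e2; have [N0 hN0] := cov J.
pose N := maxn N1 N0.
have := hN1 N; rewrite /= leq_maxl sub0r normrN ger0_norm ?nm_ge0 // => /(_ isT) h1.
have h2 : nm (cint (fun s => \sum_(i <- E N) F i s) - S) < e / 2.
  by rewrite (cint_sum _ iF).1; apply: hJ => //; apply: hN0; exact: leq_maxr.
rewrite (_ : cint G - S = - (cint (fun s => \sum_(i <- E N) F i s) - cint G)
  + (cint (fun s => \sum_(i <- E N) F i s) - S)); last by ring.
by apply: le_trans (nmD _ _) _; rewrite nmN [leRHS](splitr e) lerD // ltW.
Qed.

(** Analyticity under the integral sign: the Cauchy estimate bounds the [m]-th coefficient by the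
    integrable [r ^- m * g s], and [cint_hs] integrates the expansion term by term. *)
Lemma pser_cint (K : C -> R -> C) (w0 : C) (r : R) (g : R -> R) : 0 < r ->
  (forall s, D s -> exists c, pser w0 r (K^~ s) c) ->
  (forall h, nm h < r -> itg (K (w0 + h)) g) ->
  exists c : nat -> R -> C, [/\ forall s, D s -> pser w0 r (K^~ s) (c^~ s),
    forall m, itg (c m) (fun s => r ^- m * g s) &
    pser w0 r (fun w => cint (K w)) (fun m => cint (c m))].
Proof.
move=> r0 hK hg.
pose c s : nat -> C := if pselect (D s) is left Ds then proj1_sig (cid (hK s Ds)) else fun=> 0.
have hc s : D s -> pser w0 r (K^~ s) (c s).
  by move=> Ds; rewrite /c; case: pselect => // Ds'; case: cid.
have mc := mfunC_coef r0 hc (fun h hr => let: And3 a _ _ := hg h hr in a).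
have ig : leb.-integrable D (EFin \o g) by have [|] := hg 0; rewrite ?nm0.
have bc m s : D s -> nm (c s m) <= r ^- m * g s.
  move=> Ds; rewrite mulrC ler_pdivlMr ?exprn_gt0 //.
  apply: cauchy_estimate (hc s Ds) r0 _ => h /hg[_ _]; exact.
have ic m : itg (fun s => c s m) (fun s => r ^- m * g s).
  by split; [exact: mc|exact: integrableZ|exact: bc].
exists (fun m s => c s m); split=> // h hr.
have g0 s : D s -> 0 <= g s.
  by have [|_ _ H Ds] := hg 0; [rewrite nm0|apply: le_trans (nm_ge0 _) (H s Ds)].
have q : 0 <= nm h / r < 1.
  by rewrite divr_ge0 ?nm_ge0 ?(ltW r0) //= ltr_pdivrMr // mul1r.
have tb m s : D s -> nm (c s m * h ^+ m) <= g s * (nm h / r) ^+ m.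
  move=> Ds; apply: pser_term_bound (hc s Ds) r0 _ => k /hg[_ _]; exact.
have [||||_] := @cint_hs nat (fun m s => h ^+ m * c s m) (K (w0 + h)) (fun s => g s * (1 - nm h / r)^-1).
- by move=> m; have [] := itgZ (h ^+ m) (ic m).
- by rewrite (_ : _ \o _ = EFin \o (fun s => (1 - nm h / r)^-1 * g s)) //; [exact: integrableZ|apply/funext => s /=; rewrite mulrC].
- move=> s Ds; apply: sbd_le (lexx _) (sbdZ (g0 s Ds) (sbd_geom q)) => m.
  by rewrite mulrC tb.
- by move=> s Ds; apply: eq_hs (hc s Ds h hr) => m; rewrite mulrC.
by apply: eq_hs => m; rewrite (cintZ _ (ic m)) mulrC.
Qed.

End ComplexIntegral.

(** * Linear substitution in Lebesgue integrals *)

Section Scaling.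
Variable R : realType.
Local Notation leb := (@lebesgue_measure R).
Local Open Scope ereal_scope.

(** Both sides are measures in [A] that agree on half-open intervals, which characterises Lebesgue
    measure. *)
Lemma leb_scale (c : R) (A : set R) : (0 < c)%R -> measurable A ->
  leb A = c%:E * leb [set x | A (c * x)%R].
Proof.
move=> c0 mA.
have mphi : measurable_fun [set: measurableTypeR R] ( *%R c : measurableTypeR R -> measurableTypeR R).
  exact: mulrl_measurable.
pose phi : measurableTypeR R -> measurableTypeR R := *%R c.
pose k : {nonneg R} := NngNum (ltW c0).
pose m' : {measure set (measurableTypeR R) -> \bar R} := mscale k (pushforward leb phi).
pose m := m' mphi.
rewrite -[RHS]/(m A).
apply: lebesgue_measure_unique => // X [[a b] _ <-].
rewrite /m /m' /= /mscale /= /pushforward /=.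
rewrite (_ : _ @^-1` _ = `]c^-1 * a, c^-1 * b]%classic)%R; last first.
  apply/seteqP; split => x /=; rewrite !in_itv /= => /andP[h1 h2]; apply/andP; split.
  - by rewrite mulrC ltr_pdivrMr // mulrC.
  - by rewrite mulrC ler_pdivlMr // mulrC.
  - by move: h1; rewrite mulrC ltr_pdivrMr // mulrC.
  - by move: h2; rewrite mulrC ler_pdivlMr // mulrC.
rewrite !lebesgue_measure_itv /= !lte_fin ltr_pM2l ?invr_gt0 //.
case: ifP => _; last by rewrite mule0.
rewrite -!EFinB -EFinM; congr EFin.
by rewrite -mulrBr mulrA divff ?mul1r // gt_eqF.
Qed.

Lemma ge0_integral_scale (c : R) (D : set R) (f : R -> \bar R) : (0 < c)%R ->
  measurable D -> measurable_fun D f -> (forall x, D x -> 0 <= f x) ->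
  \int[leb]_(x in D) f x = c%:E * \int[leb]_(x in [set x | D (c * x)%R]) f (c * x)%R.
Proof.
move=> c0 mD mf f0.
have mphi : measurable_fun [set: measurableTypeR R] ( *%R c : measurableTypeR R -> measurableTypeR R).
  exact: mulrl_measurable.
pose phi : measurableTypeR R -> measurableTypeR R := *%R c.
pose k : {nonneg R} := NngNum (ltW c0).
pose m' : {measure set (measurableTypeR R) -> \bar R} := mscale k (pushforward leb phi).
pose m := m' mphi.
rewrite (eq_measure_integral m); last first.
  by move=> A mA _; exact: leb_scale.
rewrite ge0_integral_mscale //; congr (_ * _).
by rewrite ge0_integral_pushforward // => x; rewrite inE => /f0.
Qed.

End Scaling.

                                                 

(** * Product integrals over a quadrant *)

Section Quadrant.
Variable R : realType.
Local Notation leb := (@lebesgue_measure R).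
Local Notation P := (`]0%R, +oo[%classic : set R).
Local Notation I := (`]0%R, 1%R[%classic : set R).
Variable q : R -> R.
Hypothesis mq : measurable_fun setT q.
Hypothesis q01 : forall m, 0 < q m <= 1.
Local Open Scope ereal_scope.

Lemma tonelli_on (D1 D2 : set R) (f : R * R -> \bar R) : measurable D1 -> measurable D2 ->
  measurable_fun setT f -> (forall x, 0 <= f x) ->
  \int[leb]_(x in D1) \int[leb]_(y in D2) f (x, y) =
  \int[leb]_(y in D2) \int[leb]_(x in D1) f (x, y).
Proof.
move=> mD1 mD2 mf f0.
pose g := f \_ (D1 `*` D2).
have mg : measurable_fun setT g.
  have mX : measurable (D1 `*` D2) by exact: measurableX.
  by apply/(measurable_restrictT f mX); exact: measurable_funTS.
have g0 x : 0 <= g x by rewrite /g /patch; case: ifP.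
have E1 x : \int[leb]_y g (x, y) = ((fun x => \int[leb]_(y in D2) f (x, y)) \_ D1) x.
  rewrite /patch; case: ifPn => [xD|xD].
    rewrite [RHS]integral_mkcond; apply: eq_integral => y _.
    by rewrite /g /patch in_setX /= xD.
  by apply: integral0_eq => y _; rewrite /g /patch in_setX /= (negbTE xD).
have E2 y : \int[leb]_x g (x, y) = ((fun y => \int[leb]_(x in D1) f (x, y)) \_ D2) y.
  rewrite /patch; case: ifPn => [yD|yD].
    rewrite [RHS]integral_mkcond; apply: eq_integral => x _.
    by rewrite /g /patch in_setX /= yD andbT.
  by apply: integral0_eq => x _; rewrite /g /patch in_setX /= (negbTE yD) andbF.
rewrite [LHS]integral_mkcond [RHS]integral_mkcond.
under eq_integral do rewrite -E1.
under [RHS]eq_integral do rewrite -E2.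
exact: fubini_tonelli.
Qed.

Lemma measurable_int_fst (D1 D2 : set R) (f : R * R -> \bar R) : measurable D2 ->
  measurable_fun setT f -> (forall x, 0 <= f x) ->
  measurable_fun D1 (fun x => \int[leb]_(y in D2) f (x, y)).
Proof.
move=> mD2 mf f0; apply: measurable_funTS.
pose g := f \_ (setT `*` D2).
have mX : measurable ([set: R] `*` D2) by exact: measurableX.
have mg : measurable_fun setT g.
  by apply/(measurable_restrictT f mX); exact: measurable_funTS.
have g0 x : 0 <= g x by rewrite /g /patch; case: ifP.
apply: eq_measurable_fun (measurable_fun_fubini_tonelli_F (m2 := leb) g mg g0) => x _.
rewrite /fubini_F [RHS]integral_mkcond; apply: eq_integral => y _.
by rewrite /g /patch in_setX in_setT.
Qed.

Lemma measurable_int_snd (D1 D2 : set R) (f : R * R -> \bar R) : measurable D1 ->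
  measurable_fun setT f -> (forall x, 0 <= f x) ->
  measurable_fun D2 (fun y => \int[leb]_(x in D1) f (x, y)).
Proof.
move=> mD1 mf f0.
have ms : measurable_fun setT (fun z : R * R => (z.2, z.1)).
  by apply/measurable_fun_pairP; split; [exact: measurable_snd|exact: measurable_fst].
by apply: (@measurable_int_fst D2 D1 (fun z => f (z.2, z.1))) => //; exact: measurableT_comp.
Qed.

(** The coordinates [x = s * (m * q m)], [y = s * q m] with [0 < m < 1] fill the triangle [x < y] of
    the quadrant, and [s * q m ^+ 2] is their Jacobian. The later choice of [q] gives
    [s ^ k = x ^ k + y ^ k]. *)
Definition wedge (a b : R -> R) (s : R) : \bar R :=
  \int[leb]_(m in I) ((s * q m ^+ 2) * (a (s * (m * q m)) * b (s * q m)))%R%:E.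

Variables a b : R -> R.
Hypothesis ma : measurable_fun setT a.
Hypothesis mb : measurable_fun setT b.
Hypothesis a0 : forall x, (0 <= a x)%R.
Hypothesis b0 : forall x, (0 <= b x)%R.

Lemma measurable_wedge_kernel :
  measurable_fun setT (fun x : R * R => (`|x.1| * q x.2 ^+ 2) * (a (x.1 * (x.2 * q x.2)) * b (x.1 * q x.2)))%R.
Proof.
have m1 : measurable_fun setT (fun x : R * R => q x.2) by exact: measurableT_comp.
apply: measurable_funM; first by apply: measurable_funM; [exact: measurableT_comp|exact: measurable_funX].
apply: measurable_funM; (apply: measurableT_comp => //).
  by apply: measurable_funM => //; exact: measurable_funM.
exact: measurable_funM.
Qed.

(** Two linear substitutions, [x = y * m] at fixed [y] and [y = s * q m] at fixed [m], with Tonelli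
    between and after them, stand for the two-dimensional change of variables. *)
Lemma triangle_wedge :
  \int[leb]_(y in P) \int[leb]_(x in `]0%R, y[) (a x * b y)%:E = \int[leb]_(s in P) wedge a b s.
Proof.
have mkern := measurable_wedge_kernel.
(* The absolute value makes the kernel nonnegative on the whole plane for Tonelli; on the domain of
   integration it is [y] itself. *)
pose K (y m : R) : \bar R := (`|y| * (a (y * m) * b y))%R%:E.
have mK : measurable_fun setT (fun x : R * R => K x.1 x.2).
  apply/measurable_EFinP; apply: measurable_funM; first exact: measurableT_comp.
  apply: measurable_funM; apply: measurableT_comp => //; exact: measurable_funM.
have K0 y m : 0 <= K y m by rewrite lee_fin !mulr_ge0.
transitivity (\int[leb]_(y in P) \int[leb]_(m in I) K y m).
  apply: eq_integral => y; rewrite inE /= in_itv /= andbT => y0.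
  rewrite (ge0_integral_scale (c := y)) //; last 2 first.
  - by apply/measurable_EFinP; apply: measurable_funM; [exact: measurable_funS ma|exact: measurable_cst].
  - by move=> x _; rewrite lee_fin mulr_ge0.
  rewrite (_ : [set x | (`]0%R, y[%classic : set R) (y * x)%R] = I); last first.
    apply/seteqP; split => x /=; rewrite !in_itv /=.
      move=> /andP[h1 h2]; rewrite pmulr_rgt0 // in h1; rewrite h1 /=.
      by rewrite -(ltr_pM2l y0) mulr1.
    by move=> /andP[x0 x1]; rewrite pmulr_rgt0 // x0 /= -[ltRHS]mulr1 ltr_pM2l.
  rewrite -ge0_integralZl //; last 3 first.
  - apply/measurable_EFinP; apply: measurable_funM; last exact: measurable_cst.
    apply: measurable_funTS; apply: measurableT_comp => //; exact: mulrl_measurable.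
  - by move=> x _; rewrite lee_fin mulr_ge0.
  - by rewrite lee_fin ltW.
  by apply: eq_integral => m _; rewrite /K -EFinM gtr0_norm.
transitivity (\int[leb]_(m in I) \int[leb]_(y in P) K y m).
  by apply: (@tonelli_on P I (fun x => K x.1 x.2)).
transitivity (\int[leb]_(m in I) \int[leb]_(s in P)
   (`|s| * q m ^+ 2 * (a (s * (m * q m)) * b (s * q m)))%R%:E).
  apply: eq_integral => m _ /=.
  have /andP[qm0 qm1] := q01 m.
  rewrite (ge0_integral_scale (c := q m)) //; last first.
    by apply: measurable_funS (measurableT_comp mK (measurable_pair2 m)).
  rewrite (_ : [set x | P (q m * x)%R] = P); last first.
    by apply/seteqP; split => x /=; rewrite !in_itv /= !andbT pmulr_rgt0.
  rewrite -ge0_integralZl //; last 2 first.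
  - apply: measurable_funTS; apply/measurable_EFinP.
    have mqs : measurable_fun setT (fun s : R => q m * s)%R by exact: mulrl_measurable.
    apply: measurable_funM; first exact: measurableT_comp.
    apply: measurable_funM; (apply: measurableT_comp => //); exact: measurable_funM.
  - by rewrite lee_fin ltW.
  apply: eq_integral => s _; rewrite /K -EFinM; congr EFin.
  rewrite normrM (gtr0_norm qm0) (_ : q m * s * m = s * (m * q m))%R; last by ring.
  by rewrite (_ : q m * s = s * q m)%R; [ring | exact: mulrC].
transitivity (\int[leb]_(s in P) \int[leb]_(m in I)
   (`|s| * q m ^+ 2 * (a (s * (m * q m)) * b (s * q m)))%R%:E).
  apply/esym/(@tonelli_on P I (fun x => (`|x.1| * q x.2 ^+ 2 * (a (x.1 * (x.2 * q x.2)) * b (x.1 * q x.2)))%R%:E)) => //.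
    by apply/measurable_EFinP.
  by move=> x; rewrite lee_fin mulr_ge0 // mulr_ge0 // sqr_ge0.
apply: eq_integral => s; rewrite inE /= in_itv /= andbT => s0.
by apply: eq_integral => m _ /=; rewrite gtr0_norm.
Qed.

Lemma wedge_ge0 (s : R) : (0 <= s)%R -> 0 <= wedge a b s.
Proof.
move=> s0; apply: integral_ge0 => m _; rewrite lee_fin.
by apply: mulr_ge0; apply: mulr_ge0 => //; exact: sqr_ge0.
Qed.

Lemma measurable_wedge : measurable_fun P (wedge a b).
Proof.
pose f (x : R * R) : \bar R :=
  ((`|x.1| * q x.2 ^+ 2) * (a (x.1 * (x.2 * q x.2)) * b (x.1 * q x.2)))%R%:E.
have mf : measurable_fun setT f by apply/measurable_EFinP; exact: measurable_wedge_kernel.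
have f0 x : 0 <= f x.
  by rewrite lee_fin; apply: mulr_ge0; apply: mulr_ge0 => //; exact: sqr_ge0.
have mF : measurable_fun P (fun s => \int[leb]_(m in I) f (s, m)).
  exact: measurable_int_fst.
apply: eq_measurable_fun mF => s; rewrite inE /= in_itv /= andbT => s0.
by apply: eq_integral => m _; rewrite /f /= gtr0_norm.
Qed.

End Quadrant.

Section QuadrantReal.
Variable R : realType.
Local Notation leb := (@lebesgue_measure R).
Local Notation P := (`]0%R, +oo[%classic : set R).
Local Notation I := (`]0%R, 1%R[%classic : set R).
Variable q : R -> R.
Hypothesis mq : measurable_fun setT q.
Hypothesis q01 : forall m, 0 < q m <= 1.
Local Open Scope ereal_scope.

                                                                          
                                
(** The diagonal cuts the quadrant into two triangles, each given by [triangle_wedge] with [a] and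
    [b] exchanged; the diagonal itself is negligible. *)
Lemma quadrant_wedge (a b : R -> R) :
  measurable_fun setT a -> measurable_fun setT b ->
  (forall x, 0 <= a x)%R -> (forall x, 0 <= b x)%R ->
  (\int[leb]_(x in P) (a x)%:E) * (\int[leb]_(y in P) (b y)%:E) =
  \int[leb]_(s in P) (wedge q a b s + wedge q b a s).
Proof.
move=> ma mb a0 b0.
have mab : measurable_fun setT (fun x : R * R => (a x.1 * b x.2)%R%:E).
  by apply/measurable_EFinP; apply: measurable_funM; apply: measurableT_comp.
have mEa : measurable_fun P (EFin \o a) by apply: measurable_funTS; exact/measurable_EFinP.
have mEb : measurable_fun P (EFin \o b) by apply: measurable_funTS; exact/measurable_EFinP.
have P0 (s : R) : s \in P -> (0 <= s)%R by rewrite inE /= in_itv /= andbT => /ltW.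
rewrite ge0_integralD //; last 4 first.
- by move=> s Ps; apply: wedge_ge0 => //; apply: P0; rewrite inE.
- exact: measurable_wedge.
- by move=> s Ps; apply: wedge_ge0 => //; apply: P0; rewrite inE.
- exact: measurable_wedge.
rewrite -!triangle_wedge //.
transitivity (\int[leb]_(y in P) \int[leb]_(x in P) (a x * b y)%R%:E).
  rewrite -ge0_integralZl //; last 2 first.
  - by move=> y _; rewrite lee_fin.
  - by apply: integral_ge0 => x _; rewrite lee_fin.
  apply: eq_integral => y _; rewrite -ge0_integralZr //; last by rewrite lee_fin.
  by move=> x _; rewrite lee_fin.
pose t1 (x : R * R) : \bar R := (a x.1 * b x.2 * \1_[set z : R * R | z.1 < z.2] x)%R%:E.
pose t2 (x : R * R) : \bar R := (a x.1 * b x.2 * \1_[set z : R * R | z.2 <= z.1] x)%R%:E.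
have mfst : measurable_fun setT (fun z : R * R => z.1) by exact: measurable_fst.
have msnd : measurable_fun setT (fun z : R * R => z.2) by exact: measurable_snd.
have mS1 : measurable [set z : R * R | z.1 < z.2]%R.
  have := measurable_fun_ltr mfst msnd measurableT (Y := [set true]) => /(_ Logic.I).
  by rewrite setTI (_ : _ @^-1` _ = [set z : R * R | z.1 < z.2]%R).
have mS2 : measurable [set z : R * R | z.2 <= z.1]%R.
  have := measurable_fun_ler msnd mfst measurableT (Y := [set true]) => /(_ Logic.I).
  by rewrite setTI (_ : _ @^-1` _ = [set z : R * R | z.2 <= z.1]%R).
have mt1 : measurable_fun setT t1.
  apply/measurable_EFinP; apply: measurable_funM => //.
  by apply/measurable_EFinP.
have mt2 : measurable_fun setT t2.
  apply/measurable_EFinP; apply: measurable_funM => //.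
  by apply/measurable_EFinP.
have t10 x : 0 <= t1 x by rewrite lee_fin !mulr_ge0.
have t20 x : 0 <= t2 x by rewrite lee_fin !mulr_ge0.
have t1E x y : t1 (x, y) = (a x * b y * (x < y)%R%:R)%:E.
  rewrite /t1 indicE (_ : ((x, y) \in [set z | z.1 < z.2]%R) = (x < y)%R) //.
  by apply/idP/idP; rewrite inE.
have t2E x y : t2 (x, y) = (a x * b y * (y <= x)%R%:R)%:E.
  rewrite /t2 indicE (_ : ((x, y) \in [set z | z.2 <= z.1]%R) = (y <= x)%R) //.
  by apply/idP/idP; rewrite inE.
pose f1 y := \int[leb]_(x in P) t1 (x, y).
pose f2 y := \int[leb]_(x in P) t2 (x, y).
transitivity (\int[leb]_(y in P) (f1 y + f2 y)).
  apply: eq_integral => y _; rewrite /f1 /f2 -ge0_integralD //; last 2 first.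
  - exact: measurable_funTS (measurableT_comp mt1 (measurable_pair2 y)).
  - exact: measurable_funTS (measurableT_comp mt2 (measurable_pair2 y)).
  apply: eq_integral => x _; rewrite t1E t2E -EFinD -mulrDr; congr EFin.
  by case: (ltP x y) => xy; rewrite /= ?addr0 ?add0r mulr1.
have mf1 : measurable_fun P f1 by exact: (@measurable_int_snd R P P t1).
have mf2 : measurable_fun P f2 by exact: (@measurable_int_snd R P P t2).
have f10 y : 0 <= f1 y by exact: integral_ge0.
have f20 y : 0 <= f2 y by exact: integral_ge0.
transitivity (\int[leb]_(y in P) f1 y + \int[leb]_(y in P) f2 y).
  by apply: ge0_integralD.
have E1 : \int[leb]_(y in P) f1 y = \int[leb]_(y in P) \int[leb]_(x in `]0%R, y[) (a x * b y)%:E.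
  apply: eq_integral => y; rewrite inE /= in_itv /= andbT => y0.
  rewrite /f1 [LHS]integral_mkcond [RHS]integral_mkcond; apply: eq_integral => x _.
  rewrite /patch t1E !mem_setE !in_itv /= andbT.
  by case: (ltP 0%R x) => // x0; case: (ltP x y) => xy; rewrite /= ?mulr1 ?mulr0.
rewrite E1; congr (_ + _).
transitivity (\int[leb]_(x in P) \int[leb]_(y in P) t2 (x, y)).
  by apply/esym/(@tonelli_on R P P t2).
apply: eq_integral => x; rewrite inE /= in_itv /= andbT => x0.
transitivity (\int[leb]_(y in `]0%R, x]) (b y * a x)%R%:E).
  rewrite [LHS]integral_mkcond [RHS]integral_mkcond; apply: eq_integral => y _.
  rewrite /patch t2E !mem_setE !in_itv /= andbT.
  by case: (ltP 0%R y) => // y0; case: (leP y x) => xy; rewrite /= ?mulr1 ?mulr0 // mulrC.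
rewrite -integral_itv_bndo_bndc //.
apply: measurable_funTS; apply/measurable_EFinP.
by apply: measurable_funM => //; exact: measurable_cst.
Qed.

End QuadrantReal.

(** * The quadrant formula for complex integrands *)

Section ComplexQuadrant.
Variable R : realType.
Local Notation C := (Cx R).
Local Notation leb := (@lebesgue_measure R).
Local Notation P := (`]0%R, +oo[%classic : set R).
Local Notation I := (`]0%R, 1%R[%classic : set R).

(** Four nonnegative components, recombined with powers of the imaginary unit in [part4E]; by
    bilinearity they carry the Tonelli argument over to complex functions. *)
Definition part4 (k : 'I_4) (z : C) : R :=
  Num.max ([:: ReC z; ImC z; - ReC z; - ImC z]`_k) 0.

Lemma part4_ge0 k z : 0 <= part4 k z.
Proof. by rewrite /part4 le_max lexx orbT. Qed.

Lemma part4_le k z : part4 k z <= nm z.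
Proof.
rewrite /part4 ge_max nm_ge0 andbT; have a := nm_Re z; have b := nm_Im z.
case: k => -[|[|[|[|//]]]] _ /=; [move: a|move: b|move: a|move: b]; rewrite ler_norml => /andP[x y] //; lra.
Qed.

Lemma part4E z : z = \sum_(k < 4) 'i%C ^+ k * RtoC (part4 k z).
Proof.
rewrite !big_ord_recr big_ord0 /= add0r /part4 /=.
have i2 : 'i%C ^+ 2 = -1 :> C by exact: sqr_i.
have i3 : 'i%C ^+ 3 = - 'i%C :> C by rewrite exprS i2 mulrN1.
rewrite i2 i3 expr0 expr1 mul1r.
have H (x : R) : RtoC (Num.max x 0) - RtoC (Num.max (- x) 0) = RtoC x.
  rewrite (_ : _ - _ = RtoC (Num.max x 0 - Num.max (- x) 0)); last by rewrite /RtoC rmorphB.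
  congr RtoC.
  case: (lerP 0 x) => h.
    have -> : Num.max (- x) 0 = 0 by apply/max_idPr; rewrite oppr_le0.
    by rewrite subr0.
  have -> : Num.max (- x) 0 = - x by apply/max_idPl; rewrite oppr_ge0 ltW.
  by rewrite sub0r opprK.
rewrite [LHS]complexE -/(RtoC _) -/(RtoC (complex.Im z)) -(H (complex.Re z)) -(H (complex.Im z)).
rewrite /ReC /ImC; ring.
Qed.

Lemma mfunC_part4 (D : set R) (mD : measurable D) (A : R -> C) k : mfunC D A ->
  measurable_fun D (fun s => part4 k (A s)).
Proof.
move=> [mr mi]; rewrite /part4.
apply: measurable_maxr; last exact: measurable_cst.
case: k => -[|[|[|[|//]]]] _ //=; exact: measurableT_comp.
Qed.

Lemma cint_real (D : set R) (mD : measurable D) (f : R -> R) : cint D (fun s => RtoC (f s)) = RtoC (\int[leb]_(s in D) f s).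
Proof. by rewrite /cint /RtoC /= /Rintegral integral0. Qed.

Lemma itg_real (D : set R) (mD : measurable D) (f g : R -> R) : measurable_fun D f ->
  leb.-integrable D (EFin \o g) -> (forall s, D s -> 0 <= f s <= g s) ->
  itg D (fun s => RtoC (f s)) g.
Proof.
move=> mf ig h; split => //.
by move=> s /h/andP[f0 fg]; rewrite nm_RtoC ger0_norm.
Qed.

Variable q : R -> R.
Hypothesis mq : measurable_fun setT q.
Hypothesis q01 : forall m, 0 < q m <= 1.

(** Local boundedness makes the inner integral over [m] finite for every positive [s], not merely
    almost everywhere. *)
Definition lbd (a : R -> R) := forall s, exists M, forall u, 0 < u <= s -> a u <= M.

Definition loc (a : R -> R) := [/\ measurable_fun setT a, forall s, 0 <= a s & lbd a].

Definition adm (a : R -> R) := [/\ measurable_fun setT a, forall s, 0 <= a s, lbd a &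
  leb.-integrable P (EFin \o a)].

Lemma adm_loc a : adm a -> loc a. Proof. by case. Qed.

Definition rker (a b : R -> R) (s m : R) : R :=
  (s * q m ^+ 2) * (a (s * (m * q m)) * b (s * q m)).

Definition rwedge (a b : R -> R) (s : R) : R := \int[leb]_(m in I) rker a b s m.

Lemma mI : measurable I. Proof. exact: measurable_itv. Qed.
Lemma mP : measurable P. Proof. exact: measurable_itv. Qed.

Lemma integrable_cst_I (c : R) : leb.-integrable I (EFin \o (fun _ => c)).
Proof.
apply/integrableP; split; first exact/measurable_EFinP/measurable_cst.
rewrite integral_cst /=; last exact: mI.
by rewrite lebesgue_measure_itv /= lte_fin ltr01 -EFinB -EFinM ltry.
Qed.

Lemma measurable_rker (a b : R -> R) s : measurable_fun setT a -> measurable_fun setT b ->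
  measurable_fun setT (rker a b s).
Proof.
move=> ma mb; have m2 : measurable_fun setT (fun m : R => q m ^+ 2) by exact: measurable_funX.
apply: measurable_funM.
  by apply: measurable_funM => //; exact: measurable_cst.
apply: measurable_funM; apply: measurableT_comp => //; apply: measurable_funM => //.
exact: measurable_funM.
Qed.

Lemma in_mq (s m : R) : 0 < s -> I m -> [/\ 0 < s * (m * q m) <= s, 0 < s * q m <= s
   & 0 <= s * q m ^+ 2 <= s].
Proof.
rewrite /= in_itv /= => s0 /andP[m0 m1]; have /andP[q0 q1] := q01 m.
have mq0 : 0 < m * q m by exact: mulr_gt0.
have mq1 : m * q m <= 1 by rewrite mulr_ile1 // ltW.
split; apply/andP; split.
- exact: mulr_gt0.
- by rewrite ler_piMr // ltW.
- exact: mulr_gt0.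
- by rewrite ler_piMr // ltW.
- by rewrite mulr_ge0 ?sqr_ge0 // ltW.
- by rewrite ler_piMr ?(ltW s0) // expr2 mulr_ile1 // ltW.
Qed.

Lemma rker_bound (a b : R -> R) s : loc a -> loc b -> 0 < s ->
  exists M, forall m, I m -> 0 <= rker a b s m <= M.
Proof.
move=> [_ a0 la] [_ b0 lb] s0.
have [M1 h1] := la s; have [M2 h2] := lb s.
exists (s * (M1 * M2)) => m Im.
have [u1 u2 /andP[u3 u4]] := in_mq s0 Im.
apply/andP; split; first by rewrite mulr_ge0 // mulr_ge0.
apply: ler_pM => //; first exact: mulr_ge0.
by apply: ler_pM => //; [exact: h1|exact: h2].
Qed.

Lemma integrable_rker (a b : R -> R) s : loc a -> loc b -> 0 < s ->
  leb.-integrable I (EFin \o rker a b s).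
Proof.
move=> Ha Hb s0; have [M hM] := rker_bound Ha Hb s0.
case: Ha Hb => ma _ _ [mb _ _].
apply: le_integrable (integrable_cst_I M); first exact: mI.
  by apply/measurable_EFinP; apply: measurable_funTS; exact: measurable_rker.
move=> m Im /=; rewrite lee_fin; have /andP[x y] := hM m Im.
by rewrite ger0_norm //; apply: le_trans y _; exact: ler_norm.
Qed.

Lemma wedgeE (a b : R -> R) s : loc a -> loc b -> 0 < s -> wedge q a b s = (rwedge a b s)%:E.
Proof.
move=> Ha Hb s0; rewrite /rwedge /Rintegral fineK //.
have := integrable_rker Ha Hb s0 => h.
by apply: integrable_fin_num h => //; exact: mI.
Qed.

Lemma rwedge_ge0 (a b : R -> R) s : loc a -> loc b -> 0 < s -> 0 <= rwedge a b s.
Proof.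
move=> Ha Hb s0; have [M hM] := rker_bound Ha Hb s0.
by apply: Rintegral_ge0 => m /hM/andP[].
Qed.

Lemma adm_le (a a' : R -> R) : adm a -> measurable_fun setT a' ->
  (forall s, 0 <= a' s <= a s) -> adm a'.
Proof.
move=> [ma a0 la ia] ma' h; split=> //.
- by move=> s; case/andP: (h s).
- move=> s; have [M hM] := la s; exists M => u /hM; apply: le_trans.
  by case/andP: (h u).
- apply: le_integrable ia; first exact: mP.
    by apply/measurable_EFinP; exact: measurable_funTS.
  move=> s _ /=; rewrite lee_fin; have /andP[x y] := h s.
  by rewrite ger0_norm //; apply: le_trans y _; exact: ler_norm.
Qed.

Lemma measurable_rwedge (a b : R -> R) : loc a -> loc b -> measurable_fun P (rwedge a b).
Proof.
move=> Ha Hb; have [ma a0 _] := Ha; have [mb b0 _] := Hb.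
apply/measurable_EFinP; apply: eq_measurable_fun (measurable_wedge mq ma mb a0 b0) => s.
by rewrite inE /= in_itv /= andbT => s0; rewrite wedgeE.
Qed.

Lemma rwedge_quadrant (a b : R -> R) : adm a -> adm b ->
  leb.-integrable P (EFin \o rwedge a b) /\
  (\int[leb]_(s in P) a s) * (\int[leb]_(s in P) b s) =
    \int[leb]_(s in P) (rwedge a b s + rwedge b a s).
Proof.
move=> Ha Hb; have [ma a0 _ ia] := Ha; have [mb b0 _ ib] := Hb.
have fa : (\int[leb]_(s in P) (a s)%:E)%E \is a fin_num by apply: integrable_fin_num ia => //; exact: mP.
have fb : (\int[leb]_(s in P) (b s)%:E)%E \is a fin_num by apply: integrable_fin_num ib => //; exact: mP.
have E : (\int[leb]_(s in P) (a s)%:E * \int[leb]_(s in P) (b s)%:E =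
    \int[leb]_(s in P) (rwedge a b s + rwedge b a s)%:E)%E.
  rewrite (quadrant_wedge mq q01) //; apply: eq_integral => s.
  by rewrite inE /= in_itv /= andbT => s0; rewrite EFinD !wedgeE //; apply: adm_loc.
have m1 := measurable_rwedge (adm_loc Ha) (adm_loc Hb); have m2 := measurable_rwedge (adm_loc Hb) (adm_loc Ha).
split; last by rewrite /Rintegral -E fineM.
apply/integrableP; split; first exact/measurable_EFinP.
apply: le_lt_trans (_ : (\int[leb]_(s in P) (rwedge a b s + rwedge b a s)%:E < +oo)%E).
  apply: ge0_le_integral => //.
  - by apply: measurableT_comp => //; exact/measurable_EFinP.
  - by apply/measurable_EFinP; exact: measurable_funD.
  move=> s; rewrite /= in_itv /= andbT => s0; rewrite lee_fin ger0_norm; last by apply: rwedge_ge0 => //; exact: adm_loc.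
  by rewrite lerDl rwedge_ge0 //; exact: adm_loc.
rewrite -E -(fineK fa) -(fineK fb) -EFinM; exact: ltry.
Qed.

Definition cker (A B : R -> C) (s m : R) : C :=
  RtoC (s * q m ^+ 2) * (A (s * (m * q m)) * B (s * q m)).

Section Pair.
Variables (A B : R -> C) (a b : R -> R).
Hypothesis mA : mfunC setT A.
Hypothesis mB : mfunC setT B.
Hypothesis Ha : adm a.
Hypothesis Hb : adm b.
Hypothesis hA : forall s, nm (A s) <= a s.
Hypothesis hB : forall s, nm (B s) <= b s.

Let Ak k s := part4 k (A s).
Let Bk k s := part4 k (B s).

Let admA k : adm (Ak k).
Proof.
apply: adm_le Ha _ _; first exact: mfunC_part4.
by move=> s; rewrite part4_ge0 /=; apply: le_trans (part4_le _ _) (hA s).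
Qed.

Let admB k : adm (Bk k).
Proof.
apply: adm_le Hb _ _; first exact: mfunC_part4.
by move=> s; rewrite part4_ge0 /=; apply: le_trans (part4_le _ _) (hB s).
Qed.

Lemma ckerE s m : cker A B s m =
  \sum_(kl : 'I_4 * 'I_4) ('i%C ^+ kl.1 * 'i%C ^+ kl.2) * RtoC (rker (Ak kl.1) (Bk kl.2) s m).
Proof.
rewrite /cker (part4E (A _)) (part4E (B _)) big_distrlr /= pair_big /= mulr_sumr.
by apply: eq_bigr => -[k l] _ /=; rewrite /rker !RtoCM; ring.
Qed.

Let itk s k l : 0 < s -> itg I (fun m => RtoC (rker (Ak k) (Bk l) s m)) (rker (Ak k) (Bk l) s).
Proof.
move=> s0; apply: itg_real; first exact: mI.
- by apply: measurable_funTS; case: (admA k) => ? _ _ _; case: (admB l) => ? _ _ _; exact: measurable_rker.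
- by apply: integrable_rker => //; apply: adm_loc.
- have [M hM] := rker_bound (adm_loc (admA k)) (adm_loc (admB l)) s0.
  by move=> m /hM/andP[-> _] /=.
Qed.

Lemma cint_ckerE s : 0 < s -> cint I (cker A B s) =
  \sum_(kl : 'I_4 * 'I_4) ('i%C ^+ kl.1 * 'i%C ^+ kl.2) * RtoC (rwedge (Ak kl.1) (Bk kl.2) s).
Proof.
move=> s0; have h (kl : 'I_4 * 'I_4) := itgZ mI ('i%C ^+ kl.1 * 'i%C ^+ kl.2) (@itk s kl.1 kl.2 s0).
rewrite (eq_cint (G := fun m => \sum_(kl : 'I_4 * 'I_4) ('i%C ^+ kl.1 * 'i%C ^+ kl.2) * RtoC (rker (Ak kl.1) (Bk kl.2) s m))); last first.
  by move=> m _; exact: ckerE.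
rewrite (cint_sum mI _ h).1; apply: eq_bigr => kl _.
by rewrite (cintZ mI _ (@itk s kl.1 kl.2 s0)) cint_real //; exact: mI.
Qed.

End Pair.

(** The formula holds for each of the sixteen products of nonnegative parts. With the Laplace kernel
    inserted it becomes the convolution theorem. *)
Lemma cint_quadrant (A B : R -> C) (a b : R -> R) : mfunC setT A -> mfunC setT B ->
  adm a -> adm b -> (forall s, nm (A s) <= a s) -> (forall s, nm (B s) <= b s) ->
  cint P A * cint P B = cint P (fun s => cint I (cker A B s) + cint I (cker B A s)).
Proof.
move=> mA mB Ha Hb hA hB.
have admA k : adm (fun s => part4 k (A s)).
  apply: adm_le Ha _ _; first exact: mfunC_part4.
  by move=> s; rewrite part4_ge0 /=; apply: le_trans (part4_le _ _) (hA s).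
have admB k : adm (fun s => part4 k (B s)).
  apply: adm_le Hb _ _; first exact: mfunC_part4.
  by move=> s; rewrite part4_ge0 /=; apply: le_trans (part4_le _ _) (hB s).
have iA k : itg P (fun s => RtoC (part4 k (A s))) (fun s => part4 k (A s)).
  case: (admA k) => m0 h0 _ i0; apply: (itg_real mP) => //; first exact: measurable_funTS.
  by move=> s _; rewrite h0 lexx.
have iB k : itg P (fun s => RtoC (part4 k (B s))) (fun s => part4 k (B s)).
  case: (admB k) => m0 h0 _ i0; apply: (itg_real mP) => //; first exact: measurable_funTS.
  by move=> s _; rewrite h0 lexx.
have EA : cint P A = \sum_(k < 4) 'i%C ^+ k * RtoC (\int[leb]_(s in P) part4 k (A s)).
  rewrite (eq_cint (G := fun s => \sum_(k < 4) 'i%C ^+ k * RtoC (part4 k (A s)))); last first.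
    by move=> s _; exact: part4E.
  rewrite (cint_sum mP _ (fun k : 'I_4 => itgZ mP ('i%C ^+ k) (iA k))).1.
  by apply: eq_bigr => k _; rewrite (cintZ mP _ (iA k)) cint_real //; exact: mP.
have EB : cint P B = \sum_(k < 4) 'i%C ^+ k * RtoC (\int[leb]_(s in P) part4 k (B s)).
  rewrite (eq_cint (G := fun s => \sum_(k < 4) 'i%C ^+ k * RtoC (part4 k (B s)))); last first.
    by move=> s _; exact: part4E.
  rewrite (cint_sum mP _ (fun k : 'I_4 => itgZ mP ('i%C ^+ k) (iB k))).1.
  by apply: eq_bigr => k _; rewrite (cintZ mP _ (iB k)) cint_real //; exact: mP.
rewrite EA EB big_distrlr /= pair_big /=.
pose w (kl : 'I_4 * 'I_4) s := rwedge (fun s => part4 kl.1 (A s)) (fun s => part4 kl.2 (B s)) s +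
  rwedge (fun s => part4 kl.2 (B s)) (fun s => part4 kl.1 (A s)) s.
have iw kl : itg P (fun s => RtoC (w kl s)) (w kl).
  apply: itg_real; first exact: mP.
  - by apply: measurable_funD; apply: measurable_rwedge; exact: adm_loc.
  - rewrite (_ : _ \o _ = (EFin \o rwedge (fun s => part4 kl.1 (A s)) (fun s => part4 kl.2 (B s))) \+
       (EFin \o rwedge (fun s => part4 kl.2 (B s)) (fun s => part4 kl.1 (A s))))%E //.
    apply: integrableD; first exact: mP.
      exact: (rwedge_quadrant (admA kl.1) (admB kl.2)).1.
    exact: (rwedge_quadrant (admB kl.2) (admA kl.1)).1.
  - by move=> s; rewrite /= in_itv /= andbT => s0; rewrite lexx andbT; apply: addr_ge0; apply: rwedge_ge0 => //; exact: adm_loc.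
rewrite [RHS](eq_cint (G := fun s => \sum_(kl : 'I_4 * 'I_4) ('i%C ^+ kl.1 * 'i%C ^+ kl.2) * RtoC (w kl s))).
  rewrite (cint_sum mP _ (fun kl : 'I_4 * 'I_4 => itgZ mP ('i%C ^+ kl.1 * 'i%C ^+ kl.2) (iw kl))).1.
  apply: eq_bigr => -[k l] _ /=; rewrite (cintZ mP _ (iw (k, l))) cint_real; last exact: mP.
  by rewrite /w /= -(rwedge_quadrant (admA k) (admB l)).2 RtoCM; ring.
move=> s; rewrite /= in_itv /= andbT => s0.
rewrite (cint_ckerE mA mB Ha Hb) // (cint_ckerE mB mA Hb Ha) //.
rewrite -(pair_big xpredT xpredT (fun k l : 'I_4 => 'i%C ^+ k * 'i%C ^+ l * RtoC (rwedge (fun s => part4 k (B s)) (fun s => part4 l (A s)) s))) /=.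
rewrite exchange_big pair_big /= -big_split /=.
by apply: eq_bigr => -[k l] _; rewrite /w RtoCD /= mulrDr [in X in _ + X = _](mulrC ('i%C ^+ l)).
Qed.

End ComplexQuadrant.

Lemma integrableDR (R : realType) (D : set R) (f g : R -> R) : measurable D ->
  (@lebesgue_measure R).-integrable D (EFin \o f) -> (@lebesgue_measure R).-integrable D (EFin \o g) ->
  (@lebesgue_measure R).-integrable D (EFin \o (fun s => f s + g s)).
Proof.
move=> mD h1 h2; rewrite (_ : _ \o _ = (EFin \o f) \+ (EFin \o g))%E //.
exact: integrableD.
Qed.

                               

(** * Convolution of order k on majorants *)

Section Convolution.
Variable R : realType.
Variable k : nat.
Hypothesis k_gt0 : (0 < k)%N.
Local Notation C := (Cx R).
Local Notation leb := (@lebesgue_measure R).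
Local Notation P := (`]0%R, +oo[%classic : set R).
Local Notation I := (`]0%R, 1%R[%classic : set R).

                                                                                                     
(** Chosen so that [(m * qk m) ^+ k + qk m ^+ k = 1] ([qkX]): in wedge coordinates the factors
    [exp(-p x^k)] and [exp(-p y^k)] multiply to [exp(-p s^k)]. The absolute value keeps the base at
    least 1 for every real [m]. *)
Definition qk (m : R) : R := (1 + `|m| ^+ k) `^ (- k%:R^-1).

Lemma qk_base (m : R) : 1 <= 1 + `|m| ^+ k.
Proof. by rewrite lerDl exprn_ge0. Qed.

Lemma qk01 m : 0 < qk m <= 1.
Proof.
have h := qk_base m; apply/andP; split; first by rewrite powR_gt0 // (lt_le_trans ltr01).
have := @ler_powR _ _ h (- k%:R^-1) 0; rewrite powRr0; apply.
by rewrite oppr_le0 invr_ge0.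
Qed.

Lemma measurable_qk : measurable_fun setT qk.
Proof.
apply: (@measurableT_comp _ _ _ _ _ _ (@powR R ^~ (- k%:R^-1))) => //.
apply: measurable_funD; first exact: measurable_cst.
by apply: measurable_funX; exact: normr_measurable.
Qed.

Lemma qkX (m : R) : 0 <= m -> (m * qk m) ^+ k + qk m ^+ k = 1.
Proof.
move=> m0; have h := qk_base m; have h0 : 0 < 1 + `|m| ^+ k by exact: lt_le_trans ltr01 h.
have -> : (m * qk m) ^+ k + qk m ^+ k = (1 + `|m| ^+ k) * qk m ^+ k.
  by rewrite exprMn (ger0_norm m0); ring.
rewrite /qk -powR_mulrn ?powR_ge0 // -powRrM mulNr mulVf ?pnatr_eq0 -?lt0n //.
by rewrite powR_inv1 ?ltW // mulfV // gt_eqF.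
Qed.

Definition mono (a : R -> R) := (forall s, 0 <= a s) /\ {homo a : s t / s <= t}.

Lemma mono_measurable a : mono a -> measurable_fun setT a.
Proof. by move=> [_ h]; apply: nondecreasing_measurable => //; exact: measurableT. Qed.

Lemma mono_loc a : mono a -> loc a.
Proof.
move=> h; split; [exact: mono_measurable|by case: h|].
by move=> s; exists (a s) => u /andP[_ us]; case: h => _; apply.
Qed.

Lemma measurable_max0 : measurable_fun setT (fun s : R => Num.max s 0).
Proof. by apply: measurable_maxr => //; exact: measurable_cst. Qed.

(** Clamping at 0 gives a function measurable and nonnegative on the whole line, as the quadrant
    formula asks; the integral runs over positive [s], where the clamp is the identity. *)
Definition lapE (p : R) (a : R -> R) (s : R) : R :=
  a (Num.max s 0) * expR (- (p * Num.max s 0 ^+ k)) * k%:R.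

Definition lap (p : R) (a : R -> R) : R := \int[leb]_(s in P) lapE p a s.

Lemma max0P (s : R) : 0 < s -> Num.max s 0 = s.
Proof. by move=> s0; rewrite max_l // ltW. Qed.

Lemma lapE_pos p a s : 0 < s -> lapE p a s = a s * expR (- (p * s ^+ k)) * k%:R.
Proof. by move=> s0; rewrite /lapE max0P. Qed.

Lemma lapE_ge0 p a s : mono a -> 0 <= lapE p a s.
Proof. by move=> [h _]; rewrite /lapE mulr_ge0 // mulr_ge0 // expR_ge0. Qed.

Lemma measurable_lapE p a : mono a -> measurable_fun setT (lapE p a).
Proof.
move=> h; apply: measurable_funM; last exact: measurable_cst.
apply: measurable_funM.
  by apply: measurableT_comp measurable_max0; exact: mono_measurable.
apply: (@measurableT_comp _ _ _ _ _ _ (@expR R)) => //.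
apply: measurableT_comp => //; apply: measurable_funM; first exact: measurable_cst.
by apply: measurable_funX; exact: measurable_max0.
Qed.

Lemma adm_lapE p a : 0 <= p -> mono a -> leb.-integrable P (EFin \o lapE p a) -> adm (lapE p a).
Proof.
move=> p0 h i; split => //; [exact: measurable_lapE|by move=> s; exact: lapE_ge0|].
move=> s; exists (a s * 1 * k%:R) => u /andP[u0 us].
rewrite lapE_pos //; apply: ler_wpM2r => //; apply: ler_pM; rewrite ?expR_ge0 //.
- by case: h.
- by case: h => _; apply.
by rewrite -expR0 ler_expR oppr_le0 mulr_ge0 // exprn_ge0 // ltW.
Qed.

(** The convolution of two majorants; the value 0 for [s <= 0] keeps it nondecreasing. *)
Definition cmaj (a b : R -> R) (s : R) : R :=
  if 0 < s then k%:R * (rwedge qk a b s + rwedge qk b a s) else 0.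

Lemma rwedge_mono a b s t : mono a -> mono b -> 0 < s -> s <= t -> rwedge qk a b s <= rwedge qk a b t.
Proof.
move=> ha hb s0 st; have t0 : 0 < t by exact: lt_le_trans st.
have la := mono_loc ha; have lb := mono_loc hb.
apply: le_Rintegral; [exact: mI|exact: (integrable_rker measurable_qk qk01 la lb)|exact: (integrable_rker measurable_qk qk01 la lb)|].
move=> m; rewrite /= in_itv /= => /andP[m0 m1].
have /andP[q0 q1] := qk01 m; have mq0 := mulr_gt0 m0 q0.
case: ha hb => a0 ah [b0 bh].
apply: ler_pM.
- by rewrite mulr_ge0 ?sqr_ge0 // ltW.
- by rewrite mulr_ge0.
- by apply: ler_wpM2r => //; exact: sqr_ge0.
by apply: ler_pM => //; [apply: ah|apply: bh]; apply: ler_wpM2r => //; exact: ltW.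
Qed.

Lemma mono_cmaj a b : mono a -> mono b -> mono (cmaj a b).
Proof.
move=> ha hb; have la := mono_loc ha; have lb := mono_loc hb.
have W0 s : 0 < s -> 0 <= k%:R * (rwedge qk a b s + rwedge qk b a s).
  by move=> s0; rewrite mulr_ge0 // addr_ge0 // (rwedge_ge0 qk01).
split=> [s|s t st]; rewrite /cmaj; first by case: ifP => // /W0.
case: ifP => [s0|_]; last by case: ifP => // /W0.
rewrite (lt_le_trans s0 st); apply: ler_wpM2l => //.
by apply: lerD; exact: rwedge_mono.
Qed.

Lemma rker_lapE p a b s m : 0 < s -> I m ->
  rker qk (lapE p a) (lapE p b) s m = (expR (- (p * s ^+ k)) * k%:R ^+ 2) * rker qk a b s m.
Proof.
move=> s0 Im; have [/andP[u1 _] /andP[u2 _] _] := in_mq qk01 s0 Im.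
rewrite /rker !lapE_pos //.
have -> : expR (- (p * s ^+ k)) = expR (- (p * (s * (m * qk m)) ^+ k)) * expR (- (p * (s * qk m) ^+ k)).
  rewrite -expRD; congr expR; move: Im; rewrite /= in_itv /= => /andP[m0 _].
  by rewrite -[in LHS](mulr1 (s ^+ k)) -(qkX (ltW m0)) !exprMn; ring.
ring.
Qed.

Lemma rwedge_lapE p a b s : 0 < s -> mono a -> mono b ->
  rwedge qk (lapE p a) (lapE p b) s = (expR (- (p * s ^+ k)) * k%:R ^+ 2) * rwedge qk a b s.
Proof.
move=> s0 ha hb; rewrite /rwedge -RintegralZl; [|exact: mI|].
  by apply: eq_Rintegral => m; rewrite inE => Im; exact: rker_lapE.
exact: (integrable_rker measurable_qk qk01 (mono_loc ha) (mono_loc hb)).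
Qed.

Lemma lapE_cmaj p a b s : 0 < s -> mono a -> mono b ->
  lapE p (cmaj a b) s = rwedge qk (lapE p a) (lapE p b) s + rwedge qk (lapE p b) (lapE p a) s.
Proof. by move=> s0 ha hb; rewrite !rwedge_lapE // lapE_pos // /cmaj s0; ring. Qed.

(** The convolution theorem for nonnegative functions. It makes the weighted size multiplicative, so
    that Borel transforms form a normed algebra. *)
Lemma lap_cmaj p a b : 0 <= p -> mono a -> mono b ->
  leb.-integrable P (EFin \o lapE p a) -> leb.-integrable P (EFin \o lapE p b) ->
  leb.-integrable P (EFin \o lapE p (cmaj a b)) /\ lap p (cmaj a b) = lap p a * lap p b.
Proof.
move=> p0 ha hb ia ib; have Aa := adm_lapE p0 ha ia; have Ab := adm_lapE p0 hb ib.
have [i1 e1] := rwedge_quadrant measurable_qk qk01 Aa Ab.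
have [i2 _] := rwedge_quadrant measurable_qk qk01 Ab Aa.
split.
  have := integrableDR (@mP R) i1 i2; apply: eq_integrable => //.
  by move=> s; rewrite inE /= in_itv /= andbT => s0; rewrite lapE_cmaj.
rewrite /lap e1; apply: eq_Rintegral => s; rewrite inE /= in_itv /= andbT => s0.
by rewrite lapE_cmaj.
Qed.

End Convolution.

(** * Majorised analytic functions in the Borel plane *)

Section Majorants.
Variable R : realType.
Variable k : nat.
Hypothesis k_gt0 : (0 < k)%N.
Local Notation C := (Cx R).
Local Notation leb := (@lebesgue_measure R).
Local Notation P := (`]0%R, +oo[%classic : set R).
Local Notation I := (`]0%R, 1%R[%classic : set R).
Local Notation qk := (@qk R k).

Variable Om : set C.
Hypothesis Om_open : forall w, Om w -> exists2 r : R, 0 < r & forall v, nm (v - w) < r -> Om v.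
Hypothesis Om_star : forall w (s : R), Om w -> 0 <= s <= 1 -> Om (RtoC s * w).

Lemma anl_lip (F : C -> C) w : anl Om F -> Om w ->
  exists K d : R, [/\ 0 <= K, 0 < d & forall h, nm h < d -> nm (F (w + h) - F w) <= K * nm h].
Proof.
move=> hF Ow; have [r r0 H] := Om_open Ow; have [c hc] := hF _ _ r0 H.
have [|K K0 hK] := pser_rem (rho := r / 2) 1 hc.
  by rewrite divr_gt0 //= ltr_pdivrMr // ltr_pMr // ltr1n.
exists K, (r / 2); split => //; first by rewrite divr_gt0.
move=> h hr; have := hK h (ltW hr); rewrite big_ord_recl big_ord0 addr0 expr0 mulr1 expr1.
by rewrite -(pser_at0 r0 hc).
Qed.

Lemma mfunC_ray (F : C -> C) (g : R -> R) w : anl Om F -> (forall s t, `|g s - g t| <= `|s - t|) ->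
  (forall s, Om (RtoC (g s) * w)) -> mfunC setT (fun s => F (RtoC (g s) * w)).
Proof.
move=> hF cg hO.
have key s (e : R) : 0 < e -> \forall t \near s, nm (F (RtoC (g s) * w) - F (RtoC (g t) * w)) <= e.
  move=> e0; have [K [d [K0 d0 h]]] := anl_lip hF (hO s).
  pose d' : R := Num.min d (e / (K + 1)).
  have d'0 : 0 < d' by rewrite lt_min d0 divr_gt0 // ltr_wpDl.
  have w1 : 0 < nm w + 1 by rewrite ltr_wpDl // nm_ge0.
  exists (d' / (nm w + 1)) => /= [|t ht0]; first exact: divr_gt0.
  have ht := le_lt_trans (cg s t) ht0.
  have E : RtoC (g t) * w = RtoC (g s) * w + (RtoC (g t - g s)) * w.
    by rewrite -mulrDl -RtoCD; congr (RtoC _ * _); ring.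
  have hs : nm (RtoC (g t - g s) * w) < d'.
    rewrite nmM nm_RtoC distrC; apply: le_lt_trans (_ : `|g s - g t| * (nm w + 1) < _).
      by apply: ler_wpM2l => //; rewrite lerDl.
    by rewrite -ltr_pdivlMr.
  rewrite nm_distC E; apply: le_trans (h _ _) _; first by apply: lt_le_trans hs _; rewrite ge_min lexx.
  apply: le_trans (_ : K * (e / (K + 1)) <= _).
    by apply: ler_wpM2l => //; apply: le_trans (ltW hs) _; rewrite ge_min lexx orbT.
  rewrite mulrCA ler_piMr // ?(ltW e0) // ler_pdivrMr ?ltr_wpDl // mul1r.
  by rewrite lerDl.
split; apply: continuous_measurable_fun => s; apply/cvgrPdist_le => e e0.
- apply: filterS (key s e e0) => t; apply: le_trans.
  by apply: le_trans (nm_Re _); rewrite /ReC raddfB.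
- apply: filterS (key s e e0) => t; apply: le_trans.
  by apply: le_trans (nm_Im _); rewrite /ImC raddfB.
Qed.

Definition ray (F : C -> C) (w : C) (s : R) : C := F (RtoC s * w).

(** Projection onto the unit interval: it extends a function on a segment inside the star-shaped
    [Om] to all real parameters, keeping continuity. *)
Definition clamp (s : R) : R := Num.min (Num.max s 0) 1.

Lemma max0_lip (s t : R) : `|Num.max s 0 - Num.max t 0| <= `|s - t|.
Proof.
rewrite ler_norml; have /andP[a b] : - `|s - t| <= s - t <= `|s - t| by rewrite -ler_norml.
by case: (lerP s 0) => hs; case: (lerP t 0) => ht; apply/andP; split; have := normr_ge0 (s - t); lra.
Qed.

Lemma clamp_lip (s t : R) : `|clamp s - clamp t| <= `|s - t|.
Proof.
apply: le_trans (max0_lip s t); rewrite /clamp; set x := Num.max s 0; set y := Num.max t 0.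
rewrite ler_norml; have /andP[a b] : - `|x - y| <= x - y <= `|x - y| by rewrite -ler_norml.
by case: (lerP x 1) => hs; case: (lerP y 1) => ht; apply/andP; split; have := normr_ge0 (x - y); lra.
Qed.

Lemma clamp01 s : 0 <= clamp s <= 1.
Proof. by rewrite /clamp le_min le_max lexx orbT ler01 /= ge_min lexx orbT. Qed.

Lemma clampE s : 0 <= s <= 1 -> clamp s = s.
Proof. by move=> /andP[a b]; rewrite /clamp max_l // min_l. Qed.

Lemma mfunC_comp (A : R -> C) (D : set R) (g : R -> R) : mfunC setT A -> measurable_fun D g ->
  mfunC D (fun m => A (g m)).
Proof. by move=> [a b] mg; split; [exact: (measurableT_comp a mg)|exact: (measurableT_comp b mg)]. Qed.

Lemma mfunC_cker F G w : anl Om F -> anl Om G -> Om w ->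
  mfunC I (cker qk (ray F w) (ray G w) 1).
Proof.
move=> hF hG Ow.
have cl H : anl Om H -> mfunC setT (fun s => H (RtoC (clamp s) * w)).
  by move=> hH; apply: mfunC_ray => //; [exact: clamp_lip|move=> s; exact: Om_star (clamp01 s)].
have mq := @measurable_qk R k.
have m1 : measurable_fun I (fun m => 1 * (m * qk m)).
  apply: measurable_funTS; apply: measurable_funM; first exact: measurable_cst.
  by apply: measurable_funM.
have m2 : measurable_fun I (fun m => 1 * qk m).
  by apply: measurable_funTS; apply: measurable_funM => //; exact: measurable_cst.
have m3 : measurable_fun I (fun m => 1 * qk m ^+ 2).
  by apply: measurable_funTS; apply: measurable_funM; [exact: measurable_cst|exact: measurable_funX].
have := mfunCM (mfunC_real m3) (mfunCM (mfunC_comp (cl _ hF) m1) (mfunC_comp (cl _ hG) m2)).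
apply: mfunC_ext => m Im; have [/andP[a b] /andP[c d] _] := in_mq (@qk01 R k) ltr01 Im.
by rewrite /cker /ray !clampE // ?a ?b ?c ?d ?ltW.
Qed.

                                                                                    
                                                                                                      
(** The convolution of order [k], with all arguments on the segment from 0 to [w]; the two summands
    are the two triangles of the quadrant. *)
Definition bconv (F G : C -> C) (w : C) : C :=
  k%:R * w * (cint I (cker qk (ray F w) (ray G w) 1) + cint I (cker qk (ray G w) (ray F w) 1)).

(** A radial nondecreasing majorant: monotonicity survives convolution, and it converts
    integrability into pointwise growth bounds ([maj_growth]). *)
Definition maj (p : R) (F : C -> C) (a : R -> R) :=
  [/\ anl Om F, forall w, Om w -> nm (F w) <= a (nm w), mono a &
      leb.-integrable P (EFin \o lapE k p a)].

Lemma nm_ray p F a w s : maj p F a -> Om w -> 0 <= s <= 1 -> nm (ray F w s) <= a (s * nm w).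
Proof.
move=> [_ h _ _] Ow /andP[s0 s1]; apply: le_trans (h _ _) _; first by apply: Om_star; rewrite ?s0.
by rewrite nmM nm_RtoC ger0_norm.
Qed.

Lemma itg_ck p F G a b w : maj p F a -> maj p G b -> Om w ->
  itg I (cker qk (ray F w) (ray G w) 1) (fun m => qk m ^+ 2 * (a (nm w * (m * qk m)) * b (nm w * qk m))) /\
  itg I (cker qk (ray F w) (ray G w) 1) (fun m => a (nm w) * b (nm w)).
Proof.
move=> hF hG Ow; have [aF _ [a0 ah] _] := hF; have [aG _ [b0 bh] _] := hG.
have mk : mfunC I (cker qk (ray F w) (ray G w) 1) by exact: mfunC_cker.
have B1 m : I m -> nm (cker qk (ray F w) (ray G w) 1 m) <= qk m ^+ 2 * (a (nm w * (m * qk m)) * b (nm w * qk m)).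
  move=> Im; have [/andP[u1 u2] /andP[u3 u4] /andP[u5 u6]] := in_mq (@qk01 R k) ltr01 Im.
  rewrite /cker !nmM nm_RtoC ger0_norm // mul1r; apply: ler_wpM2l; first exact: sqr_ge0.
  rewrite !mul1r in u1 u2 u3 u4 *; apply: ler_pM; rewrite ?nm_ge0 //.
    by rewrite [nm w * _]mulrC; apply: nm_ray hF _ _ => //; rewrite u2 ltW.
  by rewrite [nm w * _]mulrC; apply: nm_ray hG _ _ => //; rewrite u4 ltW.
have B2 m : I m -> qk m ^+ 2 * (a (nm w * (m * qk m)) * b (nm w * qk m)) <= a (nm w) * b (nm w).
  move=> Im; have [/andP[u1 u2] /andP[u3 u4] /andP[u5 u6]] := in_mq (@qk01 R k) ltr01 Im.
  rewrite !mul1r in u1 u2 u3 u4 u6.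
  rewrite -[leRHS]mul1r; apply: ler_pM => //; [exact: sqr_ge0|by rewrite mulr_ge0|].
  by apply: ler_pM => //; [apply: ah|apply: bh]; rewrite ler_piMr ?nm_ge0.
have ic : leb.-integrable I (EFin \o (fun _ => a (nm w) * b (nm w))) by exact: integrable_cst_I.
split; split=> //; last by move=> m Im; apply: le_trans (B1 m Im) (B2 m Im).
apply: le_integrable ic; first exact: mI.
  have mq := @measurable_qk R k.
  apply/measurable_EFinP; apply: measurable_funTS; apply: measurable_funM; first exact: measurable_funX.
  have am := mono_measurable (conj a0 ah); have bm := mono_measurable (conj b0 bh).
  apply: measurable_funM; apply: measurableT_comp => //; apply: measurable_funM => //; try exact: measurable_cst.
  exact: measurable_funM.
move=> m Im /=; rewrite lee_fin ger0_norm; last by rewrite mulr_ge0 ?sqr_ge0 // mulr_ge0.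
by apply: le_trans (B2 m Im) _; exact: ler_norm.
Qed.

Lemma anl_conv p F G a b : maj p F a -> maj p G b -> anl Om (bconv F G).
Proof.
move=> hF hG w0 r r0 H.
suff key F' G' a' b' : maj p F' a' -> maj p G' b' ->
    exists c, pser w0 r (fun w => cint I (cker qk (ray F' w) (ray G' w) 1)) c.
  have [c1 h1] := key _ _ _ _ hF hG; have [c2 h2] := key _ _ _ _ hG hF.
  by eexists; exact: (pser_mul (pser_Z k%:R (@pser_id _ w0 r)) (pser_add h1 h2)).
move=> hF' hG'; have [aF _ [a0 ah] _] := hF'; have [aG _ [b0 bh] _] := hG'.
(* [S] bounds [nm] on the disc, so the constant [a' S * b' S] dominates all integrands at once. *)
pose S := nm w0 + r.
have [||c [_ _ hc]] := pser_cint (@mI R) (K := fun w => cker qk (ray F' w) (ray G' w) 1)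
    (w0 := w0) (g := fun _ => a' S * b' S) r0; last by exists (fun m => cint I (c m)).
- move=> m Im; have [/andP[u1 u2] /andP[u3 u4] _] := in_mq (@qk01 R k) ltr01 Im.
  have s1 : anl Om (fun w => F' (RtoC (1 * (m * qk m)) * w)).
    by apply: anl_scale aF => w Ow; apply: Om_star; rewrite // u2 ltW.
  have s2 : anl Om (fun w => G' (RtoC (1 * qk m) * w)).
    by apply: anl_scale aG => w Ow; apply: Om_star; rewrite // u4 ltW.
  exact: (anl_Z (RtoC (1 * qk m ^+ 2)) (anl_mul s1 s2) r0 H).
move=> h hr; have Ow : Om (w0 + h) by apply: H; rewrite addrC addKr.
apply: itg_le (itg_ck hF' hG' Ow).2 _ _; first exact: integrable_cst_I.
have hS : nm (w0 + h) <= S by apply: le_trans (nmD _ _) _; rewrite lerD2l ltW.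
have [_ _ B] := (itg_ck hF' hG' Ow).2.
by move=> m /B/le_trans; apply; apply: ler_pM => //; [apply: ah|apply: bh].
Qed.

Lemma conv_maj p F G a b : 0 <= p -> maj p F a -> maj p G b ->
  maj p (bconv F G) (cmaj k a b).
Proof.
move=> p0 hF hG; have [aF _ ma ia] := hF; have [aG _ mb ib] := hG.
split; [exact: anl_conv hF hG| |exact: mono_cmaj|exact: (lap_cmaj k_gt0 p0 ma mb ia ib).1].
move=> w Ow; have [->|w0] := eqVneq w 0.
  by rewrite /bconv mulr0 mul0r nm0; case: (mono_cmaj k ma mb).
have nw := nm_gt0 w0.
have key F' G' a' b' : maj p F' a' -> maj p G' b' ->
    nm w * nm (cint I (cker qk (ray F' w) (ray G' w) 1)) <= rwedge qk a' b' (nm w).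
  move=> hF' hG'; have [_ _ ma' _] := hF'; have [_ _ mb' _] := hG'.
  have i1 := (itg_ck hF' hG' Ow).1; have [_ ii _] := i1.
  apply: le_trans (ler_wpM2l (nm_ge0 w) (nm_cint_le (@mI R) i1)) _.
  rewrite -RintegralZl //.
  apply: le_Rintegral; [exact: mI|exact: (integrableZ (@mI R))| |].
    exact: (integrable_rker (@measurable_qk R k) (@qk01 R k) (mono_loc ma') (mono_loc mb')).
  by move=> m _; rewrite /rker mulrA.
rewrite /bconv /cmaj nw !nmM nm_nat -mulrA; apply: ler_wpM2l => //.
apply: le_trans (ler_wpM2l (nm_ge0 w) (nmD _ _)) _.
by rewrite mulrDr; apply: lerD; exact: key.
Qed.

End Majorants.

(** * Scaling of half-line integrals *)

Section ScaleIntegral.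
Variable R : realType.
Local Notation C := (Cx R).
Local Notation leb := (@lebesgue_measure R).
Local Notation P := (`]0%R, +oo[%classic : set R).

Lemma integrable_scale (c : R) (f : R -> R) : 0 < c -> measurable_fun setT f ->
  (forall s, 0 <= f s) -> leb.-integrable P (EFin \o f) ->
  leb.-integrable P (EFin \o (fun s => c * f (c * s))) /\
  \int[leb]_(s in P) (c * f (c * s)) = \int[leb]_(s in P) f s.
Proof.
move=> c0 mf f0 fi.
have E : (\int[leb]_(s in P) (c * f (c * s))%:E = \int[leb]_(s in P) (f s)%:E)%E.
  have mE : measurable_fun P (fun s => (f s)%:E).
    by apply/measurable_EFinP; exact: measurable_funTS.
  have mE2 : measurable_fun P (fun s => (f (c * s))%:E).
    by apply/measurable_EFinP; apply: measurable_funTS; apply: (measurableT_comp mf).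
  have e0 : (forall x, P x -> 0 <= (f x)%:E)%E by move=> x _; rewrite lee_fin.
  rewrite [RHS](ge0_integral_scale c0 (@mP R) mE e0).
  rewrite (_ : [set x | P (c * x)] = P); last first.
    by apply/seteqP; split => x /=; rewrite !in_itv /= !andbT pmulr_rgt0.
  rewrite -ge0_integralZl //; first by move=> x _; rewrite lee_fin.
  by rewrite lee_fin ltW.
split; last by rewrite /Rintegral E.
apply/integrableP; split.
  apply/measurable_EFinP; apply: measurable_funTS.
  by apply: measurable_funM; [exact: measurable_cst|exact: measurableT_comp].
have [_] := integrableP _ _ _ fi; apply: le_lt_trans.
have E1 : (\int[leb]_(x in P) `|(EFin \o (fun s : R => (c * f (c * s))%R)) x| = \int[leb]_(s in P) (c * f (c * s))%:E)%E.
  by apply: eq_integral => s _ /=; rewrite ger0_norm // mulr_ge0 // ltW.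
have E2 : (\int[leb]_(x in P) `|(EFin \o f) x| = \int[leb]_(s in P) (f s)%:E)%E.
  by apply: eq_integral => s _ /=; rewrite ger0_norm.
by rewrite E1 E E2.
Qed.

Lemma cint_scale (c : R) (F : R -> C) (g : R -> R) : 0 < c -> mfunC setT F -> itg P F g ->
  cint P (fun s => RtoC c * F (c * s)) = cint P F.
Proof.
move=> c0 mF [_ ig hF].
have mk l : measurable_fun setT (fun s => part4 l (F s)) by exact: mfunC_part4.
have ik l : leb.-integrable P (EFin \o (fun s => part4 l (F s))).
  apply: le_integrable ig; first exact: mP.
    by apply/measurable_EFinP; exact: (measurable_funTS (mk l)).
  move=> s Ps /=; rewrite lee_fin ger0_norm ?part4_ge0 //.
  by apply: le_trans (part4_le _ _) _; apply: le_trans (hF s Ps) (ler_norm _).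
have sc l := integrable_scale c0 (mk l) (fun s => part4_ge0 l (F s)) (ik l).
have i1 l : itg P (fun s => RtoC (part4 l (F s))) (fun s => part4 l (F s)).
  apply: (itg_real (@mP R)) => //; first exact: measurable_funTS.
  by move=> s _; rewrite part4_ge0 lexx.
have i2 l : itg P (fun s => RtoC (c * part4 l (F (c * s)))) (fun s => c * part4 l (F (c * s))).
  apply: (itg_real (@mP R)) => //; last by move=> s _; rewrite lexx andbT mulr_ge0 ?part4_ge0 // ltW.
    apply: measurable_funTS; apply: measurable_funM; first exact: measurable_cst.
    by apply: (measurableT_comp (mk l)).
  exact: (sc l).1.
rewrite (eq_cint (G := fun s => \sum_(l < 4) 'i%C ^+ l * RtoC (c * part4 l (F (c * s))))); last first.
  move=> s _; rewrite {1}(part4E (F (c * s))) mulr_sumr.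
  by apply: eq_bigr => l _; rewrite RtoCM; ring.
rewrite [RHS](eq_cint (G := fun s => \sum_(l < 4) 'i%C ^+ l * RtoC (part4 l (F s)))); last first.
  by move=> s _; exact: part4E.
rewrite (cint_sum (@mP R) _ (fun l : 'I_4 => itgZ (@mP R) ('i%C ^+ l) (i1 l))).1.
rewrite (cint_sum (@mP R) _ (fun l : 'I_4 => itgZ (@mP R) ('i%C ^+ l) (i2 l))).1.
apply: eq_bigr => l _; rewrite (cintZ (@mP R) _ (i1 l)) (cintZ (@mP R) _ (i2 l)).
by rewrite !cint_real ?(sc l).2 //; exact: mP.
Qed.

End ScaleIntegral.

                          

(** * Laplace integrals along rays *)

Section LaplaceRay.
Variable R : realType.
Variable k : nat.
Hypothesis k_gt0 : (0 < k)%N.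
Local Notation C := (Cx R).
Local Notation leb := (@lebesgue_measure R).
Local Notation P := (`]0%R, +oo[%classic : set R).
Local Notation I := (`]0%R, 1%R[%classic : set R).

(** The Laplace kernel, with [X] standing for [(x ^+ k)^-1]. *)
Definition lapker (X w : C) : C := cexp (- (w ^+ k * X)).

Definition lint (u X : C) (F : C -> C) (s : R) : C :=
  F (RtoC s * u) * lapker X (RtoC s * u) * k%:R * u.

(** The direction [u] may have any nonzero modulus: rotations and scalings of the ray are varied
    together in the proof of ray independence. *)
Definition LA (u X : C) (F : C -> C) : C := cint P (lint u X F).

Lemma anl_lker Om X : anl Om (lapker X).
Proof.
move=> w0 r r0 _.
pose D : set C := [set w | nm (w - w0) < r].
have h : anl D (fun w => cexp (- X * w ^+ k)).
  apply: (@anl_cexp _ _ _ _ ((nm w0 + r) ^+ k)); first exact/anl_exp/anl_id.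
  move=> w /ltW wr; rewrite nmX lerXn2r ?nnegrE ?nm_ge0 //; first by rewrite addr_ge0 ?nm_ge0 ?ltW.
  by rewrite -(subrK w0 w) addrC; apply: le_trans (nmD _ _) _; rewrite lerD2l.
have [|c hc] := h w0 r r0; first by [].
by exists c; apply: pser_ext hc => w _; rewrite /lapker mulNr mulrC.
Qed.

Lemma nm_lker (X u : C) (s : R) : nm (lapker X (RtoC s * u)) = expR (- (s ^+ k * ReC (u ^+ k * X))).
Proof.
rewrite /lapker nm_cexp exprMn -mulrA -RtoCX; congr expR.
by rewrite /ReC /RtoC raddfN /= -/(RtoC _) ; case: (u ^+ k * X) => a b; rewrite /= mul0r subr0.
Qed.

Lemma lkerM (X : C) (u v w : C) : u ^+ k + v ^+ k = w ^+ k -> lapker X u * lapker X v = lapker X w.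
Proof. by move=> e; rewrite /lapker -cexpD -e; congr cexp; ring. Qed.

Variable Om : set C.
Hypothesis Om_open : forall w, Om w -> exists2 r : R, 0 < r & forall v, nm (v - w) < r -> Om v.
Hypothesis Om_star : forall w (s : R), Om w -> 0 <= s <= 1 -> Om (RtoC s * w).
Local Notation maj := (maj k Om).

Definition in_ray (u : C) := forall s : R, 0 <= s -> Om (RtoC s * u).

Lemma mfunC_lint u X F : anl Om F -> in_ray u ->
  mfunC setT (fun s : R => lint u X F (Num.max s 0)).
Proof.
move=> hF hu; have h0 (s : R) : 0 <= Num.max s 0 by rewrite le_max lexx orbT.
have a1 := anl_mul (anl_Z k%:R (anl_Z u hF)) (@anl_lker Om X).
have := mfunC_ray Om_open a1 (@max0_lip R) (fun s => hu _ (h0 s)).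
by apply: mfunC_ext => s _; rewrite /lint; ring.
Qed.

Lemma nm_lint p F a u X s : maj p F a -> in_ray u -> 0 <= s -> p * nm u ^+ k <= ReC (u ^+ k * X) ->
  nm (lint u X F s) <= nm u * lapE k p a (nm u * s).
Proof.
move=> [_ hF [a0 _] _] hu s0 hX; rewrite /lint 3!nmM nm_lker nm_nat mulrC.
apply: ler_wpM2l; first exact: nm_ge0.
rewrite /lapE max_l; last by rewrite mulr_ge0 ?nm_ge0.
apply: ler_wpM2r => //; apply: ler_pM; rewrite ?nm_ge0 ?expR_ge0 //.
  by apply: le_trans (hF _ (hu _ s0)) _; rewrite nmM nm_RtoC ger0_norm // mulrC.
rewrite ler_expR lerN2 exprMn mulrA mulrC; apply: ler_wpM2l => //; exact: exprn_ge0.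
Qed.

Lemma maj_integrable p F a (c : R) : 0 <= p -> maj p F a -> 0 < c ->
  leb.-integrable P (EFin \o (fun s => c * lapE k p a (c * s))) /\
  \int[leb]_(s in P) (c * lapE k p a (c * s)) = lap k p a.
Proof.
move=> p0 [_ _ ma ia] c0; apply: integrable_scale => //; first exact: measurable_lapE.
by move=> s; exact: lapE_ge0.
Qed.

Lemma itg_lint p F a u X : 0 <= p -> maj p F a -> in_ray u -> u != 0 ->
  p * nm u ^+ k <= ReC (u ^+ k * X) ->
  itg P (lint u X F) (fun s => nm u * lapE k p a (nm u * s)).
Proof.
move=> p0 hF hu u0 hX; split; last 2 first.
- exact: (maj_integrable p0 hF (nm_gt0 u0)).1.
- by move=> s; rewrite /= in_itv /= andbT => /ltW s0; exact: (nm_lint hF hu).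
have [aF _ _ _] := hF; have [m1 m2] := mfunC_lint X aF hu.
apply: (mfunC_ext (F := fun s => lint u X F (Num.max s 0))).
  by move=> s; rewrite /= in_itv /= andbT => s0; rewrite max0P.
by split; apply: measurable_funTS.
Qed.

Lemma nm_LA p F a u X : 0 <= p -> maj p F a -> in_ray u -> u != 0 ->
  p * nm u ^+ k <= ReC (u ^+ k * X) -> nm (LA u X F) <= lap k p a.
Proof.
move=> p0 hF hu u0 hX; rewrite -(maj_integrable p0 hF (nm_gt0 u0)).2.
exact: (nm_cint_le (@mP R) (itg_lint p0 hF hu u0 hX)).
Qed.

Lemma LA_add p F G a b u X : 0 <= p -> maj p F a -> maj p G b -> in_ray u -> u != 0 ->
  p * nm u ^+ k <= ReC (u ^+ k * X) -> LA u X (fun w => F w + G w) = LA u X F + LA u X G.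
Proof.
move=> p0 hF hG hu u0 hX; rewrite /LA -(cintD (@mP R) (itg_lint p0 hF hu u0 hX) (itg_lint p0 hG hu u0 hX)).
by apply: eq_cint => s _; rewrite /lint; ring.
Qed.

Lemma LA_Z p F a u X c : 0 <= p -> maj p F a -> in_ray u -> u != 0 ->
  p * nm u ^+ k <= ReC (u ^+ k * X) -> LA u X (fun w => c * F w) = c * LA u X F.
Proof.
move=> p0 hF hu u0 hX; rewrite /LA -(cintZ (@mP R) _ (itg_lint p0 hF hu u0 hX)).
by apply: eq_cint => s _; rewrite /lint; ring.
Qed.

Lemma LA_ext F G u X : in_ray u -> (forall w, Om w -> F w = G w) -> LA u X F = LA u X G.
Proof.
move=> hu e; apply: eq_cint => s; rewrite /= in_itv /= andbT => s0.
by rewrite /lint e //; apply: hu; exact: ltW.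
Qed.

(** [cint_quadrant] applied to the two Laplace integrands: [qkX] merges the two kernels into one,
    and the remaining integral over [m] is the one in [bconv]. *)
Lemma LA_conv p F G a b u X : 0 <= p -> maj p F a -> maj p G b -> in_ray u -> nm u = 1 ->
  p <= ReC (u ^+ k * X) -> LA u X (bconv k F G) = LA u X F * LA u X G.
Proof.
move=> p0 hF hG hu u1 hX.
have hX' : p * nm u ^+ k <= ReC (u ^+ k * X) by rewrite u1 expr1n mulr1.
have [aF _ ma ia] := hF; have [aG _ mb ib] := hG.
have B H c : maj p H c -> forall s, nm (lint u X H (Num.max s 0)) <= lapE k p c s.
  move=> hH s; have h0 : 0 <= Num.max s 0 by rewrite le_max lexx orbT.
  apply: le_trans (nm_lint hH hu h0 hX') _; rewrite u1 !mul1r /lapE.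
  by rewrite (max_l h0).
have Q := cint_quadrant (@measurable_qk R k) (@qk01 R k) (mfunC_lint X aF hu) (mfunC_lint X aG hu)
  (adm_lapE p0 ma ia) (adm_lapE p0 mb ib) (B _ _ hF) (B _ _ hG).
have E H : LA u X H = cint P (fun s : R => lint u X H (Num.max s 0)).
  by apply: eq_cint => s; rewrite /= in_itv /= andbT => s0; rewrite max0P.
rewrite (E F) (E G) Q; apply: eq_cint => s; rewrite /= in_itv /= andbT => s0.
have key F' G' a' b' : maj p F' a' -> maj p G' b' ->
    cint I (cker (qk k) (fun s => lint u X F' (Num.max s 0)) (fun s => lint u X G' (Num.max s 0)) s) =
    ((k%:R * u) ^+ 2 * RtoC s * lapker X (RtoC s * u)) *
      cint I (cker (qk k) (ray F' (RtoC s * u)) (ray G' (RtoC s * u)) 1).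
  move=> hF' hG'; rewrite -(cintZ (@mI R) _ (itg_ck Om_open Om_star hF' hG' (hu _ (ltW s0))).1).
  apply: eq_cint => m Im; have [/andP[u1' _] /andP[u2 _] _] := in_mq (@qk01 R k) s0 Im.
  rewrite /cker /ray /lint !max0P // -(lkerM X (u := RtoC (s * (m * qk k m)) * u) (v := RtoC (s * qk k m) * u) (w := RtoC s * u)).
    have e1 : RtoC (1 * (m * qk k m)) * (RtoC s * u) = RtoC (s * (m * qk k m)) * u.
      by rewrite mulrA -RtoCM; congr (RtoC _ * _); ring.
    have e2 : RtoC (1 * qk k m) * (RtoC s * u) = RtoC (s * qk k m) * u.
      by rewrite mulrA -RtoCM; congr (RtoC _ * _); ring.
    by rewrite e1 e2 mul1r (RtoCM s); ring.
  have m0 : 0 <= m by move: Im; rewrite /= in_itv /= => /andP[/ltW].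
  rewrite !exprMn -!RtoCX -mulrDl -RtoCD !exprMn -mulrDr -exprMn (qkX k_gt0 m0) mulr1 //.
rewrite (key _ _ _ _ hF hG) (key _ _ _ _ hG hF) /lint /bconv; ring.
Qed.

(** The integrand is compared with the majorant rescaled by [sg^-1]: monotonicity gives
    [a s <= a (sg^-1 * s)], and the rescaling gains the factor [sg]. This yields the behaviour of
    sums at [x = 0]. *)
Lemma LA_small p F a u X (sg : R) : 0 <= p -> maj p F a -> in_ray u -> nm u = 1 ->
  0 < sg <= 1 -> p <= sg ^+ k * ReC (u ^+ k * X) -> nm (LA u X F) <= sg * lap k p a.
Proof.
move=> p0 hF hu u1 /andP[sg0 sg1] hX.
have [aF bF [a0 ah] ia] := hF.
have sV : 0 < sg^-1 by rewrite invr_gt0.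
have u0 : u != 0 by apply/eqP => e; move: u1; rewrite e nm0 => /esym/eqP; rewrite oner_eq0.
have [i1 e1] := maj_integrable p0 hF sV.
have i2 := integrableZ (@mP R) sg i1.
have hX1 : p <= ReC (u ^+ k * X).
  have X0 : 0 <= ReC (u ^+ k * X).
    by rewrite -(pmulr_rge0 (ReC (u ^+ k * X)) (exprn_gt0 k sg0)); exact: le_trans hX.
  by apply: le_trans hX _; rewrite ler_piMl // exprn_ile1 // ltW.
have hX' : p * nm u ^+ k <= ReC (u ^+ k * X) by rewrite u1 expr1n mulr1.
have it := itg_lint p0 hF hu u0 hX'.
have it2 : itg P (lint u X F) (fun s => sg * (sg^-1 * lapE k p a (sg^-1 * s))).
  apply: itg_le it i2 _ => s; rewrite /= in_itv /= andbT => s0.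
  rewrite mulrA divff ?gt_eqF // mul1r /lint 3!nmM nm_lker nm_nat u1 mulr1.
  rewrite lapE_pos; last exact: mulr_gt0.
  apply: ler_wpM2r => //; apply: ler_pM; rewrite ?nm_ge0 ?expR_ge0 //.
    apply: le_trans (bF _ (hu _ (ltW s0))) _; rewrite nmM u1 mulr1 nm_RtoC gtr0_norm //.
    by apply: ah; rewrite ler_peMl ?(ltW s0) // invf_ge1.
  rewrite ler_expR lerN2 exprMn mulrA mulrC; apply: ler_wpM2l; first exact/exprn_ge0/ltW.
  by rewrite exprVn ler_pdivrMr ?exprn_gt0 // mulrC.
apply: le_trans (nm_cint_le (@mP R) it2) _.
by rewrite RintegralZl ?e1 //; exact: mP.
Qed.

(** By monotonicity [a s] is below its values on []s, s + 1[], where the kernel is at least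
    [expR (- (p * (s + 1) ^+ k))]. Hence Borel transforms have exponential growth of order at most
    [k]. *)
Lemma maj_growth p F a s : 0 <= p -> maj p F a -> 0 <= s ->
  a s * k%:R <= lap k p a * expR (p * (s + 1) ^+ k).
Proof.
move=> p0 [_ _ ma ia] s0; have [a0 ah] := ma.
set e := expR (p * (s + 1) ^+ k).
have e0 : 0 < e by exact: expR_gt0.
rewrite -ler_pdivrMr //.
pose J : set R := `]s, s + 1[%classic.
have mJ : measurable J by exact: measurable_itv.
have JP : J `<=` P.
  by move=> x; rewrite /J /= !in_itv /= andbT => /andP[sx _]; exact: le_lt_trans sx.
have iJ : leb.-integrable J (EFin \o lapE k p a) by apply: integrableS ia => //; exact: mP.
apply: le_trans (_ : \int[leb]_(x in J) lapE k p a x <= _); last first.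
  rewrite /lap /Rintegral fine_le //.
  - by apply: integrable_fin_num iJ.
  - by apply: integrable_fin_num ia; exact: mP.
  apply: ge0_subset_integral => //.
    by apply/measurable_EFinP; apply: measurable_funTS; exact: measurable_lapE.
  by move=> x _; rewrite lee_fin lapE_ge0.
have ic : leb.-integrable J (EFin \o (fun _ => a s * k%:R / e)).
  apply/integrableP; split; first exact/measurable_EFinP/measurable_cst.
  rewrite integral_cst //= lebesgue_measure_itv /= lte_fin ltrDl ltr01 -EFinB -EFinM; exact: ltry.
apply: le_trans (_ : \int[leb]_(x in J) (a s * k%:R / e) <= _).
  rewrite Rintegral_cst // (_ : fine (leb J) = 1) ?mulr1 //.
  by rewrite lebesgue_measure_itv /= lte_fin ltrDl ltr01 /= addrAC subrr add0r.
apply: le_Rintegral => // x; rewrite /J /= in_itv /= => /andP[sx xs].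
have x0 : 0 < x by exact: le_lt_trans sx.
rewrite lapE_pos // mulrAC; apply: ler_wpM2r => //; apply: ler_pM => //.
- by rewrite invr_ge0 ltW.
- by apply: ah; exact: ltW.
by rewrite /e -expRN ler_expR lerN2; apply: ler_wpM2l => //; rewrite lerXn2r ?nnegrE ?(ltW xs) ?(ltW x0) // addr_ge0.
Qed.

End LaplaceRay.

(** * Complex derivatives through quadratic remainders *)

Section Derivative.
Variable R : realType.
Local Notation C := (Cx R).

(** The quadratic remainder, which power series always have, makes uniqueness and the chain rule
    elementary. *)
Definition der (F : C -> C) (w0 b : C) := exists K d : R, [/\ 0 <= K, 0 < d &
  forall h, nm h < d -> nm (F (w0 + h) - F w0 - b * h) <= K * nm h ^+ 2].

Lemma pser_der w0 r F c : 0 < r -> pser w0 r F c -> der F w0 (c 1%N).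
Proof.
move=> r0 hF; have [|K K0 hK] := pser_rem (rho := r / 2) 2 hF.
  by rewrite divr_gt0 //= ltr_pdivrMr // ltr_pMr // ltr1n.
exists K, (r / 2); split => //; first by rewrite divr_gt0.
move=> h /ltW/hK; rewrite !big_ord_recl big_ord0 addr0 expr0 mulr1 expr1 -(pser_at0 r0 hF).
by rewrite opprD addrA.
Qed.

Lemma der_uniq F w0 b b' : der F w0 b -> der F w0 b' -> b = b'.
Proof.
move=> [K [d [K0 d0 h]]] [K' [d' [K0' d0' h']]].
apply/eqP; rewrite -subr_eq0; apply/eqP/nm_eq0/ler_addgt0Pr => e e0; rewrite add0r.
pose x : R := Num.min (Num.min d d' / 2) (e / (K + K' + 1)).
have KK : 0 < K + K' + 1 by rewrite ltr_wpDl // addr_ge0.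
have x0 : 0 < x by rewrite lt_min !divr_gt0 // lt_min d0 d0'.
have xd : x < Num.min d d'.
  have m0 : 0 < Num.min d d' by rewrite lt_min d0 d0'.
  by rewrite /x gt_min ltr_pdivrMr // ltr_pMr // ltr1n.
have nx : nm (RtoC x) = x by rewrite nm_RtoC gtr0_norm.
move: xd; rewrite lt_min => /andP[xd xd'].
have := h (RtoC x); have := h' (RtoC x); rewrite nx => /(_ xd') b1 /(_ xd) b2.
rewrite -(ler_pM2r x0) -{1}nx -nmM.
have -> : (b - b') * RtoC x = (F (w0 + RtoC x) - F w0 - b' * RtoC x) - (F (w0 + RtoC x) - F w0 - b * RtoC x) by ring.
apply: le_trans (nmB _ _) _; apply: le_trans (lerD b1 b2) _.
rewrite -mulrDl expr2 mulrA; apply: ler_wpM2r; first exact: ltW.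
apply: le_trans (_ : (K' + K) * (e / (K + K' + 1)) <= _).
  by apply: ler_wpM2l; [exact: addr_ge0|rewrite /x ge_min lexx orbT].
rewrite mulrCA ler_piMr ?ltW // ltr_pdivrMr // mul1r; lra.
Qed.

Lemma der_comp F G w0 b b' : der F w0 b -> der G (F w0) b' -> der (fun w => G (F w)) w0 (b' * b).
Proof.
move=> [K [d [K0 d0 h]]] [K' [d' [K0' d0' h']]].
pose L : R := nm b + K * d.
have L0 : 0 <= L by rewrite addr_ge0 ?nm_ge0 // mulr_ge0 // ltW.
exists (K' * L ^+ 2 + nm b' * K), (Num.min d (d' / (L + 1))); split.
- by rewrite addr_ge0 // mulr_ge0 ?nm_ge0 ?sqr_ge0.
- by rewrite lt_min d0 divr_gt0 // ltr_wpDl.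
move=> x; rewrite lt_min => /andP[xd xd'].
have h1 := h x xd; pose D := F (w0 + x) - F w0.
have DL : nm D <= L * nm x.
  have -> : D = (F (w0 + x) - F w0 - b * x) + b * x by rewrite subrK.
  apply: le_trans (nmD _ _) _; apply: le_trans (lerD h1 (lexx _)) _.
  rewrite nmM /L mulrDl addrC lerD2l expr2 mulrA; apply: ler_wpM2r; first exact: nm_ge0.
  by apply: ler_wpM2l => //; exact: ltW.
have Dd : nm D < d'.
  apply: le_lt_trans DL _; apply: le_lt_trans (_ : (L + 1) * nm x < _).
    by apply: ler_wpM2r; [exact: nm_ge0|rewrite lerDl].
  by rewrite mulrC -ltr_pdivlMr // ltr_wpDl.
have := h' D Dd; rewrite (_ : F w0 + D = F (w0 + x)) => [h2|]; last by rewrite /D addrC subrK.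
have -> : G (F (w0 + x)) - G (F w0) - b' * b * x = (G (F (w0 + x)) - G (F w0) - b' * D) +
   b' * (F (w0 + x) - F w0 - b * x) by rewrite /D; ring.
apply: le_trans (nmD _ _) _; rewrite mulrDl; apply: lerD.
  apply: le_trans h2 _; rewrite -mulrA; apply: ler_wpM2l => //.
  by rewrite -exprMn lerXn2r ?nnegrE ?nm_ge0 // mulr_ge0 ?nm_ge0.
by rewrite nmM -mulrA; apply: ler_wpM2l; [exact: nm_ge0|].
Qed.

Lemma pser_exp_coef w0 r m : exists c, [/\ pser w0 r (fun w : C => w ^+ m) c, c 0%N = w0 ^+ m &
  c 1%N = m%:R * w0 ^+ m.-1].
Proof.
elim: m => [|m [c [hc c0 c1]]].
  exists (fun m => if m == 0%N then 1 else 0); split; [|by []|by rewrite /= mul0r].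
  by apply: pser_ext (@pser_cst _ w0 r 1) => w _; rewrite expr0.
eexists; split; first by apply: pser_ext (pser_mul (@pser_id _ w0 r) hc) => w _; rewrite exprS.
  by rewrite /= big_ord_recl big_ord0 addr0 c0 exprS.
rewrite /= !big_ord_recl big_ord0 addr0 /= c0 c1 mul1r.
case: m {hc c0 c1} => [|m]; first by rewrite !mul0r mulr0 add0r expr0 mulr1.
by rewrite /= mulrCA -exprS -[m.+2%:R]natr1 mulrDl mul1r.
Qed.

(** Compare the coefficients of degree 1 in the product of [x ^+ k] with its inverse, which is
    constant. *)
Lemma der_inv_exp (x0 : C) k : x0 != 0 -> der (fun x => (x ^+ k)^-1) x0 (- (k%:R / x0 ^+ k.+1)).
Proof.
move=> x00; pose r := nm x0; have r0 : 0 < r by exact: nm_gt0.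
pose D : set C := [set w | nm (w - x0) < r].
have nD : ~ D 0 by rewrite /D /= sub0r nmN ltxx.
have hG : anl D (fun x => (x ^+ k)^-1).
  by apply: anl_ext (anl_exp k (anl_inv nD)) => w _; rewrite subr0 exprVn.
have [|g hg] := hG x0 r r0; first by [].
have [c [hc c0 c1]] := pser_exp_coef x0 r k.
have h1 : pser x0 r (fun _ : C => 1) (fun m => \sum_(i < m.+1) g i * c (m - i)%N).
  apply: pser_ext (pser_mul hg hc) => w wr; rewrite mulVf // expf_neq0 //.
  by apply/eqP => w0; apply: nD; rewrite -w0.
have g0 : g 0%N = (x0 ^+ k)^-1 by rewrite -(pser_at0 r0 hg).
have := pser_unique r0 h1 (@pser_cst _ x0 r 1) (fun _ _ => erefl) 1%N.
rewrite !big_ord_recl big_ord0 addr0 /= c0 c1 g0 /bump /= => /eqP.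
rewrite addrC addr_eq0 => /eqP e.
have -> : - (k%:R / x0 ^+ k.+1) = g 1%N; last exact: pser_der r0 hg.
have xk : x0 ^+ k != 0 by rewrite expf_neq0.
apply: (mulIf xk); rewrite e.
case: (k) => [|j]; first by rewrite !mul0r oppr0 mulr0 mul0r oppr0.
by rewrite /= 2!exprS; field; rewrite x00 expf_neq0.
Qed.

Lemma der_cexp (y : C) : der (@cexp R) y (cexp y).
Proof.
have h : pser y 1 (@cexp R) (fun m => cexp y / m`!%:R).
  by move=> h _; rewrite cexpD; apply: eq_hs (hs_Ml (cexp y) (hs_cexp h)) => m; ring.
by have := pser_der ltr01 h; rewrite factS fact0 muln1 divr1.
Qed.

Lemma der_scale a b F w : der F w b -> der (fun v => a * F v) w (a * b).
Proof.
move=> [K [d [K0 d0 h]]]; exists (nm a * K), d; split => //; first by rewrite mulr_ge0 ?nm_ge0.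
move=> x /h hx; rewrite -mulrA -!mulrBr nmM -mulrA.
by apply: ler_wpM2l; [exact: nm_ge0|].
Qed.

(** Differentiating the kernel brings down [v ^+ k]: under the Laplace integral, (1/k) x^(k+1) d/dx
    is multiplication by w^k. *)
Lemma lker_der (k : nat) (v x0 : C) : x0 != 0 ->
  der (fun x => lapker k (x ^+ k)^-1 v) x0 (lapker k (x0 ^+ k)^-1 v * (v ^+ k * (k%:R / x0 ^+ k.+1))).
Proof.
move=> x00; have h := der_scale (- v ^+ k) (der_inv_exp k x00).
have := der_comp h (der_cexp _); rewrite mulrNN.
by rewrite /lapker; under eq_fun do rewrite mulNr; rewrite mulNr.
Qed.

End Derivative.

(** * Polar coordinates near 1 *)

Section Angles.
Variable R : realType.
Local Notation C := (Cx R).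

Lemma cis_near1 (e : R) : 0 < e -> exists2 d : R, 0 < d & forall t, `|t| < d -> nm (cis t - 1) < e.
Proof.
move=> e0; have e2 : 0 < e / 2 by rewrite divr_gt0.
have /cvgrPdist_lt /(_ _ e2) [d1 /= d10 h1] := @continuous_cos R 0.
have /cvgrPdist_lt /(_ _ e2) [d2 /= d20 h2] := @continuous_sin R 0.
exists (Num.min d1 d2); first by rewrite lt_min d10 d20.
move=> t; rewrite lt_min => /andP[t1 t2].
have := h1 t; rewrite /ball_ /= sub0r normrN cos0 => /(_ t1) c1.
have := h2 t; rewrite /ball_ /= sub0r normrN sin0 sub0r normrN => /(_ t2) s1.
apply: le_lt_trans (nm_ReIm _) _; rewrite [ltRHS]splitr.
have -> : ReC (cis t - 1) = cos t - 1 by [].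
have -> : ImC (cis t - 1) = sin t by rewrite /ImC /= subr0.
by rewrite distrC; apply: ltrD.
Qed.

Lemma polar_near1 (e : R) : 0 < e -> exists2 d : R, 0 < d & forall v, nm (v - 1) < d ->
  exists2 t, `|t| < e & v = RtoC (nm v) * cis t.
Proof.
move=> e0; have /cvgrPdist_lt /(_ _ e0) [d /= d0 h] := @continuous_atan R 0.
have m0 : 0 < Num.min d 1 by rewrite lt_min d0 ltr01.
exists (Num.min d 1 / 2); first by rewrite divr_gt0.
move=> v hv.
have v1 : `|ReC v - 1| < Num.min d 1 / 2.
  by apply: le_lt_trans hv; rewrite (_ : ReC v - 1 = ReC (v - 1)) ?nm_Re // /ReC raddfB.
have v2 : `|ImC v| < Num.min d 1 / 2.
  by apply: le_lt_trans hv; rewrite (_ : ImC v = ImC (v - 1)) ?nm_Im // /ImC raddfB /= subr0.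
have m1 : Num.min d 1 <= 1 by rewrite ge_min lexx orbT.
have md : Num.min d 1 <= d by rewrite ge_min lexx.
move: v1; rewrite ltr_norml => /andP[v1 _].
have x12 : 1 / 2 < ReC v by lra.
have x0 : 0 < ReC v by lra.
pose y := ImC v / ReC v.
have yd : `|y| < d.
  rewrite /y normrM normfV (gtr0_norm x0) ltr_pdivrMr //.
  apply: lt_le_trans v2 _; apply: le_trans (_ : d / 2 <= _); first by lra.
  by rewrite ler_pM2l //; lra.
exists (atan y).
  by have := h y; rewrite /ball_ /= sub0r normrN atan0 sub0r normrN; apply.
have ca : 0 < cos (atan y) by apply: cos_gt0_pihalf; rewrite atan_gtNpi2 atan_ltpi2.
have E : v = RtoC (ReC v / cos (atan y)) * cis (atan y).
  have sa : sin (atan y) = y * cos (atan y).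
    by rewrite -{2}(atanK y) /tan divfK ?gt_eqF.
  apply/eqP; rewrite eq_complex /= sa !mul0r subr0 addr0; apply/andP; split; apply/eqP.
    by rewrite divfK // gt_eqF.
  by rewrite mulrA mulrAC divfK ?gt_eqF // /y mulrC divfK // gt_eqF.
have -> : nm v = ReC v / cos (atan y); last by [].
by rewrite {1}E nmM nm_cis mulr1 nm_RtoC gtr0_norm // divr_gt0.
Qed.

Lemma cis_inj0 (d : R) : `|d| < 2 * pi -> cis d = 1 -> d = 0.
Proof.
move=> hd e; have c1 : cos d = 1 by have := congr1 (@ReC R) e.
apply/eqP; apply/negPn/negP => d0.
have n0 : 0 < `|d| by rewrite normr_gt0.
have s0 : 0 < sin (`|d| / 2) by apply: sin_gt0_pi; rewrite divr_gt0 //= ltr_pdivrMr // mulrC.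
have := cosD (`|d| / 2) (`|d| / 2); rewrite -splitr cos_norm c1 -!expr2 cos2sin2 => h.
have : sin (`|d| / 2) ^+ 2 = 0 by lra.
by move/eqP; rewrite sqrf_eq0 gt_eqF.
Qed.

End Angles.

                                

(** * Independence of the Laplace integral from the ray *)

Section RayIndependence.
Variable R : realType.
Variable k : nat.
Hypothesis k_gt0 : (0 < k)%N.
Local Notation C := (Cx R).
Local Notation leb := (@lebesgue_measure R).
Local Notation P := (`]0%R, +oo[%classic : set R).
Variable Om : set C.
Hypothesis Om_open : forall w, Om w -> exists2 r : R, 0 < r & forall v, nm (v - w) < r -> Om v.
Hypothesis Om_star : forall w (s : R), Om w -> 0 <= s <= 1 -> Om (RtoC s * w).
Local Notation maj := (maj k Om).
Local Notation LA := (LA k).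
Local Notation in_ray := (in_ray Om).

Lemma LA_realscale p F a u X c : 0 <= p -> maj p F a -> in_ray u -> u != 0 ->
  p * nm u ^+ k <= ReC (u ^+ k * X) -> 0 < c -> LA (RtoC c * u) X F = LA u X F.
Proof.
move=> p0 hF hu u0 hX c0; have [aF _ _ _] := hF.
have it := itg_lint Om_open p0 hF hu u0 hX.
have mF := mfunC_lint k Om_open X aF hu.
have it' : itg P (fun s : R => lint k u X F (Num.max s 0)) (fun s => nm u * lapE k p a (nm u * s)).
  have e0 s : P s -> lint k u X F s = lint k u X F (Num.max s 0).
    by rewrite /= in_itv /= andbT => s0; rewrite max0P.
  exact: (itg_ext (@mP R) e0 (fun _ _ => erefl) it).
have e1 : LA u X F = cint P (fun s : R => lint k u X F (Num.max s 0)).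
  by apply: eq_cint => s; rewrite /= in_itv /= andbT => s0; rewrite max0P.
rewrite e1 -(cint_scale c0 mF it'); apply: eq_cint => s; rewrite /= in_itv /= andbT => s0.
have cs : 0 < c * s by exact: mulr_gt0.
have e2 : RtoC s * (RtoC c * u) = RtoC (c * s) * u by rewrite mulrA -RtoCM [s * c]mulrC.
by rewrite (max0P cs) /lint e2; ring.
Qed.

(** The integral along [v * u] is analytic in [v] near 1, and for real [v] slightly above 1 it is
    unchanged by a substitution. The identity theorem makes it constant, so small rotations of the
    ray are harmless. This takes the place of Cauchy's theorem. *)
Lemma LA_local p F a u X d : 0 <= p -> maj p F a -> nm u = 1 -> 0 < d <= 1 ->
  (forall v, nm (v - 1) < d -> in_ray (v * u) /\ p * (1 + d) ^+ k <= ReC ((v * u) ^+ k * X)) ->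
  forall v, nm (v - 1) < d -> LA (v * u) X F = LA u X F.
Proof.
move=> p0 hF u1 /andP[d0 d1] H; have [aF bF [a0 ah] _] := hF.
have D0 : 0 < 1 + d by rewrite ltr_wpDl.
have u0 : u != 0 by apply/eqP => e; move: u1; rewrite e nm0 => /esym/eqP; rewrite oner_eq0.
have nv v : nm (v - 1) < d -> nm v <= 1 + d.
  move=> hv; rewrite -(subrK 1 v) addrC; apply: le_trans (nmD _ _) _.
  by rewrite nm1 lerD2l ltW.
have v0 v : nm (v - 1) < d -> v != 0.
  by move=> hv; apply/eqP => e; move: hv; rewrite e sub0r nmN nm1 ltNge d1.
have [||c [_ _ hc]] := pser_cint (@mP R) (K := fun v s => lint k (v * u) X F s) (w0 := 1)
    (g := fun s => (1 + d) * lapE k p a ((1 + d) * s)) d0.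
- move=> s; rewrite /= in_itv /= andbT => s0.
  pose D : set C := [set v | nm (v - 1) < d].
  have h1 : anl D (fun v => F (RtoC s * u * v) * lapker k X (RtoC s * u * v)).
    apply: anl_scale (anl_mul aF (@anl_lker R k Om X)) => v Dv.
    by rewrite -mulrA [u * v]mulrC; apply: (H v Dv).1; exact: ltW.
  have [|c hc] := anl_mul h1 (anl_Z (k%:R * u) (@anl_id _ D)) d0 (w0 := 1); first by [].
  by exists c; apply: pser_ext hc => v _; rewrite /lint -!mulrA [u * v]mulrC; ring.
- move=> h hd; have hv : nm (1 + h - 1) < d by rewrite addrAC subrr add0r.
  have [r1 r2] := H _ hv; set v := 1 + h in hv r1 r2 *.
  have vu0 : v * u != 0 by apply: mulf_neq0 => //; exact: v0.
  have X1 : p * nm (v * u) ^+ k <= ReC ((v * u) ^+ k * X).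
    apply: le_trans r2; apply: ler_wpM2l => //.
    by rewrite lerXn2r ?nnegrE ?nm_ge0 // ?(ltW D0) // nmM u1 mulr1 nv.
  apply: (itg_le (itg_lint Om_open p0 hF r1 vu0 X1) (maj_integrable p0 hF D0).1).
  move=> s; rewrite /= in_itv /= andbT => s0.
  rewrite /lint 3!nmM nm_lker // nm_nat mulrC; apply: ler_pM; rewrite ?nm_ge0 ?mulr_ge0 ?nm_ge0 ?expR_ge0 //.
    by rewrite nmM u1 mulr1 nv.
  rewrite lapE_pos; last exact: mulr_gt0.
  apply: ler_wpM2r => //; apply: ler_pM; rewrite ?nm_ge0 ?expR_ge0 //.
    apply: le_trans (bF _ (r1 _ (ltW s0))) _; apply: ah.
    rewrite !nmM u1 mulr1 nm_RtoC gtr0_norm // mulrC; apply: ler_wpM2r; [exact: ltW|exact: nv].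
  rewrite ler_expR lerN2 exprMn mulrA mulrC; apply: ler_wpM2l => //; exact/exprn_ge0/ltW.
have Fa (h : R) : 0 < h < d -> cint P (lint k ((1 + RtoC h) * u) X F) = LA u X F.
  move=> /andP[h0 hd]; have := H 1; rewrite subrr nm0 mul1r => /(_ d0) [r1 r2].
  rewrite -RtoC1 -RtoCD; apply: (@LA_realscale p F a) => //; last by rewrite ltr_wpDl.
  by apply: le_trans r2; rewrite u1 expr1n mulr1 ler_peMr // exprn_ege1 // lerDl ltW.
by move=> v hv; have := pser_const d0 hc Fa hv; rewrite addrC subrK.
Qed.

(** The radius in [LA_local] can be chosen uniformly in the angle, so finitely many small rotations
    lead from [t1] to [t2]. *)
Lemma ray_indep p F a X t1 t2 bt M : 0 <= p -> maj p F a -> t1 <= t2 -> 0 < bt ->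
  (forall t tau, t1 <= t <= t2 -> `|tau| < bt -> in_ray (cis (t + tau))) ->
  (forall t, t1 <= t <= t2 -> M <= ReC (cis t ^+ k * X)) -> p * 2 ^+ k < M ->
  LA (cis t1) X F = LA (cis t2) X F.
Proof.
move=> p0 hF t12 bt0 hray hM pM.
have [d1 d10 h1] := polar_near1 bt0.
have [K [d2 [K0 d20 h2]]] : exists K d : R, [/\ 0 <= K, 0 < d & forall h : C, nm h < d -> nm ((1 + h) ^+ k - 1 ^+ k) <= K * nm h].
  by apply: (@anl_lip R setT _ (fun w => w ^+ k) 1) => //; [move=> w _; exists 1|exact/anl_exp/anl_id].
(* The room left for the real part: a change of [v ^+ k] by at most [(K + 1) * e] costs at most
   [M - p * 2 ^+ k], while [1 + d <= 2]. *)
pose e := (M - p * 2 ^+ k) / ((K + 1) * (nm X + 1)).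
have KX : 0 < (K + 1) * (nm X + 1) by rewrite mulr_gt0 ?ltr_wpDl ?nm_ge0.
have e0 : 0 < e by rewrite divr_gt0 // subr_gt0.
pose d := Num.min (Num.min d1 d2) (Num.min e 1).
have d0 : 0 < d by rewrite !lt_min d10 d20 e0 ltr01.
have dd1 : d <= d1 by rewrite !ge_min lexx.
have dd2 : d <= d2 by rewrite !ge_min lexx orbT.
have dde : d <= e by rewrite !ge_min lexx !orbT.
have d1' : d <= 1 by rewrite !ge_min lexx !orbT.
have key t : t1 <= t <= t2 -> forall v, nm (v - 1) < d ->
    in_ray (v * cis t) /\ p * (1 + d) ^+ k <= ReC ((v * cis t) ^+ k * X).
  move=> ht v hv; split.
    have [tau ltau ev] := h1 v (lt_le_trans hv dd1).
    move=> s s0; rewrite ev -mulrA -cisD mulrA -RtoCM addrC; apply: hray => //.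
    by rewrite mulr_ge0 // nm_ge0.
  apply: le_trans (_ : p * 2 ^+ k <= _).
    by apply: ler_wpM2l => //; rewrite lerXn2r ?nnegrE ?addr_ge0 ?(ltW d0) //; lra.
  have -> : (v * cis t) ^+ k * X = cis t ^+ k * X + (v ^+ k - 1) * cis t ^+ k * X by rewrite exprMn; ring.
  have -> (y z : C) : ReC (y + z) = ReC y + ReC z by exact: ReCD.
  have b1 := hM t ht.
  have b2 : `|ReC ((v ^+ k - 1) * cis t ^+ k * X)| <= M - p * 2 ^+ k.
    apply: le_trans (nm_Re _) _; rewrite 2!nmM nmX nm_cis expr1n mulr1.
    have := h2 (v - 1) (lt_le_trans hv dd2); rewrite [1 + _]addrC subrK expr1n => b3.
    have -> : M - p * 2 ^+ k = (K + 1) * e * (nm X + 1).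
      have n1 : K + 1 != 0 by rewrite gt_eqF // ltr_wpDl.
      have n2 : nm X + 1 != 0 by rewrite gt_eqF // ltr_wpDl // nm_ge0.
      by rewrite /e; field; rewrite n1 n2.
    apply: ler_pM; rewrite ?nm_ge0 ?lerDl //; apply: le_trans b3 _.
    by apply: ler_pM; rewrite ?nm_ge0 ?lerDl // (le_trans (ltW hv)).
  by move: b2; rewrite ler_norml => /andP[b2 _]; lra.
have [et et0 het] := cis_near1 d0.
have loc t t' : t1 <= t <= t2 -> `|t' - t| < et -> LA (cis t') X F = LA (cis t) X F.
  move=> ht htt; rewrite -[t'](subrK t) cisD.
  by apply: (LA_local p0 hF (nm_cis t) _ (key t ht)); rewrite ?d0 //; exact: het.
pose N := (Num.truncn ((t2 - t1) / et)).+1.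
have N0 : 0 < N%:R :> R by rewrite ltr0n.
have hN : (t2 - t1) / N%:R < et.
  rewrite ltr_pdivrMr // mulrC -ltr_pdivrMr //.
  exact: truncnS_gt.
have st0 : 0 <= (t2 - t1) / N%:R by rewrite divr_ge0 ?subr_ge0 // ltW.
have step i : (i <= N)%N -> LA (cis (t1 + i%:R * ((t2 - t1) / N%:R))) X F = LA (cis t1) X F.
  elim: i => [|i IH] iN; first by rewrite mul0r addr0.
  rewrite -(IH (ltnW iN)); apply: loc.
    rewrite lerDl mulr_ge0 //=; have : i%:R <= N%:R :> R by rewrite ler_nat ltnW.
    have N1 : N%:R != 0 :> R by rewrite gt_eqF.
    move=> h; rewrite -lerBrDl -[leRHS](divfK N1) //.
    by rewrite [leRHS]mulrC; apply: ler_wpM2r.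
  rewrite -natr1 (_ : _ - _ = (t2 - t1) / N%:R); last by ring.
  by rewrite ger0_norm.
have := step N (leqnn N); rewrite mulrC divfK ?gt_eqF // addrC subrK => <- //.
Qed.

End RayIndependence.

(** * Laplace integrals of constants *)

Section Constants.
Variable R : realType.
Variable k : nat.
Hypothesis k_gt0 : (0 < k)%N.
Local Notation C := (Cx R).
Local Notation leb := (@lebesgue_measure R).
Local Notation P := (`]0%R, +oo[%classic : set R).

Lemma mono_cst (c : R) : 0 <= c -> mono (fun _ : R => c).
Proof. by move=> c0; split => // s t _; exact: lexx. Qed.

Lemma expr_ge_sub1 (s : R) : 0 <= s -> s - 1 <= s ^+ k.
Proof.
move=> s0; have [s1|s1] := leP s 1.
  by apply: le_trans (exprn_ge0 k s0); rewrite subr_le0.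
apply: le_trans (_ : s <= _); first by rewrite gerBl.
by case: k k_gt0 => // j _; rewrite exprS ler_peMr // exprn_ege1 // ltW.
Qed.

Lemma integrable_lapE_cst p c : 0 < p -> 0 <= c ->
  leb.-integrable P (EFin \o lapE k p (fun _ => c)).
Proof.
move=> p0 c0; have mc := mono_cst c0.
have h1 : leb.-integrable P (EFin \o exponential_pdf p).
  have h0 : leb.-integrable setT (EFin \o exponential_pdf p) by exact: integrable_exponential_pdf.
  by apply: integrableS h0 => //; exact: mP.
have h2 := integrableZ (@mP R) (c * k%:R * expR p / p) h1.
apply: le_integrable h2; first exact: mP.
  by apply/measurable_EFinP; apply: measurable_funTS; exact: measurable_lapE.
move=> s; rewrite /= in_itv /= andbT => s0; rewrite lee_fin ger0_norm ?lapE_ge0 //.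
apply: le_trans (ler_norm _); rewrite lapE_pos // (exponential_pdfE _ (ltW s0)).
have -> : c * k%:R * expR p / p * (p * expR (- p * s)) = c * expR (p - p * s) * k%:R.
  by rewrite expRD mulNr; field; rewrite gt_eqF.
apply: ler_wpM2r => //; apply: ler_wpM2l => //; rewrite ler_expR.
have := ler_wpM2l (ltW p0) (expr_ge_sub1 (ltW s0)); lra.
Qed.

(** The integral of k exp(-s^k) over the half-line, that is Gamma(1/k); so the Borel transform of
    [x] is the constant [gam^-1]. *)
Definition gam : R := lap k 1 (fun _ : R => 1).

Lemma maj_cst (Om : set C) p (c : C) : 0 < p -> maj k Om p (fun _ => c) (fun _ => nm c).
Proof.
move=> p0; split; [exact: anl_cst|by []|exact/mono_cst/nm_ge0|].
by apply: integrable_lapE_cst; rewrite ?nm_ge0.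
Qed.

Lemma maj_one (Om : set C) p : 0 < p -> maj k Om p (fun _ => 1) (fun _ => 1).
Proof. by move=> p0; have := @maj_cst Om p 1 p0; rewrite nm1. Qed.

Lemma gam_gt0 : 0 < gam.
Proof.
have := maj_growth ler01 (maj_one setT ltr01) (lexx 0).
rewrite mul1r => h.
have k0 : 0 < k%:R :> R by rewrite ltr0n.
by have := lt_le_trans k0 h; rewrite pmulr_lgt0 // expR_gt0.
Qed.

Lemma lap_cstE p c : 0 < p -> 0 <= c -> lap k p (fun _ : R => c) = c * lap k p (fun _ : R => 1).
Proof.
move=> p0 c0; rewrite /lap -RintegralZl; [|exact: mP|exact: integrable_lapE_cst].
by apply: eq_Rintegral => s _; rewrite /lapE mul1r !mulrA.
Qed.

(** Scaling [s] by [q]. With weight [q ^+ k] the element [x] therefore gets size [q^-1], small for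
    large [q]. *)
Lemma lap_cst (q c : R) : 0 < q -> 0 <= c -> lap k (q ^+ k) (fun _ => c) = c * (gam / q).
Proof.
move=> q0 c0; have qk0 : 0 < q ^+ k by exact: exprn_gt0.
rewrite lap_cstE //; congr (_ * _).
have [_ e] := maj_integrable ler01 (maj_one setT ltr01) q0; rewrite /gam -e.
rewrite [X in X / q](_ : _ = q * lap k (q ^+ k) (fun _ => 1)).
  by rewrite mulrAC divff ?mul1r // gt_eqF.
rewrite /lap -RintegralZl; [|exact: mP|by apply: integrable_lapE_cst].
apply: eq_Rintegral => s; rewrite inE /= in_itv /= andbT => s0.
have qs : 0 < q * s by exact: mulr_gt0.
by rewrite (lapE_pos _ _ _ qs) (lapE_pos _ _ _ s0) exprMn !mul1r.
Qed.

Lemma ReC_cisX (t tau rho : R) : rho != 0 ->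
  ReC (cis t ^+ k * ((RtoC rho * cis tau) ^+ k)^-1) = cos (k%:R * (tau - t)) / rho ^+ k.
Proof.
move=> r0; rewrite exprMn invfM mulrCA !cisX -cisN -cisD -RtoCX -RtoCV.
rewrite (_ : k%:R * t + _ = - (k%:R * (tau - t))); last by ring.
by rewrite /ReC /cis /RtoC /= cosN mul0r subr0 mulrC.
Qed.

Lemma LA_cst_ray (tau rho : R) c : 0 < rho ->
  LA k (cis tau) ((RtoC rho * cis tau) ^+ k)^-1 (fun _ => c) = c * RtoC gam * (RtoC rho * cis tau).
Proof.
move=> r0; have ri : 0 < rho^-1 by rewrite invr_gt0.
have m1 := maj_one setT (@ltr01 R).
have [i1 e1] := maj_integrable ler01 m1 ri.
have mc := mono_cst (@ler01 R).
have it : itg P (fun s => RtoC (rho^-1 * lapE k 1 (fun _ => 1) (rho^-1 * s)))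
   (fun s => rho^-1 * lapE k 1 (fun _ => 1) (rho^-1 * s)).
  apply: (itg_real (@mP R)) => //.
    apply: measurable_funTS; apply: measurable_funM; first exact: measurable_cst.
    by apply: (measurableT_comp (measurable_lapE k 1 mc)).
  by move=> s _; rewrite lexx andbT mulr_ge0 ?(ltW ri) // lapE_ge0.
have rC : RtoC rho != 0 by rewrite -RtoC0; apply/eqP => /RtoC_inj/eqP; rewrite gt_eqF.
rewrite /LA (eq_cint (G := fun s => (c * (RtoC rho * cis tau)) * RtoC (rho^-1 * lapE k 1 (fun _ => 1) (rho^-1 * s)))).
  rewrite (cintZ (@mP R) _ it) cint_real; last exact: mP.
  by rewrite e1 /gam; ring.
move=> s; rewrite /= in_itv /= andbT => s0; rewrite /lint lapE_pos ?mulr_gt0 //.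
have e : RtoC s * cis tau = RtoC (rho^-1 * s) * (RtoC rho * cis tau) by rewrite RtoCM RtoCV; field.
have -> : lapker k ((RtoC rho * cis tau) ^+ k)^-1 (RtoC s * cis tau) = RtoC (expR (- (1 * (rho^-1 * s) ^+ k))).
  rewrite /lapker e exprMn mulfK; last by rewrite expf_neq0 // mulf_neq0 // cis_neq0.
  rewrite mul1r -RtoCX /cexp /RtoC -rmorphN /ReC /ImC /=.
  by rewrite (_ : cis 0 = 1) ?mulr1 // cis0.
by rewrite !RtoCM RtoCV RtoC_nat RtoC1 mul1r; field.
Qed.

Lemma cos_le_norm (y b : R) : `|y| <= b -> b <= pi -> cos b <= cos y.
Proof.
move=> yb bp; rewrite -[cos y]cos_norm leNgt ltr_cos -?leNgt //; rewrite in_itv /=.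
  by rewrite bp (le_trans _ yb).
by rewrite normr_ge0 (le_trans yb).
Qed.

(** Rotating the ray to the argument of [x] makes the kernel real, which is the case of
    [LA_cst_ray]; a constant is analytic everywhere, so only the decay of the kernel limits the
    rotation. *)
Lemma LA_cst t x c mu : 0 <= mu -> laplace_domain k mu t x ->
  LA k (cis t) (x ^+ k)^-1 (fun _ => c) = c * RtoC gam * x.
Proof.
move=> mu0 [rho [tau [r0 -> tt hc]]].
rewrite -LA_cst_ray //.
have k0 : 0 < k%:R :> R by rewrite ltr0n.
pose M := cos (k%:R * (tau - t)) / rho ^+ k.
have M0 : 0 < M by rewrite divr_gt0 ?exprn_gt0 //; apply: le_lt_trans hc; rewrite exprn_ge0 // mulr_ge0 // ltW.
(* Half of the available decay, divided by the factor [2 ^+ k] that [ray_indep] consumes. *)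
pose p := M / 2 / 2 ^+ k.
have p0 : 0 < p by rewrite /p; apply: divr_gt0; [exact: divr_gt0|exact: exprn_gt0].
have pM : p * 2 ^+ k < M by rewrite /p divfK ?expf_neq0 ?pnatr_eq0 // ltr_pdivrMr // ltr_pMr // ltr1n.
have hM t' : `|tau - t'| <= `|tau - t| -> M <= ReC (cis t' ^+ k * ((RtoC rho * cis tau) ^+ k)^-1).
  move=> h; rewrite ReC_cisX ?gt_eqF //; apply: ler_wpM2r; first by rewrite invr_ge0 exprn_ge0 // ltW.
  rewrite -[cos (k%:R * (tau - t))]cos_norm; apply: cos_le_norm.
    by rewrite !normrM; apply: ler_wpM2l.
  rewrite normrM normr_nat -ler_pdivlMl // mulrC; apply: le_trans (ltW tt) _.
  rewrite invfM mulrA ler_wpM2r ?invr_ge0 // ler_piMr ?pi_ge0 // invf_le1 // ler1n //.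
have R1 (u : C) : in_ray setT u by [].
have st (w : C) (s : R) : setT w -> 0 <= s <= 1 -> setT (RtoC s * w) by [].
have op (w : C) : setT w -> exists2 r : R, 0 < r & forall v : C, nm (v - w) < r -> setT v by move=> _; exists 1.
have [h|h] := leP t tau.
  apply: (ray_indep op (p := p) (ltW p0) (@maj_cst setT p c p0) h ltr01 (fun _ _ _ _ => R1 _) _ pM).
  move=> t' /andP[a b]; apply: hM; rewrite !ger0_norm ?subr_ge0 //; lra.
apply/esym.
apply: (ray_indep op (p := p) (ltW p0) (@maj_cst setT p c p0) (ltW h) ltr01 (fun _ _ _ _ => R1 _) _ pM).
move=> t' /andP[a b]; apply: hM; rewrite !ler0_norm ?subr_le0 ?(ltW h) //; lra.
Qed.

End Constants.

(** * Admissible rays for a given x, and analyticity in x *)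

Section LaplaceDomain.
Variable R : realType.
Variable k : nat.
Hypothesis k_gt0 : (0 < k)%N.
Local Notation C := (Cx R).
Local Notation leb := (@lebesgue_measure R).
Local Notation P := (`]0%R, +oo[%classic : set R).
Variable Om : set C.
Hypothesis Om_open : forall w, Om w -> exists2 r : R, 0 < r & forall v, nm (v - w) < r -> Om v.
Hypothesis Om_star : forall w (s : R), Om w -> 0 <= s <= 1 -> Om (RtoC s * w).
Local Notation maj := (maj k Om).
Local Notation LA := (LA k).
Local Notation in_ray := (in_ray Om).

Lemma laplace_domain_Re mu t x : 0 <= mu -> laplace_domain k mu t x ->
  x != 0 /\ mu ^+ k < @ReC R (cis t ^+ k * (x ^+ k)^-1).
Proof.
move=> mu0 [rho [tau [r0 -> tt hc]]]; split.
  rewrite mulf_neq0 ?cis_neq0 // -RtoC0; apply/eqP => /RtoC_inj/eqP; rewrite gt_eqF //.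
by rewrite ReC_cisX ?gt_eqF // ltr_pdivlMr ?exprn_gt0 // -exprMn.
Qed.

Lemma cis_arg_uniq (rho rho' tau tau' : R) : 0 < rho -> 0 < rho' -> `|tau - tau'| < 2 * pi ->
  RtoC rho * cis tau = RtoC rho' * cis tau' -> rho = rho' /\ tau = tau'.
Proof.
move=> r0 r0' ht e.
have er : rho = rho'.
  by have := congr1 (@nm R _) e; rewrite !nmM !nm_cis !mulr1 !nm_RtoC !gtr0_norm.
split=> //; apply/eqP; rewrite -subr_eq0; apply/eqP; apply: cis_inj0 => //.
have rC : RtoC rho != 0 by rewrite -RtoC0; apply/eqP => /RtoC_inj/eqP; rewrite gt_eqF.
move: e; rewrite -er => /(mulfI rC) e.
by rewrite cisD cisN e divff ?cis_neq0.
Qed.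

(** For a direction between two admissible ones, the angle to [x] is at most the larger of the two
    end angles, so the decay stays above the smaller end value and every intermediate ray
    converges. *)
Lemma ray_indep_domain p F a x theta alpha mu t1 t2 : 0 <= p -> maj p F a -> 0 <= mu ->
  p * 2 ^+ k <= mu ^+ k -> alpha < pi ->
  (forall t, `|t - theta| < alpha / 2 -> in_ray (cis t)) ->
  `|t1 - theta| < alpha / 2 -> `|t2 - theta| < alpha / 2 ->
  laplace_domain k mu t1 x -> laplace_domain k mu t2 x ->
  LA (cis t1) (x ^+ k)^-1 F = LA (cis t2) (x ^+ k)^-1 F.
Proof.
move=> p0 hF mu0 pmu api hray.
wlog t12 : t1 t2 / t1 <= t2 => [H h1 h2 d1 d2|].
  by have [t12|/ltW t21] := leP t1 t2; [exact: H|apply/esym; exact: H].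
move=> h1 h2 [rho [tau [r0 ex tt hc]]] [rho' [tau' [r0' ex' tt' hc']]].
have k0 : 0 < k%:R :> R by rewrite ltr0n.
have pik : pi / (2 * k%:R) <= pi / 2 :> R.
  by rewrite invfM mulrA ler_piMr ?divr_ge0 ?pi_ge0 // invf_le1 // ler1n.
have := pi_gt0 R => pi0.
(* Since [alpha < pi], the two arguments of [x] differ by less than [2 * pi], hence coincide. *)
have [er et] : rho = rho' /\ tau = tau'.
  apply: cis_arg_uniq => //; last by rewrite -ex -ex'.
  move: h1 h2 tt tt'; rewrite !ltr_norml => /andP[a1 a2] /andP[a3 a4] /andP[a5 a6] /andP[a7 a8].
  apply/andP; split; lra.
move: tt' hc'; rewrite -et -er => tt' hc' {ex' rho' r0' er tau' et}.
pose M := Num.min (cos (k%:R * (tau - t1)) / rho ^+ k) (cos (k%:R * (tau - t2)) / rho ^+ k).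
have rk : 0 < rho ^+ k by exact: exprn_gt0.
have pM : p * 2 ^+ k < M.
  apply: le_lt_trans pmu _; rewrite lt_min !ltr_pdivlMr // -exprMn hc hc' //.
pose bt := alpha / 2 - Num.max `|t1 - theta| `|t2 - theta|.
have bt0 : 0 < bt by rewrite subr_gt0 gt_max h1 h2.
apply: (ray_indep Om_open p0 hF t12 bt0 (M := M)) => //.
- move=> t s /andP[at1 at2] hs; apply: hray.
  have : `|t - theta| <= Num.max `|t1 - theta| `|t2 - theta|.
    rewrite le_max; have [th|th] := leP theta t.
      by apply/orP; right; rewrite !ger0_norm ?subr_ge0 ?(le_trans th) //; lra.
    by apply/orP; left; rewrite !ler0_norm ?subr_le0 ?(le_trans at1) ?(ltW th) //; lra.
  move=> h; rewrite addrAC; apply: le_lt_trans (ler_normD _ _) _.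
  rewrite /bt in hs; lra.
move=> t /andP[at1 at2]; rewrite ex ReC_cisX ?gt_eqF //.
have hb s : `|tau - s| < pi / (2 * k%:R) -> `|tau - t| <= `|tau - s| ->
    cos (k%:R * (tau - s)) / rho ^+ k <= cos (k%:R * (tau - t)) / rho ^+ k.
  move=> hs hts; apply: ler_wpM2r; first by rewrite invr_ge0 ltW.
  rewrite -[cos (k%:R * (tau - s))]cos_norm; apply: cos_le_norm.
    by rewrite !normrM; apply: ler_wpM2l.
  rewrite normrM normr_nat -ler_pdivlMl // mulrC; apply: le_trans (ltW hs) _.
  by rewrite invfM mulrA ler_wpM2r ?invr_ge0 // ler_piMr ?pi_ge0 // invf_le1 // ler1n.
have [th|th] := leP t tau.
  rewrite /M ge_min; apply/orP; left; apply: hb => //.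
  by rewrite !ger0_norm ?subr_ge0 // ?(le_trans at1) //; lra.
rewrite /M ge_min; apply/orP; right; apply: hb => //.
by rewrite !ler0_norm ?subr_le0 // ?(ltW th) // ?(ltW (lt_le_trans th at2)) //; lra.
Qed.

(** The integrand expands in powers of [x - x0] and is dominated uniformly on the disc. Its first
    coefficient is the derivative of the kernel, which identifies multiplication by [w ^+ k] with
    (1/k) x^(k+1) d/dx. *)
Lemma LA_pser p F a u x0 r : 0 <= p -> maj p F a -> in_ray u -> nm u = 1 ->
  0 < r < nm x0 -> (forall x, nm (x - x0) < r -> p <= ReC (u ^+ k * (x ^+ k)^-1)) ->
  exists c, [/\ pser x0 r (fun x => LA u (x ^+ k)^-1 F) c,
    forall x, nm (x - x0) < r -> nm (LA u (x ^+ k)^-1 F) <= lap k p a &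
    k%:R * LA u (x0 ^+ k)^-1 (fun w => w ^+ k * F w) = x0 ^+ k.+1 * c 1%N].
Proof.
move=> p0 hF hu u1 /andP[r0 rx] hX.
have u0 : u != 0 by apply/eqP => e; move: u1; rewrite e nm0 => /esym/eqP; rewrite oner_eq0.
have hX' x : nm (x - x0) < r -> p * nm u ^+ k <= ReC (u ^+ k * (x ^+ k)^-1).
  by move=> xr; rewrite u1 expr1n mulr1; exact: hX.
have x00 : x0 != 0 by apply/eqP => e; move: rx; rewrite e nm0 ltNge ltW.
pose D : set C := [set x | nm (x - x0) < r].
have nD x : D x -> nm x0 - r <= nm x.
  move=> xr; have : nm x0 <= nm x + nm (x - x0) by rewrite -{1}(subKr x x0); exact: nmB.
  move: xr; rewrite /D /=; lra.
have nD0 : ~ D 0 by move=> /nD; rewrite nm0; lra.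
have hG : anl D (fun x => (x ^+ k)^-1).
  by apply: anl_ext (anl_exp k (anl_inv nD0)) => w _; rewrite subr0 exprVn.
have bG x : D x -> nm ((x ^+ k)^-1) <= ((nm x0 - r) ^+ k)^-1.
  move=> /nD h; rewrite nmV nmX lef_pV2 ?posrE ?exprn_gt0 //; try lra.
  by rewrite lerXn2r ?nnegrE ?nm_ge0 //; lra.
have pK s : exists c, pser x0 r (fun x => lint k u (x ^+ k)^-1 F s) c.
  have h1 := anl_Z (F (RtoC s * u) * (k%:R * u)) (anl_cexp (- (RtoC s * u) ^+ k) hG bG).
  have [|c hc] := h1 x0 r r0; first by [].
  by exists c; apply: pser_ext hc => x _; rewrite /lint /lapker mulNr; ring.
have itg1 x : nm (x - x0) < r -> itg P (lint k u (x ^+ k)^-1 F) (fun s => nm u * lapE k p a (nm u * s)).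
  by move=> xr; exact: (itg_lint Om_open p0 hF hu u0 (hX' x xr)).
have [||c [c1 c2 c3]] := pser_cint (@mP R) (K := fun x s => lint k u (x ^+ k)^-1 F s) (w0 := x0)
   (g := fun s => nm u * lapE k p a (nm u * s)) r0.
- by move=> s _; exact: pK.
- by move=> h hr; apply: itg1; rewrite addrAC subrr add0r.
exists (fun m => cint P (c m)); split => //.
  by move=> x xr; apply: (nm_LA Om_open p0 hF hu u0); exact: hX'.
have e1 s : P s -> lint k u (x0 ^+ k)^-1 (fun w => w ^+ k * F w) s = (x0 ^+ k.+1 / k%:R) * c 1%N s.
  move=> Ps; have d1 := pser_der r0 (c1 s Ps).
  have d2 := der_scale (F (RtoC s * u) * (k%:R * u)) (lker_der k (RtoC s * u) x00).
  have d3 : der (fun x => lint k u (x ^+ k)^-1 F s) x0 (F (RtoC s * u) * (k%:R * u) *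
      (lapker k (x0 ^+ k)^-1 (RtoC s * u) * ((RtoC s * u) ^+ k * (k%:R / x0 ^+ k.+1)))).
    move: d2; rewrite (_ : (fun v => _) = (fun x => lint k u (x ^+ k)^-1 F s)) //.
    by apply/funext => x; rewrite /lint; ring.
  rewrite (der_uniq d1 d3) /lint exprS; field.
  by rewrite expf_neq0 // x00 pnatr_eq0 -lt0n.
rewrite /LA (eq_cint e1) (cintZ (@mP R) _ (c2 1%N)); field.
by rewrite pnatr_eq0 -lt0n.
Qed.

End LaplaceDomain.

                      

(** * Multi-indices and finite lists of indices *)

Section MultiIndex.
Variable n : nat.

Definition madd (a b : mindex n) : mindex n := [ffun i => (a i + b i)%N].
Definition mzero : mindex n := [ffun=> 0%N].
Definition mone (s : 'I_n) : mindex n := [ffun i => (i == s) : nat].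

Definition tadd (a b : nat * mindex n) : nat * mindex n := ((a.1 + b.1)%N, madd a.2 b.2).
Definition tdeg (a : nat * mindex n) : nat := (a.1 + mdeg a.2)%N.

Lemma mdegD a b : mdeg (madd a b) = (mdeg a + mdeg b)%N.
Proof. by rewrite /mdeg -big_split; apply: eq_bigr => i _; rewrite ffunE. Qed.

Lemma mdeg0 : mdeg mzero = 0%N.
Proof. by rewrite /mdeg big1 // => i _; rewrite ffunE. Qed.

Lemma mdeg1 s : mdeg (mone s) = 1%N.
Proof.
rewrite /mdeg (bigD1 s) //= ffunE eqxx big1 // => i /negbTE h.
by rewrite ffunE h.
Qed.

Lemma leq_mdeg (a : mindex n) i : (a i <= mdeg a)%N.
Proof. by rewrite /mdeg (bigD1 i) //= leq_addr. Qed.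

Lemma tdegD a b : tdeg (tadd a b) = (tdeg a + tdeg b)%N.
Proof. by rewrite /tdeg /= mdegD addnACA. Qed.

Definition unbox N (x : 'I_N.+1 * {ffun 'I_n -> 'I_N.+1}) : nat * mindex n :=
  (nat_of_ord x.1, [ffun i => nat_of_ord (x.2 i)]).

Definition box (N : nat) : seq (nat * mindex n) :=
  [seq unbox x | x <- enum {: 'I_N.+1 * {ffun 'I_n -> 'I_N.+1}}].

Lemma uniq_box N : uniq (box N).
Proof.
rewrite map_inj_uniq ?enum_uniq // => -[x1 x2] [y1 y2] [/val_inj -> /ffunP e].
by congr (_, _); apply/ffunP => i; apply: val_inj; have := e i; rewrite !ffunE.
Qed.

Lemma mem_box N t : (tdeg t <= N)%N -> t \in box N.
Proof.
case: t => q c; rewrite /tdeg /= => h.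
have hq : (q < N.+1)%N by rewrite ltnS (leq_trans _ h) // leq_addr.
have hc i : (c i < N.+1)%N by rewrite ltnS (leq_trans (leq_mdeg c i)) // (leq_trans _ h) // leq_addl.
apply/mapP; exists (Ordinal hq, [ffun i => Ordinal (hc i)]); first by rewrite mem_enum.
by congr (_, _); apply/ffunP => i; rewrite !ffunE.
Qed.

Definition lower (t : nat * mindex n) : seq (nat * mindex n) :=
  [seq u <- box (tdeg t) | (tdeg u <= tdeg t)%N].

Lemma uniq_lower t : uniq (lower t).
Proof. by rewrite filter_uniq // uniq_box. Qed.

Lemma mem_lower t u : (u \in lower t) = (tdeg u <= tdeg t)%N.
Proof. by rewrite mem_filter; apply: andb_idr; exact: mem_box. Qed.

Definition anti (t : nat * mindex n) : seq ((nat * mindex n) * (nat * mindex n)) :=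
  [seq p <- [seq (u, v) | u <- box (tdeg t), v <- box (tdeg t)] | tadd p.1 p.2 == t].

Lemma uniq_anti t : uniq (anti t).
Proof.
rewrite filter_uniq // allpairs_uniq ?uniq_box //.
by move=> [u v] [u' v'].
Qed.

Lemma mem_anti t p : (p \in anti t) = (tadd p.1 p.2 == t).
Proof.
rewrite mem_filter; apply: andb_idr => /eqP e; have := tdegD p.1 p.2; rewrite e => et.
case: p e et => u v /= _ et; apply/allpairsP; exists (u, v) => /=.
by rewrite !mem_box // et ?leq_addr ?leq_addl.
Qed.

End MultiIndex.

(** * Monomials and weights *)

Section Monomials.
Variable R : realType.
Variable n : nat.
Local Notation C := (Cx R).

Lemma monomD (a b : mindex n) (z : 'cV[C]_n) : monom (madd a b) z = monom a z * monom b z.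
Proof. by rewrite /monom -big_split; apply: eq_bigr => i _; rewrite ffunE exprD. Qed.

Lemma monom0 (z : 'cV[C]_n) : monom (mzero n) z = 1.
Proof. by rewrite /monom big1 // => i _; rewrite ffunE expr0. Qed.

Lemma monom1 s (z : 'cV[C]_n) : monom (mone s) z = z s 0.
Proof.
rewrite /monom (bigD1 s) //= ffunE eqxx expr1 big1 ?mulr1 // => i /negbTE h.
by rewrite ffunE h expr0.
Qed.

(** A monomial at real radii; different radii per coordinate give the anisotropic polydiscs needed
    against the nilpotent part. *)
Definition wt (w : 'I_n -> R) (a : mindex n) : R := \prod_(i < n) w i ^+ a i.

Lemma wtD w (a b : mindex n) : wt w (madd a b) = wt w a * wt w b.
Proof. by rewrite /wt -big_split; apply: eq_bigr => i _; rewrite ffunE exprD. Qed.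

Lemma wt0 w : wt w (mzero n) = 1.
Proof. by rewrite /wt big1 // => i _; rewrite ffunE expr0. Qed.

Lemma wt1 w s : wt w (mone s) = w s.
Proof.
rewrite /wt (bigD1 s) //= ffunE eqxx expr1 big1 ?mulr1 // => i /negbTE h.
by rewrite ffunE h expr0.
Qed.

Lemma wt_ge0 w a : (forall i, 0 <= w i) -> 0 <= wt w a.
Proof. by move=> h; apply: prodr_ge0 => i _; exact: exprn_ge0. Qed.

Lemma wt_gt0 w a : (forall i, 0 < w i) -> 0 < wt w a.
Proof. by move=> h; apply: prodr_gt0 => i _; exact: exprn_gt0. Qed.

Lemma wt_le w w' a : (forall i, 0 <= w i <= w' i) -> wt w a <= wt w' a.
Proof.
move=> h; apply: ler_prod => i _; have /andP[a0 b] := h i.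
by rewrite exprn_ge0 //= lerXn2r // nnegrE // (le_trans a0).
Qed.

Lemma nm_monom w (a : mindex n) (z : 'cV[C]_n) : (forall i, nm (z i 0) <= w i) ->
  nm (monom a z) <= wt w a.
Proof.
move=> h; rewrite /monom nm_prod; apply: ler_prod => i _; rewrite nmX exprn_ge0 ?nm_ge0 //=.
by rewrite lerXn2r ?nnegrE ?nm_ge0 // (le_trans _ (h i)) // nm_ge0.
Qed.

End Monomials.

(** * Formal series over an abstract normed algebra *)

Section FormalSeries.
Variable R : realType.
Variable n : nat.
Local Notation C := (Cx R).
Local Notation T := (nat * mindex n)%type.
Variable V : zmodType.
(** Associativity and commutativity are not assumed. The size [nv] is exactly additive and
    multiplicative because in the model it is a declared bound carried by the element; it is
    meaningful on [good] elements. *)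
Variables (vmul : V -> V -> V) (vZ : C -> V -> V) (vone : V) (nv : V -> R) (good : V -> Prop).
Hypothesis good0 : good 0.
Hypothesis goodD : forall u v, good u -> good v -> good (u + v).
Hypothesis goodM : forall u v, good u -> good v -> good (vmul u v).
Hypothesis goodZ : forall c v, good v -> good (vZ c v).
Hypothesis good1 : good vone.
Hypothesis nv0 : nv 0 = 0.
Hypothesis nvD : forall u v, nv (u + v) = nv u + nv v.
Hypothesis nvM : forall u v, nv (vmul u v) = nv u * nv v.
Hypothesis nvZ : forall c v, nv (vZ c v) = nm c * nv v.
Hypothesis nv1 : nv vone = 1.
Hypothesis nv_ge0 : forall v, good v -> 0 <= nv v.
Hypothesis vmul0 : forall v, vmul 0 v = 0.
Hypothesis vmulr0 : forall v, vmul v 0 = 0.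

Implicit Types F G : T -> V.

                                                                                          
                                                                                 
Definition sadd F G : T -> V := fun t => F t + G t.
Definition sscal c F : T -> V := fun t => vZ c (F t).
Definition svm (v : V) F : T -> V := fun t => vmul v (F t).
Definition smul F G : T -> V := fun t => \sum_(p <- anti t) vmul (F p.1) (G p.2).
Definition sdelta (t0 : T) (v : V) : T -> V := fun t => if t == t0 then v else 0.
(** Multiplication by the bookkeeping variable epsilon, whose exponent is the first index of [T]. It
    orders the recursion and is set to 1 on evaluation. *)
Definition seps F : T -> V := fun t => if t.1 is q.+1 then F (q, t.2) else 0.
Definition sdz (s : 'I_n) F : T -> V := fun t => vZ (t.2 s).+1%:R (F (t.1, madd t.2 (mone s))).
Definition spow F (m : nat) : T -> V := iter m (smul F) (sdelta (0%N, mzero n) vone).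
Definition sypow (y : 'I_n -> T -> V) (c : mindex n) : T -> V :=
  foldr (fun i F => smul (spow (y i) (c i)) F) (sdelta (0%N, mzero n) vone) (enum 'I_n).
(** Substitution of the series [y] into [f]. When they have no constant term ([sord 1]), only the
    finitely many [u] of degree at most [tdeg t] contribute at [t] ([scomp_out]). *)
Definition scomp (f : T -> V) (y : 'I_n -> T -> V) : T -> V := fun t =>
  \sum_(u <- lower t) smul (sdelta (u.1, mzero n) (f u)) (sypow y u.2) t.
Definition ssum (J : Type) (r : seq J) (F : J -> T -> V) : T -> V := fun t => \sum_(j <- r) F j t.

Lemma good_sum (J : eqType) (r : seq J) (F : J -> V) : (forall j, j \in r -> good (F j)) ->
  good (\sum_(j <- r) F j).
Proof. by move=> h; rewrite big_seq; elim/big_rec: _ => // j v jr; apply: goodD; exact: h. Qed.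

Lemma nv_sum (J : Type) (r : seq J) (F : J -> V) : nv (\sum_(j <- r) F j) = \sum_(j <- r) nv (F j).
Proof. by elim: r => [|j r IH]; rewrite ?big_nil ?big_cons ?nv0 // nvD IH. Qed.

(** Congruence modulo the [Q]-th power of epsilon: [seps] raises [Q] by one and the other operations
    preserve it. *)
Definition agree (Q : nat) F G := forall t, (t.1 < Q)%N -> F t = G t.

Lemma agree_smul Q F F' G G' : agree Q F F' -> agree Q G G' -> agree Q (smul F G) (smul F' G').
Proof.
move=> hF hG t tQ; rewrite /smul big_seq [RHS]big_seq; apply: eq_bigr => p; rewrite mem_anti => /eqP e.
move: tQ; rewrite -e /= => tQ.
by rewrite hF ?hG // (leq_ltn_trans _ tQ) // ?leq_addr ?leq_addl.
Qed.

Lemma agree_refl Q F : agree Q F F. Proof. by []. Qed.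

Lemma agree_sadd Q F F' G G' : agree Q F F' -> agree Q G G' -> agree Q (sadd F G) (sadd F' G').
Proof. by move=> hF hG t tQ; rewrite /sadd hF ?hG. Qed.

Lemma agree_sscal Q c F F' : agree Q F F' -> agree Q (sscal c F) (sscal c F').
Proof. by move=> hF t tQ; rewrite /sscal hF. Qed.

Lemma agree_svm Q v F F' : agree Q F F' -> agree Q (svm v F) (svm v F').
Proof. by move=> hF t tQ; rewrite /svm hF. Qed.

Lemma agree_seps Q F F' : agree Q F F' -> agree Q.+1 (seps F) (seps F').
Proof. by move=> hF [[|q] c] //= tQ; rewrite /seps /= hF. Qed.

Lemma agree_sdz Q s F F' : agree Q F F' -> agree Q (sdz s F) (sdz s F').
Proof. by move=> hF t tQ; rewrite /sdz hF. Qed.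

Lemma agree_ssum Q (J : Type) (r : seq J) (F F' : J -> T -> V) : (forall j, agree Q (F j) (F' j)) ->
  agree Q (ssum r F) (ssum r F').
Proof. by move=> hF t tQ; rewrite /ssum; apply: eq_bigr => j _; exact: hF. Qed.

Lemma agree_spow Q F F' m : agree Q F F' -> agree Q (spow F m) (spow F' m).
Proof. by move=> hF; elim: m => // m IH; exact: agree_smul. Qed.

Lemma agree_sypow Q y y' c : (forall i, agree Q (y i) (y' i)) -> agree Q (sypow y c) (sypow y' c).
Proof.
move=> hy; rewrite /sypow; elim: (enum 'I_n) => //= i r IH.
by apply: agree_smul => //; exact: agree_spow.
Qed.

Lemma agree_scomp Q f y y' : (forall i, agree Q (y i) (y' i)) -> agree Q (scomp f y) (scomp f y').
Proof.
move=> hy t tQ; rewrite /scomp; apply: eq_bigr => u _.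
by apply: agree_smul tQ => //; exact: agree_sypow.
Qed.

Definition sord (d : nat) F := forall t, (tdeg t < d)%N -> F t = 0.

Lemma sord_smul d e F G : sord d F -> sord e G -> sord (d + e) (smul F G).
Proof.
move=> hF hG t td; rewrite /smul big_seq big1 // => p; rewrite mem_anti => /eqP ep.
move: td; rewrite -ep tdegD => td.
have [h|h] := ltnP (tdeg p.1) d; first by rewrite hF // vmul0.
rewrite [G _]hG ?vmulr0 // -(ltn_add2l d); apply: leq_ltn_trans td.
by rewrite leq_add2r.
Qed.

Lemma sord_delta t v : sord (tdeg t) (sdelta t v).
Proof. by move=> u; rewrite /sdelta; case: eqP => // ->; rewrite ltnn. Qed.

Lemma sord_spow F m : sord 1 F -> sord m (spow F m).
Proof. by move=> hF; elim: m => // m IH; exact: (sord_smul hF IH). Qed.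

Lemma sord_sypow y c : (forall i, sord 1 (y i)) -> sord (mdeg c) (sypow y c).
Proof.
move=> hy; rewrite /sypow /mdeg -big_enum /=.
elim: (enum 'I_n) => [|i r IH] /=; first by rewrite big_nil.
by rewrite big_cons; apply: sord_smul => //; exact: sord_spow.
Qed.

Lemma scomp_out f y u t : (forall i, sord 1 (y i)) -> u \notin lower t ->
  smul (sdelta (u.1, mzero n) (f u)) (sypow y u.2) t = 0.
Proof.
move=> hy; rewrite mem_lower -ltnNge => h.
have := sord_smul (@sord_delta (u.1, mzero n) (f u)) (@sord_sypow y u.2 hy).
by move=> hs0; apply: hs0; rewrite (_ : (_ + mdeg u.2 = tdeg u)%N) // {1}/tdeg /= mdeg0 addn0.
Qed.

Section Norm.
Variable w : 'I_n -> R.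
Hypothesis w0 : forall i, 0 <= w i.

(** Epsilon has weight 1, so the bound remains available after epsilon is set to 1. *)
Definition SN F (M : R) := (forall t, good (F t)) /\ sbd (fun t => nv (F t) * wt w t.2) M.

Let nw0 F t : (forall t, good (F t)) -> 0 <= nv (F t) * wt w t.2.
Proof. by move=> h; rewrite mulr_ge0 ?nv_ge0 // wt_ge0. Qed.

Lemma SN_le F M N : M <= N -> SN F M -> SN F N.
Proof. by move=> MN [h1 h2]; split => //; apply: sbd_le h2 => // t. Qed.

Lemma SN0 : SN (fun _ => 0) 0.
Proof.
split=> // J uJ; rewrite big1 // => t _; by rewrite nv0 mul0r.
Qed.

Lemma SN_add F G M N : SN F M -> SN G N -> SN (sadd F G) (M + N).
Proof.
move=> [gF sF] [gG sG]; split=> [t|]; first exact: goodD.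
by apply: sbd_le (lexx _) (sbdD sF sG) => t; rewrite nvD mulrDl.
Qed.

Lemma SN_scal c F M : SN F M -> SN (sscal c F) (nm c * M).
Proof.
move=> [gF sF]; split=> [t|]; first exact: goodZ.
by apply: sbd_le (lexx _) (sbdZ (nm_ge0 c) sF) => t; rewrite nvZ mulrA.
Qed.

Lemma SN_svm v F M : good v -> SN F M -> SN (svm v F) (nv v * M).
Proof.
move=> gv [gF sF]; split=> [t|]; first exact: goodM.
by apply: sbd_le (lexx _) (sbdZ (nv_ge0 gv) sF) => t; rewrite nvM mulrA.
Qed.

Lemma SN_sum (J : eqType) (r : seq J) (F : J -> T -> V) (M : J -> R) :
  (forall j, SN (F j) (M j)) -> SN (ssum r F) (\sum_(j <- r) M j).
Proof.
move=> h; split=> [t|]; first by apply: good_sum => j _; case: (h j).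
have := @sbd_sum _ _ _ r (fun j t => nv (F j t) * wt w t.2) M (fun j => (h j).2).
by apply: sbd_le => // t; rewrite nv_sum mulr_suml.
Qed.

Lemma SN_delta t v : good v -> SN (sdelta t v) (nv v * wt w t.2).
Proof.
move=> gv; split=> [u|]; first by rewrite /sdelta; case: eqP.
move=> J uJ; have [tJ|tJ] := boolP (t \in J).
  rewrite (bigD1_seq t) //= /sdelta eqxx big1 ?addr0 // => u /negbTE ->.
  by rewrite nv0 mul0r.
rewrite big_seq big1 ?mulr_ge0 ?nv_ge0 ?wt_ge0 // => u uJ'.
rewrite /sdelta; case: eqP => [e|_]; first by rewrite e in uJ'; rewrite uJ' in tJ.
by rewrite nv0 mul0r.
Qed.

Lemma SN_mul F G M N : SN F M -> SN G N -> SN (smul F G) (M * N).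
Proof.
move=> [gF sF] [gG sG]; split=> [t|]; first by apply: good_sum => p _; exact: goodM.
have h := sbd_prod (fun t => nw0 t gF) (fun t => nw0 t gG) sF sG.
apply: (@sbd_fiber R (T * T)%type T (fun p => tadd p.1 p.2)
  (fun p => nv (F p.1) * wt w p.1.2 * (nv (G p.2) * wt w p.2.2)) _ (M * N)) => //.
  by move=> p; rewrite mulr_ge0 ?nw0.
move=> t e e0; exists (anti t); first exact: uniq_anti.
have -> : nv (smul F G t) * wt w t.2 = \sum_(p <- anti t | tadd p.1 p.2 == t)
    nv (F p.1) * wt w p.1.2 * (nv (G p.2) * wt w p.2.2).
  rewrite /smul nv_sum mulr_suml big_seq [RHS]big_seq_cond; apply: eq_big => p.
    by rewrite mem_anti andbb.
  by rewrite mem_anti => /eqP <-; rewrite nvM /= wtD mulrACA.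
by rewrite lerDl ltW.
Qed.

Lemma SN_eps F M : SN F M -> SN (seps F) M.
Proof.
move=> [gF sF]; split=> [[[|q] c]|]; [exact: good0|exact: gF|].
move=> J uJ; pose f (t : T) : T := (t.1.+1, t.2).
have fi : injective f by move=> [a b] [a' b'] [-> ->].
have [J' uJ' hJ'] := preim_seq J fi.
apply: le_trans (sF J' uJ'); rewrite (bigID (fun t : T => t.1 == 0%N)) /= big1 => [|[[|q] c] //= _]; last by rewrite nv0 mul0r.
rewrite add0r (_ : \sum_(t <- J' ) _ = \sum_(t <- map f J') nv (seps F t) * wt w t.2); last first.
  by rewrite big_map; apply: eq_bigr => -[q c].
rewrite -big_filter; apply: ler_sum_sub; rewrite ?filter_uniq ?map_inj_uniq //.
  by move=> [[|q] c] /=; rewrite ?nv0 ?mul0r //; exact: (nw0 (q, c) gF).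
move=> [[|q] c]; rewrite mem_filter //= => tJ.
by apply/mapP; exists (q, c); rewrite // hJ'.
Qed.

Lemma SN_spow F M m : SN F M -> SN (spow F m) (M ^+ m).
Proof.
move=> hF; elim: m => [|m IH]; last by rewrite exprS; exact: SN_mul.
have := SN_delta (0%N, mzero n) good1; by rewrite nv1 mul1r wt0.
Qed.

Lemma SN_sypow (y : 'I_n -> T -> V) (Y : 'I_n -> R) c : (forall i, SN (y i) (Y i)) ->
  SN (sypow y c) (wt Y c).
Proof.
move=> hy; rewrite /sypow /wt -big_enum /=.
elim: (enum 'I_n) => [|i r IH] /=.
  by rewrite big_nil; have := SN_delta (0%N, mzero n) good1; rewrite nv1 mul1r wt0.
by rewrite big_cons; apply: SN_mul => //; exact: SN_spow.
Qed.

Let cterm f (y : 'I_n -> T -> V) (p : T * T) : V := smul (sdelta (p.1.1, mzero n) (f p.1)) (sypow y p.1.2) p.2.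

Lemma SN_cterm f y (Y : 'I_n -> R) M : (forall i, SN (y i) (Y i)) -> (forall u, good (f u)) ->
  sbd (fun u => nv (f u) * wt Y u.2) M ->
  (forall p, good (cterm f y p)) /\ sbd (fun p => nv (cterm f y p) * wt w p.2.2) M.
Proof.
move=> hy gf hf.
have h u : SN (smul (sdelta (u.1, mzero n) (f u)) (sypow y u.2)) (nv (f u) * wt Y u.2).
  by have := SN_mul (SN_delta (u.1, mzero n) (gf u)) (SN_sypow u.2 hy); rewrite wt0 mulr1.
split=> [[u t]|]; first exact: (h u).1.
apply: (@sbd_pair _ _ _ _ (fun u => nv (f u) * wt Y u.2)) => // [[u t]|u].
  by apply: mulr_ge0; [exact/nv_ge0/(h u).1|exact: wt_ge0].
exact: (h u).2.
Qed.

(** Substituting series of sizes [Y] costs at most the majorant of [f] at [Y]; the bound is proved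
    for the double family over terms of [f] and output indices, which is then summed along
    fibres. *)
Lemma SN_comp f y (Y : 'I_n -> R) M : (forall i, SN (y i) (Y i)) -> (forall u, good (f u)) ->
  sbd (fun u => nv (f u) * wt Y u.2) M -> SN (scomp f y) M.
Proof.
move=> hy gf hf; have [g1 h1] := SN_cterm hy gf hf.
split=> [t|]; first by apply: good_sum => u _; exact: (g1 (u, t)).
apply: (@sbd_fiber R (T * T)%type T (fun p => p.2) (fun p => nv (cterm f y p) * wt w p.2.2) _ M) => //.
  by move=> p; apply: mulr_ge0; [exact: nv_ge0|exact: wt_ge0].
move=> t e e0; exists [seq (u, t) | u <- lower t].
  by rewrite map_inj_uniq ?uniq_lower // => u v [].
rewrite /scomp nv_sum mulr_suml big_map /= [X in _ <= X + _](eq_bigl xpredT) => [|u]; last exact: eqxx.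
by rewrite lerDl ltW.
Qed.

End Norm.

Section Evaluation.
Variable w : 'I_n -> R.
Hypothesis w0 : forall i, 0 <= w i.
Variable chi : V -> C.
Hypothesis chi0 : chi 0 = 0.
Hypothesis chiD : forall u v, good u -> good v -> chi (u + v) = chi u + chi v.
Hypothesis chiM : forall u v, good u -> good v -> chi (vmul u v) = chi u * chi v.
Hypothesis chiZ : forall c v, good v -> chi (vZ c v) = c * chi v.
Hypothesis chi1 : chi vone = 1.
Hypothesis chi_le : forall v, good v -> nm (chi v) <= nv v.
Variable z : 'cV[C]_n.
Hypothesis zw : forall i, nm (z i 0) <= w i.
Local Notation SN := (SN w).

(** Here epsilon becomes 1: the first index of [t] enters only through the coefficient. *)
Definition EV F (s : C) := hs (fun t => chi (F t) * monom t.2 z) s.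

Lemma chi_sum (J : eqType) (r : seq J) (F : J -> V) : (forall j, j \in r -> good (F j)) ->
  chi (\sum_(j <- r) F j) = \sum_(j <- r) chi (F j).
Proof.
elim: r => [|j r IH] h; first by rewrite !big_nil.
rewrite !big_cons chiD ?IH //; last by apply: good_sum => i ir; apply: h; rewrite inE ir orbT.
  by move=> i ir; apply: h; rewrite inE ir orbT.
by apply: h; rewrite inE eqxx.
Qed.

Lemma chi_bound F t : good (F t) -> nm (chi (F t) * monom t.2 z) <= nv (F t) * wt w t.2.
Proof.
move=> g; rewrite nmM; apply: ler_pM; rewrite ?nm_ge0 ?chi_le //.
exact: nm_monom.
Qed.

Lemma SN_sbd F M : SN F M -> sbd (fun t => nm (chi (F t) * monom t.2 z)) M.
Proof. by move=> [g h]; apply: sbd_le (lexx _) h => t; exact: chi_bound. Qed.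

Lemma EV_ex F M : SN F M -> exists2 s, EV F s & nm s <= M.
Proof. by move=> h; apply: hs_ex; exact: SN_sbd h. Qed.

Lemma EV_add F G s s' M N : SN F M -> SN G N -> EV F s -> EV G s' -> EV (sadd F G) (s + s').
Proof.
move=> [gF _] [gG _] hF hG; apply: eq_hs (hs_add hF hG) => t.
by rewrite /sadd chiD // mulrDl.
Qed.

Lemma EV_scal c F s M : SN F M -> EV F s -> EV (sscal c F) (c * s).
Proof. by move=> [gF _] hF; apply: eq_hs (hs_Ml c hF) => t; rewrite /sscal chiZ // mulrA. Qed.

Lemma EV_svm v F s M : good v -> SN F M -> EV F s -> EV (svm v F) (chi v * s).
Proof. by move=> gv [gF _] hF; apply: eq_hs (hs_Ml (chi v) hF) => t; rewrite /svm chiM // mulrA. Qed.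

Lemma EV_sum (J : eqType) (r : seq J) (F : J -> T -> V) (s : J -> C) (M : J -> R) :
  (forall j, SN (F j) (M j)) -> (forall j, EV (F j) (s j)) -> EV (ssum r F) (\sum_(j <- r) s j).
Proof.
move=> h1 h2; apply: eq_hs (hs_sum r h2) => t.
by rewrite /ssum chi_sum ?mulr_suml // => j _; case: (h1 j).
Qed.

Lemma EV_delta t v : EV (sdelta t v) (chi v * monom t.2 z).
Proof.
apply: eq_hs (hs_delta t (chi v * monom t.2 z)) => u.
by rewrite /sdelta; case: eqP => [->|] //; rewrite chi0 mul0r.
Qed.

Lemma EV_mul F G s s' M N : SN F M -> SN G N -> EV F s -> EV G s' -> EV (smul F G) (s * s').
Proof.
move=> hF hG eF eG; have [gF _] := hF; have [gG _] := hG.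
have bnd : sbd (fun p : T * T => nm (chi (F p.1) * monom p.1.2 z * (chi (G p.2) * monom p.2.2 z))) (M * N).
  have := sbd_prod (fun t => nm_ge0 _) (fun t => nm_ge0 _) (SN_sbd hF) (SN_sbd hG).
  by apply: sbd_le => // p; rewrite -nmM.
apply: (@hs_fiber R _ (T * T)%type T (fun p => tadd p.1 p.2) _ _ _ _ bnd (hs_prod eF eG)) => t.
rewrite /smul chi_sum => [|p _]; last exact: goodM.
rewrite mulr_suml.
have -> : \sum_(p <- anti t) chi (vmul (F p.1) (G p.2)) * monom t.2 z =
  \sum_(p <- anti t) (if tadd p.1 p.2 == t then chi (F p.1) * monom p.1.2 z * (chi (G p.2) * monom p.2.2 z) else 0).
  rewrite big_seq [RHS]big_seq; apply: eq_bigr => p; rewrite mem_anti => /[dup] e ->.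
  by rewrite -(eqP e) /= monomD chiM // mulrACA.
apply: hs_fin; first exact: uniq_anti.
by move=> p; rewrite mem_anti => /negbTE ->.
Qed.

Lemma EV_eps F s : EV F s -> EV (seps F) s.
Proof.
move=> hF; pose f (t : T) : T := (t.1.+1, t.2).
have fi : injective f by move=> [a b] [a' b'] [-> ->].
apply/(hs_inj (f := f)) => //.
  move=> [[|q] c] h /=; first by rewrite /seps chi0 mul0r.
  by have := h (q, c).
by apply: eq_hs hF => -[q c].
Qed.

Lemma EV_spow F s M m : SN F M -> EV F s -> EV (spow F m) (s ^+ m).
Proof.
move=> hF eF; elim: m => [|m IH]; last by rewrite exprS; exact: (EV_mul hF (SN_spow w0 m hF)).
by have := EV_delta (0%N, mzero n) vone; rewrite chi1 mul1r monom0.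
Qed.

Lemma EV_sypow y (s : 'I_n -> C) (Y : 'I_n -> R) c : (forall i, SN (y i) (Y i)) ->
  (forall i, EV (y i) (s i)) -> EV (sypow y c) (\prod_(i < n) s i ^+ c i).
Proof.
move=> hy ey.
suff : SN (sypow y c) (wt Y c) /\ EV (sypow y c) (\prod_(i < n) s i ^+ c i) by case.
rewrite /sypow /wt -!big_enum /=.
elim: (enum 'I_n) => [|i r [IH1 IH2]] /=.
  rewrite !big_nil; split; first by have := SN_delta w0 (0%N, mzero n) good1; rewrite nv1 mul1r wt0.
  by have := EV_delta (0%N, mzero n) vone; rewrite chi1 mul1r monom0.
rewrite !big_cons; split; first by apply: SN_mul => //; exact: SN_spow.
by apply: (EV_mul (SN_spow w0 (c i) (hy i)) IH1) => //; exact: (EV_spow _ (hy i)).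
Qed.

(** The double family of [SN_cterm] is absolutely summable, so the sum over terms of [f] and the sum
    over output indices may be exchanged. *)
Lemma EV_comp f y (s : 'I_n -> C) (Y : 'I_n -> R) M S : (forall i, sord 1 (y i)) ->
  (forall i, SN (y i) (Y i)) -> (forall i, EV (y i) (s i)) -> (forall u, good (f u)) ->
  sbd (fun u => nv (f u) * wt Y u.2) M ->
  hs (fun u => chi (f u) * \prod_(i < n) s i ^+ u.2 i) S -> EV (scomp f y) S.
Proof.
move=> oy hy ey gf hf hS.
pose ct (p : T * T) : V := smul (sdelta (p.1.1, mzero n) (f p.1)) (sypow y p.1.2) p.2.
have [g1 h1] := SN_cterm w0 hy gf hf.
have bnd : sbd (fun p : T * T => nm (chi (ct p) * monom p.2.2 z)) M.
  apply: sbd_le (lexx _) h1 => p; rewrite nmM; apply: ler_pM; rewrite ?nm_ge0 //.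
    exact/chi_le/(g1 p).
  exact: nm_monom.
apply: (@hs_pair_swap R _ _ (fun p : T * T => chi (ct p) * monom p.2.2 z) _ _ _ _ bnd) hS.
  move=> u; have := EV_mul (SN_delta w0 (u.1, mzero n) (gf u)) (SN_sypow w0 u.2 hy)
    (EV_delta (u.1, mzero n) (f u)) (EV_sypow u.2 hy ey).
  by rewrite /= monom0 mulr1.
move=> t; rewrite /scomp chi_sum => [|u _]; last exact: (g1 (u, t)).
rewrite mulr_suml; apply: hs_fin; first exact: uniq_lower.
by move=> u ut; rewrite /ct /= scomp_out // chi0 mul0r.
Qed.

End Evaluation.

End FormalSeries.

                              

(** * The Borel algebra and its characters *)

Section BorelAlgebra.
Variable R : realType.
Variable k : nat.
Hypothesis k_gt0 : (0 < k)%N.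
Local Notation C := (Cx R).
Local Notation leb := (@lebesgue_measure R).
Local Notation P := (`]0%R, +oo[%classic : set R).
Local Notation I := (`]0%R, 1%R[%classic : set R).
Variable Om : set C.
Hypothesis Om_open : forall w, Om w -> exists2 r : R, 0 < r & forall v, nm (v - w) < r -> Om v.
Hypothesis Om_star : forall w (s : R), Om w -> 0 <= s <= 1 -> Om (RtoC s * w).
Variable p : R.
Hypothesis p_gt0 : 0 < p.
Local Notation maj := (maj k Om p).
Local Notation LA := (LA k).
Local Notation in_ray := (in_ray Om).

Let p0 : 0 <= p := ltW p_gt0.

                                                                                                                                        
(** A constant term, the Borel transform of the rest, and a declared bound of the size. Carrying the
    bound along makes the size exactly additive and multiplicative; [bgood] says that the
    declaration is honest. *)
Definition bel : Type := (C * (C -> C) * R)%type.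
HB.instance Definition _ := GRing.Zmodule.on bel.

Definition bmul (u v : bel) : bel :=
  (u.1.1 * v.1.1, (fun w => u.1.1 * v.1.2 w + v.1.1 * u.1.2 w + bconv k u.1.2 v.1.2 w), u.2 * v.2).
Definition bZ (c : C) (v : bel) : bel := (c * v.1.1, (fun w => c * v.1.2 w), nm c * v.2).
Definition bone : bel := (1, (fun _ => 0), 1).
                                                                                       
(** The element [x]: no constant term, and Borel transform 1 / Gamma(1/k). Its declared size is left
    free. *)
Definition bX (m : R) : bel := (0, (fun _ => RtoC (gam R k)^-1), m).
(** Inverse of (1/k) x^(k+1) d/dx - a, which acts as w^k - a on the Borel part and as -a on the
    constant term; [d] bounds both inverses. *)
Definition bdiv (a : C) (d : R) (v : bel) : bel :=
  (- a^-1 * v.1.1, (fun w => (w ^+ k - a)^-1 * v.1.2 w), d * v.2).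
Definition bnv (v : bel) : R := v.2.

Definition bgood (v : bel) := exists2 a, maj v.1.2 a & nm v.1.1 + lap k p a <= v.2.

Lemma lap_ge0 a : mono a -> 0 <= lap k p a.
Proof. by move=> ma; apply: Rintegral_ge0 => s _; exact: lapE_ge0. Qed.

Lemma majD F G a b : maj F a -> maj G b ->
  maj (fun w => F w + G w) (fun s => a s + b s) /\
  lap k p (fun s => a s + b s) = lap k p a + lap k p b.
Proof.
move=> [h1 h2 [a0 ah] h4] [g1 g2 [b0 bh] g4].
have E : lapE k p (fun s => a s + b s) = fun s => lapE k p a s + lapE k p b s.
  by apply/funext => s; rewrite /lapE !mulrDl.
split; last by rewrite /lap E RintegralD //; exact: mP.
split; first exact: anl_add.
- move=> w Ow; apply: le_trans (nmD _ _) _; apply: lerD; [exact: h2|exact: g2].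
- split=> [s|s t st]; first exact: addr_ge0.
  by apply: lerD; [exact: ah|exact: bh].
by rewrite E; apply: integrableDR => //; exact: mP.
Qed.

Lemma majZ (c : C) F a : maj F a ->
  maj (fun w => c * F w) (fun s => nm c * a s) /\
  lap k p (fun s => nm c * a s) = nm c * lap k p a.
Proof.
move=> [h1 h2 [a0 ah] h4].
have E : lapE k p (fun s => nm c * a s) = fun s => nm c * lapE k p a s.
  by apply/funext => s; rewrite /lapE !mulrA.
split; last by rewrite /lap E RintegralZl //; exact: mP.
split; first exact: anl_Z.
- by move=> w Ow; rewrite nmM; apply: ler_wpM2l; [exact: nm_ge0|exact: h2].
- split=> [s|s t st]; first by rewrite mulr_ge0 ?nm_ge0.
  by apply: ler_wpM2l; [exact: nm_ge0|exact: ah].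
by rewrite E; apply: integrableZ => //; exact: mP.
Qed.

Lemma maj0 : maj (fun _ => 0) (fun _ => 0).
Proof. by have := @maj_cst R k k_gt0 Om p 0 p_gt0; rewrite nm0. Qed.

Lemma lap0 : lap k p (fun _ => 0) = 0.
Proof. by rewrite (lap_cstE k_gt0 p_gt0 (lexx 0)) mul0r. Qed.

Lemma bgood0 : bgood 0.
Proof. by exists (fun _ => 0); [exact: maj0|rewrite lap0 nm0 addr0]. Qed.

Lemma bgoodD u v : bgood u -> bgood v -> bgood (u + v).
Proof.
move=> [a ha la] [b hb lb]; have [h e] := majD ha hb.
exists (fun s => a s + b s); first exact: h.
change (nm (u.1.1 + v.1.1) + lap k p (fun s => a s + b s) <= u.2 + v.2).
by rewrite e; apply: le_trans (lerD la lb); rewrite [leRHS]addrACA lerD2r nmD.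
Qed.

Lemma bgoodZ c v : bgood v -> bgood (bZ c v).
Proof.
move=> [a ha la]; have [h e] := majZ c ha.
exists (fun s => nm c * a s) => //=.
by rewrite e nmM -mulrDr; apply: ler_wpM2l => //; exact: nm_ge0.
Qed.

Lemma bgood1 : bgood bone.
Proof. by exists (fun _ => 0); [exact: maj0|rewrite lap0 /= nm1 addr0]. Qed.

Lemma bgoodX (q m : R) : 0 < q -> p = q ^+ k -> q^-1 <= m -> bgood (bX m).
Proof.
move=> q0 pq qm; have g0 := gam_gt0 R k_gt0.
have gi : 0 <= (gam R k)^-1 by rewrite invr_ge0 ltW.
exists (fun _ => (gam R k)^-1).
  have := @maj_cst R k k_gt0 Om p (RtoC (gam R k)^-1) p_gt0.
  by rewrite nm_RtoC ger0_norm.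
by rewrite /= nm0 add0r pq lap_cst // mulrA mulVf ?gt_eqF // mul1r.
Qed.

Lemma bgoodM u v : bgood u -> bgood v -> bgood (bmul u v).
Proof.
move=> [a ha la] [b hb lb].
have [h1 e1] := majZ u.1.1 hb; have [h2 e2] := majZ v.1.1 ha.
have [h3 e3] := majD h1 h2.
have h4 := conv_maj k_gt0 Om_open Om_star p0 ha hb.
have e4 : lap k p (cmaj k a b) = lap k p a * lap k p b.
  by case: ha hb => _ _ ma ia [_ _ mb ib]; have [] := lap_cmaj k_gt0 p0 ma mb ia ib.
have [h5 e5] := majD h3 h4.
eexists; first exact: h5.
rewrite e5 e3 e1 e2 e4 /= nmM.
apply: le_trans (_ : (nm u.1.1 + lap k p a) * (nm v.1.1 + lap k p b) <= _); first by lra.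
have a0 : 0 <= lap k p a by apply: lap_ge0; case: ha.
have b0 : 0 <= lap k p b by apply: lap_ge0; case: hb.
by apply: ler_pM => //; rewrite addr_ge0 ?nm_ge0.
Qed.

(** Factor w^k - a into linear factors; none of its roots lies in [Om], so [anl_inv] applies to
    each. *)
Lemma anl_inv_poly (a : C) : (forall w, Om w -> w ^+ k != a) -> anl Om (fun w => (w ^+ k - a)^-1).
Proof.
move=> h; have [r hr] := closed_field_poly_normal ('X^k - a%:P : {poly C}).
have lc : lead_coef ('X^k - a%:P : {poly C}) = 1 by rewrite lead_coefXnsubC.
have E w : w ^+ k - a = \prod_(x <- r) (w - x).
  have := congr1 (horner^~ w) hr; rewrite lc scale1r hornerD hornerN hornerXn hornerC => ->.
  by rewrite horner_prod; apply: eq_bigr => x _; rewrite hornerXsubC.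
have hx x : x \in r -> ~ Om x.
  move=> xr Ox; have := h x Ox; rewrite -subr_eq0 E => /negP; apply.
  by rewrite (big_rem x xr) /= subrr mul0r.
suff : anl Om (fun w => \prod_(x <- r) (w - x)^-1).
  by apply: anl_ext => w _; rewrite E prodfV.
elim: r hx {hr E} => [|x r IH] hx.
  by apply: (@anl_ext _ Om (fun=> 1)) => [w _|]; [rewrite big_nil|exact: anl_cst].
have h1 : anl Om (fun w => (w - x)^-1) by apply: anl_inv; apply: hx; rewrite inE eqxx.
have h2 := IH (fun y yr => hx y (predU1r y x yr)).
by apply: anl_ext (anl_mul h1 h2) => w _; rewrite big_cons.
Qed.

Lemma maj_div (a : C) d F b : 0 <= d -> (forall w, Om w -> 1 <= d * nm (w ^+ k - a)) ->
  maj F b -> maj (fun w => (w ^+ k - a)^-1 * F w) (fun s => d * b s) /\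
  lap k p (fun s => d * b s) = d * lap k p b.
Proof.
move=> d0 hd hF; have [h1 h2 [b0 bh] h4] := hF.
have [[_ _ m3 m4] e] := majZ (RtoC d) hF.
have nd : nm (RtoC d) = d by rewrite nm_RtoC ger0_norm.
rewrite nd in m3 m4 e; split => //; split => //.
  apply: anl_mul h1; apply: anl_inv_poly => w Ow; rewrite -subr_eq0; apply/eqP => e0.
  by have := hd w Ow; rewrite e0 nm0 mulr0 ler10.
move=> w Ow; rewrite nmM nmV; apply: ler_pM; rewrite ?invr_ge0 ?nm_ge0 //; last exact: h2.
have := hd w Ow => h; have n0 : 0 < nm (w ^+ k - a).
  rewrite lt_neqAle nm_ge0 andbT eq_sym; apply/eqP => e0.
  by move: h; rewrite e0 mulr0 ler10.
by rewrite -[X in X <= _]mul1r ler_pdivrMr.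
Qed.

Lemma bgood_div a d v : 0 <= d -> (forall w, Om w -> 1 <= d * nm (w ^+ k - a)) -> 1 <= d * nm a ->
  bgood v -> bgood (bdiv a d v).
Proof.
move=> d0 hd ha [b hb lb]; have [h e] := maj_div d0 hd hb.
exists (fun s => d * b s) => //=.
rewrite e; apply: le_trans (ler_wpM2l d0 lb); rewrite mulrDr lerD2r mulNr nmN nmM nmV.
apply: ler_wpM2r; first exact: nm_ge0.
have n0 : 0 < nm a.
  rewrite lt_neqAle nm_ge0 andbT eq_sym; apply/eqP => e0.
  by move: ha; rewrite e0 mulr0 ler10.
by rewrite -[X in X <= _]mul1r ler_pdivrMr.
Qed.

Lemma bnv_ge0 v : bgood v -> 0 <= bnv v.
Proof.
by move=> [a ha]; apply: le_trans; rewrite addr_ge0 ?nm_ge0 // lap_ge0 //; case: ha.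
Qed.

Lemma bconv0l (F : C -> C) : bconv k (fun _ => 0) F = fun _ => 0.
Proof.
apply/funext => w; rewrite /bconv.
rewrite (eq_cint (G := fun _ => 0)) ?cint0; last by move=> m _; rewrite /cker /ray mul0r mulr0.
rewrite (eq_cint (G := fun _ => 0)) ?cint0; last by move=> m _; rewrite /cker /ray !mulr0.
by rewrite addr0 mulr0.
Qed.

Lemma bconv0r (F : C -> C) : bconv k F (fun _ => 0) = fun _ => 0.
Proof. by apply/funext => w; rewrite -[RHS](congr1 (fun f => f w) (bconv0l F)) /bconv addrC. Qed.

Lemma bmul0 v : bmul 0 v = 0.
Proof.
rewrite /bmul /=; congr (_, _, _); rewrite ?mul0r //.
by apply/funext => w; rewrite bconv0l /= mul0r mulr0 !addr0.
Qed.

Lemma bmulr0 v : bmul v 0 = 0.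
Proof.
rewrite /bmul /=; congr (_, _, _); rewrite ?mulr0 //.
by apply/funext => w; rewrite bconv0r /= mul0r mulr0 !addr0.
Qed.

                                                      
Definition bval0 (v : bel) : C := v.1.1.

Lemma bval0_le v : bgood v -> nm (bval0 v) <= bnv v.
Proof. by move=> [a ha]; apply: le_trans; rewrite lerDl lap_ge0 //; case: ha. Qed.

Section Character.
Variables u X : C.
Hypothesis hu : in_ray u.
Hypothesis u1 : nm u = 1.
Hypothesis hX : p <= ReC (u ^+ k * X).

Definition bchi (v : bel) : C := v.1.1 + LA u X v.1.2.

Let u0 : u != 0.
Proof. by apply/eqP => e; move: u1; rewrite e nm0 => /esym/eqP; rewrite oner_eq0. Qed.

Let hX' : p * nm u ^+ k <= ReC (u ^+ k * X).
Proof. by rewrite u1 expr1n mulr1. Qed.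

Lemma LA0 : LA u X (fun _ => 0) = 0.
Proof.
rewrite /LA (eq_cint (G := fun _ => 0)) ?cint0 // => s _.
by rewrite /lint !mul0r.
Qed.

Lemma bchi0 : bchi 0 = 0.
Proof. by rewrite /bchi [LA _ _ _]LA0 addr0. Qed.

Lemma bchi1 : bchi bone = 1.
Proof. by rewrite /bchi /= LA0 addr0. Qed.

Lemma bchiD v1 v2 : bgood v1 -> bgood v2 -> bchi (v1 + v2) = bchi v1 + bchi v2.
Proof.
move=> [a ha _] [b hb _].
by rewrite /bchi /= [LA _ _ _](LA_add Om_open p0 ha hb hu u0 hX') addrACA.
Qed.

Lemma bchiZ c v : bgood v -> bchi (bZ c v) = c * bchi v.
Proof. by move=> [a ha _]; rewrite /bchi /= (LA_Z Om_open _ p0 ha hu u0 hX') mulrDr. Qed.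

Lemma bchiM v1 v2 : bgood v1 -> bgood v2 -> bchi (bmul v1 v2) = bchi v1 * bchi v2.
Proof.
move=> [a ha _] [b hb _].
have [h1 _] := majZ v1.1.1 hb; have [h2 _] := majZ v2.1.1 ha.
have [h3 _] := majD h1 h2.
have h4 := conv_maj k_gt0 Om_open Om_star p0 ha hb.
rewrite /bchi /= (LA_add Om_open p0 h3 h4 hu u0 hX') (LA_add Om_open p0 h1 h2 hu u0 hX').
rewrite (LA_Z Om_open _ p0 hb hu u0 hX') (LA_Z Om_open _ p0 ha hu u0 hX').
rewrite (LA_conv k_gt0 Om_open Om_star p0 ha hb hu u1 hX); ring.
Qed.

Lemma bchi_le v : bgood v -> nm (bchi v) <= bnv v.
Proof.
move=> [a ha la]; apply: le_trans (nmD _ _) _; apply: le_trans la; rewrite lerD2l.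
exact: (nm_LA Om_open p0 ha hu u0 hX').
Qed.

Lemma bchi_small v sg : bgood v -> 0 < sg <= 1 -> p <= sg ^+ k * ReC (u ^+ k * X) ->
  nm (bchi v - bval0 v) <= sg * bnv v.
Proof.
move=> [a ha la] hs hp; rewrite /bchi /bval0 addrAC subrr add0r.
apply: le_trans (LA_small Om_open p0 ha hu u1 hs hp) _.
case/andP: hs => s0 _; apply: ler_wpM2l; first exact: ltW.
by apply: le_trans la; rewrite lerDr nm_ge0.
Qed.

                                             
(** On the Borel part w^k / (w^k - a) = 1 + a / (w^k - a), and the constant term [- a^-1 * v.1.1]
    supplies the remaining [v.1.1]. *)
Lemma LA_div a d v : 0 <= d -> (forall w, Om w -> 1 <= d * nm (w ^+ k - a)) -> a != 0 ->
  bgood v -> LA u X (fun w => w ^+ k * (bdiv a d v).1.2 w) - a * bchi (bdiv a d v) = bchi v.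
Proof.
move=> d0 hd a0 [b hb _]; have [h _] := maj_div d0 hd hb.
have [h2 _] := majZ a h.
have -> : LA u X (fun w => w ^+ k * (bdiv a d v).1.2 w) =
    LA u X (fun w => v.1.2 w + a * (bdiv a d v).1.2 w).
  apply: LA_ext hu _ => w Ow /=.
  have n0 : w ^+ k - a != 0.
    by apply/eqP => e0; have := hd w Ow; rewrite e0 nm0 mulr0 ler10.
  by field.
rewrite (LA_add Om_open p0 hb h2 hu u0 hX') (LA_Z Om_open _ p0 h hu u0 hX') /bchi /=; field; exact: a0.
Qed.

End Character.

End BorelAlgebra.

                                 

(** * The fixed-point equation and its evaluation *)

Section Recursion.
Variable R : realType.
Variable n : nat.
Local Notation C := (Cx R).
Local Notation T := (nat * mindex n)%type.
Variable V : zmodType.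
Variables (vmul : V -> V -> V) (vZ : C -> V -> V) (vone : V) (nv : V -> R) (good : V -> Prop).
Hypothesis good0 : good 0.
Hypothesis goodD : forall u v, good u -> good v -> good (u + v).
Hypothesis goodM : forall u v, good u -> good v -> good (vmul u v).
Hypothesis goodZ : forall c v, good v -> good (vZ c v).
Hypothesis good1 : good vone.
Hypothesis nv0 : nv 0 = 0.
Hypothesis nvD : forall u v, nv (u + v) = nv u + nv v.
Hypothesis nvM : forall u v, nv (vmul u v) = nv u * nv v.
Hypothesis nvZ : forall c v, nv (vZ c v) = nm c * nv v.
Hypothesis nv1 : nv vone = 1.
Hypothesis nv_ge0 : forall v, good v -> 0 <= nv v.
Hypothesis vmul0 : forall v, vmul 0 v = 0.
Hypothesis vmulr0 : forall v, vmul v 0 = 0.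
Variable w : 'I_n -> R.
Hypothesis w_gt0 : forall i, 0 < w i.

Let w0 i : 0 <= w i := ltW (w_gt0 i).
Local Notation SN := (SN nv good w).

(** The iterates from 0 stabilise in each epsilon-degree, because the operator gains one order. The
    invariant bounds [B] pass to the limit since a finite subsum sees a single iterate; no
    contraction estimate enters. *)
Lemma recursion_fixpoint (TT : ('I_n -> T -> V) -> 'I_n -> T -> V) (B : 'I_n -> R) :
  (forall i, 0 <= B i) ->
  (forall Q E E', (forall i, agree Q (E i) (E' i)) -> forall i, agree Q.+1 (TT E i) (TT E' i)) ->
  (forall E, (forall i, SN (E i) (B i)) -> forall i, SN (TT E i) (B i)) ->
  exists2 E, forall i t, E i t = TT E i t & forall i, SN (E i) (B i).
Proof.
move=> B0 hc hb.
pose it r := iter r TT (fun _ _ => 0).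
have sn r i : SN (it r i) (B i).
  elim: r i => [|r IH] i; last exact: hb.
  by apply: SN_le (B0 i) _; exact: SN0.
have st r i : agree r (it r i) (it r.+1 i).
  by elim: r i => [|r IH] i //; apply: hc.
have st' r d i : agree r (it r i) (it (d + r)%N i).
  elim: d i => [|d IH] i t tr //; rewrite IH // addSn; apply: st.
  exact: leq_trans tr (leq_addl _ _).
(* The coefficients of epsilon-degree [t.1] are final from the iterate [t.1.+1] on. *)
pose E i (t : T) := it t.1.+1 i t.
have EQ Q i : agree Q (E i) (it Q i).
  by move=> t tQ; rewrite /E (st' t.1.+1 (Q - t.1.+1)%N) ?leqnn // subnK.
exists E => [i t|i].
  by rewrite (hc t.1 E (it t.1) (EQ t.1) i t (leqnn _)).
split=> [t|]; first exact: (sn t.1.+1 i).1.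
move=> J uJ; have [_ h] := sn (\max_(t <- J) t.1).+1 i.
rewrite (eq_big_seq (fun t => nv (it (\max_(t0 <- J) t0.1).+1 i t) * wt w t.2)) => [|t tJ]; first exact: h.
rewrite (EQ (\max_(t <- J) t.1).+1) // ltnS.
by rewrite (big_rem t tJ) /= leq_maxl.
Qed.

Section Shift.

(** A derivative costs the exponent, at most the total degree, and one power of [w s]; the
    hypothesis on [G] is exactly the gain of a nonresonant divisor. *)
Lemma SN_dz s F G M d : 0 <= d -> SN F M -> (forall t, good (G t)) ->
  (forall t, nv (G t) * (1 + (mdeg t.2)%:R) <= d * nv (F t)) ->
  SN (sdz vZ s G) (d / w s * M).
Proof.
move=> d0 [gF sF] gG hG; split=> [t|]; first exact: goodZ.
pose f (t : T) : T := (t.1, madd t.2 (mone s)).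
have fi : injective f.
  move=> [a1 b1] [a2 b2] [-> /ffunP e]; congr (_, _); apply/ffunP => i.
  by have := e i; rewrite !ffunE => /addIn.
have h := sbd_inj fi (sbdZ (divr_ge0 d0 (w0 s)) sF).
apply: sbd_le (lexx _) h => t; rewrite /sdz nvZ nm_nat /f /=.
rewrite wtD wt1 [leRHS](_ : _ = d * nv (F (f t)) * wt w t.2); last first.
  by rewrite /f; field; rewrite gt_eqF.
apply: ler_wpM2r; first exact: wt_ge0.
apply: le_trans (hG (f t)); rewrite mulrC; apply: ler_wpM2l; first exact/nv_ge0.
rewrite /f /= mdegD mdeg1 -natr1 addrC lerD2l ler_nat.
by rewrite (leq_trans (leq_mdeg t.2 s)) // leq_addr.
Qed.

End Shift.

Variable k : nat.
Variable vX : V.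
Variable vdiv : C -> R -> V -> V.
Hypothesis good_X : good vX.
Hypothesis nv_div : forall a d v, nv (vdiv a d v) = d * nv v.
Variables (a : 'I_n -> mindex n -> C) (res : 'I_n -> mindex n -> bool) (d0 : R).
Hypothesis d0_ge0 : 0 <= d0.
(** Bound for the inverse of a nonresonant divisor; its decay in the degree pays for one derivative
    in [z]. *)
Definition dlt (c : mindex n) : R := d0 / (1 + (mdeg c)%:R).
Hypothesis good_div : forall i c v, ~~ res i c -> good v -> good (vdiv (a i c) (dlt c) v).
Variables (Xi : 'M[C]_n) (fc : 'I_n -> T -> C).

Definition vXn (m : nat) : V := iter m (vmul vX) vone.

(** In [fc] the first index is the power of [x], realised by [vXn]. [scomp] also counts it as an
    epsilon-degree, which evaluation at epsilon = 1 forgets. *)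
Definition coefX (i : 'I_n) (u : T) : V := vZ (fc i u) (vXn u.1).
(** The unknown [E] is the right-hand side of the homological equation. Its nonresonant part,
    divided, is phi; its near-resonant part, undivided, is g ([resp]). *)
Definition nonresp (E : 'I_n -> T -> V) i (t : T) : V :=
  if res i t.2 then 0 else vdiv (a i t.2) (dlt t.2) (E i t).
Definition resp (E : 'I_n -> T -> V) i (t : T) : V := if res i t.2 then E i t else 0.
(** The new variable [z + x phi], with the perturbation marked by epsilon. *)
Definition pert (phi : 'I_n -> T -> V) i : T -> V :=
  sadd (sdelta (0%N, mone i) vone) (seps (svm vmul vX (phi i))).

Definition nilterm (phi : 'I_n -> T -> V) i : T -> V :=
  ssum (index_enum 'I_n) (fun s => ssum (index_enum 'I_n) (fun j =>
    sscal vZ (Xi s j) (smul vmul (sdelta (0%N, mone j) vone) (sdz vZ s (phi i))))).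
Definition rotterm (phi : 'I_n -> T -> V) i : T -> V :=
  ssum (index_enum 'I_n) (fun j => sscal vZ (- Xi i j) (phi j)).
Definition tranterm (phi g : 'I_n -> T -> V) i : T -> V :=
  svm vmul vX (ssum (index_enum 'I_n) (fun s => smul vmul (sdz vZ s (phi i)) (g s))).
Definition eulterm (phi : 'I_n -> T -> V) i : T -> V :=
  sscal vZ k%:R^-1 (svm vmul (vXn k) (phi i)).
Definition lowterm (E : 'I_n -> T -> V) i : T -> V :=
  sadd (sadd (nilterm (nonresp E) i) (rotterm (nonresp E) i))
       (sadd (tranterm (nonresp E) (resp E) i) (eulterm (nonresp E) i)).
                                                                                          
(** The conjugacy equation divided by [x]: E = f(x, z + x phi) - (D phi . Xi z - Xi phi + x D phi .
    g + x^k phi / k). Every occurrence of the unknown carries a factor epsilon, so one order is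
    gained. *)
Definition mainop (E : 'I_n -> T -> V) i : T -> V :=
  sadd (scomp vmul vone (coefX i) (pert (nonresp E))) (sscal vZ (-1) (seps (lowterm E i))).

Lemma agree_nonresp Q E E' : (forall i, agree Q (E i) (E' i)) ->
  forall i, agree Q (nonresp E i) (nonresp E' i).
Proof. by move=> h i t tQ; rewrite /nonresp h. Qed.

Lemma agree_resp Q E E' : (forall i, agree Q (E i) (E' i)) ->
  forall i, agree Q (resp E i) (resp E' i).
Proof. by move=> h i t tQ; rewrite /resp h. Qed.

Lemma agree_pert Q E E' : (forall i, agree Q (E i) (E' i)) ->
  forall i, agree Q.+1 (pert E i) (pert E' i).
Proof.
move=> h i; apply: agree_sadd; first exact: agree_refl.
by apply: agree_seps; exact: agree_svm.
Qed.

Lemma agree_mainop Q E E' : (forall i, agree Q (E i) (E' i)) ->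
  forall i, agree Q.+1 (mainop E i) (mainop E' i).
Proof.
move=> h i; have hn := agree_nonresp h; have hr := agree_resp h.
apply: agree_sadd; first by apply: agree_scomp; exact: agree_pert.
apply: agree_sscal; apply: agree_seps; apply: agree_sadd; apply: agree_sadd.
- by do 2!apply: agree_ssum => ?; apply: agree_sscal; apply: agree_smul; [exact: agree_refl|exact: agree_sdz].
- by apply: agree_ssum => j; exact: agree_sscal.
- by apply: agree_svm; apply: agree_ssum => s; apply: agree_smul => //; exact: agree_sdz.
- by apply: agree_sscal; exact: agree_svm.
Qed.

Lemma good_Xn m : good (vXn m).
Proof. by elim: m => // m IH; exact: goodM. Qed.

Lemma nv_Xn m : nv (vXn m) = nv vX ^+ m.
Proof. by elim: m => [|m IH]; rewrite ?expr0 //= nvM IH exprS. Qed.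

Lemma good_coefX i u : good (coefX i u). Proof. exact/goodZ/good_Xn. Qed.

Lemma sord_pert phi i : sord 1 (pert phi i).
Proof.
move=> t t0; have t00 : t.1 = 0%N by move: t0; rewrite /tdeg ltnS leqn0 addn_eq0 => /andP[/eqP].
rewrite /pert /sadd /seps t00 /= addr0 /sdelta; case: eqP => // e.
by move: t0; rewrite e /tdeg /= mdeg1.
Qed.

Lemma dlt_bound c : 0 <= dlt c <= d0.
Proof.
have c0 : 0 < 1 + (mdeg c)%:R :> R by rewrite ltr_wpDr.
by rewrite /dlt divr_ge0 ?(ltW c0) //= ler_pdivrMr // ler_peMr // lerDl.
Qed.

Lemma SN_resp E i M : SN (E i) M -> SN (resp E i) M.
Proof.
move=> [gE sE]; split=> [t|]; first by rewrite /resp; case: ifP.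
apply: sbd_le (lexx _) sE => t; rewrite /resp; case: ifP => // _.
by rewrite nv0 mul0r mulr_ge0 ?nv_ge0 ?wt_ge0.
Qed.

Lemma good_nonresp E i t : good (E i t) -> good (nonresp E i t).
Proof. by move=> g; rewrite /nonresp; case: ifPn => // nr; exact: good_div. Qed.

Lemma SN_nonresp E i M : SN (E i) M -> SN (nonresp E i) (d0 * M).
Proof.
move=> [gE sE]; split=> [t|]; first exact: good_nonresp.
apply: sbd_le (lexx _) (sbdZ d0_ge0 sE) => t; rewrite /nonresp; case: ifP => _.
  by rewrite nv0 mul0r !mulr_ge0 ?nv_ge0 ?wt_ge0.
rewrite nv_div mulrA; apply: ler_wpM2r; first exact: wt_ge0.
by apply: ler_wpM2r; [exact: nv_ge0|case/andP: (dlt_bound t.2)].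
Qed.

Lemma SN_dz_nonresp s E i M : SN (E i) M -> SN (sdz vZ s (nonresp E i)) (d0 / w s * M).
Proof.
move=> hE; have [gE sE] := hE.
apply: SN_dz hE _ _ => // [t|t]; first exact: good_nonresp.
have c0 : 0 < 1 + (mdeg t.2)%:R :> R by rewrite ltr_wpDr.
rewrite /nonresp; case: ifP => _; first by rewrite nv0 mul0r mulr_ge0 ?nv_ge0.
by rewrite nv_div /dlt mulrAC divfK // gt_eqF.
Qed.

Let SNadd := SN_add goodD nvD (w := w).
Let SNmul := SN_mul good0 goodD goodM nv0 nvD nvM nv_ge0 w0.
Let SNsum := SN_sum good0 goodD nv0 nvD (w := w).
Let SNscal := SN_scal goodZ nvZ (w := w).
Let SNsvm := SN_svm goodM nvM nv_ge0 (w := w).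
Let SNdelta := SN_delta good0 nv0 nv_ge0 w0.
Let SNeps := SN_eps good0 nv0 nv_ge0 w0.

Lemma SN_pert phi i M : SN (phi i) M -> SN (pert phi i) (w i + nv vX * M).
Proof.
move=> h; apply: SNadd; last by apply: SNeps; exact: SNsvm.
by have := SNdelta (0%N, mone i) good1; rewrite nv1 mul1r /= wt1.
Qed.

(** The summands follow the terms of [mainop]: composition with [f], nilpotent derivative, nilpotent
    rotation, transport by g, and the term from [x ^+ k]. *)
Lemma SN_mainop E (B : 'I_n -> R) Mf :
  (forall i, SN (E i) (B i)) ->
  (forall i, sbd (fun u : T => nm (fc i u) * nv vX ^+ u.1 * wt (fun j => w j + nv vX * (d0 * B j)) u.2) (Mf i)) ->
  forall i, SN (mainop E i) (Mf i +
    (\sum_s \sum_j nm (Xi s j) * (w j * (d0 / w s * B i)) + \sum_j nm (Xi i j) * (d0 * B j) +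
     (nv vX * (\sum_s (d0 / w s * B i) * B s) + k%:R^-1 * (nv vX ^+ k * (d0 * B i))))).
Proof.
move=> hE hf i.
have hn j := SN_nonresp (hE j).
have hd s j := SN_dz_nonresp s (hE j).
have hr j := SN_resp (hE j).
apply: SNadd.
  apply: (SN_comp good0 goodD goodM good1 nv0 nvD nvM nv1 nv_ge0 w0 (fun j => SN_pert (hn j)) (good_coefX i)).
  by apply: sbd_le (lexx _) (hf i) => u; rewrite /coefX nvZ nv_Xn.
rewrite -[X in SN _ X]mul1r -[X in X * _]nm1 -[X in X * _]nmN; apply: SNscal; apply: SNeps.
apply: SNadd; apply: SNadd.
- apply: SNsum => s; apply: SNsum => j; apply: SNscal; apply: SNmul (hd s i).
  by have := SNdelta (0%N, mone j) good1; rewrite nv1 mul1r /= wt1.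
- by apply: SNsum => j; have := SNscal (- Xi i j) (hn j); rewrite nmN.
- by apply: SNsvm => //; apply: SNsum => s; exact: SNmul.
have := SNscal k%:R^-1 (SNsvm (good_Xn k) (hn i)).
by rewrite nv_Xn nmV nm_nat.
Qed.

Variable chi : V -> C.
Hypothesis chi0 : chi 0 = 0.
Hypothesis chiD : forall u v, good u -> good v -> chi (u + v) = chi u + chi v.
Hypothesis chiM : forall u v, good u -> good v -> chi (vmul u v) = chi u * chi v.
Hypothesis chiZ : forall c v, good v -> chi (vZ c v) = c * chi v.
Hypothesis chi1 : chi vone = 1.
Hypothesis chi_le : forall v, good v -> nm (chi v) <= nv v.
Variable z : 'cV[C]_n.
Hypothesis zw : forall i, nm (z i 0) <= w i.
Local Notation EV := (EV chi z).

                                                          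
(** The shift by [mone s] reindexes the sum; the indices it misses have exponent 0 in [z s] and
    contribute nothing. *)
Lemma EV_euler s G D : (forall t, good (G t)) -> EV (sdz vZ s G) D ->
  hs (fun t : T => (t.2 s)%:R * (chi (G t) * monom t.2 z)) (z s 0 * D).
Proof.
move=> gG hD.
pose f (t : T) : T := (t.1, madd t.2 (mone s)).
have fi : injective f.
  move=> [a1 b1] [a2 b2] [-> /ffunP e]; congr (_, _); apply/ffunP => i.
  by have := e i; rewrite !ffunE => /addIn.
apply/(hs_inj (f := f)) => //.
  move=> [q c] h /=; case: (posnP (c s)) => [->|cs]; first by rewrite mul0r.
  have /= := h (q, [ffun i => (c i - (i == s))%N]); rewrite /f /=; case.
  congr (_, _); apply/ffunP => i; rewrite !ffunE; case: eqP => [->|_]; first by rewrite subnK.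
  by rewrite subn0 addn0.
apply: eq_hs (hs_Ml (z s 0) hD) => t; rewrite /sdz chiZ // /f /= monomD monom1 !ffunE eqxx addn1.
by ring.
Qed.

Let EVadd := EV_add (nv := nv) chiD (w := w) (z := z).
Let EVmul := EV_mul good0 goodD goodM chi0 chiD chiM chi_le zw.
Let EVsum := EV_sum (nv := nv) good0 goodD chi0 chiD (w := w) (z := z).
Let EVscal := EV_scal (nv := nv) chiZ (w := w) (z := z).
Let EVsvm := EV_svm (nv := nv) chiM (w := w) (z := z).
Let EVdelta := EV_delta chi0 z.
Let EVeps := EV_eps chi0 (z := z).

Lemma chi_Xn m : chi (vXn m) = chi vX ^+ m.
Proof. by elim: m => [|m IH] //=; rewrite chiM ?IH ?exprS //; exact: good_Xn. Qed.

Lemma EV_pert phi i s M : SN (phi i) M -> EV (phi i) s -> EV (pert phi i) (z i 0 + chi vX * s).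
Proof.
move=> h e; have h1 := SNdelta (0%N, mone i) good1.
have e1 := EVdelta (0%N, mone i) vone; rewrite chi1 mul1r /= monom1 in e1.
exact: (EVadd h1 (SNeps (SNsvm good_X h)) e1 (EVeps (EVsvm good_X h e))).
Qed.

Lemma EV_comp_pert (f : T -> V) (phi : 'I_n -> T -> V) (Y : 'I_n -> R) (s : 'I_n -> C) Mf S :
  (forall i, SN (phi i) (Y i)) -> (forall i, EV (phi i) (s i)) ->
  (forall u, good (f u)) ->
  sbd (fun u : T => nv (f u) * wt (fun j => w j + nv vX * Y j) u.2) Mf ->
  hs (fun u => chi (f u) * \prod_(j < n) (z j 0 + chi vX * s j) ^+ u.2 j) S ->
  EV (scomp vmul vone f (pert phi)) S.
Proof.
move=> hp ep gf hf hS.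
exact: (EV_comp good0 goodD goodM good1 nv0 nvD nvM nv1 nv_ge0 vmul0 vmulr0 w0 chi0 chiD chiM chi1 chi_le
  zw (sord_pert phi) (fun j => SN_pert (hp j)) (fun j => EV_pert (hp j) (ep j)) gf hf hS).
Qed.

Lemma EV_mainop E (B Mf : 'I_n -> R) (e p g F : 'I_n -> C) (D : 'I_n -> 'I_n -> C) :
  (forall i t, E i t = mainop E i t) ->
  (forall i, SN (E i) (B i)) ->
  (forall i, sbd (fun u : T => nm (fc i u) * nv vX ^+ u.1 * wt (fun j => w j + nv vX * (d0 * B j)) u.2) (Mf i)) ->
  (forall i, EV (E i) (e i)) -> (forall i, EV (nonresp E i) (p i)) ->
  (forall i, EV (resp E i) (g i)) -> (forall s i, EV (sdz vZ s (nonresp E i)) (D s i)) ->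
  (forall i, hs (fun u => fc i u * (chi vX ^+ u.1 * \prod_(j < n) (z j 0 + chi vX * p j) ^+ u.2 j)) (F i)) ->
  forall i, e i = F i - (\sum_s \sum_j Xi s j * (z j 0 * D s i) + \sum_j - Xi i j * p j +
     (chi vX * (\sum_s D s i * g s) + k%:R^-1 * (chi vX ^+ k * p i))).
Proof.
move=> hfix hE hf he hp hg hD hF i.
have hn j := SN_nonresp (hE j).
have hd s j := SN_dz_nonresp s (hE j).
have hr j := SN_resp (hE j).
have sf : sbd (fun u : T => nv (coefX i u) * wt (fun j => w j + nv vX * (d0 * B j)) u.2) (Mf i).
  by apply: sbd_le (lexx _) (hf i) => u; rewrite /coefX nvZ nv_Xn.
have e1 : EV (scomp vmul vone (coefX i) (pert (nonresp E))) (F i).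
  apply: (EV_comp_pert hn hp (good_coefX i) sf).
  by apply: eq_hs (hF i) => u; rewrite /coefX chiZ ?chi_Xn ?mulrA //; exact: good_Xn.
have s1 := SN_comp good0 goodD goodM good1 nv0 nvD nvM nv1 nv_ge0 w0 (fun j => SN_pert (hn j)) (good_coefX i) sf.
have ez j : EV (sdelta (0%N, mone j) vone) (z j 0).
  by have := EVdelta (0%N, mone j) vone; rewrite chi1 mul1r /= monom1.
have sz j := SNdelta (0%N, mone j) good1.
have e2 := EVsum (index_enum 'I_n) (fun s => SNsum (index_enum 'I_n) (fun j => SNscal (Xi s j) (SNmul (sz j) (hd s i))))
   (fun s => EVsum (index_enum 'I_n) (fun j => SNscal (Xi s j) (SNmul (sz j) (hd s i)))
     (fun j => EVscal (Xi s j) (SNmul (sz j) (hd s i)) (EVmul (sz j) (hd s i) (ez j) (hD s i)))).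
have s2 := SNsum (index_enum 'I_n) (fun s => SNsum (index_enum 'I_n) (fun j => SNscal (Xi s j) (SNmul (sz j) (hd s i)))).
have e3 := EVsum (index_enum 'I_n) (fun j => SNscal (- Xi i j) (hn j)) (fun j => EVscal (- Xi i j) (hn j) (hp j)).
have s3 := SNsum (index_enum 'I_n) (fun j => SNscal (- Xi i j) (hn j)).
have s4' := SNsum (index_enum 'I_n) (fun s => SNmul (hd s i) (hr s)).
have e4 := EVsvm good_X s4' (EVsum (index_enum 'I_n) (fun s => SNmul (hd s i) (hr s)) (fun s => EVmul (hd s i) (hr s) (hD s i) (hg s))).
have s4 := SNsvm good_X s4'.
have s5' := SNsvm (good_Xn k) (hn i).
have e5 := EVscal k%:R^-1 s5' (EVsvm (good_Xn k) (hn i) (hp i)).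
have s5 := SNscal k%:R^-1 s5'.
have s23 := SNadd s2 s3; have s45 := SNadd s4 s5.
have s6 := SNeps (SNadd s23 s45).
have e6 := EVeps (EVadd s23 s45 (EVadd s2 s3 e2 e3) (EVadd s4 s5 e4 e5)).
have := EVadd s1 (SNscal (-1) s6) e1 (EVscal (-1) s6 e6).
rewrite mulN1r chi_Xn => e7.
by apply: (hs_uniq (he i)); apply: eq_hs e7 => t; rewrite hfix.
Qed.

(** [ld] stands for the action of (1/k) x^(k+1) d/dx. Summing the divisor identities over all
    indices splits [a] into [lam 0 i] and the Euler operator weighted by [lam]. *)
Lemma EV_transport E (B : 'I_n -> R) (e p g L : 'I_n -> C) (D : 'I_n -> 'I_n -> C) (lam : 'rV[C]_n) (ld : V -> C) :
  (forall i c, a i c = lam 0 i - dotm c lam) -> ld 0 = 0 ->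
  (forall i c v, ~~ res i c -> good v -> ld (vdiv (a i c) (dlt c) v) - a i c * chi (vdiv (a i c) (dlt c) v) = chi v) ->
  (forall i, SN (E i) (B i)) ->
  (forall i, EV (E i) (e i)) -> (forall i, EV (nonresp E i) (p i)) ->
  (forall i, EV (resp E i) (g i)) -> (forall s i, EV (sdz vZ s (nonresp E i)) (D s i)) ->
  (forall i, hs (fun t => ld (nonresp E i t) * monom t.2 z) (L i)) ->
  forall i, L i = lam 0 i * p i - \sum_s lam 0 s * (z s 0 * D s i) + e i - g i.
Proof.
move=> ha ld0 hld hE he hp hg hD hL i.
have gn t : good (nonresp E i t) by apply: good_nonresp; case: (hE i).
apply: (hs_uniq (hL i)).
have h1 := hs_sum (index_enum 'I_n) (fun s => hs_Ml (lam 0 s) (EV_euler gn (hD s i))).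
have h2 := hs_add (hs_add (hs_Ml (lam 0 i) (hp i)) (hs_Ml (-1) h1)) (hs_add (he i) (hs_Ml (-1) (hg i))).
rewrite !mulN1r !addrA in h2; apply: eq_hs h2 => t; rewrite !mulN1r.
have -> : \sum_(s <- index_enum 'I_n) lam 0 s * ((t.2 s)%:R * (chi (nonresp E i t) * monom t.2 z)) =
    dotm t.2 lam * (chi (nonresp E i t) * monom t.2 z).
  by rewrite /dotm mulr_suml; apply: eq_bigr => s _; ring.
rewrite /nonresp /resp; case: ifPn => nr.
  by rewrite ld0 chi0 !mul0r !mulr0 oppr0 !addr0 add0r subrr.
have := hld i t.2 (E i t) nr ((hE i).1 t); rewrite ha chi0 mul0r oppr0 addr0 => /eqP.
rewrite subr_eq => /eqP ->; ring.
Qed.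

                                                                                  
(** The inverse of [z + x phi] has the form [y + x Ps] with [Ps = - phi(x, y + x Ps)]. Again the
    unknown occurs only with a factor epsilon, so the same recursion applies. *)
Lemma inverse_series (phi : 'I_n -> T -> V) (M : 'I_n -> R) :
  (forall i u, good (phi i u)) ->
  (forall i, sbd (fun u => nv (phi i u) * wt (fun j => w j + nv vX * M j) u.2) (M i)) ->
  exists2 Ps : 'I_n -> T -> V, forall i t, Ps i t = sscal vZ (-1) (scomp vmul vone (phi i) (pert Ps)) t
    & forall i, SN (Ps i) (M i).
Proof.
move=> gphi hM.
apply: (@recursion_fixpoint (fun Ps i => sscal vZ (-1) (scomp vmul vone (phi i) (pert Ps))) M).
- by move=> i; exact: sbd_ge0 (hM i).
- move=> Q E E' h i; apply: agree_sscal; apply: agree_scomp => j.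
  by apply: agree_sadd => //; apply: agree_seps; apply: agree_svm; exact: h.
move=> E hE i; rewrite -[X in SN _ X]mul1r -[X in X * _]nm1 -[X in X * _]nmN; apply: SNscal.
exact: (SN_comp good0 goodD goodM good1 nv0 nvD nvM nv1 nv_ge0 w0 (fun j => SN_pert (hE j)) (gphi i) (hM i)).
Qed.

Lemma EV_inverse (phi Ps : 'I_n -> T -> V) (M : 'I_n -> R) (s S : 'I_n -> C) :
  (forall i u, good (phi i u)) ->
  (forall i, sbd (fun u => nv (phi i u) * wt (fun j => w j + nv vX * M j) u.2) (M i)) ->
  (forall i t, Ps i t = sscal vZ (-1) (scomp vmul vone (phi i) (pert Ps)) t) ->
  (forall i, SN (Ps i) (M i)) -> (forall i, EV (Ps i) (s i)) ->
  (forall i, hs (fun u => chi (phi i u) * \prod_(j < n) (z j 0 + chi vX * s j) ^+ u.2 j) (S i)) ->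
  forall i, s i = - S i.
Proof.
move=> gphi hM hfix hP hs' hS i.
have s1 := SN_comp good0 goodD goodM good1 nv0 nvD nvM nv1 nv_ge0 w0 (fun j => SN_pert (hP j)) (gphi i) (hM i).
have e1 := EV_comp_pert hP hs' (gphi i) (hM i) (hS i).
have e2 := EVscal (-1) s1 e1; rewrite mulN1r in e2.
by apply: (hs_uniq (hs' i)); apply: eq_hs e2 => t; rewrite hfix.
Qed.

End Recursion.

                           

(** * Positivity of the Gamma function *)

Section GammaPos.
Variable R : realType.
Local Notation leb := (@lebesgue_measure R).
Local Notation P := (`]0%R, +oo[%classic : set R).
Variable s : R.
Hypothesis s_gt0 : 0 < s.

(** A bounded primitive of [f]. Near 0 the function [f] behaves like the Gamma integrand and at
    infinity it decays only polynomially, so a multiple of it dominates [g], while its integrals are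
    at most 1. *)
Let F (t : R) : R := - (1 + t `^ s)^-1.
Let f (t : R) : R := s * t `^ (s - 1) / (1 + t `^ s) ^+ 2.
Let g (t : R) : R := t `^ (s - 1) * expR (- t).

Let den_gt0 t : 0 < 1 + t `^ s. Proof. by rewrite ltr_wpDr ?powR_ge0. Qed.

Let is_derive_powR (t : R) : 0 < t -> is_derive t 1 (@powR R ^~ s) (s * t `^ (s - 1)).
Proof.
move=> t0; have tI : t \in `]0, +oo[ by rewrite in_itv /= t0.
apply: DeriveDef; first exact: derivable_powR.
by rewrite -derive1E powR_derive1.
Qed.

Let is_derive_F (t : R) : 0 < t -> is_derive t 1 F (f t).
Proof.
move=> t0; have h := is_derive_powR t0.
have d : (1 + t `^ s) != 0 by rewrite gt_eqF.
rewrite /F /f; apply: is_derive_eq.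
by rewrite /= /GRing.scale /=; field.
Qed.

Let powR_le_exp (t : R) m : 0 <= t -> t ^+ m <= m`!%:R * expR t.
Proof.
move=> t0; have := @sbd_exp _ _ t0 [:: m] isT; rewrite big_seq1 ler_pdivrMr ?ltr0n ?fact_gt0 //.
by rewrite mulrC.
Qed.

Let g_le : exists2 K : R, 0 < K & forall t : R, 0 < t -> g t <= K * f t.
Proof.
(* For [t >= 1] one has [(1 + t]^ s) ^+ 2 <= 4 * t ^+ (m * 2)[, and a single term of the exponential
   series gives]t ^+ (m * 2) <= (m * 2)[!%:R * expR t]. *)
pose m := (Num.truncn s).+1.
have sm : s <= m%:R by rewrite ltW // truncnS_gt.
pose K0 : R := 4 * (m * 2)`!%:R.
have f0 j : 0 < j`!%:R :> R by rewrite ltr0n fact_gt0.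
exists (K0 / s) => [|t t0]; first by rewrite divr_gt0 // mulr_gt0.
have st : 0 < t `^ s by exact: powR_gt0.
have st' : 0 < t `^ (s - 1) by exact: powR_gt0.
have d0 := den_gt0 t.
have -> : K0 / s * f t = t `^ (s - 1) * (K0 / (1 + t `^ s) ^+ 2).
  by rewrite /f; field; rewrite !gt_eqF.
rewrite /g ler_pM2l // ler_pdivlMr ?exprn_gt0 // expRN ler_pdivrMl ?expR_gt0 // [leRHS]mulrC /K0.
have et : 1 <= expR t by rewrite -expR0 ler_expR ltW.
have [t1|t1] := leP t 1.
  have ts1 : t `^ s <= 1 by have := @ge0_ler_powR R s (ltW s_gt0) t 1; rewrite !nnegrE powR1; apply; rewrite ?ler01 // ltW.
  apply: (@le_trans _ _ 4); first by have := den_gt0 t; nra.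
  have : 1 <= (m * 2)`!%:R :> R by rewrite ler1n fact_gt0.
  by move=> h; nra.
have ts1 : t `^ s <= t ^+ m by rewrite -(powR_mulrn m (ltW t0)) ler_powR ?sm // ltW.
have tm : 1 <= t ^+ m by rewrite exprn_ege1 // ltW.
apply: (@le_trans _ _ (4 * (t ^+ m) ^+ 2)); first by have := den_gt0 t; nra.
by rewrite -exprM -mulrA ler_wpM2l // powR_le_exp // ltW.
Qed.

Let cont_powR (r : R) : {in `]0, +oo[%R, continuous (fun t : R => t `^ r)}.
Proof.
move=> t t0; apply: differentiable_continuous; apply/derivable1_diffP.
exact: derivable_powR.
Qed.

Let cont_f : {in `]0, +oo[%R, continuous f}.
Proof.
move=> t t0; apply: cvgM.
  by apply: cvgM; [exact: cvg_cst|exact: cont_powR].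
apply: cvgV; first by rewrite expf_neq0 // gt_eqF.
have h : (1 + x `^ s) @[x --> t] --> 1 + t `^ s by apply: cvgD; [exact: cvg_cst|exact: cont_powR].
by apply: cvgM.
Qed.

Let cont_F : {in `]0, +oo[%R, continuous F}.
Proof.
move=> t; rewrite in_itv /= andbT => t0; apply: differentiable_continuous; apply/derivable1_diffP.
by case: (is_derive_F t0).
Qed.

Let int_f (a b : R) : 0 < a -> a < b -> (\int[leb]_(t in `[a, b]) (f t)%:E <= 1)%E.
Proof.
move=> a0 ab.
have sub : {in `[a, b], forall x, x \in `]0%R, +oo[}.
  by move=> x; rewrite !in_itv /= andbT => /andP[ax _]; exact: lt_le_trans ax.
rewrite (@continuous_FTC2 _ f F) //.
- rewrite lee_fin /F opprK; have := den_gt0 a; have := den_gt0 b; have := powR_ge0 a s => h1 h2 h3.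
  have : 0 < (1 + b `^ s)^-1 by rewrite invr_gt0.
  have : (1 + a `^ s)^-1 <= 1 by rewrite invf_le1 // lerDl.
  lra.
- apply: continuous_in_subspaceT => x xab; apply: cont_f; apply: sub.
  by move: xab; rewrite inE.
- split.
  + move=> x; rewrite in_itv /= => /andP[ax _].
    by case: (is_derive_F (lt_trans a0 ax)).
  + by apply: cvg_at_right_filter; apply: cont_F; rewrite in_itv /= a0.
  + by apply: cvg_at_left_filter; apply: cont_F; rewrite in_itv /= andbT (lt_trans a0).
move=> x; rewrite in_itv /= => /andP[ax _].
have := is_derive_F (lt_trans a0 ax) => h; rewrite derive1E; exact: derive_val.
Qed.

Let S (m : nat) : set R := `[m.+1%:R^-1, m.+2%:R]%classic.

Let S_bigcup : \bigcup_m S m = P.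
Proof.
apply/seteqP; split => [x [m _]|x]; rewrite /S /= !in_itv /= andbT.
  by case/andP => h _; apply: lt_le_trans h; rewrite invr_gt0.
move=> x0; pose m := (Num.truncn (x + x^-1)).
have hm : x + x^-1 < m.+1%:R by rewrite truncnS_gt.
have xi : 0 < x^-1 by rewrite invr_gt0.
exists m => //; rewrite /S /= in_itv /=; apply/andP; split.
  by rewrite invf_ple ?posrE // ltW // (le_lt_trans _ hm) // lerDr ltW.
apply: (@le_trans _ _ m.+1%:R); last by rewrite ler_nat.
by rewrite ltW // (le_lt_trans _ hm) // lerDl ltW.
Qed.

Let meas_powR (r : R) : measurable_fun P (fun t : R => t `^ r).
Proof. by apply: open_continuous_measurable_fun => // x; rewrite inE => /cont_powR. Qed.

Let meas_g : measurable_fun P g.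
Proof.
apply: measurable_funM; first exact: meas_powR.
by apply: measurable_funTS; apply: measurableT_comp => //; exact: measurable_oppr.
Qed.

Let meas_f : measurable_fun P f.
Proof. by apply: open_continuous_measurable_fun => // x; rewrite inE => /cont_f. Qed.

Let SP m : S m `<=` P. Proof. by rewrite -S_bigcup; exact: bigcup_sup. Qed.

Let g_ge0 t : 0 <= g t. Proof. by rewrite mulr_ge0 ?powR_ge0 ?expR_ge0. Qed.

Let f_ge0 t : 0 <= f t.
Proof. by rewrite /f divr_ge0 ?mulr_ge0 ?powR_ge0 ?(ltW s_gt0) ?exprn_ge0 ?(ltW (den_gt0 t)). Qed.

Let int_g_lty : (\int[leb]_(t in P) (g t)%:E < +oo)%E.
Proof.
have [K K0 hK] := g_le.
apply: (@le_lt_trans _ _ K%:E); last exact: ltry.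
have nd : nondecreasing_seq S.
  move=> m m' mm; rewrite subsetEset => x; rewrite /S /= !in_itv /= => /andP[h1 h2].
  rewrite (le_trans _ h1) ?(le_trans h2) ?ler_nat //.
  by rewrite lef_pV2 ?posrE // ler_nat.
have h : (fun i => (\int[leb]_(t in S i) (g t)%:E)%E) @ \oo --> (\int[leb]_(t in \bigcup_i S i) (g t)%:E)%E.
  apply: ge0_nondecreasing_set_cvg_integral => //.
  - by move=> i; exact: measurable_itv.
  - by move=> i; apply/measurable_EFinP; apply: measurable_funS meas_g => //; exact: SP.
  - by move=> i x _; rewrite lee_fin.
rewrite -S_bigcup -(cvg_lim _ h) //.
apply: lime_le.
    apply: ereal_nondecreasing_is_cvgn; apply: ge0_nondecreasing_set_nondecreasing_integral => //.
    + by move=> i; exact: measurable_itv.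
    + by move=> i; apply/measurable_EFinP; apply: measurable_funS meas_g => //; exact: SP.
    + by move=> i x _; rewrite lee_fin.
  apply: nearW => m.
  apply: (@le_trans _ _ (\int[leb]_(t in S m) (K * f t)%:E)%E).
    apply: ge0_le_integral => //.
    + exact: measurable_itv.
    + by move=> x _; rewrite lee_fin.
    + by apply/measurable_EFinP; apply: measurable_funS meas_g => //; exact: SP.
    + apply/measurable_EFinP; apply: measurable_funM; first exact: measurable_cst.
      by apply: measurable_funS meas_f => //; exact: SP.
    + by move=> x /SP; rewrite /= in_itv /= andbT lee_fin => /hK.
  rewrite [leLHS](_ : _ = K%:E * \int[leb]_(t in S m) (f t)%:E)%E; last first.
    rewrite -ge0_integralZl //; last by rewrite lee_fin ltW.
    + exact: measurable_itv.
    + by apply/measurable_EFinP; apply: measurable_funS meas_f => //; exact: SP.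
    + by move=> x _; rewrite lee_fin.
  rewrite -[leRHS]mule1; rewrite lee_pmul2l //.
  apply: int_f; first by rewrite invr_gt0.
  apply: (@le_lt_trans _ _ 1); last by rewrite ltr1n.
  by rewrite invf_le1 // ler1n.
Qed.

(** The real integral is obtained with [fine], which sends infinite values to 0; so finiteness must
    be proved along with a positive lower bound, taken on [[1, 2]]. *)
Lemma Gamma_gt0 : 0 < Gamma s.
Proof.
rewrite /Gamma /Rintegral; apply: fine_gt0; rewrite int_g_lty andbT.
pose c : R := 2^-1 * expR (- 2).
have c0 : 0 < c by rewrite mulr_gt0 ?expR_gt0.
apply: (@lt_le_trans _ _ (\int[leb]_(t in `[1%R, 2%R]) c%:E)%E).
  rewrite (_ : (\int[leb]_(t in `[1%R, 2%R]) c%:E)%E = (c%:E * leb `[1%R, 2%R]%classic)%E); last exact: integral_cst.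
  rewrite lebesgue_measure_itv /= lte_fin ltr1n /= -EFinD -EFinM lte_fin.
  by rewrite mulr_gt0 // subr_gt0 ltr1n.
apply: (@le_trans _ _ (\int[leb]_(t in `[1%R, 2%R]) (g t)%:E)%E).
  apply: ge0_le_integral => //.
  - by move=> x _; rewrite lee_fin ltW.
  - apply/measurable_EFinP; apply: measurable_funS meas_g => // x /=.
    by rewrite !in_itv /= andbT => /andP[h _]; exact: lt_le_trans h.
  move=> x /=; rewrite in_itv /= lee_fin => /andP[x1 x2].
  have x0 : 0 < x by exact: lt_le_trans x1.
  apply: ler_pM; rewrite ?expR_ge0 ?invr_ge0 // ?ler_expR ?lerN2 //.
  have h : 1 <= x `^ s by rewrite -[leLHS](powRr0 x) ler_powR // ltW.
  have h' := mulr_powRB1 (ltW x0) s_gt0.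
  have := powR_ge0 x (s - 1); nra.
apply: ge0_subset_integral => //.
- exact/measurable_EFinP.
- by move=> x _; rewrite lee_fin.
by move=> x /=; rewrite !in_itv /= andbT => /andP[h _]; exact: lt_le_trans h.
Qed.

End GammaPos.

                          

(** * Binomial expansion of monomials *)

Section BinomialExpansion.
Variable n : nat.

Definition mbin (c d : mindex n) : nat := \prod_(i < n) 'C(c i, d i).
Definition msub (c d : mindex n) : mindex n := [ffun i => (c i - d i)%N].
Definition mbox (N : nat) : seq (mindex n) :=
  [seq [ffun i => nat_of_ord (f i)] | f : {ffun 'I_n -> 'I_N.+1}].

Lemma uniq_mbox N : uniq (mbox N).
Proof.
rewrite map_inj_uniq ?enum_uniq // => f g /ffunP e; apply/ffunP => i.
by apply: val_inj; have := e i; rewrite !ffunE.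
Qed.

Lemma mbin_out (c d : mindex n) : d \notin mbox (mdeg c) -> mbin c d = 0%N.
Proof.
move=> dJ; apply/eqP; apply: contraNT dJ => h.
have dc i : (d i < (mdeg c).+1)%N.
  rewrite ltnS (leq_trans _ (leq_mdeg c i)) // leqNgt; apply: contra h => ci.
  by rewrite /mbin (bigD1 i) //= bin_small.
apply/mapP; exists [ffun i => Ordinal (dc i)]; first by rewrite mem_enum.
by apply/ffunP => i; rewrite !ffunE.
Qed.

Lemma prod_binomial (K : comNzRingType) (u v : 'I_n -> K) (c : mindex n) :
  \prod_i (u i + v i) ^+ c i =
  \sum_(d <- mbox (mdeg c)) (mbin c d)%:R * ((\prod_i u i ^+ msub c d i) * \prod_i v i ^+ d i).
Proof.
transitivity (\prod_i \sum_(j < (mdeg c).+1) ('C(c i, j)%:R * (u i ^+ (c i - j) * v i ^+ j))).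
  apply: eq_bigr => i _; rewrite exprDn.
  rewrite (big_ord_widen (mdeg c).+1 (fun j => u i ^+ (c i - j) * v i ^+ j *+ 'C(c i, j))) ?ltnS ?leq_mdeg //.
  rewrite big_mkcond /=; apply: eq_bigr => j _; case: ifPn => [_|]; first by rewrite mulr_natl.
  by rewrite -leqNgt => cj; rewrite bin_small // mul0r.
rewrite bigA_distr_bigA big_map big_enum /=; apply: eq_bigr => f _.
rewrite /mbin natr_prod -!big_split /=; apply: eq_bigr => i _; by rewrite !ffunE.
Qed.

Lemma mbin0 c : mbin c (mzero n) = 1%N.
Proof. by rewrite /mbin big1 // => i _; rewrite ffunE bin0. Qed.

Lemma mbin1 c s : mbin c (mone s) = c s.
Proof.
rewrite /mbin (bigD1 s) //= ffunE eqxx bin1 big1 ?muln1 // => i /negPf si.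
by rewrite ffunE si bin0.
Qed.

Lemma msub0 c : msub c (mzero n) = c.
Proof. by apply/ffunP => i; rewrite !ffunE subn0. Qed.

Lemma mdeg_le1 (d : mindex n) : (mdeg d <= 1)%N -> d = mzero n \/ exists s, d = mone s.
Proof.
move=> h; case: (pickP (fun s => (0 < d s)%N)) => [s ds|d0]; last first.
  by left; apply/ffunP => i; rewrite ffunE; apply/eqP; rewrite -leqn0 leqNgt d0.
right; exists s; apply/ffunP => i; rewrite ffunE.
move: h; rewrite /mdeg (bigD1 s) //=; case: eqP => [->|/eqP si].
  by move=> h; apply/eqP; rewrite eqn_leq ds andbT (leq_trans _ h) // leq_addr.
rewrite (bigD1 i) //= => h; apply/eqP; rewrite -leqn0 -(leq_add2l 1) addn0.
by apply: leq_trans h; apply: leq_add => //; exact: leq_addr.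
Qed.

End BinomialExpansion.

(** * Joint power series in x and z, and differentials *)

Section JointExpansion.
Variable R : realType.
Variable n : nat.
Local Notation C := (Cx R).
Local Notation T := (nat * mindex n)%type.

Definition xze (p : C * 'cV[C]_n) (rho : R) (F : C * 'cV[C]_n -> C) (c : T -> C) :=
  forall v, nm v < rho -> hs (fun a => monom_xz a v * c a) (F (p + v)).

Lemma hs_monomD (c : mindex n) (z v : 'cV[C]_n) :
  hs (fun d => (mbin c d)%:R * (monom (msub c d) z * monom d v)) (monom c (z + v)).
Proof.
have := prod_binomial (fun i => z i 0) (fun i => v i 0) c.
have -> : \prod_i (z i 0 + v i 0) ^+ c i = monom c (z + v).
  by apply: eq_bigr => i _; rewrite mxE.
move=> ->; apply: (hs_fin (uniq_mbox n (mdeg c))) => d /mbin_out ->.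
by rewrite mul0r.
Qed.

Lemma sbd_wtD (w v : 'I_n -> R) (c : mindex n) : (forall i, 0 <= w i) -> (forall i, 0 <= v i) ->
  sbd (fun d => (mbin c d)%:R * (wt w (msub c d) * wt v d)) (wt (fun i => w i + v i) c).
Proof.
move=> w0 v0 J uJ; rewrite /wt prod_binomial -/(wt _ _).
have h d : 0 <= (mbin c d)%:R * (wt w (msub c d) * wt v d).
  by rewrite !mulr_ge0 ?wt_ge0.
rewrite -[leLHS]/(\sum_(d <- J) (mbin c d)%:R * (wt w (msub c d) * wt v d)).
rewrite (bigID (fun d => d \in mbox n (mdeg c))) /= [X in _ + X]big1 ?addr0; last first.
  by move=> d /mbin_out ->; rewrite mul0r.
rewrite -big_filter; apply: ler_sum_sub => //; rewrite ?filter_uniq ?uniq_mbox //.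
by move=> d; rewrite mem_filter => /andP[].
Qed.

Section Sum.
Variable I : choiceType.
Variables (c : I -> mindex n) (F : I -> C -> C) (b : I -> nat -> C) (M : I -> R) (N : R).
Variables (w : 'I_n -> R) (x0 : C) (r : R) (z0 : 'cV[C]_n) (dl : R).
Hypothesis r_gt0 : 0 < r.
Hypothesis dl_gt0 : 0 < dl.
Hypothesis hF : forall t, pser x0 r (F t) (b t).
Hypothesis hM : forall t h, nm h < r -> nm (F t (x0 + h)) <= M t.
Hypothesis hN : sbd (fun t => M t * wt w (c t)) N.
Hypothesis hz : forall i, nm (z0 i 0) + dl <= w i.

Let M0 t : 0 <= M t.
Proof. by apply: le_trans (hM t (h := 0) _); rewrite ?nm0 ?nm_ge0. Qed.

Let wle (c0 : mindex n) (v : 'I_n -> R) : (forall i, 0 <= v i <= dl) ->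
  wt (fun i => nm (z0 i 0) + v i) c0 <= wt w c0.
Proof.
move=> hv; apply: wt_le => i; have /andP[v0 v1] := hv i.
by rewrite addr_ge0 ?nm_ge0 //= (le_trans _ (hz i)) // lerD2l.
Qed.

Let coef (t : I) (a : T) : C := b t a.1 * ((mbin (c t) a.2)%:R * monom (msub (c t) a.2) z0).

Let coef_sbd a : sbd (fun t => nm (coef t a)) (r ^- a.1 * (wt (fun=> dl) a.2)^-1 * N).
Proof.
have ra : 0 < r ^+ a.1 by exact: exprn_gt0.
have da : 0 < wt (fun=> dl) a.2 by exact: wt_gt0.
apply: sbd_le (lexx _) (sbdZ _ hN) => [t|]; last by rewrite mulr_ge0 ?invr_ge0 ?ltW.
rewrite /coef nmM [leRHS](_ : _ = (r ^- a.1 * M t) * ((wt (fun=> dl) a.2)^-1 * wt w (c t))); last by ring.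
have h1 : nm (b t a.1) <= (r ^+ a.1)^-1 * M t.
  by rewrite ler_pdivlMl // mulrC; exact: (cauchy_estimate a.1 (hF t) r_gt0 (@hM t)).
have h2 : nm ((mbin (c t) a.2)%:R * monom (msub (c t) a.2) z0) <= (wt (fun=> dl) a.2)^-1 * wt w (c t).
  rewrite ler_pdivlMl // mulrC nmM nm_nat.
  have z00 i : 0 <= nm (z0 i 0) by exact: nm_ge0.
  have := sbd_term a.2 (sbd_wtD (c t) z00 (fun=> ltW dl_gt0)).
  move=> /le_trans h3; apply: le_trans (h3 _ (wle _ _)); last by move=> i; rewrite lexx ltW.
  rewrite mulrA; apply: ler_wpM2r; first exact: ltW.
  by apply: ler_wpM2l => //; apply: nm_monom.
exact: (ler_pM (nm_ge0 _) (nm_ge0 _) h1 h2).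
Qed.

(** Expanding [F t] about [x0] and the monomials about [z0] gives an absolutely summable family:
    Cauchy estimates control [x], and the binomial formula at radii [nm (z0 i 0) + dl <= w i]
    controls [z]. The coefficients are made explicit so that first derivatives can be read off. *)
Lemma joint_expansion (G : C * 'cV[C]_n -> C) :
  (forall h v, nm h < r -> nm v < dl ->
     hs (fun t => F t (x0 + h) * monom (c t) (z0 + v)) (G (x0 + h, z0 + v))) ->
  exists2 D : T -> C, xze (x0, z0) (Num.min r dl) G D &
    forall a, hs (fun t => b t a.1 * ((mbin (c t) a.2)%:R * monom (msub (c t) a.2) z0)) (D a).
Proof.
move=> hG; pose D a := proj1_sig (cid2 (hs_ex (coef_sbd a))).
have hD a : hs (coef^~ a) (D a) by rewrite /D; case: cid2.
exists D => // -[h v]; rewrite lt_min nm_pair /= => /andP[]; rewrite !gt_max => /andP[hr _] /andP[_ vd].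
pose A (u : I * T) : C := monom_xz u.2 (h, v) * coef u.1 u.2.
have As t : sbd (fun a : T => nm (A (t, a))) ((M t * (1 - nm h / r)^-1) * wt w (c t)).
  have hh : 0 <= nm h / r < 1 by rewrite divr_ge0 ?nm_ge0 ?(ltW r_gt0) //= ltr_pdivrMr // mul1r.
  have s1 := sbdZ (M0 t) (sbd_geom hh).
  have z00 i : 0 <= nm (z0 i 0) by exact: nm_ge0.
  have v00 i : 0 <= nm (v i 0) by exact: nm_ge0.
  have s2 := sbd_le (fun=> lexx _) (@wle (c t) (fun i => nm (v i 0)) _) (sbd_wtD (c t) z00 v00).
  apply: sbd_le (lexx _) (sbd_prod _ _ s1 (s2 _)) => [a|m|d|i].
  - rewrite /A /coef /monom_xz /= mulrACA nmM; apply: ler_pM; rewrite ?nm_ge0 //.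
      by rewrite [h ^+ _ * _]mulrC; exact: (pser_term_bound h a.1 (hF t) r_gt0 (@hM t)).
    rewrite mulrCA nmM nm_nat; apply: ler_wpM2l => //; rewrite mulrC nmM.
    by apply: ler_pM; rewrite ?nm_ge0 //; exact: nm_monom.
  - by rewrite mulr_ge0 ?exprn_ge0 //; case/andP: hh.
  - by rewrite !mulr_ge0 ?wt_ge0.
  by rewrite nm_ge0 /= (le_trans (nm_mx_entry _ _ _)) // ltW.
have AS : sbd (fun u => nm (A u)) ((1 - nm h / r)^-1 * N).
  apply: (sbd_pair (fun=> nm_ge0 _) As).
  apply: sbd_le (lexx _) (sbdZ _ hN) => [t|]; first by rewrite mulrAC [_^-1 * _]mulrC.
  by rewrite invr_ge0 subr_ge0 ler_pdivrMr // mul1r ltW.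
apply: (hs_pair_swap AS (b := fun t => F t (x0 + h) * monom (c t) (z0 + v))).
- move=> t; apply: eq_hs (hs_prod (hF t hr) (hs_monomD (c t) z0 v)) => a.
  by rewrite /A /coef /monom_xz /=; ring.
- by move=> a; exact: (hs_Ml (monom_xz a (h, v)) (hD a)).
exact: hG.
Qed.

End Sum.

Lemma xze_sub p rho rho' F c : rho' <= rho -> xze p rho F c -> xze p rho' F c.
Proof. by move=> h H v vr; apply: H; exact: lt_le_trans h. Qed.

Lemma xze_scale p rho F c (s : C) : xze p rho F c -> xze p rho (fun q => s * F q) (fun a => s * c a).
Proof. by move=> h v vr; apply: eq_hs (hs_Ml s (h v vr)) => a; rewrite mulrCA. Qed.

Lemma xze_mulx p rho F c : xze p rho F c ->
  xze p rho (fun q => q.1 * F q)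
    (fun a => p.1 * c a + (if a.1 is m.+1 then c (m, a.2) else 0)).
Proof.
move=> h v vr; rewrite /= mulrDl.
have h2 : hs (fun a : T => if a.1 is m.+1 then v.1 * (monom_xz (m, a.2) v * c (m, a.2)) else 0)
    (v.1 * F (p + v)).
  pose f (a : T) : T := (a.1.+1, a.2).
  have fi : injective f by move=> [a1 a2] [b1 b2] [-> ->].
  apply/(hs_inj (f := f)) => //.
    by move=> [[|m] d] hf //; case: (hf (m, d)).
  by apply: eq_hs (hs_Ml v.1 (h v vr)) => -[m d].
apply: eq_hs (hs_add (hs_Ml p.1 (h v vr)) h2) => -[[|m] d] /=.
  by rewrite !addr0 mulrCA.
by rewrite /monom_xz /= exprS; ring.
Qed.

Lemma pair_subKC (p q : C * 'cV[C]_n) : p + (q - p) = q.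
Proof. by rewrite addrC subrK. Qed.

Definition xlin (c : T -> C) (v : C * 'cV[C]_n) : C :=
  v.1 * c (1%N, mzero n) + \sum_s v.2 s 0 * c (0%N, mone s).

Lemma nm_xlin (c : T -> C) v :
  nm (xlin c v) <= (nm (c (1%N, mzero n)) + \sum_s nm (c (0%N, mone s))) * nm v.
Proof.
apply: le_trans (nmD _ _) _; rewrite [leRHS]mulrDl; apply: lerD.
  by rewrite nmM mulrC ler_wpM2l ?nm_ge0 // nm_pair le_max lexx.
apply: le_trans (nm_sum _ _ _) _; rewrite mulr_suml; apply: ler_sum => s _.
rewrite nmM mulrC ler_wpM2l ?nm_ge0 // nm_pair le_max; apply/orP; right; exact: nm_mx_entry.
Qed.

Lemma monom_xz00 (v : C * 'cV[C]_n) : monom_xz (0%N, mzero n) v = 1.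
Proof. by rewrite /monom_xz expr0 monom0 mulr1. Qed.

Lemma monom_xz10 (v : C * 'cV[C]_n) : monom_xz (1%N, mzero n) v = v.1.
Proof. by rewrite /monom_xz expr1 monom0 mulr1. Qed.

Lemma monom_xz01 s (v : C * 'cV[C]_n) : monom_xz (0%N, mone s) v = v.2 s 0.
Proof. by rewrite /monom_xz expr0 monom1 mul1r. Qed.

Lemma nm_monom_xz (v : C * 'cV[C]_n) a : nm (monom_xz a v) <= nm v ^+ tdeg a.
Proof.
have [h1 h2] : nm v.1 <= nm v /\ nm v.2 <= nm v by rewrite nm_pair !le_max !lexx orbT.
rewrite nmM nmX exprD; apply: ler_pM; rewrite ?exprn_ge0 ?nm_ge0 //.
  by apply: lerXn2r; rewrite ?nnegrE ?nm_ge0.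
have -> : nm v ^+ mdeg a.2 = wt (fun=> nm v) a.2 by rewrite /wt /mdeg prodrXr.
by apply: nm_monom => i; apply: le_trans (nm_mx_entry _ _ _) h2.
Qed.

(** Absolute summability at the vector [vr] with all entries [rho / 2] controls all coefficients at
    once; terms of total degree at least 2 then carry the factor [(nm v / r) ^+ 2]. *)
Lemma xze_lin p rho F c : 0 < rho -> xze p rho F c ->
  exists K, forall v, nm v < rho / 2 -> nm (F (p + v) - (F p + xlin c v)) <= K * nm v ^+ 2.
Proof.
move=> rho0 hF; pose r := rho / 2.
have r0 : 0 < r by rewrite divr_gt0.
have rr : r < rho by rewrite /r; lra.
pose vr : C * 'cV[C]_n := (RtoC r, const_mx (RtoC r)).
have nvr : nm vr <= r.
  rewrite nm_pair ge_max nm_RtoC ger0_norm ?(ltW r0) // lexx /=.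
  by apply: nm_mx_le => [|i j]; rewrite ?(ltW r0) // mxE nm_RtoC ger0_norm // ltW.
have [M hM] := hs_sbd (hF vr (le_lt_trans nvr rr)).
have nvE a : nm (monom_xz a vr) = r ^+ tdeg a.
  rewrite /monom_xz nmM nmX /= nm_RtoC (ger0_norm (ltW r0)) exprD; congr (_ * _).
  rewrite /monom nm_prod /mdeg -prodrXr; apply: eq_bigr => i _.
  by rewrite mxE nmX nm_RtoC (ger0_norm (ltW r0)).
have F0 : F p = c (0%N, mzero n).
  have := hF 0; rewrite nm0 addr0 => /(_ rho0) h; apply: (hs_uniq h).
  apply: eq_hs (hs_delta (0%N, mzero n) (c (0%N, mzero n))) => -[m d].
  case: eqP => [->|/eqP ad]; first by rewrite monom_xz00 mul1r.
  rewrite [monom_xz _ _](_ : _ = 0) ?mul0r //; apply: nm_eq0.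
  have := nm_monom_xz 0 (m, d); rewrite nm0 expr0n; case: eqP => // /eqP.
  rewrite addn_eq0 /= => /andP[/eqP m0 /eqP d0].
  move: ad; rewrite m0; have [|->|[s ds]] := @mdeg_le1 n d; rewrite ?d0 // ?eqxx //.
  by move: d0; rewrite ds mdeg1.
exists (r ^- 2 * M) => v vr'.
have hv := hF v (lt_trans vr' rr).
have hd a0 : hs (fun a => if a == a0 then monom_xz a0 v * c a0 else 0) (monom_xz a0 v * c a0) by exact: hs_delta.
have hl := hs_add (hd (0%N, mzero n)) (hs_add (hd (1%N, mzero n)) (hs_sum (index_enum 'I_n) (fun s => hd (0%N, mone s)))).
have hr := hs_add hv (hs_Ml (-1) hl).
rewrite mulN1r monom_xz00 mul1r -F0 monom_xz10 in hr.
have -> : F (p + v) - (F p + xlin c v) = F (p + v) -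
    (F p + (v.1 * c (1%N, mzero n) + \sum_(s <- index_enum 'I_n) monom_xz (0%N, mone s) v * c (0%N, mone s))).
  by rewrite /xlin; congr (_ - (_ + (_ + _))); apply: eq_bigr => s _; rewrite monom_xz01.
apply: (hs_le hr); rewrite [_ * M * _]mulrAC.
have q0 : 0 <= r ^- 2 * nm v ^+ 2 by rewrite mulr_ge0 ?invr_ge0 ?exprn_ge0 ?nm_ge0 // ltW.
apply: sbd_le (lexx _) (sbdZ q0 hM) => -[m d].
have Q0 a : 0 <= r ^- 2 * nm v ^+ 2 * nm (monom_xz a vr * c a) by rewrite mulr_ge0 ?nm_ge0.
have e01 s : (mone s == mzero n) = false.
  by apply/negP => /eqP e; have := mdeg1 s; rewrite e mdeg0.
have [d2|] := leqP 2 (tdeg (m, d)); last first.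
  rewrite ltnS => d1.
  suff -> : monom_xz (m, d) v * c (m, d) + -1 * ((if (m, d) == (0%N, mzero n) then F p else 0) +
      ((if (m, d) == (1%N, mzero n) then v.1 * c (1%N, mzero n) else 0) +
      \sum_(t <- index_enum 'I_n) (if (m, d) == (0%N, mone t) then monom_xz (0%N, mone t) v * c (0%N, mone t) else 0))) = 0.
    by rewrite nm0.
  case: m d1 => [|[|m]]; rewrite /tdeg /= ?add0n ?add1n ?addSn ?ltnS //.
    move=> /mdeg_le1 [->|[s ->]]; rewrite !xpair_eqE /= ?eqxx.
      rewrite big1 => [|s _]; last by rewrite xpair_eqE /= eq_sym e01.
      by rewrite monom_xz00 -F0 !addr0; ring.
    rewrite e01 !add0r (bigD1 s) //= eqxx big1 ?addr0 => [|t ts]; first by ring.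
    case: eqP => // -[] /ffunP /(_ s); rewrite !ffunE eqxx eq_sym.
    by rewrite (negPf ts).
  rewrite leqn0 => d0; have [|->|[s ds]] := @mdeg_le1 n d; rewrite ?(eqP d0) //; last first.
    by move: d0; rewrite ds mdeg1.
  rewrite !xpair_eqE /= eqxx add0r big1 ?addr0 => [|s _ //].
  by rewrite monom_xz10; ring.
rewrite ifN; last by apply: contraTneq d2 => -[-> ->]; rewrite /tdeg /= mdeg0.
rewrite ifN; last by apply: contraTneq d2 => -[-> ->]; rewrite /tdeg /= mdeg0.
rewrite big1 => [|s _]; last first.
  by rewrite ifN //; apply: contraTneq d2 => -[-> ->]; rewrite /tdeg /= mdeg1.
rewrite !addr0 mulr0 addr0 (nmM (monom_xz (m, d) v)) (nmM (monom_xz (m, d) vr)) nvE mulrA; apply: ler_wpM2r; first exact: nm_ge0.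
apply: le_trans (nm_monom_xz _ _) _; rewrite -(subnK d2) !exprD.
rewrite [leRHS](_ : _ = r ^+ (tdeg (m, d) - 2) * nm v ^+ 2); last first.
  by field; rewrite gt_eqF.
apply: ler_wpM2r; first by rewrite exprn_ge0 ?nm_ge0.
by apply: lerXn2r; rewrite ?nnegrE ?nm_ge0 ?ltW.

Qed.

Section Differential.
Variables (p : C * 'cV[C]_n) (rho : R) (Phi : C * 'cV[C]_n -> C * 'cV[C]_n).
Variables (c1 : T -> C) (c2 : 'I_n -> T -> C).
Hypothesis rho_gt0 : 0 < rho.
Hypothesis h1 : xze p rho (fun q => (Phi q).1) c1.
Hypothesis h2 : forall i, xze p rho (fun q => (Phi q).2 i 0) (c2 i).

Definition xdiff (v : C * 'cV[C]_n) : C * 'cV[C]_n := (xlin c1 v, \col_i xlin (c2 i) v).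

Let xlinD (c : T -> C) (s : C) u v : xlin c (s *: u + v) = s * xlin c u + xlin c v.
Proof.
rewrite /xlin /= mulrDr mulr_sumr mulrDl addrACA -!big_split /= !mulrA.
by congr (_ + _); apply: eq_bigr => i _; rewrite !mxE; ring.
Qed.

Let xdiff_linear : linear xdiff.
Proof.
move=> s u v; rewrite /xdiff xlinD; congr pair.
by apply/matrixP => i j; rewrite !mxE xlinD.
Qed.
HB.instance Definition _ := GRing.isLinear.Build C (C * 'cV[C]_n)%type (C * 'cV[C]_n)%type _ xdiff xdiff_linear.

Let xdiff_bound : exists2 K, 0 < K & forall v, nm (xdiff v) <= K * nm v.
Proof.
have b c : exists2 K, 0 <= K & forall v, nm (xlin c v) <= K * nm v.
  exists (nm (c (1%N, mzero n)) + \sum_s nm (c (0%N, mone s))).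
    by rewrite addr_ge0 ?nm_ge0 // sumr_ge0 // => s _; exact: nm_ge0.
  exact: nm_xlin.
have [K1 K10 hK1] := b c1.
have /choice [K2 hK2] : forall i, exists K, 0 <= K /\ forall v, nm (xlin (c2 i) v) <= K * nm v.
  by move=> i; have [K K0 hK] := b (c2 i); exists K.
have s0 : 0 <= \sum_i K2 i by apply: sumr_ge0 => i _; case: (hK2 i).
exists (1 + K1 + \sum_i K2 i) => [|v]; first lra.
have hl i : K2 i <= \sum_i K2 i.
  by rewrite (bigD1 i) //= lerDl sumr_ge0 // => j _; case: (hK2 j).
have v0 := nm_ge0 v.
rewrite nm_pair ge_max /=; apply/andP; split.
  by apply: le_trans (hK1 v) _; apply: ler_wpM2r => //; lra.
apply: nm_mx_le => [|i j]; first by rewrite mulr_ge0 //; lra.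
rewrite mxE; apply: le_trans ((hK2 i).2 v) _; apply: ler_wpM2r => //.
by have := hl i; lra.
Qed.

(** The quadratic remainders of the coordinates are little-o of [v], and uniqueness of differentials
    identifies the derivative with [xdiff]. *)
Lemma xze_diff : differentiable Phi p /\ forall v, 'd Phi p v = xdiff v.
Proof.
have cL : continuous (xdiff : _ -> _).
  move=> v; apply/cvgrPdist_lt => e e0; have [K K0 hK] := xdiff_bound.
  have er : e = RtoC (complex.Re e) by rewrite /RtoC RRe_real // ger0_real // ltW.
  have e1 : 0 < complex.Re e by rewrite -RtoC_lt -er.
  apply/(@nbhs_nmP R (C * 'cV[C]_n)%type); exists (complex.Re e / K) => [|q hq]; first by rewrite divr_gt0.
  rewrite er nm_lt -linearB; apply: le_lt_trans (hK _) _.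
  by rewrite nm_distC mulrC -ltr_pdivlMr.
pose V : normedModType C := (C * 'cV[C]_n)%type.
pose Phi' : V -> V := Phi; pose xd : {linear V -> V} := xdiff.
have dF : Phi' \o shift (p : V) = cst (Phi' p) + (xd : V -> V) +o_ (0 : V) id.
  apply/eqaddoP => e e0.
  have er : e = RtoC (complex.Re e) by rewrite /RtoC RRe_real // ger0_real // ltW.
  have e1 : 0 < complex.Re e by rewrite -RtoC_lt -er.
  have [K1 hK1] := xze_lin rho_gt0 h1.
  have /choice [K2 hK2] := fun i => xze_lin rho_gt0 (@h2 i).
  pose K := `|K1| + \sum_i `|K2 i|.
  have K0 : 0 <= K by rewrite addr_ge0 ?normr_ge0 // sumr_ge0.
  have KK2 i : K2 i <= K.
    rewrite /K (bigD1 i) //= addrCA (le_trans (ler_norm _)) // lerDl addr_ge0 ?normr_ge0 //.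
    by rewrite sumr_ge0.
  have KK1 : K1 <= K by rewrite (le_trans (ler_norm _)) // lerDl sumr_ge0.
  apply/nbhs_nmP; exists (Num.min (rho / 2) (complex.Re e / (K + 1))).
    by rewrite lt_min !divr_gt0 // ltr_wpDl.
  move=> v; rewrite subr0 lt_min => /andP[v1 v2].
  suff h : nm (Phi (v + p : C * 'cV[C]_n) - (Phi p + xdiff v)) <= complex.Re e * nm v.
    by rewrite er !nmE -RtoCM RtoC_le; exact: h.
  rewrite [(v : C * 'cV[C]_n) + p]addrC.
  apply: (@le_trans _ _ (K * nm v ^+ 2)); last first.
    rewrite expr2 mulrA; apply: ler_wpM2r; first exact: nm_ge0.
    have K1' : 0 < K + 1 by lra.
    move: v2; rewrite ltr_pdivlMr // => v2; have := nm_ge0 v; lra.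
  have nn : 0 <= K * nm v ^+ 2 by rewrite mulr_ge0 ?exprn_ge0 ?nm_ge0.
  have s0 : 0 <= nm v ^+ 2 by rewrite exprn_ge0 ?nm_ge0.
  rewrite nm_pair ge_max; apply/andP; split.
    by apply: le_trans (hK1 v v1) _; exact: ler_wpM2r.
  apply: nm_mx_le => // i j; rewrite !mxE (ord1 j).
  by apply: le_trans (hK2 i v v1) _; exact: ler_wpM2r.
have e := @diff_unique _ V V Phi' xd p cL dF; split; last by move=> v; rewrite e.
by apply/diff_locallyP; rewrite e.
Qed.

Lemma xze_analytic : exists c : T -> C * 'cV[C]_n,
  \forall q \near p, has_sum (fun a => monom_xz a (q - p) *: c a) (Phi q).
Proof.
exists (fun a => (c1 a, \col_i c2 i a)); apply/nbhs_nmP; exists rho => // q hq.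
apply/hs_has_sum; apply: hs_cons => /=.
  by have := h1 hq; rewrite pair_subKC; exact: eq_hs.
apply: hs_col => i j; rewrite (ord1 j); have := h2 i hq; rewrite pair_subKC.
by apply: eq_hs => a; rewrite !mxE.
Qed.

End Differential.

Lemma xze_col m (F : C * 'cV[C]_n -> 'cV[C]_m) p rho (c : 'I_m -> T -> C) : 0 < rho ->
  (forall i, xze p rho (fun q => F q i 0) (c i)) -> exists c' : T -> 'cV[C]_m,
  \forall q \near p, has_sum (fun a => monom_xz a (q - p) *: c' a) (F q).
Proof.
move=> rho0 h; exists (fun a => \col_i c i a); apply/nbhs_nmP; exists rho => // q hq.
apply/hs_has_sum; apply: hs_col => i j; rewrite (ord1 j); have := h i _ hq; rewrite pair_subKC.
by apply: eq_hs => a; rewrite !mxE.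
Qed.

Lemma xze_scalar (F : C * 'cV[C]_n -> C) p rho (c : T -> C) : 0 < rho ->
  xze p rho F c -> exists c' : T -> C,
  \forall q \near p, has_sum (fun a => monom_xz a (q - p) *: c' a) (F q).
Proof.
move=> rho0 h; exists c; apply/nbhs_nmP; exists rho => // q hq.
by apply/hs_has_sum; have := h _ hq; rewrite pair_subKC.
Qed.

Lemma xze_fiber (F : C * 'cV[C]_n -> C) x0 z0 rho (c : T -> C) : 0 < rho ->
  xze (x0, z0) rho F c -> exists c' : mindex n -> C,
  \forall z \near z0, has_sum (fun d => monom d (z - z0) *: c' d) (F (x0, z)).
Proof.
move=> rho0 h; exists (fun d => c (0%N, d)); apply/nbhs_nmP; exists rho => // z hz.
apply/hs_has_sum; have := h (0, z - z0); rewrite nm_pair /= nm0.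
rewrite gt_max rho0 hz => /(_ isT); rewrite (_ : (x0, z0) + (0, z - z0) = (x0, z)); last first.
  by congr pair; rewrite /= ?addr0 // addrC subrK.
pose f (d : mindex n) : T := (0%N, d).
have fi : injective f by move=> d d' [].
move=> /(hs_inj (f := f) (a := fun a => monom_xz a (0, z - z0) * c a)) h'.
apply: eq_hs (h' fi _) => [d|]; first by rewrite /monom_xz /= expr0 mul1r.
by move=> [[|m] d] hf; [case: (hf d)|rewrite /monom_xz /= expr0n mul0r mul0r].
Qed.

End JointExpansion.

                                    

(** * Sectors, the Borel domain and admissible directions *)

Section Geometry.
Variable R : realType.
Local Notation C := (Cx R).

Lemma nm_polar (rho t : R) : 0 <= rho -> nm (RtoC rho * cis t : C) = rho.
Proof. by move=> r0; rewrite nmM nm_cis mulr1 nm_RtoC ger0_norm. Qed.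

Lemma polar_neq0 (rho t : R) : 0 < rho -> RtoC rho * cis t != 0 :> C.
Proof.
move=> r0; apply/negP => /eqP e; have := nm_polar t (ltW r0); rewrite e nm0 => e0.
by rewrite -e0 ltxx in r0.
Qed.

Lemma sectorP (theta al : R) (w : C) : sector theta al w <->
  exists rho t : R, [/\ 0 < rho, `|t - theta| < al / 2 & w = RtoC rho * cis t].
Proof.
split=> [[w0 [t [ht hw]]]|[rho [t [r0 ht ->]]]].
  by exists (nm w), t; split=> //; exact: nm_gt0.
split; first exact: polar_neq0.
by exists t; split=> //; rewrite nmE nm_polar // ltW.
Qed.

Lemma polarP (b : C) : exists g : R, `|g| <= pi /\ b = RtoC (nm b) * cis g.
Proof.
have [->|b0] := eqVneq b 0.
  by exists 0; rewrite normr0 pi_ge0 nm0 RtoC0 mul0r.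
have n0 := nm_gt0 b0; pose u := RtoC (nm b)^-1 * b.
have bu : b = RtoC (nm b) * u.
  by rewrite /u mulrA -RtoCM divff ?gt_eqF // RtoC1 mul1r.
have u1 : nm u = 1 by rewrite /u nmM nm_RtoC ger0_norm ?invr_ge0 ?(ltW n0) // mulVf // gt_eqF.
have sq : ReC u ^+ 2 + ImC u ^+ 2 = 1 by rewrite -nm_sqr u1 expr1n.
have Ru : -1 <= ReC u <= 1 by rewrite -ler_norml -u1 nm_Re.
have c1 : cos (acos (ReC u)) = ReC u by rewrite acosK // in_itv.
have s1 : sin (acos (ReC u)) = `|ImC u|.
  by rewrite sin_acos // -[X in Num.sqrt (X - _)]sq addrAC subrr add0r sqrtr_sqr.
have a0 := acos_ge0 Ru; have api := acos_lepi Ru.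
rewrite bu nmM u1 mulr1 nm_RtoC ger0_norm ?(ltW n0) //.
have [i0|i0] := leP 0 (ImC u).
  exists (acos (ReC u)); rewrite ger0_norm // api; split=> //; congr (_ * _).
  by rewrite /cis c1 s1 ger0_norm //; case: (u).
exists (- acos (ReC u)); rewrite normrN ger0_norm // api; split=> //; congr (_ * _).
by rewrite /cis cosN sinN c1 s1 ltr0_norm // opprK; case: (u).
Qed.

Section Omega.
Variables (theta al rho0 : R).
Hypothesis rho0_gt0 : 0 < rho0.

(** The sector together with a disc at 0: the disc supplies Taylor expansions at the origin, and the
    union is star-shaped about 0. *)
Definition bdom : set C := [set w | sector theta al w \/ nm w < rho0].

Lemma bdom_open w : bdom w -> exists2 r : R, 0 < r & forall v, nm (v - w) < r -> bdom v.
Proof.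
case=> [/sectorP[rho [t [r0 ht wE]]]|wr]; last first.
  exists (rho0 - nm w) => [|v hv]; first by rewrite subr_gt0.
  by right; rewrite -(subrK w v); apply: le_lt_trans (nmD _ _) _; lra.
have [|d d0 hd] := @polar_near1 R (al / 2 - `|t - theta|); first by rewrite subr_gt0.
have w0 : w != 0 by rewrite wE polar_neq0.
have nw : 0 < nm w by exact: nm_gt0.
exists (Num.min d 1 * nm w) => [|v hv]; first by rewrite mulr_gt0 // lt_min d0 ltr01.
have hq : nm (v / w - 1) < Num.min d 1.
  by rewrite -(divff w0) -mulrBl nmM nmV ltr_pdivrMr.
move: hq; rewrite lt_min => /andP[/hd[t' ht' hv'] h1].
have vw0 : 0 < nm (v / w).
  apply: nm_gt0; apply/negP => /eqP e; move: h1.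
  by rewrite e sub0r nmN nm1 ltxx.
left; apply/sectorP; exists (nm (v / w) * rho), (t' + t); split.
- by rewrite mulr_gt0.
- by rewrite -addrA; apply: le_lt_trans (ler_normD _ _) _; lra.
by rewrite RtoCM cisD mulrACA -wE -hv' divfK.
Qed.

Lemma bdom_star w (s : R) : bdom w -> 0 <= s <= 1 -> bdom (RtoC s * w).
Proof.
move=> hw /andP[s0 s1]; have [->|sn] := eqVneq s 0.
  by right; rewrite RtoC0 mul0r nm0.
have {sn}s0' : 0 < s by rewrite lt_def sn.
case: hw => [/sectorP[rho [t [r0 ht ->]]]|wr]; [left|right].
  by apply/sectorP; exists (s * rho), t; split=> //; rewrite ?mulr_gt0 // RtoCM mulrA.
by rewrite nmM nm_RtoC ger0_norm //; apply: le_lt_trans wr; rewrite ler_piMl ?nm_ge0.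
Qed.

Lemma bdom_ray t : `|t - theta| < al / 2 -> in_ray bdom (cis t).
Proof.
move=> ht s s0; have [->|sn] := eqVneq s 0.
  by right; rewrite RtoC0 mul0r nm0.
by left; apply/sectorP; exists s, t; split=> //; rewrite lt_def sn.
Qed.

End Omega.

(** A larger angle only lowers the cosine, so the angle may be taken to be [dl]; the inequality is
    then [(s - m cos dl)^2 >= 0]. *)
Lemma nm_sub_cis_ge (s dl g : R) (b : C) : 0 <= s -> 0 <= dl <= `|g| -> `|g| <= pi ->
  b = RtoC (nm b) * cis g -> nm b * sin dl <= nm (RtoC s - b).
Proof.
move=> s0 /andP[d0 dg] gp bE; set m := nm b in bE *.
have m0 : 0 <= m by exact: nm_ge0.
have cg : cos g <= cos dl.
  have -> : cos g = cos `|g|.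
    by have [g0|g0] := leP 0 g; [rewrite ger0_norm|rewrite ltr0_norm // cosN].
  by apply: cos_le_norm => //; rewrite ger0_norm.
have rE : ReC (RtoC s - b) = s - m * cos g by rewrite bE /ReC /= mul0r subr0.
have iE : ImC (RtoC s - b) = - (m * sin g) by rewrite bE /ImC /= mul0r addr0 add0r.
rewrite -ler_sqr ?nnegrE ?nm_ge0 //; last first.
  by rewrite mulr_ge0 // sin_ge0_pi // d0 (le_trans dg).
rewrite nm_sqr rE iE exprMn sin2cos2 sqrrN exprMn [sin g ^+ 2]sin2cos2.
have : s * m * cos g <= s * m * cos dl by apply: ler_wpM2l => //; rewrite mulr_ge0.
have := sqr_ge0 (s - m * cos dl); rewrite !expr2; lra.
Qed.

(** For [w] in the sector, the argument of [w ^+ k] is within [xi / 4] of [k theta] while that of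
    [a] is at least [xi / 2] away, so they enclose an angle of at least [xi / 4]. For [w] in the
    disc, [w ^+ k] has at most half the modulus of [a]. *)
Lemma pow_sub_ge (k : nat) (theta al rho0 xi c : R) (a w : C) : 0 < rho0 ->
  rho0 ^+ k <= c / 2 -> 0 < xi -> xi <= pi -> k%:R * al <= xi / 2 ->
  c <= nm a -> ~ sector (k%:R * theta) xi a -> bdom theta al rho0 w ->
  0 < c -> Num.min (c / 2) (c * sin (xi / 4)) <= nm (w ^+ k - a) /\
  Num.min (nm a / 2) (nm a * sin (xi / 4)) <= nm (w ^+ k - a).
Proof.
move=> rho00 hrho xi0 xipi kal ca nsec hw c0.
have sx : 0 <= sin (xi / 4) by apply: sin_ge0_pi; lra.
suff h : Num.min (nm a / 2) (nm a * sin (xi / 4)) <= nm (w ^+ k - a).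
  split=> //; apply: le_trans h; rewrite le_min !ge_min ler_wpM2r ?invr_ge0 //=.
  by apply/orP; right; apply: ler_wpM2r.
case: hw => [/sectorP[rho [t [r0 ht ->]]]|wr]; last first.
  rewrite ge_min; apply/orP; left.
  have h1 : nm (w ^+ k) <= c / 2.
    by rewrite nmX (le_trans _ hrho) // lerXn2r ?nnegrE ?nm_ge0 // ltW.
  have := nmB (w ^+ k) (w ^+ k - a); rewrite opprB addrCA subrr addr0; lra.
rewrite ge_min; apply/orP; right.
have a0 : a != 0 by apply/negP => /eqP e; rewrite e nm0 in ca; lra.
have na := nm_gt0 a0.
have [g [gp bE]] := polarP (a * cis (- (k%:R * t))).
have nb : nm (a * cis (- (k%:R * t))) = nm a by rewrite nmM nm_cis mulr1.
have aE : a = RtoC (nm a) * cis (k%:R * t + g).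
  by rewrite addrC cisD mulrA -nb -bE -mulrA -cisD addNr cis0 mulr1.
have gx : xi / 4 <= `|g|.
  rewrite leNgt; apply/negP => hg; apply: nsec; apply/sectorP; exists (nm a), (k%:R * t + g); split=> //.
  have -> : k%:R * t + g - k%:R * theta = k%:R * (t - theta) + g by ring.
  apply: le_lt_trans (ler_normD _ _) _; rewrite normrM ger0_norm //.
  have : k%:R * `|t - theta| <= k%:R * (al / 2) by apply: ler_wpM2l => //; exact: ltW.
  lra.
have := @nm_sub_cis_ge (rho ^+ k) (xi / 4) g (a * cis (- (k%:R * t))).
rewrite nb exprn_ge0 ?(ltW r0) // gx andbT => /(_ isT); rewrite nb in bE.
move=> /(_ (ltac:(lra)) gp bE) /le_trans; apply.
rewrite [leLHS](_ : _ = nm ((RtoC rho * cis t) ^+ k - a)) //.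
have -> : RtoC (rho ^+ k) - a * cis (- (k%:R * t)) = ((RtoC rho * cis t) ^+ k - a) * cis (- (k%:R * t)).
  by rewrite mulrBl exprMn cisX -RtoCX -mulrA -cisD subrr cis0 mulr1.
by rewrite nmM nm_cis mulr1.
Qed.

Section Domain.
Variables (k : nat) (theta al mu : R).
Hypothesis k_gt0 : (0 < k)%N.
Hypothesis al_gt0 : 0 < al.
Hypothesis mu_gt0 : 0 < mu.
Hypothesis al_pi : k%:R * al <= pi.

Definition xdom : set C := [set x | exists2 t, `|t - theta| < al / 2 & laplace_domain k mu t x].

Let K0 : 0 < k%:R :> R. Proof. by rewrite ltr0n. Qed.

(** Turn from [theta] towards [tau] by at most [3 al / 8]: the remaining angle is at most
    [pi / (2k) - al / 16], and [k] times it has cosine at least [sin (k al / 16)]. This margin is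
    uniform up to the boundary. *)
Lemma good_direction (rho tau : R) : 0 < rho -> `|tau - theta| <= pi / (2 * k%:R) + al * 5 / 16 ->
  exists2 t, `|t - theta| < al / 2 & `|tau - t| < pi / (2 * k%:R) /\
     sin (k%:R * al / 16) <= cos (k%:R * (tau - t)).
Proof.
move=> r0 ht; have al0 := al_gt0; pose d := tau - theta; pose b := al * 3 / 8.
have b0 : 0 < b by rewrite /b divr_gt0 // mulr_gt0.
have q0 : 0 < pi / (2 * k%:R) :> R by rewrite divr_gt0 ?pi_gt0 // mulr_gt0.
have [e he [hd1 hd2]] : exists2 e, `|e| <= b & `|d - e| <= pi / (2 * k%:R) - al / 16 /\ `|d - e| < pi / (2 * k%:R).
  have q1 : 0 <= pi / (2 * k%:R) - al / 16.
    rewrite subr_ge0 ler_pdivlMr ?mulr_gt0 //; rewrite [leLHS](_ : _ = k%:R * al / 8); last by field.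
    by rewrite ler_pdivrMr // (le_trans al_pi) // ler_peMr ?pi_ge0 // ler1n.
  have /andP[h1 h2] : - (pi / (2 * k%:R) + al * 5 / 16) <= d <= pi / (2 * k%:R) + al * 5 / 16.
    by rewrite -ler_norml.
  have [hb|hb] := leP `|d| b; first by exists d; rewrite // subrr normr0.
  have [d0|d0] := leP 0 d.
    exists b; rewrite ?ger0_norm ?(ltW b0) //; rewrite ger0_norm in hb => //.
    - by split; rewrite /b; lra.
    by rewrite subr_ge0 ltW.
  exists (- b); first by rewrite normrN ger0_norm // ltW.
  rewrite ltr0_norm // in hb.
  rewrite ler0_norm; last by lra.
  split; rewrite /b; lra.
exists (theta + e); first by rewrite addrC addKr; apply: le_lt_trans he _; rewrite /b; lra.
have -> : tau - (theta + e) = d - e by rewrite /d; ring.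
split=> //; rewrite -cosBpihalf -[leLHS]cosN opprB.
apply: cos_le_norm.
  rewrite normrM (ger0_norm (ltW K0)); apply: le_trans (ler_wpM2l (ltW K0) hd1) _.
  by rewrite le_eqVlt; apply/orP; left; apply/eqP; field; rewrite gt_eqF.
have := pi_gt0 R; have : 0 <= k%:R * al / 16 by rewrite divr_ge0 // mulr_ge0 // ltW.
lra.
Qed.

Lemma laplace_domain_polar (rho tau t : R) : 0 < rho -> `|tau - t| < pi / (2 * k%:R) ->
  laplace_domain k mu t (RtoC rho * cis tau) <-> (mu * rho) ^+ k < cos (k%:R * (tau - t)).
Proof.
move=> r0 ht; split=> [h|h]; last by exists rho, tau.
have mu0 := ltW mu_gt0.
have [_] := laplace_domain_Re mu0 h.
by rewrite ReC_cisX ?gt_eqF // ltr_pdivlMr ?exprn_gt0 // exprMn.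
Qed.

Lemma good_laplace (rho tau : R) : 0 < rho -> `|tau - theta| <= pi / (2 * k%:R) + al * 5 / 16 ->
  (mu * rho) ^+ k < sin (k%:R * al / 16) ->
  exists2 t, `|t - theta| < al / 2 & laplace_domain k mu t (RtoC rho * cis tau) /\
    sin (k%:R * al / 16) <= rho ^+ k * @ReC R (cis t ^+ k * ((RtoC rho * cis tau) ^+ k)^-1).
Proof.
move=> r0 ht hm; have [t tt [h1 h2]] := good_direction r0 ht.
exists t => //; split.
  by apply/laplace_domain_polar => //; exact: lt_le_trans h2.
by rewrite ReC_cisX ?gt_eqF // mulrCA mulfV ?mulr1 // expf_neq0 // gt_eqF.
Qed.

Lemma omega_polar nu (x : C) : omega k nu theta (al / 2) x ->
  exists rho tau : R, [/\ 0 < rho, rho < nu, `|tau - theta| <= pi / (2 * k%:R) + al / 4 & x = RtoC rho * cis tau].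
Proof.
case=> xn /sectorP[rho [tau [r0 ht xE]]]; exists rho, tau; split=> //.
  by move: xn; rewrite nm_lt xE nm_polar // ltW.
apply: ltW; apply: lt_le_trans ht _; rewrite le_eqVlt; apply/orP; left; apply/eqP.
by field; rewrite gt_eqF.
Qed.

(** The half-opening grows from [pi / (2k) + al / 4] to [pi / (2k) + 5 al / 16]; the slack [al / 16]
    absorbs the approximation by points of [omega]. *)
Lemma closure_omega_polar nu (x : C) : closure (omega k nu theta (al / 2)) x -> x != 0 ->
  exists rho tau : R, [/\ 0 < rho, rho <= nu, `|tau - theta| <= pi / (2 * k%:R) + al * 5 / 16 & x = RtoC rho * cis tau].
Proof.
move=> hx x0; have nx := nm_gt0 x0; have al0 := al_gt0.
have near_om e : 0 < e -> exists2 y, omega k nu theta (al / 2) y & nm (y - x) < e.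
  move=> e0; have [|y [oy hy]] := hx [set y | nm (y - x) < e]; last by exists y.
  by apply/nbhs_nmP; exists e.
have xnu : nm x <= nu.
  rewrite leNgt; apply/negP => h; have [|y /omega_polar[rho [tau [r0 rn _ yE]]] hy] := near_om (nm x - nu).
    by rewrite subr_gt0.
  have := nmD (x - y) y; rewrite subrK nm_distC; have : nm y = rho by rewrite yE nm_polar // ltW.
  lra.
have [|d d0 hd] := @polar_near1 R (al / 16); first by rewrite divr_gt0.
have [|y /omega_polar[rho [tau [r0 rn ht yE]]] hy] := near_om (d * nm x); first by rewrite mulr_gt0.
have : nm (y / x - 1) < d by rewrite -(divff x0) -mulrBl nmM nmV ltr_pdivrMr.
move=> /hd[e he ve]; exists (nm x), (tau - e); split=> //.
  rewrite addrAC; apply: le_trans (ler_normB _ _) _; lra.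
have nq : nm (y / x) = rho / nm x by rewrite nmM nmV yE nm_polar // ltW.
have yx : y = x * (RtoC (rho / nm x) * cis e) by rewrite -nq -ve mulrCA mulfV // mulr1.
have q0 : RtoC rho != 0 by rewrite -RtoC0; apply/negP => /eqP /RtoC_inj e0; rewrite e0 ltxx in r0.
have p0 : RtoC (nm x) != 0 by rewrite -RtoC0; apply/negP => /eqP /RtoC_inj e0; rewrite e0 ltxx in nx.
have : x * cis e = RtoC (nm x) * cis tau.
  have := yx; rewrite {1}yE RtoCM RtoCV => h.
  by apply: (mulfI q0); rewrite [RHS]mulrCA h; field.
rewrite cisD cisN mulrA => <-; rewrite mulfK //; exact: cis_neq0.
Qed.

(** Both conditions are strict: the argument moves little by [polar_near1], and the real part moves
    little because [(x ^+ k)^-1] has a derivative at [x0], whence the Lipschitz constant [L]. *)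
Lemma laplace_domain_open t (x0 : C) : laplace_domain k mu t x0 ->
  exists2 r : R, 0 < r < nm x0 & forall x, nm (x - x0) < r -> laplace_domain k mu t x.
Proof.
move=> h; have mu0 := ltW mu_gt0; have [xn hR] := laplace_domain_Re mu0 h.
have nx := nm_gt0 xn.
case: h => rho [tau [r0 xE ht hc]].
have [|d d0 hd] := @polar_near1 R (pi / (2 * k%:R) - `|tau - t|); first by rewrite subr_gt0.
have [K [d' [K00 d'0 hK]]] := der_inv_exp k xn.
set b : C := - (k%:R / x0 ^+ k.+1) in hK; pose L := nm b + K + 1.
have L0 : 0 < L by rewrite /L; have := nm_ge0 b; lra.
pose gap := @ReC R (cis t ^+ k * (x0 ^+ k)^-1) - mu ^+ k.
have gap0 : 0 < gap by rewrite subr_gt0.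
pose r := Num.min (Num.min (d * nm x0) (nm x0 / 2)) (Num.min (Num.min d' 1) (gap / L)).
have rp : 0 < r by rewrite !lt_min !mulr_gt0 ?d'0 ?invr_gt0 ?ltr01.
exists r => [|x]; first by rewrite rp /r !gt_min ltr_pdivrMr // ltr_pMr ?ltr1n // orbT.
rewrite !lt_min => /andP[/andP[h1 h2] /andP[/andP[h3 h4] h5]].
have : nm (x / x0 - 1) < d by rewrite -(divff xn) -mulrBl nmM nmV ltr_pdivrMr.
move=> /hd[e he ve].
have x_neq0 : x != 0.
  apply/negP => /eqP e0; move: h2; rewrite e0 sub0r nmN; have := nx; lra.
have n0 := nm_gt0 x_neq0.
have xP : x = RtoC (nm x) * cis (e + tau).
  have rE : nm x0 = rho by rewrite xE nm_polar // ltW.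
  rewrite -[LHS](divfK xn) ve nmM nmV rE RtoCM RtoCV cisD [X in _ * X = _]xE.
  have q0 : RtoC rho != 0 by rewrite -RtoC0; apply/negP => /eqP /RtoC_inj e0; rewrite e0 ltxx in r0.
  by field.
rewrite xP; apply/laplace_domain_polar => //.
  by rewrite -addrA; apply: le_lt_trans (ler_normD _ _) _; lra.
rewrite exprMn -ltr_pdivlMr ?exprn_gt0 // -ReC_cisX ?gt_eqF // -xP.
have hF : nm ((x ^+ k)^-1 - (x0 ^+ k)^-1) <= L * nm (x - x0).
  have := hK (x - x0) h3; rewrite [x0 + _]addrC subrK => hh.
  have -> : (x ^+ k)^-1 - (x0 ^+ k)^-1 = ((x ^+ k)^-1 - (x0 ^+ k)^-1 - b * (x - x0)) + b * (x - x0) by rewrite subrK.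
  apply: le_trans (nmD _ _) _; rewrite nmM.
  have : K * nm (x - x0) ^+ 2 <= K * nm (x - x0).
    by apply: ler_wpM2l => //; rewrite expr2 ler_piMr ?nm_ge0 // ltW.
  have := nm_ge0 (x - x0); rewrite /L; nra.
have hg : L * nm (x - x0) < gap by rewrite mulrC -ltr_pdivlMr.
have := nm_Re (cis t ^+ k * (x ^+ k)^-1 - cis t ^+ k * (x0 ^+ k)^-1).
rewrite -mulrBr nmM nmX nm_cis expr1n mul1r => hRe.
have {hRe} := le_lt_trans hRe (le_lt_trans hF hg).
rewrite ltr_norml mulrBr => /andP[hl _].
have eB (u v : C) : ReC (u - v) = ReC u - ReC v by case: u; case: v.
by move: hl; rewrite eB /gap; lra.
Qed.

End Domain.

End Geometry.

(** * Sums of Borel series as functions of x and z *)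

Section Character.
Variable R : realType.
Variables (k : nat) (theta al rho0 q : R).
Hypothesis k_gt0 : (0 < k)%N.
Hypothesis al_gt0 : 0 < al.
Hypothesis al_pi : al < pi.
Hypothesis kal_pi : k%:R * al <= pi.
Hypothesis rho0_gt0 : 0 < rho0.
Hypothesis q_gt0 : 0 < q.
Local Notation C := (Cx R).
Local Notation bel := (bel R).
Local Notation Om := (bdom theta al rho0).
Local Notation p := (q ^+ k).
Local Notation mu := (2 * q).
Local Notation good := (bgood k Om p).
Local Notation xdom := (xdom k theta al mu).

Let p_gt0 : 0 < p. Proof. exact: exprn_gt0. Qed.
Let p_ge0 : 0 <= p. Proof. exact: ltW. Qed.
Let mu_gt0 : 0 < mu. Proof. by rewrite mulr_gt0. Qed.
Let mu_ge0 : 0 <= mu. Proof. exact: ltW. Qed.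
Let Om_open w : Om w -> exists2 r : R, 0 < r & forall v, nm (v - w) < r -> Om v.
Proof. exact: bdom_open. Qed.
Let Om_star := @bdom_star R theta al rho0 rho0_gt0.
Let hray t (ht : `|t - theta| < al / 2) : in_ray Om (cis t) := bdom_ray rho0_gt0 ht.

Let p_mu : p <= mu ^+ k.
Proof. by rewrite exprMn ler_peMl // exprn_ege1 // ler1n. Qed.

Definition xdir (x : C) : R := if pselect (xdom x) is left h then proj1_sig (cid2 h) else 0.

(** Evaluation at [x] along a chosen ray; [chixE] shows that the choice does not matter. Off [xdom],
    in particular at [x = 0], the constant term is taken; it is again a character, so the evaluation
    lemmas hold for every [x]. *)
Definition chix (x : C) (v : bel) : C :=
  if pselect (xdom x) is left h then bchi k (cis (xdir x)) (x ^+ k)^-1 v else bval0 v.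

                                                                                         
(** The value at [x] of (1/k) x^(k+1) d/dx applied to the sum, as [chix_pser] shows. *)
Definition ldx (x : C) (v : bel) : C := LA k (cis (xdir x)) (x ^+ k)^-1 (fun w => w ^+ k * v.1.2 w).

Lemma xdirP x : xdom x -> `|xdir x - theta| < al / 2 /\ laplace_domain k mu (xdir x) x.
Proof. by rewrite /xdir; case: pselect => // h _; case: cid2. Qed.

Lemma ldom_Re t x : laplace_domain k mu t x -> p <= ReC (cis t ^+ k * (x ^+ k)^-1).
Proof.
by move=> h; have [_ h2] := laplace_domain_Re mu_ge0 h; apply: le_trans p_mu (ltW h2).
Qed.

Lemma ldom_Re1 t x : laplace_domain k mu t x -> p * nm (cis t : C) ^+ k <= ReC (cis t ^+ k * (x ^+ k)^-1).
Proof. by move=> h; rewrite nm_cis expr1n mulr1; exact: ldom_Re. Qed.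

Lemma chixE t x v : `|t - theta| < al / 2 -> laplace_domain k mu t x -> good v ->
  chix x v = bchi k (cis t) (x ^+ k)^-1 v.
Proof.
move=> ht hx [a ha _]; rewrite /chix; case: pselect => [h|]; last by case; exists t.
have [ht' hx'] := xdirP h; rewrite /bchi; congr (_ + _).
apply: (ray_indep_domain k_gt0 Om_open p_ge0 ha mu_ge0 _ al_pi (@hray)) ht' ht hx' hx.
by rewrite exprMn mulrC.
Qed.

Lemma chix_out x v : ~ xdom x -> chix x v = bval0 v.
Proof. by move=> h; rewrite /chix; case: pselect. Qed.

Lemma xdom0 : ~ xdom (0 : C).
Proof. by move=> [t _ /(laplace_domain_Re mu_ge0)[]]; rewrite eqxx. Qed.

Section At.
Variable x : C.

Lemma chix0 : chix x 0 = 0.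
Proof. by rewrite /chix; case: pselect => // h; exact: bchi0. Qed.

Lemma chix1 : chix x (bone R) = 1.
Proof. by rewrite /chix; case: pselect => // h; exact: bchi1. Qed.

Lemma chixD u v : good u -> good v -> chix x (u + v) = chix x u + chix x v.
Proof.
move=> gu gv; rewrite /chix; case: pselect => // h; have [ht hx] := xdirP h.
exact: (bchiD Om_open p_gt0 (hray ht) (nm_cis _) (ldom_Re hx)).
Qed.

Lemma chixM u v : good u -> good v -> chix x (bmul k u v) = chix x u * chix x v.
Proof.
move=> gu gv; rewrite /chix; case: pselect => // h; have [ht hx] := xdirP h.
exact: (bchiM k_gt0 Om_open Om_star p_gt0 (hray ht) (nm_cis _) (ldom_Re hx)).
Qed.

Lemma chixZ c v : good v -> chix x (bZ c v) = c * chix x v.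
Proof.
move=> gv; rewrite /chix; case: pselect => // h; have [ht hx] := xdirP h.
exact: (bchiZ Om_open p_gt0 (hray ht) (nm_cis _) (ldom_Re hx)).
Qed.

Lemma chix_le v : good v -> nm (chix x v) <= bnv v.
Proof.
move=> gv; rewrite /chix; case: pselect => h; last exact: bval0_le gv.
have [ht hx] := xdirP h.
exact: (bchi_le Om_open p_gt0 (hray ht) (nm_cis _) (ldom_Re hx)).
Qed.

Lemma chixX m : q^-1 <= m -> xdom x -> chix x (bX k m) = x.
Proof.
move=> qm [t ht hx]; rewrite (chixE ht hx); last exact: (bgoodX k_gt0 Om p_gt0 q_gt0).
rewrite /bchi /bX /= add0r (LA_cst k_gt0 _ mu_ge0 hx) -RtoCM mulVf ?RtoC1 ?mul1r //.
by rewrite gt_eqF // gam_gt0.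
Qed.

End At.

(** One ray serves a whole disc around [x0], so all good elements expand on a common disc and their
    expansions can be summed; the coefficient of degree 1 gives [ldx]. *)
Lemma chix_pser x0 : xdom x0 -> exists2 r, 0 < r & exists b : bel -> nat -> C,
  (forall x, nm (x - x0) < r -> xdom x) /\
  forall v, good v -> pser x0 r (chix^~ v) (b v) /\ k%:R * ldx x0 v = x0 ^+ k.+1 * b v 1%N.
Proof.
move=> hx0; have [ht hx] := xdirP hx0.
have [r /andP[r0 rx] hr] := laplace_domain_open mu_gt0 hx.
exists r => //.
have /choice[b hb] (v : bel) : exists c, good v -> pser x0 r (chix^~ v) c /\
    k%:R * ldx x0 v = x0 ^+ k.+1 * c 1%N.
  have [gv|ngv] := pselect (good v); last by exists (fun=> 0).
  have [a ha _] := gv.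
  have rr : 0 < r < nm x0 by rewrite r0.
  have [c [pc _ e]] := LA_pser k_gt0 Om_open p_ge0 ha (hray ht) (nm_cis _) rr (fun x hxr => ldom_Re (hr x hxr)).
  exists (fun m => (if m == 0%N then v.1.1 else 0) + c m) => _; split; last by rewrite /= add0r.
  apply: (pser_ext (F := fun x => v.1.1 + LA k (cis (xdir x0)) (x ^+ k)^-1 v.1.2)).
    by move=> x hxr; rewrite (chixE ht (hr x hxr) gv).
  exact: (pser_add (@pser_cst R x0 r v.1.1) pc).
by exists b; split=> [x hxr|//]; exists (xdir x0) => //; exact: hr.
Qed.

Lemma ldx_div x (a : C) d v : xdom x -> 0 <= d -> (forall w, Om w -> 1 <= d * nm (w ^+ k - a)) ->
  a != 0 -> 1 <= d * nm a -> good v ->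
  ldx x (bdiv k a d v) - a * chix x (bdiv k a d v) = chix x v.
Proof.
move=> hx d0 hd a0 hda gv; have [ht hl] := xdirP hx.
rewrite (chixE ht hl gv) (chixE ht hl (bgood_div k_gt0 d0 hd hda gv)).
exact: (LA_div k_gt0 Om_open p_gt0 (hray ht) (nm_cis _) (ldom_Re hl) d0 hd a0 gv).
Qed.

Section Sum.
Variable n : nat.
Local Notation T := (nat * mindex n)%type.
Variables (w : 'I_n -> R) (F : T -> bel) (M : R).
Hypothesis w_gt0 : forall i, 0 < w i.
Hypothesis gF : forall t, good (F t).
Hypothesis hM : sbd (fun t => bnv (F t) * wt w t.2) M.

(** The sum as a total function; [valP] gives its meaning on the polydisc of radii [w]. *)
Definition val (a : C * 'cV[C]_n) : C :=
  xget 0 [set s | hs (fun t => chix a.1 (F t) * monom t.2 a.2) s].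

Let term_le x (z : 'cV[C]_n) t : (forall i, nm (z i 0) <= w i) ->
  nm (chix x (F t) * monom t.2 z) <= bnv (F t) * wt w t.2.
Proof. by move=> hz; rewrite nmM ler_pM ?nm_ge0 ?chix_le //; exact: nm_monom. Qed.

Lemma valP x (z : 'cV[C]_n) : (forall i, nm (z i 0) <= w i) ->
  hs (fun t => chix x (F t) * monom t.2 z) (val (x, z)) /\ nm (val (x, z)) <= M.
Proof.
move=> hz; have h : sbd (fun t => nm (chix x (F t) * monom t.2 z)) M.
  by apply: sbd_le (lexx _) hM => t; exact: term_le.
have [s hs' sM] := hs_ex h; rewrite /val.
by case: xgetP => [y _ hy|/(_ s)//]; split=> //; exact: hs_le hy h.
Qed.

(** Besides analyticity it expresses the first-order coefficients as sums, which is how derivatives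
    of the solution enter the transport equation. *)
Lemma val_xze x0 (z0 : 'cV[C]_n) dl : 0 < dl -> xdom x0 -> (forall i, nm (z0 i 0) + dl <= w i) ->
  exists2 D : T -> C, exists2 rad, 0 < rad <= dl & xze (x0, z0) rad val D &
   [/\ hs (fun t => ldx x0 (F t) * monom t.2 z0) (k%:R^-1 * x0 ^+ k.+1 * D (1%N, mzero n)),
     forall s, hs (fun t => chix x0 (F t) * ((t.2 s)%:R * monom (msub t.2 (mone s)) z0)) (D (0%N, mone s)) &
     D (0%N, mzero n) = val (x0, z0)].
Proof.
move=> dl0 hx0 hz; have [r r0 [b [hr hb]]] := chix_pser hx0.
have hz' v : nm v < dl -> forall i, nm ((z0 + v) i 0) <= w i.
  move=> hv i; rewrite mxE; apply: le_trans (nmD _ _) _; apply: le_trans (hz i).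
  by rewrite lerD2l (le_trans (nm_mx_entry _ _ _)) // ltW.
have [|D hD hc] := @joint_expansion _ _ T (fun t => t.2) (fun t x => chix x (F t)) (fun t => b (F t))
    (fun t => bnv (F t)) M w x0 r z0 dl r0 dl0 (fun t => (hb _ (gF t)).1)
    (fun t h _ => chix_le _ (gF t)) hM hz val.
  by move=> h v hh hv; exact: (valP _ (hz' v hv)).1.
have b0 t : b (F t) 0%N = chix x0 (F t).
  by have := pser_at0 r0 (hb _ (gF t)).1.
exists D; first by exists (Num.min r dl) => //; rewrite lt_min r0 dl0 /= ge_min lexx orbT.
split=> [|s|].
- apply: eq_hs (hs_Ml (k%:R^-1 * x0 ^+ k.+1) (hc (1%N, mzero n))) => t.
  rewrite /= mbin0 msub0 mul1r -!mulrA [x0 ^+ _ * _]mulrA -(hb _ (gF t)).2 -mulrA mulKf //.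
  by rewrite pnatr_eq0 -lt0n.
- by apply: eq_hs (hc (0%N, mone s)) => t; rewrite /= b0 mbin1.
apply: (hs_uniq (hc (0%N, mzero n))).
have h0 : forall i, nm (z0 i 0) <= w i by move=> i; apply: le_trans (hz i); rewrite lerDl ltW.
by apply: eq_hs (valP x0 h0).1 => t; rewrite /= b0 mbin0 msub0 mul1r.
Qed.

Section ConstantCoefficients.
Variables (b : T -> C) (K : R).
Hypothesis K0 : 0 <= K.
Hypothesis hb : forall t, nm (b t) <= K * bnv (F t).

(** Series whose coefficients do not depend on [x]: used for the value at [x = 0] and for each
    coefficient of the formal series in [x]. *)
Definition csum (z : 'cV[C]_n) : C := xget 0 [set s | hs (fun t => b t * monom t.2 z) s].

Let sbd_b : sbd (fun t => K * bnv (F t) * wt w t.2) (K * M).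
Proof. by apply: sbd_le (lexx _) (sbdZ K0 hM) => t; rewrite mulrA. Qed.

Lemma csumP (z : 'cV[C]_n) : (forall i, nm (z i 0) <= w i) ->
  hs (fun t => b t * monom t.2 z) (csum z) /\ nm (csum z) <= K * M.
Proof.
move=> hz; have h : sbd (fun t => nm (b t * monom t.2 z)) (K * M).
  by apply: sbd_le (lexx _) sbd_b => t; rewrite nmM ler_pM ?nm_ge0 //; exact: nm_monom.
have [s hs' sM] := hs_ex h; rewrite /csum.
by case: xgetP => [y _ hy|/(_ s)//]; split=> //; exact: hs_le hy h.
Qed.

Lemma csum_xze x0 (z0 : 'cV[C]_n) dl : 0 < dl -> (forall i, nm (z0 i 0) + dl <= w i) ->
  exists D : T -> C, xze (x0, z0) dl (fun a => csum a.2) D.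
Proof.
move=> dl0 hz.
have hz' v : nm v < dl -> forall i, nm ((z0 + v) i 0) <= w i.
  move=> hv i; rewrite mxE; apply: le_trans (nmD _ _) _; apply: le_trans (hz i).
  by rewrite lerD2l (le_trans (nm_mx_entry _ _ _)) // ltW.
have [|D hD _] := @joint_expansion _ _ T (fun t => t.2) (fun t _ => b t)
    (fun t m => if m == 0%N then b t else 0)
    (fun t => K * bnv (F t)) (K * M) w x0 dl z0 dl dl0 dl0 (fun t => @pser_cst R x0 dl _)
    (fun t h _ => hb t) sbd_b hz (fun a => csum a.2).
  by move=> h v hh hv; exact: (csumP (hz' v hv)).1.
by exists D; move: hD; rewrite minxx.
Qed.

End ConstantCoefficients.

Lemma val0E z : val (0, z) = csum (fun t => bval0 (F t)) z.
Proof.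
rewrite /val /csum /=.
have -> // : (fun t => chix 0 (F t) * monom t.2 z) = (fun t => bval0 (F t) * monom t.2 z).
by apply/funext => t; rewrite (chix_out _ xdom0).
Qed.

Lemma xze_cont (p0 : C * 'cV[C]_n) rad (G : C * 'cV[C]_n -> C) D e : 0 < rad -> xze p0 rad G D -> 0 < e ->
  exists2 d, 0 < d & forall a, nm (a - p0) < d -> nm (G a - G p0) < e.
Proof.
move=> r0 hG e0; have [K hK] := xze_lin r0 hG.
pose L := nm (D (1%N, mzero n)) + \sum_s nm (D (0%N, mone s)) + `|K| * rad.
have L0 : 0 <= L.
  by rewrite !addr_ge0 ?nm_ge0 ?mulr_ge0 ?(ltW r0) // sumr_ge0 // => s _; exact: nm_ge0.
exists (Num.min (rad / 2) (e / (L + 1))) => [|a]; first by rewrite lt_min !divr_gt0 // ltr_wpDl.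
rewrite lt_min => /andP[h1 h2]; pose v := a - p0.
have -> : a = p0 + v by rewrite pair_subKC.
have hv := hK v h1.
have hl := nm_xlin D v.
apply: (@le_lt_trans _ _ (L * nm v)).
  have -> : G (p0 + v) - G p0 = (G (p0 + v) - (G p0 + xlin D v)) + xlin D v by ring.
  apply: le_trans (nmD _ _) _; rewrite /L mulrDl addrC; apply: lerD => //.
  apply: le_trans hv _; rewrite expr2 mulrA; apply: ler_wpM2r; first exact: nm_ge0.
  apply: le_trans (_ : `|K| * nm v <= _); first by apply: ler_wpM2r; rewrite ?nm_ge0 ?ler_norm.
  by apply: ler_wpM2l => //; have := h1; rewrite -/v; lra.
have L1 : 0 < L + 1 by lra.
move: h2; rewrite ltr_pdivlMr // -/v; have := nm_ge0 v; lra.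
Qed.

(** [bchi_small] summed over all terms; this is continuity at [x = 0], uniform in [z]. *)
Lemma val_small x (z : 'cV[C]_n) t sg : `|t - theta| < al / 2 -> laplace_domain k mu t x ->
  0 < sg <= 1 -> p <= sg ^+ k * ReC (cis t ^+ k * (x ^+ k)^-1) -> (forall i, nm (z i 0) <= w i) ->
  nm (val (x, z) - val (0, z)) <= sg * M.
Proof.
move=> ht hx sg01 hp hz.
have h1 := (valP x hz).1; have h2 := (valP 0 hz).1.
rewrite -[X in nm (_ + X)]mulN1r; apply: (hs_le (hs_add h1 (hs_Ml (-1) h2))).
have /andP[sg0 _] := sg01.
apply: sbd_le (lexx _) (sbdZ (ltW sg0) hM) => u.
rewrite mulN1r -mulrBl nmM mulrA; apply: ler_pM; rewrite ?nm_ge0 //; last exact: nm_monom.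
rewrite (chixE ht hx (gF u)) (chix_out _ xdom0).
exact: (bchi_small Om_open p_gt0 (hray ht) (nm_cis _) (gF u) sg01 hp).
Qed.

Section BorelTransform.

(** Pointwise bound for Borel transforms of declared size 1, from [maj_growth]. *)
Let G (s : R) : R := expR (p * (s + 1) ^+ k) / k%:R.

Let k0 : 0 < k%:R :> R. Proof. by rewrite ltr0n. Qed.

Let G_gt0 s : 0 < G s. Proof. by rewrite divr_gt0 ?expR_gt0. Qed.

Let G_le s s' : 0 <= s -> s <= s' -> G s <= G s'.
Proof.
move=> s0 ss; rewrite ler_wpM2r ?invr_ge0 ?(ltW k0) // ler_expR ler_wpM2l //.
apply: lerXn2r; rewrite ?nnegrE; lra.
Qed.

(** Since [(s + 1) ^+ k <= 2 ^+ k + 2 ^+ k * s ^+ k], the growth is governed by [mu ^+ k] with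
    [mu = 2 * q]. *)
Let G_growth s : 0 <= s -> G s <= expR (p * 2 ^+ k) / k%:R * expR (mu ^+ k * s ^+ k).
Proof.
move=> s0; rewrite /G mulrAC ler_wpM2r ?invr_ge0 ?(ltW k0) // -expRD ler_expR.
have h : (s + 1) ^+ k <= 2 ^+ k + 2 ^+ k * s ^+ k.
  have [s1|s1] := leP s 1.
    apply: (@le_trans _ _ (2 ^+ k)); first by apply: lerXn2r; rewrite ?nnegrE; lra.
    by rewrite lerDl mulr_ge0 ?exprn_ge0.
  apply: (@le_trans _ _ ((2 * s) ^+ k)); first by apply: lerXn2r; rewrite ?nnegrE; lra.
  by rewrite exprMn lerDr exprn_ge0.
have -> : p * 2 ^+ k + mu ^+ k * s ^+ k = p * (2 ^+ k + 2 ^+ k * s ^+ k) by rewrite exprMn; ring.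
exact: ler_wpM2l.
Qed.

Let F_le v z : good v -> Om z -> nm (v.1.2 z) <= bnv v * G (nm z).
Proof.
move=> [a h hl] Oz; have [_ ha _ _] := h; apply: le_trans (ha z Oz) _.
have := maj_growth p_ge0 h (nm_ge0 z); rewrite /G mulrA ler_pdivlMr // => /le_trans; apply.
apply: ler_wpM2r; first exact: expR_ge0.
by apply: le_trans hl; rewrite lerDr nm_ge0.
Qed.

Definition hval (a : C * 'cV[C]_n) : C :=
  xget 0 [set s | hs (fun t => (F t).1.2 a.1 * monom t.2 a.2) s].

Lemma hvalP y (z : 'cV[C]_n) : Om y -> (forall i, nm (z i 0) <= w i) ->
  hs (fun t => (F t).1.2 y * monom t.2 z) (hval (y, z)) /\ nm (hval (y, z)) <= G (nm y) * M.
Proof.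
move=> Oy hz; have h : sbd (fun t => nm ((F t).1.2 y * monom t.2 z)) (G (nm y) * M).
  apply: sbd_le (lexx _) (sbdZ (ltW (G_gt0 _)) hM) => t.
  rewrite nmM mulrA [G _ * _]mulrC ler_pM ?nm_ge0 //; first exact: F_le.
  exact: nm_monom.
have [s hs' sM] := hs_ex h; rewrite /hval.
by case: xgetP => [v _ hy|/(_ s)//]; split=> //; exact: hs_le hy h.
Qed.

Lemma hval_xze y0 (z0 : 'cV[C]_n) dl : 0 < dl -> Om y0 -> (forall i, nm (z0 i 0) + dl <= w i) ->
  exists2 D : T -> C, exists rad, 0 < rad /\ xze (y0, z0) rad hval D & True.
Proof.
move=> dl0 Oy hz; have [r r0 hr] := Om_open Oy.
have hz' v : nm v < dl -> forall i, nm ((z0 + v) i 0) <= w i.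
  move=> hv i; rewrite mxE; apply: le_trans (nmD _ _) _; apply: le_trans (hz i).
  by rewrite lerD2l (le_trans (nm_mx_entry _ _ _)) // ltW.
have /choice[b hb] : forall t, exists c, pser y0 r (F t).1.2 c.
  by move=> t; have [a [an _ _ _] _] := gF t; exact: an.
have hr' h : nm h < r -> Om (y0 + h) by move=> hh; apply: hr; rewrite addrAC subrr add0r.
have [|||D hD _] := @joint_expansion _ _ T (fun t => t.2) (fun t => (F t).1.2) b
    (fun t => G (nm y0 + r) * bnv (F t)) (G (nm y0 + r) * M) w y0 r z0 dl r0 dl0 hb _ _ hz hval.
- move=> t h hh; apply: le_trans (F_le (gF t) (hr' h hh)) _.
  rewrite mulrC ler_wpM2r //; first exact: bnv_ge0 (gF t).
  by apply: G_le; rewrite ?nm_ge0 // (le_trans (nmD _ _)) // lerD2l ltW.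
- by apply: sbd_le (lexx _) (sbdZ (ltW (G_gt0 _)) hM) => t; rewrite mulrA.
- by move=> h v hh hv; exact: (hvalP (hr' h hh) (hz' v hv)).1.
by exists D => //; exists (Num.min r dl); split=> //; rewrite lt_min r0.
Qed.

(** The Laplace integral and the sum over indices are exchanged; the excess [p'] of the kernel's
    decay over the growth [mu ^+ k] leaves an integrable majorant. *)
Lemma laplace_hval t x (z : 'cV[C]_n) : `|t - theta| < al / 2 -> laplace_domain k mu t x ->
  (forall i, nm (z i 0) <= w i) ->
  hs (fun u => LA k (cis t) (x ^+ k)^-1 (F u).1.2 * monom u.2 z) (laplace k t hval x z).
Proof.
move=> ht hx hz; pose X := (x ^+ k)^-1.
have [_ hR] := laplace_domain_Re mu_ge0 hx; rewrite -/X in hR.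
pose p' := @ReC R (cis t ^+ k * X) - mu ^+ k.
have p'0 : 0 < p' by rewrite subr_gt0.
pose c := expR (p * 2 ^+ k) / k%:R * M.
have M0 : 0 <= M by exact: sbd_ge0 hM.
have c0 : 0 <= c by rewrite !mulr_ge0 ?expR_ge0 ?invr_ge0.
pose Fi (u : T) s := lint k (cis t) X (F u).1.2 s * monom u.2 z.
have lb u s : 0 < s -> nm (lint k (cis t) X (F u).1.2 s) <=
    bnv (F u) * (expR (p * 2 ^+ k) / k%:R * expR (- (p' * s ^+ k)) * k%:R).
  move=> s0; rewrite /lint 3!nmM nm_lker nm_cis mulr1 nm_nat mulrA; apply: ler_wpM2r => //.
  have rs : nm (RtoC s * cis t : C) = s by rewrite nm_polar // ltW.
  have Os : Om (RtoC s * cis t) by exact: hray (ltW s0).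
  have g0 := bnv_ge0 (gF u).
  apply: le_trans (ler_wpM2r (expR_ge0 _) (F_le (gF u) Os)) _.
  rewrite rs -[leLHS]mulrA; apply: ler_wpM2l => //.
  apply: le_trans (ler_wpM2r (expR_ge0 _) (G_growth (ltW s0))) _.
  rewrite -[leLHS]mulrA -expRD; apply: ler_wpM2l; first by rewrite divr_ge0 ?expR_ge0.
  by rewrite ler_expR /p' le_eqVlt; apply/orP; left; apply/eqP; ring.
have [||||_ h] := @cint_hs R _ (@mP R) T Fi (fun s => hval (RtoC s * cis t, z) * lapker k X (RtoC s * cis t) * k%:R * cis t)
    (lapE k p' (fun _ => c)).
- move=> u; apply: mfunCM; last exact: mfunC_cst.
  have [a ha _] := gF u.
  by have [] := itg_lint Om_open p_ge0 ha (hray ht) (cis_neq0 t) (ldom_Re1 hx).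
- exact: integrable_lapE_cst.
- move=> s; rewrite /= in_itv /= andbT => s0.
  have s1 := sbdZ (c := expR (p * 2 ^+ k) / k%:R * expR (- (p' * s ^+ k)) * k%:R) _ hM.
  apply: sbd_le (s1 _) => [u||]; last by rewrite !mulr_ge0 ?invr_ge0 ?expR_ge0.
    rewrite /Fi nmM mulrA [_ * bnv _]mulrC; apply: ler_pM; rewrite ?nm_ge0 ?lb //.
    exact: nm_monom.
  by rewrite lapE_pos // /c le_eqVlt; apply/orP; left; apply/eqP; ring.
- move=> s; rewrite /= in_itv /= andbT => s0.
  have Os : Om (RtoC s * cis t) by exact: hray (ltW s0).
  have h1 := hs_Ml (lapker k X (RtoC s * cis t) * k%:R * cis t) (hvalP Os hz).1.
  rewrite [X in hs _ X](_ : _ = lapker k X (RtoC s * cis t) * k%:R * cis t * hval (RtoC s * cis t, z)); last by ring.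
  by apply: eq_hs h1 => u; rewrite /Fi /lint; ring.
apply: eq_hs h => u; rewrite /LA -[RHS]mulrC.
have [a ha _] := gF u.
rewrite -(cintZ (@mP R) _ (itg_lint Om_open p_ge0 ha (hray ht) (cis_neq0 t) (ldom_Re1 hx))).
by apply: eq_cint => s _; rewrite mulrC.
Qed.

(** The formal series comes from the Taylor expansion of the Borel transforms at 0: the coefficient
    of [x ^ l] is Gamma(l/k) times the Taylor coefficient of index [l - 1]. Cauchy estimates on the
    disc of radius [rho0] give the Gevrey bound. *)
Lemma val_ksum r nu : 0 < r -> (forall i, r <= w i) -> (mu * nu) ^+ k < sin (k%:R * al / 16) ->
  exists h, is_ksum k r theta (omega k nu theta (al / 2)) h val.
Proof.
move=> r0 hr hnu.
have zr (z : 'cV[C]_n) : Bn r z -> forall i, nm (z i 0) <= w i.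
  rewrite /Bn /= nm_lt => hz i; apply: le_trans (nm_mx_entry _ _ _) _.
  by apply: le_trans (ltW hz) (hr i).
have M0 : 0 <= M by exact: sbd_ge0 hM.
have O0 y : nm y < rho0 -> Om y by right.
have /choice[e he] : forall t, exists c, pser 0 rho0 (F t).1.2 c.
  move=> t; have [a [an _ _ _] _] := gF t; apply: an => // y; rewrite subr0; exact: O0.
have hF0 t h : nm h < rho0 -> nm ((F t).1.2 (0 + h)) <= G rho0 * bnv (F t).
  move=> hh; rewrite add0r mulrC; apply: le_trans (F_le (gF t) (O0 _ hh)) _.
  by apply: ler_wpM2l; [exact: bnv_ge0 (gF t)|apply: G_le; rewrite ?nm_ge0 // ltW].
pose K l := (rho0 ^+ l)^-1 * G rho0.
have K0 l : 0 <= K l by rewrite mulr_ge0 ?invr_ge0 ?exprn_ge0 // ltW.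
have eb l t : nm (e t l) <= K l * bnv (F t).
  rewrite /K -mulrA ler_pdivlMl ?exprn_gt0 // mulrC.
  exact: (cauchy_estimate l (he t) rho0_gt0 (hF0 t)).
have b0 t : nm (bval0 (F t)) <= 1 * bnv (F t) by rewrite mul1r; exact: bval0_le (gF t).
have Gm l : 0 < Gamma (l.+1%:R / k%:R : R) by apply: Gamma_gt0; rewrite divr_gt0.
pose h l z := if l is l'.+1 then RtoC (Gamma (l%:R / k%:R)) * csum (e^~ l') z else csum (fun t => bval0 (F t)) z.
exists h, al, mu, hval; split.
  split.
  - move=> l z0 hz0.
    pose dl := r - nm z0.
    have dl0 : 0 < dl by rewrite subr_gt0; move: hz0; rewrite /Bn /= nm_lt.
    have hz i : nm (z0 i 0) + dl <= w i.
      apply: le_trans (hr i); rewrite /dl addrCA gerDl subr_le0; exact: nm_mx_entry.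
    case: l => [|l].
      have [D hD] := csum_xze ler01 b0 0 dl0 hz.
      exact: (xze_fiber dl0 hD).
    have [D hD] := csum_xze (K0 l) (eb l) 0 dl0 hz.
    exact: (xze_fiber dl0 (xze_scale (RtoC (Gamma (l.+1%:R / k%:R))) hD)).
  - exists (M * G rho0 + 1), rho0^-1; split; rewrite ?invr_gt0 //.
      by rewrite ltr_wpDl // mulr_ge0 // ltW.
    move=> [|l] z // _ hz; rewrite nm_le /= nmM nm_RtoC ger0_norm ?(ltW (Gm l)) // mulrC.
    apply: ler_wpM2r; first exact: ltW.
    apply: le_trans (csumP (K0 l) (eb l) (zr z hz)).2 _.
    rewrite /K exprVn -mulrA mulrC ler_wpM2r ?invr_ge0 ?exprn_ge0 ?(ltW rho0_gt0) //.
    by rewrite mulrC lerDl.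
  - by rewrite al_gt0.
  - split=> [[y0 z0] [/= sy hz0]|].
      pose dl := r - nm z0.
      have dl0 : 0 < dl by rewrite subr_gt0; move: hz0; rewrite /Bn /= nm_lt.
      have hz i : nm (z0 i 0) + dl <= w i.
        apply: le_trans (hr i); rewrite /dl addrCA gerDl subr_le0; exact: nm_mx_entry.
      have Oy : Om y0 by left.
      have [D [rad [rad0 hD]] _] := hval_xze dl0 Oy hz.
      exact: (xze_scalar rad0 hD).
    exists rho0 => // y z; rewrite nm_lt => hy _ hz.
    have hz' := zr z hz.
    apply: hs_series.
    have h2 : pser 0 rho0 (fun y => hval (y, z)) (fun l => csum (e^~ l) z).
      apply: (pser_sum (F := fun t y => monom t.2 z * (F t).1.2 y) (c := fun t l => monom t.2 z * e t l)
        (M := fun t => G rho0 * (bnv (F t) * wt w t.2)) (N := G rho0 * M) rho0_gt0).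
      + by move=> t; apply: pser_Z.
      + move=> t v hv; rewrite nmM mulrC mulrA; apply: ler_pM; rewrite ?nm_ge0 ?hF0 //.
        exact: nm_monom.
      + by apply: sbdZ => //; rewrite ltW.
      + move=> v hv; rewrite add0r; apply: eq_hs (hvalP (O0 v hv) hz').1 => t.
        by rewrite mulrC.
      + by move=> l; apply: eq_hs (csumP (K0 l) (eb l) hz').1 => t; rewrite mulrC.
    have := h2 y hy; rewrite add0r; apply: eq_hs => l.
    rewrite /h; congr (_ * _); rewrite mulrAC mulfV ?mul1r //.
    rewrite -RtoC0; apply/negP => /eqP /RtoC_inj e0; have := Gm l; by rewrite e0 ltxx.
  - split=> //; exists (expR (p * 2 ^+ k) / k%:R * M + 1).
      by rewrite ltr_wpDl // !mulr_ge0 ?invr_ge0 ?expR_ge0.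
    move=> y z sy hz; rewrite nm_le nmM nm_cexp.
    have Oy : Om y by left.
    have -> : ReC (- (RtoC mu ^+ k * `|y| ^+ k)) = - (mu ^+ k * nm y ^+ k).
      by rewrite nmE -!RtoCX -RtoCM.
    apply: le_trans (ler_wpM2r (expR_ge0 _) (hvalP Oy (zr z hz)).2) _.
    apply: (@le_trans _ _ (expR (p * 2 ^+ k) / k%:R * M)); last by rewrite lerDl.
    rewrite expRN ler_pdivrMr ?expR_gt0 // [leRHS]mulrAC; apply: ler_wpM2r => //.
    exact: G_growth (nm_ge0 y).
move=> x hx; split.
  have [rho [tau [rp rn htau ->]]] := omega_polar k_gt0 hx.
  have htau' : `|tau - theta| <= pi / (2 * k%:R) + al * 5 / 16.
    apply: le_trans htau _; rewrite lerD2l; have h' := al_gt0; lra.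
  have hs' : (mu * rho) ^+ k < sin (k%:R * al / 16).
    apply: le_lt_trans hnu; apply: lerXn2r; last by apply: ler_wpM2l => //; exact: ltW.
      by rewrite nnegrE; apply: mulr_ge0 => //; exact: ltW.
    by rewrite nnegrE; apply: mulr_ge0 => //; apply: ltW; exact: lt_trans rn.
  have [t ht [hl _]] := good_laplace k_gt0 al_gt0 mu_gt0 kal_pi rp htau' hs'.
  by exists t.
move=> t z ht hx' hz; have hz' := zr z hz.
have h1 := hs_add (csumP ler01 b0 hz').1 (laplace_hval ht hx' hz').
apply: (hs_uniq (valP x hz').1); apply: eq_hs h1 => u.
by rewrite (chixE ht hx' (gF u)) /bchi mulrDl.
Qed.

End BorelTransform.

End Sum.

End Character.

Lemma nm_split2 (R : realType) (a b c : Cx R) (e : R) :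
  nm (a - b) < e / 2 -> nm (b - c) < e / 2 -> nm (a - c) < e.
Proof. by move=> h1 h2; have := nmD (a - b) (b - c); rewrite addrA subrK; lra. Qed.

(** * Continuous extension to the closure *)

Section Closure.
Variable R : realType.
Variables (k : nat) (theta al rho0 q : R).
Hypothesis k_gt0 : (0 < k)%N.
Hypothesis al_gt0 : 0 < al.
Hypothesis al_pi : al < pi.
Hypothesis kal_pi : k%:R * al <= pi.
Hypothesis rho0_gt0 : 0 < rho0.
Hypothesis q_gt0 : 0 < q.
Variable n : nat.
Local Notation C := (Cx R).
Local Notation bel := (bel R).
Local Notation T := (nat * mindex n)%type.
Local Notation good := (bgood k (bdom theta al rho0) (q ^+ k)).
Local Notation mu := (2 * q).
Local Notation val := (val k theta al q).
Local Notation sig := (sin (k%:R * al / 16)).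
Variables (nu r dl : R) (w : 'I_n -> R).
Hypothesis nu_gt0 : 0 < nu.
Hypothesis r_gt0 : 0 < r.
Hypothesis dl_gt0 : 0 < dl.
Hypothesis rw : forall i, r + dl <= w i.
Hypothesis nu_sig : (mu * nu) ^+ k < sig.

Let mu_gt0 : 0 < mu. Proof. by rewrite mulr_gt0. Qed.

Local Notation D := (omega k nu theta (al / 2) `*` Bn r : set (C * 'cV[C]_n)).

Let sig_gt0 : 0 < sig.
Proof. by apply: le_lt_trans nu_sig; rewrite exprn_ge0 // mulr_ge0 // ltW. Qed.

Lemma closure_omega_ldom x : closure (omega k nu theta (al / 2)) x -> x != 0 ->
  exists2 t, `|t - theta| < al / 2 & laplace_domain k mu t x /\
    sig <= nm x ^+ k * @ReC R (cis t ^+ k * (x ^+ k)^-1).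
Proof.
move=> hx x0; have [rho [tau [rp rn ht xE]]] := closure_omega_polar k_gt0 al_gt0 hx x0.
have hs' : (mu * rho) ^+ k < sig.
  apply: le_lt_trans nu_sig; apply: lerXn2r; last by apply: ler_wpM2l => //; exact: ltW.
    by rewrite nnegrE mulr_ge0 // ltW.
  by rewrite nnegrE mulr_ge0 // ltW.
have [t h1 h2] := good_laplace k_gt0 al_gt0 mu_gt0 kal_pi rp ht hs'.
by exists t => //; rewrite xE nm_polar // ltW.
Qed.

Lemma closure_omega_xdom x : closure (omega k nu theta (al / 2)) x -> x != 0 -> xdom k theta al mu x.
Proof. by move=> hx x0; have [t h1 [h2 _]] := closure_omega_ldom hx x0; exists t. Qed.

Lemma omega_neq0 (x : C) : omega k nu theta (al / 2) x -> x != 0.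
Proof. by case=> _ []. Qed.

Lemma omega_xdom x : omega k nu theta (al / 2) x -> xdom k theta al mu x.
Proof.
by move=> hx; apply: closure_omega_xdom; [exact: subset_closure|exact: omega_neq0].
Qed.

Lemma closure_dom x z : closure D (x, z) -> closure (omega k nu theta (al / 2)) x /\ nm z <= r.
Proof.
move=> h; have near_D e : 0 < e -> exists a : C * 'cV[C]_n, [/\ D a, nm (a.1 - x) < e & nm (a.2 - z) < e].
  move=> e0; have [|a [Da]] := h [set a | nm (a - (x, z)) < e].
    by apply/(@nbhs_nmP R (C * 'cV[C]_n)%type); exists e.
  by rewrite /= nm_pair gt_max => /andP[h1 h2]; exists a.
split.
  move=> B /nbhs_nmP[e e0 hB]; have [a [[oa _] h1 _]] := near_D e e0.
  by exists a.1; split=> //; exact: hB.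
rewrite leNgt; apply/negP => hr; have [|a [[_ ba] _ h2]] := near_D (nm z - r); first by rewrite subr_gt0.
move: ba; rewrite /Bn /= nm_lt => ba.
by have := nmB a.2 (a.2 - z); rewrite opprB addrCA subrr addr0; lra.
Qed.

Section Scalar.
Variables (F : T -> bel) (M : R).
Hypothesis gF : forall t, good (F t).
Hypothesis hM : sbd (fun t => bnv (F t) * wt w t.2) M.

Let zw (z : 'cV[C]_n) : nm z <= r -> forall i, nm (z i 0) + dl <= w i.
Proof.
move=> zr i; apply: le_trans (rw i); rewrite lerD2r; apply: le_trans zr; exact: nm_mx_entry.
Qed.

Let zw' (z : 'cV[C]_n) : nm z <= r -> forall i, nm (z i 0) <= w i.
Proof. by move=> zr i; apply: le_trans (zw zr i); rewrite lerDl ltW. Qed.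

(** Closure points with [x0 != 0] still lie in [xdom], where the sum is analytic. At [x0 = 0] the
    sum is close to its value at [x = 0] by [val_small], and that value is continuous in [z]. *)
Lemma val_cont_closure (p0 : C * 'cV[C]_n) e : closure D p0 -> 0 < e ->
  exists2 d, 0 < d & forall a, closure D a -> nm (a - p0) < d -> nm (val F a - val F p0) < e.
Proof.
case: p0 => x0 z0 /closure_dom[hx hz] e0; have [->|x0n] := eqVneq x0 0; last first.
  have hx0 := closure_omega_xdom hx x0n.
  have [E [rad /andP[rad0 _] hE] _] := val_xze k_gt0 al_pi rho0_gt0 q_gt0 gF hM dl_gt0 hx0 (zw hz).
  by have [d d0 hd] := xze_cont rad0 hE e0; exists d => // a _; exact: hd.
have M0 := sbd_ge0 hM.
have b0 t : nm (bval0 (F t)) <= 1 * bnv (F t) by rewrite mul1r; exact: bval0_le (gF t).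
have [E hE] := csum_xze hM ler01 b0 0 dl_gt0 (zw hz).
have e2 : 0 < e / 2 by rewrite divr_gt0.
have [d1 d10 hd1] := xze_cont dl_gt0 hE e2.
(* With this slope [sg = s * nm x] meets the hypothesis of [val_small]: the decay is at least
   [sig / nm x ^+ k], and [sig ^+ k <= sig] because [sig <= 1]. *)
pose s := q / sig.
have s0 : 0 < s by rewrite divr_gt0.
pose d2 := Num.min s^-1 (e / 2 / (s * (M + 1))).
have M1 : 0 < s * (M + 1) by rewrite mulr_gt0 // ltr_wpDl.
have d20 : 0 < d2 by rewrite lt_min invr_gt0 s0 divr_gt0.
exists (Num.min d1 d2) => [|[x z] /closure_dom[hx' hz']]; first by rewrite lt_min d10.
rewrite lt_min => /andP[h1 h2].
have hv0 (y : 'cV[C]_n) : val F (0, y) = csum (fun t => bval0 (F t)) y by exact: val0E.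
have c2 : nm (val F (0, z) - val F (0, z0)) < e / 2.
  rewrite !hv0; apply: (hd1 (0, z)); apply: le_lt_trans h1.
  by rewrite !nm_pair /= subrr nm0 ge_max !le_max nm_ge0 lexx orbT.
suff c1 : nm (val F (x, z) - val F (0, z)) < e / 2.
  exact: nm_split2 c1 c2.
have [->|xn] := eqVneq x 0; first by rewrite subrr nm0.
have nx := nm_gt0 xn.
have [t ht [hl hs']] := closure_omega_ldom hx' xn.
have hxs : nm x < d2 by apply: le_lt_trans h2; rewrite nm_pair le_max /= subr0 lexx.
move: hxs; rewrite lt_min => /andP[x1 x2].
have sg01 : 0 < s * nm x <= 1.
  by rewrite mulr_gt0 //= mulrC -ler_pdivlMr // mul1r ltW.
have hp : q ^+ k <= (s * nm x) ^+ k * @ReC R (cis t ^+ k * (x ^+ k)^-1).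
  rewrite exprMn -mulrA; apply: le_trans (ler_wpM2l _ hs'); last by rewrite exprn_ge0 // ltW.
  rewrite [s ^+ k * _](_ : _ = q ^+ k * (sig / sig ^+ k)); last by rewrite /s exprMn exprVn mulrAC mulrA.
  rewrite ler_peMr ?exprn_ge0 ?(ltW q_gt0) // ler_pdivlMr ?exprn_gt0 // mul1r.
  have sig1 : sig <= 1 by exact: sin_le1.
  by case: k k_gt0 sig_gt0 sig1 => // j _ h0 h1'; rewrite exprS ler_piMr ?(ltW h0) // exprn_ile1 // ltW.
apply: le_lt_trans (val_small k_gt0 al_pi rho0_gt0 q_gt0 gF hM ht hl sg01 hp (zw' hz')) _.
move: x2; rewrite ltr_pdivlMr //.
have : 0 <= s * nm x by rewrite mulr_ge0 // ltW.
nra.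
Qed.

End Scalar.

Lemma vec_extends (F : 'I_n -> T -> bel) (M : 'I_n -> R) :
  (forall i t, good (F i t)) -> (forall i, sbd (fun t => bnv (F i t) * wt w t.2) (M i)) ->
  extends_to_closure D (fun a => \col_i val (F i) a : 'cV[C]_n).
Proof.
move=> gF hM; exists (fun a => \col_i val (F i) a) => //.
apply/subspace_continuousP => p0 hp0; apply/cvgrPdist_lt => e e0.
have er : e = RtoC (complex.Re e) by rewrite /RtoC RRe_real // ger0_real // ltW.
have e1 : 0 < complex.Re e by rewrite -RtoC_lt -er.
have /choice[d hd] : forall i, exists d, 0 < d /\ forall a, closure D a -> nm (a - p0) < d ->
    nm (val (F i) a - val (F i) p0) < complex.Re e.
  by move=> i; have [d d0 h] := val_cont_closure (gF i) (hM i) hp0 e1; exists d.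
apply/(@nbhs_nmP R (C * 'cV[C]_n)%type); exists (\big[Num.min/1]_i d i).
  by apply: lt_bigmin => // i _; case: (hd i).
move=> a ha hDa; rewrite er nm_lt nm_distC; apply: nm_mx_lt => // i j; rewrite !mxE.
by apply: (hd i).2 => //; apply: lt_le_trans ha _; exact: bigmin_le.
Qed.

End Closure.

(** * Lipschitz bounds for monomials *)

Section Lipschitz.
Variable R : realType.
Local Notation C := (Cx R).

(** [K] is a distance relative to the bound [W]. In a product the bounds multiply and the relative
    distances add ([lipb_mul]), which produces the factor [mdeg c] for a monomial. *)
Let lipb (a b : C) (W K : R) := [/\ nm a <= W, nm b <= W & nm (a - b) <= K * W].

Let lipb_mul a b W K a' b' W' K' : lipb a b W K -> lipb a' b' W' K' -> lipb (a * a') (b * b') (W * W') (K + K').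
Proof.
move=> [h1 h2 h3] [h1' h2' h3']; have W0 := le_trans (nm_ge0 a) h1; have W0' := le_trans (nm_ge0 a') h1'.
split; rewrite ?nmM; try by apply: ler_pM; rewrite ?nm_ge0.
have -> : a * a' - b * b' = (a - b) * a' + b * (a' - b') by ring.
apply: le_trans (nmD _ _) _; rewrite !nmM mulrDl; apply: lerD.
  by rewrite mulrA; apply: ler_pM; rewrite ?nm_ge0.
by rewrite [leRHS](_ : _ = W * (K' * W')); [apply: ler_pM; rewrite ?nm_ge0|ring].
Qed.

Lemma monom_lip n (w : 'I_n -> R) (wm : R) (c : mindex n) (z z' : 'cV[C]_n) :
  0 < wm -> (forall i, wm <= w i) ->
  (forall i, nm (z i 0) <= w i) -> (forall i, nm (z' i 0) <= w i) ->
  nm (monom c z - monom c z') <= (mdeg c)%:R * (nm (z - z') / wm) * wt w c.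
Proof.
move=> wm0 wmw hz hz'.
have K0 : 0 <= nm (z - z') / wm by rewrite divr_ge0 ?nm_ge0 // ltW.
have one : lipb 1 1 1 0 by split; rewrite ?nm1 // subrr nm0 mul0r.
have hi i : lipb (z i 0) (z' i 0) (w i) (nm (z - z') / wm).
  split=> //; apply: le_trans (_ : nm (z - z') <= _).
    by have := nm_mx_entry (z - z') i 0; rewrite !mxE.
  by rewrite mulrAC ler_pdivlMr // ler_wpM2l ?nm_ge0.
have hp i m : lipb (z i 0 ^+ m) (z' i 0 ^+ m) (w i ^+ m) (m%:R * (nm (z - z') / wm)).
  elim: m => [|m IH]; first by rewrite !expr0 mul0r.
  by rewrite !exprS -natr1 addrC mulrDl mul1r; apply: lipb_mul.
suff [_ _] : lipb (monom c z) (monom c z') (wt w c) ((mdeg c)%:R * (nm (z - z') / wm)) by [].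
rewrite /monom /wt /mdeg natr_sum mulr_suml.
elim: (index_enum _) => [|i s IH]; first by rewrite !big_nil.
by rewrite !big_cons; apply: lipb_mul.
Qed.

End Lipschitz.

(** * Vector-valued sums and the fibered map *)

Section Fibered.
Variable R : realType.
Variables (k : nat) (theta al rho0 q : R).
Hypothesis k_gt0 : (0 < k)%N.
Hypothesis al_gt0 : 0 < al.
Hypothesis al_pi : al < pi.
Hypothesis rho0_gt0 : 0 < rho0.
Hypothesis q_gt0 : 0 < q.
Variable n : nat.
Local Notation C := (Cx R).
Local Notation bel := (bel R).
Local Notation T := (nat * mindex n)%type.
Local Notation good := (bgood k (bdom theta al rho0) (q ^+ k)).
Local Notation mu := (2 * q).
Local Notation val := (val k theta al q).
Local Notation chix := (chix k theta al q).
Local Notation ldx := (ldx k theta al q).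
Variables (w : 'I_n -> R) (F : 'I_n -> T -> bel) (M : 'I_n -> R).
Hypothesis gF : forall i t, good (F i t).
Hypothesis hM : forall i, sbd (fun t => bnv (F i t) * wt w t.2) (M i).

Definition vecval (a : C * 'cV[C]_n) : 'cV[C]_n := \col_i val (F i) a.

Lemma vecval_xze x0 (z0 : 'cV[C]_n) dl : 0 < dl -> xdom k theta al mu x0 -> (forall i, nm (z0 i 0) + dl <= w i) ->
  exists2 D : 'I_n -> T -> C, exists2 rad, 0 < rad & forall i, xze (x0, z0) rad (val (F i)) (D i) &
  forall i, [/\ hs (fun t => ldx x0 (F i t) * monom t.2 z0) (k%:R^-1 * x0 ^+ k.+1 * D i (1%N, mzero n)),
     forall s, hs (fun t => chix x0 (F i t) * ((t.2 s)%:R * (monom (msub t.2 (mone s)) z0))) (D i (0%N, mone s)) &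
     D i (0%N, mzero n) = val (F i) (x0, z0)].
Proof.
move=> dl0 hx hz.
have /choice[D hD] : forall i, exists D : T -> C, (exists2 rad, 0 < rad & xze (x0, z0) rad (val (F i)) D) /\
   [/\ hs (fun t => ldx x0 (F i t) * monom t.2 z0) (k%:R^-1 * x0 ^+ k.+1 * D (1%N, mzero n)),
     forall s, hs (fun t => chix x0 (F i t) * ((t.2 s)%:R * (monom (msub t.2 (mone s)) z0))) (D (0%N, mone s)) &
     D (0%N, mzero n) = val (F i) (x0, z0)].
  move=> i; have [D [rad /andP[rad0 _] h1] h2] := val_xze k_gt0 al_pi rho0_gt0 q_gt0 (gF i) (hM i) dl0 hx hz.
  by exists D; split=> //; exists rad.
have /choice[rad hrad] : forall i, exists rad, 0 < rad /\ xze (x0, z0) rad (val (F i)) (D i).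
  by move=> i; have [[rad r0 h] _] := hD i; exists rad.
exists D => [|i]; last exact: (hD i).2.
exists (\big[Num.min/1]_i rad i) => [|i]; first by apply: lt_bigmin => // i _; case: (hrad i).
by apply: xze_sub (hrad i).2; exact: bigmin_le.
Qed.

Lemma vecval_analytic (B : set C) (r : R) : B `<=` xdom k theta al mu -> (forall i, r <= w i) ->
  analytic_xz (B `*` Bn r) vecval.
Proof.
move=> hB hr [x0 z0] [/= Bx]; rewrite /Bn /= nm_lt => hz.
have dl0 : 0 < r - nm z0 by rewrite subr_gt0.
have hz' i : nm (z0 i 0) + (r - nm z0) <= w i.
  by apply: le_trans (hr i); rewrite addrCA gerDl subr_le0; exact: nm_mx_entry.
have [D [rad rad0 hD] _] := vecval_xze dl0 (hB _ Bx) hz'.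
apply: (xze_col rad0 (c := D)) => i v hv; have := hD i v hv.
by rewrite /vecval mxE.
Qed.

                                                      
(** Together with [fibc2]: the Taylor coefficients at [(x0, z0)] of the two components of
    [(x, z + x phi)]. *)
Definition fibc1 (x0 : C) (a : T) : C :=
  (if a == (1%N, mzero n) then 1 else 0) + (if a == (0%N, mzero n) then x0 else 0).
Definition fibc2 (x0 : C) (z0 : 'cV[C]_n) (D : 'I_n -> T -> C) (i : 'I_n) (a : T) : C :=
  ((if a == (0%N, mone i) then 1 else 0) + (if a == (0%N, mzero n) then z0 i 0 else 0)) +
  (x0 * D i a + (if a.1 is m.+1 then D i (m, a.2) else 0)).

Lemma fibered_xze x0 z0 rad D : (forall i, xze (x0, z0) rad (val (F i)) (D i)) ->
  xze (x0, z0) rad (fun a => (fibered vecval a).1) (fibc1 x0) /\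
  forall i, xze (x0, z0) rad (fun a => (fibered vecval a).2 i 0) (fibc2 x0 z0 D i).
Proof.
move=> hD.
have cst (c : C) v : hs (fun a => monom_xz a v * (if a == (0%N, mzero n) then c else 0)) c.
  apply: eq_hs (hs_delta (0%N, mzero n) c) => a.
  by case: eqP => [->|_]; rewrite ?mulr0 // monom_xz00 mul1r.
split=> [v hv|i].
  rewrite /fibered /= addrC.
  have h1 : hs (fun a => monom_xz a v * (if a == (1%N, mzero n) then 1 else 0)) v.1.
    apply: eq_hs (hs_delta (1%N, mzero n) v.1) => a.
    by case: eqP => [->|_]; rewrite ?mulr0 // monom_xz10 mulr1.
  by apply: eq_hs (hs_add h1 (cst x0 v)) => a; rewrite /fibc1 mulrDr.
have h := xze_mulx (hD i).
move=> v hv; rewrite /fibered /= !mxE.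
have h1 : hs (fun a => monom_xz a v * (if a == (0%N, mone i) then 1 else 0)) (v.2 i 0).
  apply: eq_hs (hs_delta (0%N, mone i) (v.2 i 0)) => a.
  by case: eqP => [->|_]; rewrite ?mulr0 // monom_xz01 mulr1.
rewrite [z0 i 0 + _]addrC.
apply: eq_hs (hs_add (hs_add h1 (cst (z0 i 0) v)) (h v hv)) => a.
by rewrite /fibc2 !mulrDr.
Qed.

Lemma xlin_fibc1 x0 v : xlin (fibc1 x0) v = v.1.
Proof.
rewrite /xlin /fibc1 eqxx xpair_eqE /= addr0 mulr1 big1 ?addr0 // => s _.
rewrite !xpair_eqE /=; case: eqP => [e|_]; last by rewrite add0r mulr0.
by have := mdeg1 s; rewrite e mdeg0.
Qed.

Lemma xlin_fibc2 x0 z0 D i v : xlin (fibc2 x0 z0 D i) v =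
  v.1 * (x0 * D i (1%N, mzero n) + D i (0%N, mzero n)) +
  (v.2 i 0 + x0 * \sum_s v.2 s 0 * D i (0%N, mone s)).
Proof.
rewrite /xlin /fibc2 !xpair_eqE /= !add0r; congr (_ + _).
have e01 s : (mone s == mzero n :> mindex n) = false.
  by apply/negP => /eqP e; have := mdeg1 s; rewrite e mdeg0.
rewrite (eq_bigr (fun s => (if s == i then v.2 i 0 else 0) + x0 * (v.2 s 0 * D i (0%N, mone s)))).
  by rewrite big_split /= -big_mkcond big_pred1_eq -mulr_sumr.
move=> s _; rewrite !xpair_eqE /= e01 !addr0 mulrDr mulrCA; congr (_ + _).
have -> : (mone s == mone i) = (s == i).
  apply/eqP/eqP => [/ffunP/(_ s)|->//]; rewrite !ffunE eqxx; by case: eqP.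
by case: eqP => [->|_]; rewrite ?mulr1 ?mulr0.
Qed.

Lemma fibered_analytic (B : set (C * 'cV[C]_n)) :
  (forall a, B a -> xdom k theta al mu a.1 /\ exists2 dl, 0 < dl & forall i, nm (a.2 i 0) + dl <= w i) ->
  analytic_xz B (fibered vecval).
Proof.
move=> hB [x0 z0] /hB /= [hx [dl dl0 hz]].
have [D [rad rad0 hD] _] := vecval_xze dl0 hx hz.
have [h1 h2] := fibered_xze hD.
exact: (xze_analytic rad0 h1 h2).
Qed.

End Fibered.

                      

(** * The solution of the homological equation *)

Section Solution.
Variable R : realType.
Variables (k : nat) (theta al rho0 q : R).
Hypothesis k_gt0 : (0 < k)%N.
Hypothesis al_gt0 : 0 < al.
Hypothesis al_pi : al < pi.
Hypothesis kal_pi : k%:R * al <= pi.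
Hypothesis rho0_gt0 : 0 < rho0.
Hypothesis q_gt0 : 0 < q.
Variable n : nat.
Local Notation C := (Cx R).
Local Notation bel := (bel R).
Local Notation T := (nat * mindex n)%type.
Local Notation Om := (bdom theta al rho0).
Local Notation good := (bgood k Om (q ^+ k)).
Local Notation mu := (2 * q).
Local Notation val := (val k theta al q).
Local Notation chix := (chix k theta al q).
Local Notation ldx := (ldx k theta al q).
Local Notation xdom := (xdom k theta al mu).
Local Notation nX := (q^-1).
Local Notation vX := (bX k q^-1).
Variables (w : 'I_n -> R) (lam : 'rV[C]_n) (Xi : 'M[C]_n) (res : 'I_n -> mindex n -> bool).
Variables (d0 : R) (fc : 'I_n -> T -> C) (B Mf : 'I_n -> R).
Local Notation a := (fun i c => lam 0 i - dotm c lam).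
Hypothesis w_gt0 : forall i, 0 < w i.
Hypothesis B_ge0 : forall i, 0 <= B i.
Hypothesis d0_gt0 : 0 < d0.
Hypothesis a_neq0 : forall i c, ~~ res i c -> a i c != 0.
Hypothesis a_dlt : forall i c, ~~ res i c -> 1 <= dlt d0 c * nm (a i c).
Hypothesis a_div : forall i c, ~~ res i c -> forall y, Om y -> 1 <= dlt d0 c * nm (y ^+ k - a i c).
Hypothesis hfc : forall i,
  sbd (fun u : T => nm (fc i u) * nX ^+ u.1 * wt (fun j => w j + nX * (d0 * B j)) u.2) (Mf i).
Hypothesis hB : forall i, Mf i +
  (\sum_s \sum_j nm (Xi s j) * (w j * (d0 / w s * B i)) + \sum_j nm (Xi i j) * (d0 * B j) +
   (nX * (\sum_s (d0 / w s * B i) * B s) + k%:R^-1 * (nX ^+ k * (d0 * B i)))) <= B i.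
Hypothesis nX_small : forall i, nX * (d0 * B i) <= w i / 2.

Local Notation SN := (SN (@bnv R) good).
Local Notation mainop := (mainop (bmul k) (@bZ R) (bone R) k vX (bdiv k) a res d0 Xi fc).

Let p_gt0 : 0 < q ^+ k. Proof. exact: exprn_gt0. Qed.
Let Om_open y : Om y -> exists2 r : R, 0 < r & forall v, nm (v - y) < r -> Om v.
Proof. exact: bdom_open. Qed.
Let Om_star := @bdom_star R theta al rho0 rho0_gt0.
Let d0_ge0 := ltW d0_gt0.
Let dlt_ge0 (c : mindex n) : 0 <= dlt d0 c. Proof. by case/andP: (dlt_bound d0_ge0 c). Qed.

Let good0 : good 0. Proof. exact: bgood0. Qed.
Let goodD u v : good u -> good v -> good (u + v). Proof. exact: bgoodD. Qed.
Let goodM u v : good u -> good v -> good (bmul k u v). Proof. exact: bgoodM. Qed.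
Let goodZ c v : good v -> good (bZ c v). Proof. exact: bgoodZ. Qed.
Let good1 : good (bone R). Proof. exact: bgood1. Qed.
Let goodX : good vX. Proof. exact: (bgoodX k_gt0 Om p_gt0 q_gt0). Qed.
Let nv0 : bnv (0 : bel) = 0. Proof. by []. Qed.
Let nvD (u v : bel) : bnv (u + v) = bnv u + bnv v. Proof. by []. Qed.
Let nvM (u v : bel) : bnv (bmul k u v) = bnv u * bnv v. Proof. by []. Qed.
Let nvZ c (v : bel) : bnv (bZ c v) = nm c * bnv v. Proof. by []. Qed.
Let nv1 : bnv (bone R) = 1. Proof. by []. Qed.
Let nv_ge0 v : good v -> 0 <= bnv v. Proof. exact: bnv_ge0. Qed.
Let nv_div b d (v : bel) : bnv (bdiv k b d v) = d * bnv v. Proof. by []. Qed.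
Let good_div i c v : ~~ res i c -> good v -> good (bdiv k (a i c) (dlt d0 c) v).
Proof. by move=> h; apply: bgood_div => //; [exact: a_div|exact: a_dlt]. Qed.

Lemma formal_solution :
  exists2 E : 'I_n -> T -> bel, forall i t, E i t = mainop E i t & forall i, SN w (E i) (B i).
Proof.
apply: (recursion_fixpoint good0 nv0 (TT := mainop)).
- exact: B_ge0.
- by move=> Q E E' h i; exact: agree_mainop.
move=> E hE i.
have h := SN_mainop good0 goodD goodM goodZ good1 nv0 nvD nvM nvZ nv1 nv_ge0 w_gt0 k goodX nv_div
  d0_ge0 good_div Xi hE hfc i.
exact: SN_le (hB i) h.
Qed.

Section FixedPoint.
Variable E : 'I_n -> T -> bel.
Hypothesis hfix : forall i t, E i t = mainop E i t.
Hypothesis hE : forall i, SN w (E i) (B i).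

Definition solphi : 'I_n -> T -> bel := nonresp (bdiv k) a res d0 E.
Definition solg : 'I_n -> T -> bel := resp res E.

Lemma SN_solphi i : SN w (solphi i) (d0 * B i).
Proof. exact: (SN_nonresp good0 nv0 nv_ge0 w_gt0 nv_div d0_ge0 good_div (hE i)). Qed.

Lemma SN_solg i : SN w (solg i) (B i).
Proof. exact: (SN_resp good0 nv0 nv_ge0 w_gt0 res (hE i)). Qed.

Let ch0 x := chix0 k theta al q x.
Let chD x := chixD (k := k) (theta := theta) (al := al) rho0_gt0 q_gt0 x.
Let chM x := chixM (theta := theta) (al := al) k_gt0 rho0_gt0 q_gt0 x.
Let chZ x := chixZ (k := k) (theta := theta) (al := al) rho0_gt0 q_gt0 x.
Let ch1 x := chix1 k theta al q x.
Let ch_le x := chix_le (k := k) (theta := theta) (al := al) rho0_gt0 q_gt0 x.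

Let EV_phi x (z : 'cV[C]_n) i : (forall j, nm (z j 0) <= w j) -> EV (chix x) z (solphi i) (val (solphi i) (x, z)).
Proof. by move=> hz; have [g h] := SN_solphi i; have [] := valP rho0_gt0 q_gt0 g h x hz. Qed.

Let EV_g x (z : 'cV[C]_n) i : (forall j, nm (z j 0) <= w j) -> EV (chix x) z (solg i) (val (solg i) (x, z)).
Proof. by move=> hz; have [g h] := SN_solg i; have [] := valP rho0_gt0 q_gt0 g h x hz. Qed.

Lemma EV_sdz x (z : 'cV[C]_n) (F : T -> bel) s d : (forall t, good (F t)) ->
  hs (fun t => chix x (F t) * ((t.2 s)%:R * (monom (msub t.2 (mone s)) z))) d ->
  EV (chix x) z (sdz (@bZ R) s F) d.
Proof.
move=> gF; pose f (t : T) : T := (t.1, madd t.2 (mone s)).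
have fi : injective f.
  move=> [a1 b1] [a2 b2] [-> /ffunP e]; congr (_, _); apply/ffunP => i.
  by have := e i; rewrite !ffunE => /addIn.
move/(hs_inj (f := f)) => h; apply: eq_hs (h fi _) => [t|[b c] hf].
  rewrite /sdz chZ // /f /= ffunE ffunE eqxx addn1.
  have -> : msub (madd t.2 (mone s)) (mone s) = t.2 by apply/ffunP => i; rewrite !ffunE addnK.
  by ring.
case: (posnP (c s)) => [-> /=|cs]; first by rewrite mul0r mulr0.
case: (hf (b, msub c (mone s))); congr (_, _); apply/ffunP => i; rewrite !ffunE.
by case: eqP => [->|_]; [rewrite subnK|rewrite subn0 addn0].
Qed.

(** [EV_mainop] computes the value of [E] and [EV_transport] applies the divisor identities to it;
    eliminating that value leaves the differential equation for phi and g. *)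
Lemma solution_transport x (z : 'cV[C]_n) (D : 'I_n -> T -> C) (Fv : 'I_n -> C) : xdom x ->
  (forall i, nm (z i 0) <= w i) ->
  (forall i, hs (fun t => ldx x (solphi i t) * monom t.2 z) (k%:R^-1 * x ^+ k.+1 * D i (1%N, mzero n)) /\
     forall s, hs (fun t => chix x (solphi i t) * ((t.2 s)%:R * (monom (msub t.2 (mone s)) z))) (D i (0%N, mone s))) ->
  (forall i, hs (fun u => fc i u * (x ^+ u.1 * \prod_(j < n) (z j 0 + x * val (solphi j) (x, z)) ^+ u.2 j)) (Fv i)) ->
  forall i, k%:R^-1 * x ^+ k.+1 * D i (1%N, mzero n) =
    lam 0 i * val (solphi i) (x, z) - \sum_s lam 0 s * (z s 0 * D i (0%N, mone s)) +
    (Fv i - (\sum_s \sum_j Xi s j * (z j 0 * D i (0%N, mone s)) + \sum_j - Xi i j * val (solphi j) (x, z) +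
     (x * (\sum_s D i (0%N, mone s) * val (solg s) (x, z)) + k%:R^-1 * (x ^+ k * val (solphi i) (x, z)))))
    - val (solg i) (x, z).
Proof.
move=> hx hz hD hF.
have hX : chix x vX = x by exact: (chixX k_gt0 al_pi rho0_gt0 q_gt0 (lexx _) hx).
have /choice[e he] i : exists e, EV (chix x) z (E i) e.
  by have [e he _] := EV_ex (@ch_le x) hz (hE i); exists e.
have hDs s i : EV (chix x) z (sdz (@bZ R) s (solphi i)) (D i (0%N, mone s)).
  by apply: EV_sdz; [exact: (SN_solphi i).1|exact: (hD i).2].
have hF' i : hs (fun u => fc i u * (chix x vX ^+ u.1 *
    \prod_(j < n) (z j 0 + chix x vX * val (solphi j) (x, z)) ^+ u.2 j)) (Fv i).
  by rewrite hX; exact: hF.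
have e1 := EV_mainop good0 goodD goodM goodZ good1 nv0 nvD nvM nvZ nv1 nv_ge0 (@bmul0 R k) (@bmulr0 R k)
  w_gt0 goodX nv_div d0_ge0 good_div (ch0 x) (@chD x) (@chM x) (@chZ x) (ch1 x) (@ch_le x) hz
  hfix hE hfc he (fun i => EV_phi x i hz) (fun i => EV_g x i hz) hDs hF'.
have ld0 : ldx x 0 = 0.
  rewrite /ldx [X in LA _ _ _ X](_ : _ = fun=> 0); last by apply/funext => y; rewrite mulr0.
  exact: LA0.
have e2 := EV_transport good0 good_div (ch0 x) (@chZ x) (lam := lam) (ld := ldx x) (fun i c => erefl) ld0
  (fun i c v nr gv => ldx_div k_gt0 al_pi rho0_gt0 q_gt0 hx (dlt_ge0 c) (a_div nr) (a_neq0 nr) (a_dlt nr) gv)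
  hE he (fun i => EV_phi x i hz) (fun i => EV_g x i hz) hDs (fun i => (hD i).1).
by move=> i; rewrite e2 e1 hX.
Qed.

(** The inverse is built on halved radii: [nX_small] keeps [y + x Ps] within the radii [w], where
    phi converges. *)
Lemma solution_inverse : exists2 Ps : 'I_n -> T -> bel,
  forall i, SN (fun j => w j / 2) (Ps i) (d0 * B i) &
  forall x (y : 'cV[C]_n), xdom x -> (forall i, nm (y i 0) <= w i / 2) ->
    forall i, val (Ps i) (x, y) = - val (solphi i) (x, y + x *: vecval k theta al q Ps (x, y)).
Proof.
have w2 i : 0 < w i / 2 by rewrite divr_gt0.
have gphi i u : good (solphi i u) by exact: (SN_solphi i).1.
have hM i : sbd (fun u => bnv (solphi i u) * wt (fun j => w j / 2 + bnv vX * (d0 * B j)) u.2) (d0 * B i).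
  apply: sbd_le (lexx _) (SN_solphi i).2 => u; apply: ler_wpM2l; first exact: nv_ge0.
  apply: wt_le => j; have := nX_small j; rewrite /= => h.
  have h0 : 0 <= nX * (d0 * B j) by rewrite !mulr_ge0 ?B_ge0 ?invr_ge0 // ltW.
  by have := w2 j; rewrite /bnv /bX /=; lra.
have [Ps hPs sPs] := inverse_series good0 goodD goodM goodZ good1 nv0 nvD nvM nvZ nv1 nv_ge0 w2 goodX gphi hM.
exists Ps => // x y hx hy.
have hX : chix x vX = x by exact: (chixX k_gt0 al_pi rho0_gt0 q_gt0 (lexx _) hx).
have nx : nm x <= nX by rewrite -{1}hX; exact: (ch_le x goodX).
have hv i := valP rho0_gt0 q_gt0 (sPs i).1 (sPs i).2 x hy.
have hz i : nm ((y + x *: vecval k theta al q Ps (x, y)) i 0) <= w i.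
  rewrite !mxE; apply: le_trans (nmD _ _) _; rewrite nmM.
  have := ler_pM (nm_ge0 x) (nm_ge0 (val (Ps i) (x, y))) nx (hv i).2.
  by have := hy i; have := nX_small i; lra.
apply: (EV_inverse good0 goodD goodM good1 nv0 nvD nvM nv1 nv_ge0 (@bmul0 R k) (@bmulr0 R k) w2 goodX
  (ch0 x) (@chD x) (@chM x) (@chZ x) (ch1 x) (@ch_le x) hy gphi hM hPs sPs (fun i => (hv i).1)) => i.
rewrite hX; apply: eq_hs (EV_phi x i hz) => t; congr (_ * _).
by apply: eq_bigr => j _; rewrite !mxE.
Qed.

(** The difference of two monomials costs their degree, which the divisor bound [dlt] compensates,
    so only the size of [E] remains. *)
Lemma solution_lipschitz x (wm : R) (z z' : 'cV[C]_n) i : 0 < wm -> (forall i, wm <= w i) ->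
  (forall i, nm (z i 0) <= w i) -> (forall i, nm (z' i 0) <= w i) ->
  nm (val (solphi i) (x, z) - val (solphi i) (x, z')) <= d0 * B i / wm * nm (z - z').
Proof.
move=> wm0 hwm hz hz'.
have h1 := EV_phi x i hz; have h2 := EV_phi x i hz'.
rewrite -[X in nm (_ + X)]mulN1r; apply: (hs_le (hs_add h1 (hs_Ml (-1) h2))).
have K0 : 0 <= d0 / wm * nm (z - z') by rewrite !mulr_ge0 ?nm_ge0 ?invr_ge0 // ltW.
apply: sbd_le (sbdZ K0 (hE i).2) => [t|]; last by rewrite le_eqVlt; apply/orP; left; apply/eqP; ring.
rewrite mulN1r -mulrBr nmM.
have g := (SN_solphi i).1 t.
apply: le_trans (ler_pM (nm_ge0 _) (nm_ge0 _) (ch_le x g) (monom_lip t.2 wm0 hwm hz hz')) _.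
have E0 : 0 <= bnv (E i t) by apply: nv_ge0; exact: (hE i).1.
have w0 : 0 <= wt w t.2 by apply: wt_ge0 => j; exact: ltW.
have hb : bnv (solphi i t) * (mdeg t.2)%:R <= d0 * bnv (E i t).
  rewrite /solphi /nonresp; case: ifP => _; first by rewrite nv0 mul0r mulr_ge0.
  rewrite nv_div mulrAC; apply: ler_wpM2r => //; rewrite /dlt mulrAC ler_pdivrMr ?ltr_wpDr //.
  by apply: ler_wpM2l => //; rewrite lerDr.
have Z0 : 0 <= nm (z - z') / wm * wt w t.2 by rewrite !mulr_ge0 ?nm_ge0 ?invr_ge0 // ltW.
apply: le_trans (_ : bnv (solphi i t) * (mdeg t.2)%:R * (nm (z - z') / wm * wt w t.2) <= _).
  by rewrite le_eqVlt; apply/orP; left; apply/eqP; ring.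
apply: le_trans (ler_wpM2r Z0 hb) _.
by rewrite le_eqVlt; apply/orP; left; apply/eqP; ring.
Qed.

End FixedPoint.

End Solution.

(** * Choice of the constants *)

Section Constants.
Variable R : realType.
Local Notation C := (Cx R).

Lemma nonresonance_constants (n k : nat) (lam : 'rV[C]_n) (c theta : R) : (0 < k)%N -> 0 < c ->
  (exists2 xi : R, 0 < xi & forall (i : 'I_n) (j : mindex n), ~ near_resonant c lam (i, j) ->
       ~ sector (k%:R * theta) xi (lam 0 i - dotm j lam)) ->
  exists al rho0 d0 : R, [/\ 0 < al, al < pi & k%:R * al <= pi] /\ [/\ 0 < rho0, 0 < d0 &
    forall i j, (i, j) \notin near_resonant c lam -> [/\ lam 0 i - dotm j lam != 0,
      1 <= dlt d0 j * nm (lam 0 i - dotm j lam) &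
      forall y, bdom theta al rho0 y -> 1 <= dlt d0 j * nm (y ^+ k - (lam 0 i - dotm j lam))]].
Proof.
move=> k_gt0 c0 [xi0 xi00 hxi0].
pose xi := Num.min xi0 pi.
have pi0 : 0 < pi :> R by exact: pi_gt0.
have xi_gt0 : 0 < xi by rewrite lt_min xi00.
have xi_pi : xi <= pi by rewrite ge_min lexx orbT.
have hxi i j : ~ near_resonant c lam (i, j) -> ~ sector (k%:R * theta) xi (lam 0 i - dotm j lam).
  move=> h1 /sectorP[rho [t [r0 ht e]]]; apply: (hxi0 i j h1); apply/sectorP; exists rho, t; split=> //.
  by apply: lt_le_trans ht _; rewrite ler_wpM2r ?invr_ge0 // ge_min lexx.
have kR : 0 < k%:R :> R by rewrite ltr0n.
have k1 : 1 <= k%:R :> R by rewrite ler1n.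
(* [k * al] is [xi / 2], so [w ^+ k] deviates from the direction [k theta] by less than [xi / 4] on
   the sector; [rho0] below keeps it under half of every nonresonant divisor on the disc. *)
pose al := xi / (2 * k%:R).
have kal : k%:R * al = xi / 2 by rewrite /al; field; rewrite gt_eqF.
pose rho0 := Num.min 1 (c / 2).
have rho00 : 0 < rho0 by rewrite lt_min ltr01 divr_gt0.
have rhok : rho0 ^+ k <= c / 2.
  apply: (@le_trans _ _ rho0); last by rewrite ge_min lexx orbT.
  by apply: ler_iXnr => //; [exact: ltW|rewrite ge_min lexx].
pose s := sin (xi / 4).
have s0 : 0 < s by apply: sin_gt0_pi; apply/andP; split; lra.
(* [h] is the relative gap from [pow_sub_ge]; together with [nm a >= c * (1 + (mdeg j)%:R)] it
   explains the constant [(c * h)^-1]. *)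
pose h := Num.min 2^-1 s.
have h0 : 0 < h by rewrite lt_min s0 invr_gt0 ltr0n.
have h1 : h <= 1 by rewrite ge_min invf_le1 ?ler1n.
have al0 : 0 < al by rewrite divr_gt0 // mulr_gt0.
exists al, rho0, (c * h)^-1; split; split=> //.
- have : al <= k%:R * al by rewrite ler_peMl // ltW.
  by rewrite kal; lra.
- by rewrite kal; lra.
- by rewrite invr_gt0 mulr_gt0.
move=> i j nr; have nr' : ~ near_resonant c lam (i, j) by move=> h'; move/negP: nr; apply; exact/mem_set.
set a := lam 0 i - dotm j lam.
have m0 : 0 < 1 + (mdeg j)%:R :> R by rewrite ltr_wpDr.
have ca : c * (1 + (mdeg j)%:R) <= nm a.
  by rewrite leNgt; apply/negP => h'; apply: nr'; rewrite /near_resonant /= nm_le ltW.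
have ca1 : c <= nm a by apply: le_trans ca; rewrite ler_peMr ?(ltW c0) // lerDl.
have key x : h * nm a <= x -> 1 <= dlt (c * h)^-1 j * x.
  move=> hx; have -> : dlt (c * h)^-1 j * x = x / (c * h * (1 + (mdeg j)%:R)).
    by rewrite /dlt; field; rewrite !gt_eqF.
  rewrite ler_pdivlMr ?mulr_gt0 // mul1r; apply: le_trans hx.
  by rewrite -mulrA mulrCA; apply: ler_wpM2l => //; exact: ltW.
split.
- by apply/negP => /eqP e; move: ca1; rewrite e nm0; lra.
- by apply: key; rewrite ler_piMl ?nm_ge0.
move=> y hy; apply: key.
have kalx : k%:R * al <= xi / 2 by rewrite kal.
have [_] := pow_sub_ge rho00 rhok xi_gt0 xi_pi kalx ca1 (hxi i j nr') hy c0.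
by apply: le_trans; rewrite le_min ![_ * nm a]mulrC !ler_wpM2l ?nm_ge0 // ge_min lexx ?orbT.
Qed.

Lemma expansion_at0 (n : nat) (U : set (C * 'cV[C]_n)) (f : C * 'cV[C]_n -> 'cV[C]_n) :
  open U -> U (0, 0) -> analytic_xz U f ->
  exists (rf Mf : R) (cf : 'I_n -> nat * mindex n -> C), [/\ 0 < rf, 0 < Mf,
    forall x y, nm x <= rf -> nm y <= rf -> U (x, y) /\
      forall i, hs (fun u => cf i u * (x ^+ u.1 * \prod_(j < n) y j 0 ^+ u.2 j)) (f (x, y) i 0) &
    forall i, sbd (fun u : nat * mindex n => nm (cf i u) * rf ^+ u.1 * wt (fun=> rf) u.2) Mf].
Proof.
move=> oU U0 /(_ _ U0)[c hc].
have /(@nbhs_nmP R (C * 'cV[C]_n)%type)[e1 e10 h1] := hc.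
have /(@nbhs_nmP R (C * 'cV[C]_n)%type)[e2 e20 h2] := open_nbhs_nbhs (conj oU U0).
pose rf := Num.min e1 e2 / 2.
have m0 : 0 < Num.min e1 e2 by rewrite lt_min e10.
have rf0 : 0 < rf by rewrite divr_gt0.
have rfe : rf < Num.min e1 e2 by rewrite /rf ltr_pdivrMr // ltr_pMr // ltr1n.
have nq (x : C) (y : 'cV[C]_n) : nm x <= rf -> nm y <= rf -> nm ((x, y) - (0, 0)) < Num.min e1 e2.
  by move=> hx hy; rewrite subr0; apply: le_lt_trans rfe; rewrite nm_pair ge_max hx.
have hf x (y : 'cV[C]_n) i : nm x <= rf -> nm y <= rf ->
    hs (fun u => c u i 0 * (x ^+ u.1 * \prod_(j < n) y j 0 ^+ u.2 j)) (f (x, y) i 0).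
  move=> hx hy; have := nq x y hx hy; rewrite lt_min => /andP[/h1/hs_has_sum h _].
  by apply: eq_hs (hs_entry i 0 h) => u; rewrite !mxE subr0 mulrC.
have nr : nm (RtoC rf : C) = rf by rewrite nm_RtoC ger0_norm // ltW.
have /choice[M hM] i : exists M, sbd (fun u : nat * mindex n => nm (c u i 0) * rf ^+ u.1 * wt (fun=> rf) u.2) M.
  have hy : nm (const_mx (RtoC rf) : 'cV[C]_n) <= rf.
    by apply: nm_mx_le => [|j l]; rewrite ?mxE ?nr // ltW.
  have hx : nm (RtoC rf : C) <= rf by rewrite nr.
  have [M hM] := hs_sbd (hf _ _ i hx hy); exists M.
  apply: sbd_le (lexx _) hM => u; rewrite nmM -mulrA; apply: ler_wpM2l; first exact: nm_ge0.
  rewrite nmM nmX nr nm_prod /wt le_eqVlt; apply/orP; left; apply/eqP; congr (_ * _).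
  by apply: eq_bigr => j _; rewrite mxE nmX nr.
exists rf, (\sum_i M i + 1), (fun i u => c u i 0); split=> //.
- by rewrite ltr_wpDl // sumr_ge0 // => i _; exact: sbd_ge0 (hM i).
- move=> x y hx hy; split=> [|i]; last exact: hf.
  by apply: h2; have := nq x y hx hy; rewrite lt_min => /andP[].
move=> i; apply: sbd_le (hM i) => //.
by rewrite (bigD1 i) //= -addrA lerDl addr_ge0 // sumr_ge0 // => j _; exact: sbd_ge0 (hM j).
Qed.

(** Row [s] has at most one nonzero entry, in column [s + 1]; [u] is defined on all of [nat] so that
    the last row is no exception. *)
Lemma superdiagonal_sum (n : nat) (Xi : 'M[C]_n) (u : nat -> R) (s : 'I_n) :
  (forall i j : 'I_n, j <> i.+1 :> nat -> Xi i j = 0) -> (forall i j, nm (Xi i j) <= 1) ->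
  (forall m, 0 <= u m) -> \sum_j nm (Xi s j) * u j <= u s.+1.
Proof.
move=> h0 h1 u0; case: (pickP (fun j : 'I_n => j == s.+1 :> nat)) => [j /eqP js|hj]; last first.
  by rewrite big1 // => j _; rewrite h0 ?nm0 ?mul0r // => /eqP; rewrite hj.
rewrite (bigD1 j) //= big1 ?addr0 => [|l lj]; first by rewrite js ler_piMl.
rewrite h0 ?nm0 ?mul0r // => ls; move/eqP: lj; apply; apply: val_inj; by rewrite /= ls js.
Qed.

(** Radii and bounds decrease geometrically in [i], so each superdiagonal entry gains a factor
    [kap]; terms containing [x] are made small by a large [q]. The source takes half of [B i], and
    three groups of other terms an eighth each. *)
Lemma weight_constants (n k : nat) (Xi : 'M[C]_n) (rf Mf d0 : R) : (0 < k)%N ->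
  (forall i j : 'I_n, j <> i.+1 :> nat -> Xi i j = 0) -> (forall i j, nm (Xi i j) <= 1) ->
  0 < rf -> 0 < Mf -> 0 < d0 ->
  exists (q wm : R) (w B : 'I_n -> R), [/\ 0 < q, 0 < wm, q^-1 <= rf,  wm <= rf & forall i, wm <= w i] /\
   [/\ forall i, 0 <= B i, forall i, w i + q^-1 * (d0 * B i) <= rf, forall i, q^-1 * (d0 * B i) <= wm / 8 &
    forall i, Mf + (\sum_s \sum_j nm (Xi s j) * (w j * (d0 / w s * B i)) + \sum_j nm (Xi i j) * (d0 * B j) +
     (q^-1 * (\sum_s (d0 / w s * B i) * B s) + k%:R^-1 * (q^-1 ^+ k * (d0 * B i)))) <= B i].
Proof.
move=> k_gt0 h0 h1 rf0 Mf0 d00.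
have n1 : 0 < n.+1%:R :> R by [].
pose kap := Num.min 1 (8 * n.+1%:R * d0)^-1.
have kap0 : 0 < kap by rewrite lt_min ltr01 invr_gt0 !mulr_gt0.
have kap1 : kap <= 1 by rewrite ge_min lexx.
have kapn : n.+1%:R * (kap * d0) <= 8^-1.
  apply: (@le_trans _ _ (n.+1%:R * ((8 * n.+1%:R * d0)^-1 * d0))).
    by rewrite ler_wpM2l // ler_wpM2r ?(ltW d00) // ge_min lexx orbT.
  by rewrite le_eqVlt; apply/orP; left; apply/eqP; field; rewrite !gt_eqF.
have kX m : 0 < kap ^+ m by exact: exprn_gt0.
have kX1 m : kap ^+ m <= 1 by apply: exprn_ile1 => //; exact: ltW.
have kXn m : (m <= n)%N -> kap ^+ n <= kap ^+ m.
  by move=> mn; rewrite -(subnK mn) exprD ler_piMl // ltW.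
pose rho := rf / 2.
have rho0 : 0 < rho by rewrite divr_gt0.
(* [kap ^+ n] is below every [kap ^+ i], so [Mf <= B0 * kap ^+ i / 2] for each component. *)
pose B0 := 2 * Mf / kap ^+ n.
have B00 : 0 < B0 by rewrite divr_gt0 // mulr_gt0.
have B0E : B0 * kap ^+ n = 2 * Mf by rewrite divfK // gt_eqF.
clearbody B0.
pose u m := B0 * kap ^+ m; pose v m := rho * kap ^+ m.
have u0 m : 0 < u m by rewrite mulr_gt0.
have v0 m : 0 < v m by rewrite mulr_gt0.
have uB m : u m <= B0 by rewrite ler_piMr // ltW.
pose wm := rho * kap ^+ n.
have wm0 : 0 < wm by rewrite mulr_gt0.
have wmv (i : 'I_n) : wm <= v i by apply: ler_wpM2l; [exact: ltW|apply: kXn; exact: ltnW].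
have wmr : wm <= rho by rewrite ler_piMr // ltW.
clearbody wm.
(* The bounds serve, in order: [nX ^+ k <= nX], convergence of [f] in [x], smallness of [nX * d0],
   and smallness of [nX * d0 * B0] relative to the least radius [wm]. *)
pose nX := Num.min (Num.min 1 rf) (Num.min (8 * d0)^-1 (wm / (8 * n.+1%:R * d0 * B0))).
have z1 : 0 < 8 * d0 by rewrite mulr_gt0.
have z2 : 0 < 8 * n.+1%:R * d0 * B0 by apply: mulr_gt0 => //; rewrite !mulr_gt0.
have nX0 : 0 < nX by rewrite !lt_min ltr01 rf0 invr_gt0 z1 (divr_gt0 wm0 z2).
have nX1 : nX <= 1 by rewrite !ge_min lexx.
have nXr : nX <= rf by rewrite !ge_min lexx orbT.
have nXd : nX * d0 <= 8^-1.
  apply: (@le_trans _ _ ((8 * d0)^-1 * d0)).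
    by rewrite ler_wpM2r ?(ltW d00) // !ge_min lexx ?orbT.
  by rewrite le_eqVlt; apply/orP; left; apply/eqP; field; rewrite gt_eqF.
have nXB : n.+1%:R * (nX * (d0 * B0)) <= wm / 8.
  apply: (@le_trans _ _ (n.+1%:R * (wm / (8 * n.+1%:R * d0 * B0) * (d0 * B0)))).
    by rewrite ler_wpM2l // ler_wpM2r ?mulr_ge0 ?(ltW d00) ?(ltW B00) // !ge_min lexx ?orbT.
  by rewrite le_eqVlt; apply/orP; left; apply/eqP; field; rewrite !gt_eqF.
have nXB1 m : nX * (d0 * u m) <= wm / 8.
  apply: le_trans nXB; apply: le_trans (_ : nX * (d0 * B0) <= _).
    by rewrite ler_wpM2l ?(ltW nX0) // ler_wpM2l ?(ltW d00).
  by rewrite ler_peMl ?ler1n // !mulr_ge0 // ltW.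
exists nX^-1, wm, (fun i : 'I_n => v i), (fun i : 'I_n => u i); rewrite invrK.
split; split=> //.
- by rewrite invr_gt0.
- by rewrite /rho in wmr; lra.
- by move=> i; exact: ltW.
- move=> i; have := nXB1 i; have : v i <= rho by rewrite ler_piMr // ltW.
  by rewrite /rho in wmr *; lra.
move=> i.
have ui := u0 i; have ui0 := ltW ui.
have bM : Mf <= u i / 2.
  have : B0 * kap ^+ n <= u i by apply: ler_wpM2l; [exact: ltW|apply: kXn; exact: ltnW].
  by rewrite B0E; lra.
have b1 : \sum_s \sum_j nm (Xi s j) * (v j * (d0 / v s * u i)) <= n%:R * (kap * d0) * u i.
  apply: (@le_trans _ _ (\sum_(s < n) (kap * d0 * u i))); last first.
    by rewrite big_const_ord iter_addr_0 -[_ *+ n]mulr_natl le_eqVlt; apply/orP; left; apply/eqP; ring.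
  apply: ler_sum => s _.
  apply: (@le_trans _ _ (v s.+1 * (d0 / v s * u i))).
    apply: (superdiagonal_sum s (u := fun m => v m * (d0 / v s * u i)) h0 h1) => m.
    by rewrite !mulr_ge0 ?invr_ge0 // ltW.
  rewrite /v exprSr le_eqVlt; apply/orP; left; apply/eqP; field.
  by rewrite !gt_eqF.
have b2 : \sum_j nm (Xi i j) * (d0 * u j) <= kap * d0 * u i.
  apply: (@le_trans _ _ (d0 * u i.+1)).
    apply: (superdiagonal_sum i (u := fun m => d0 * u m) h0 h1) => m.
    by rewrite mulr_ge0 // ltW.
  by rewrite /u exprSr le_eqVlt; apply/orP; left; apply/eqP; ring.
have b12 : n%:R * (kap * d0) * u i + kap * d0 * u i <= u i / 8.
  have -> : n%:R * (kap * d0) * u i + kap * d0 * u i = n.+1%:R * (kap * d0) * u i.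
    by rewrite -natr1; ring.
  by rewrite mulrC; apply: ler_wpM2l.
have b3 : nX * (\sum_(s < n) (d0 / v s * u i) * u s) <= u i / 8.
  apply: (@le_trans _ _ (nX * (\sum_(s < n) (d0 / wm * u i) * B0))).
    apply: ler_wpM2l; first exact: ltW.
    apply: ler_sum => s _; apply: ler_pM => //.
    - by apply: mulr_ge0 => //; apply: divr_ge0; exact: ltW.
    - exact: ltW.
    by rewrite ler_wpM2r // ler_wpM2l ?(ltW d00) // lef_pV2 ?posrE.
  rewrite big_const_ord iter_addr_0 -[_ *+ n]mulr_natl.
  rewrite [leLHS](_ : _ = n%:R * (nX * (d0 * B0)) * (u i / wm)); last by field; rewrite gt_eqF.
  apply: (@le_trans _ _ (wm / 8 * (u i / wm))).
    apply: ler_wpM2r; first by rewrite divr_ge0 // ltW.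
    apply: le_trans nXB; apply: ler_wpM2r; first by rewrite !mulr_ge0 // ltW.
    by rewrite ler_nat.
  by rewrite le_eqVlt; apply/orP; left; apply/eqP; field; rewrite gt_eqF.
have b4 : k%:R^-1 * (nX ^+ k * (d0 * u i)) <= u i / 8.
  have k1 : k%:R^-1 <= 1 :> R by rewrite invf_le1 ?ltr0n // ler1n.
  have nXk : nX ^+ k <= nX.
    by apply: ler_iXnr => //; exact: ltW.
  apply: (@le_trans _ _ (nX * (d0 * u i))).
    rewrite -[leRHS]mul1r; apply: ler_pM => //.
      by rewrite !mulr_ge0 ?exprn_ge0 // ltW.
    by apply: ler_wpM2r => //; rewrite mulr_ge0 // ltW.
  by rewrite mulrA [leRHS]mulrC; apply: ler_wpM2r.
lra.
Qed.

End Constants.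

(** * Neighbourhoods inside the domain *)

Section Near.
Variable R : realType.
Local Notation C := (Cx R).

Lemma nm_near (V : normedModType C) (a b : V) (e : R) : nm (b - a) < e - nm a -> nm b < e.
Proof. by move=> h; have := nmD a (b - a); rewrite subrKC; lra. Qed.

Lemma omega_nbhs k nu theta al (x0 : C) : omega k nu theta al x0 ->
  exists2 d : R, 0 < d & forall x, nm (x - x0) < d -> omega k nu theta al x.
Proof.
case=> hxn hxs; have x00 : x0 != 0 by case: hxs.
have nx0 : 0 < nm x0 by exact: nm_gt0.
have nx02 : 0 < nm x0 / 2 by rewrite divr_gt0.
have nxn : 0 < nu - nm x0 by rewrite subr_gt0 -nm_lt.
(* The sector joined with the disc of radius [nm x0 / 2] is open, and points close to [x0] avoid
   that disc, hence lie in the sector. *)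
have [d d0 hd] := @bdom_open R theta (al + pi / k%:R) (nm x0 / 2) x0 (or_introl hxs).
exists (Num.min d (Num.min (nm x0 / 2) (nu - nm x0))) => [|x]; first by rewrite !lt_min d0 nx02.
rewrite !lt_min => /and3P[v1 v2 v3]; split; first by rewrite nm_lt; exact: nm_near v3.
have [//|hb] := hd x v1.
by have := nmD (x0 - x) x; rewrite subrK nm_distC; lra.
Qed.

Lemma xze_near n (p : C * 'cV[C]_n) rho (G : C * 'cV[C]_n -> 'cV[C]_n) c e : 0 < rho ->
  (forall i, xze p rho (fun a => G a i 0) (c i)) -> nm (G p) < e ->
  exists2 d : R, 0 < d & forall a, nm (a - p) < d -> nm (G a) < e.
Proof.
move=> rho0 hG he; have ep : 0 < e - nm (G p) by rewrite subr_gt0.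
have /choice[d hd] i : exists d, 0 < d /\ forall a, nm (a - p) < d ->
    nm (G a i 0 - G p i 0) < e - nm (G p).
  have [K hK] := xze_lin rho0 (hG i).
  pose L := nm (c i (1%N, mzero n)) + \sum_s nm (c i (0%N, mone s)).
  have L0 : 0 <= L by rewrite addr_ge0 ?nm_ge0 // sumr_ge0 // => s _; exact: nm_ge0.
  have LK : 0 < L + `|K| * rho + 1 by rewrite ltr_wpDl // addr_ge0 // mulr_ge0 // ltW.
  exists (Num.min (rho / 2) ((e - nm (G p)) / (L + `|K| * rho + 1))); split.
    by rewrite lt_min !divr_gt0.
  move=> a; rewrite lt_min => /andP[a1 a2]; have := hK _ a1; rewrite pair_subKC => h.
  set w := a - p in a1 a2 h; have w0 := nm_ge0 w.
  have -> : G a i 0 - G p i 0 = (G a i 0 - (G p i 0 + xlin (c i) w)) + xlin (c i) w by ring.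
  move: a2; rewrite ltr_pdivlMr //; apply: le_lt_trans.
  apply: le_trans (nmD _ _) _; apply: le_trans (lerD h (nm_xlin _ _)) _; rewrite -/L.
  have : K * nm w ^+ 2 <= `|K| * rho * nm w.
    rewrite expr2 mulrA; apply: ler_wpM2r => //.
    apply: le_trans (ler_wpM2r w0 (ler_norm K)) _; apply: ler_wpM2l => //; lra.
  by clear -w0; lra.
exists (\big[Num.min/1]_i d i) => [|a ha].
  by apply: lt_bigmin => // i _; case: (hd i).
apply: (@nm_near _ (G p)); apply: nm_mx_lt => // i j; rewrite (ord1 j) mxE [X in _ + X]mxE.
by apply: (hd i).2; apply: lt_le_trans ha _; exact: bigmin_le.
Qed.

End Near.

(** Pure algebra: [x] times the transport equation plus the linear part is the conjugacy equation
    for [y = z + x p]. Here [d0] and [d] stand for the derivatives of [p i] in [x] and in [z], and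
    [v] for the field in [z]. *)
Lemma conjugacy_identity (K : fieldType) n (lam p g z d v y : 'I_n -> K) (Xi : 'M[K]_n)
    (x d0 F : K) i (k1 : K) k :
  (forall l, v l = lam l * z l + \sum_j Xi l j * z j + x * g l) ->
  (forall l, y l = z l + x * p l) ->
  k1 * x ^+ k.+1 * d0 = lam i * p i - \sum_s lam s * (z s * d s) +
    (F - (\sum_s \sum_j Xi s j * (z j * d s) + \sum_j - Xi i j * p j +
      (x * \sum_s d s * g s + k1 * (x ^+ k * p i)))) - g i ->
  k1 * x ^+ k.+1 * (x * d0 + p i) + (v i + x * \sum_s v s * d s) =
    lam i * y i + \sum_j Xi i j * y j + x * F.
Proof.
move=> hv hy; have -> : \sum_s v s * d s = \sum_s lam s * (z s * d s) +
    \sum_s \sum_j Xi s j * (z j * d s) + x * \sum_s d s * g s.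
  rewrite mulr_sumr -!big_split /=; apply: eq_bigr => s _.
  rewrite hv mulrDl mulrDl mulr_suml; congr (_ + _ + _); [by ring| |by ring].
  by apply: eq_bigr => l _; ring.
have -> : \sum_j Xi i j * y j = \sum_j Xi i j * z j + x * \sum_j Xi i j * p j.
  rewrite mulr_sumr -big_split /=; apply: eq_bigr => l _.
  by rewrite hy; ring.
have -> : \sum_j - Xi i j * p j = - \sum_j Xi i j * p j.
  by rewrite -sumrN; apply: eq_bigr => l _; rewrite mulNr.
rewrite hv hy; move: (\sum_s lam s * _) (\sum_s \sum_j _) (\sum_s d s * _) (\sum_j Xi i j * p j) => S1 S2 S3 S4 tr.
have -> : k1 * x ^+ k.+1 * (x * d0 + p i) = x * (k1 * x ^+ k.+1 * d0) + k1 * x ^+ k.+1 * p i by ring.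
by rewrite tr exprS; ring.
Qed.

Section Regroup.
Variable R : realType.
Variables (k : nat) (theta al rho0 q : R).
Hypothesis rho0_gt0 : 0 < rho0.
Hypothesis q_gt0 : 0 < q.
Variable n : nat.
Local Notation C := (Cx R).
Local Notation T := (nat * mindex n)%type.
Local Notation val := (val k theta al q).
Local Notation chix := (chix k theta al q).

(** Summing over the epsilon-degree at a fixed exponent of [z] yields the coefficients of the power
    series in [z]; an exponent at which the series vanishes keeps coefficient 0, which gives the
    near-resonant support of g. *)
Lemma val_regroup (w : 'I_n -> R) (F : T -> bel R) M : (forall i, 0 < w i) ->
  (forall t, bgood k (bdom theta al rho0) (q ^+ k) (F t)) -> sbd (fun t => bnv (F t) * wt w t.2) M ->
  exists gc : mindex n -> C -> C,
    (forall x (z : 'cV[C]_n), (forall i, nm (z i 0) <= w i) -> hs (fun j => gc j x * monom j z) (val F (x, z))) /\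
    forall j x, (forall m, F (m, j) = 0) -> gc j x = 0.
Proof.
move=> w0 gF hM.
have sj x j : exists s, hs (fun m => chix x (F (m, j))) s.
  have wj : 0 < wt w j by exact: wt_gt0.
  pose f (m : nat) : T := (m, j).
  have fi : injective f by move=> m m' [].
  have h := sbd_inj fi hM.
  have wj0 : 0 <= (wt w j)^-1 by rewrite invr_ge0 ltW.
  have [|s hs' _] := @hs_ex _ _ (fun m => chix x (F (m, j))) ((wt w j)^-1 * M); last by exists s.
  apply: sbd_le (lexx _) (sbdZ wj0 h) => m; rewrite mulrC mulfK ?gt_eqF //.
  exact: (chix_le rho0_gt0 q_gt0).
have /choice[gc0 hgc] := fun p : C * mindex n => sj p.1 p.2.
exists (fun j x => gc0 (x, j)); split=> [x z hz|j x hj]; last first.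
  apply: (hs_uniq (hgc (x, j))); apply: eq_hs (hs0 _ _) => m /=.
  by rewrite hj chix0.
have [hv _] := valP rho0_gt0 q_gt0 gF hM x hz.
pose a (u : mindex n * nat) : C := chix x (F (u.2, u.1)) * monom u.1 z.
have w0' i : 0 <= w i by exact: ltW.
have s1 : sbd (fun t : T => nm (chix x (F t) * monom t.2 z)) M.
  apply: sbd_le (lexx _) hM => t; rewrite nmM ler_pM ?nm_ge0 //; last exact: nm_monom.
  exact: (chix_le rho0_gt0 q_gt0).
have sa : sbd (fun u => nm (a u)) M.
  by apply: sbd_le (lexx _) (sbd_swap s1) => u; rewrite /a.
have ha : hs a (val F (x, z)).
  pose f (t : T) := (t.2, t.1).
  apply/(hs_inj (f := f)) => //.
  - by move=> [m j] [m' j'] [-> ->].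
  - by move=> [j m] h; case: (h (m, j)).
  - by apply: eq_hs hv => -[m j].
apply: (hs_pair sa ha) => j; rewrite /a /= mulrC.
by apply: eq_hs (hs_Ml (monom j z) (hgc (x, j))) => m; rewrite mulrC.
Qed.

End Regroup.

Theorem theorem2p1 (R : realType) (n k : nat) (n_gt0 : (0 < n)%N)
  (k_gt0 : (0 < k)%N)
  (U : set (Cx R * 'cV[Cx R]_n)) (U_open : open U) (U0 : U (0, 0))
  (f : Cx R * 'cV[Cx R]_n -> 'cV[Cx R]_n) (f_an : analytic_xz U f)
  (lam : 'rV[Cx R]_n) (lam_neq0 : forall i, lam 0 i != 0)
  (Xi : 'M[Cx R]_n)
  (Xi_off : forall i j : 'I_n, j <> i.+1 :> nat -> Xi i j = 0)
  (Xi_super : forall i j : 'I_n, j = i.+1 :> nat ->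
     (Xi i j = 0 \/ Xi i j = 1) /\ (Xi i j = 1 -> lam 0 j = lam 0 i))
  (c : R) (c_gt0 : 0 < c) (theta : R)
  (theta_ok : exists2 xi : R, 0 < xi &
     forall (i : 'I_n) (j : mindex n), ~ near_resonant c lam (i, j) ->
       ~ sector (k%:R * theta) xi (lam 0 i - dotm j lam)) :
  let A := diag_mx lam + Xi in
  exists r nu alpha : R,
    [/\ 0 < r, 0 < nu & 0 < alpha] /\
  exists phi g : Cx R * 'cV[Cx R]_n -> 'cV[Cx R]_n,
    let D := omega k nu theta alpha `*` Bn r in
    [/\ analytic_xz D phi /\ analytic_xz D g,
        (exists hphi, is_ksum_vec k r theta (omega k nu theta alpha) hphi phi)
        /\ (exists hg, is_ksum_vec k r theta (omega k nu theta alpha) hg g),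
        extends_to_closure D phi /\ extends_to_closure D g,
        exists gc : 'I_n -> mindex n -> Cx R -> Cx R,
          forall x z, omega k nu theta alpha x -> Bn r z -> forall i : 'I_n,
            has_sum (fun j => if (i, j) \in near_resonant c lam
                              then gc i j x * monom j z else 0) (g (x, z) i 0)
      & [/\ diffeo_on D (fibered phi),
            fibered phi @` D `<=` U,
            (exists nu' r' : R, [/\ 0 < nu', 0 < r' &
               omega k nu' theta alpha `*` Bn r' `<=` fibered phi @` D])
          & conjugates_on D (fibered phi) (vfield k A g) (vfield k A f)]].
Proof.
move=> A.
have Xi1 i j : nm (Xi i j) <= 1.
  have [ji|/eqP ji] := eqVneq (j : nat) i.+1; last by rewrite Xi_off // nm0.
  by have [[->|->] _] := Xi_super i j ji; rewrite ?nm0 ?nm1.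
have [al [rho0 [d0 [[al0 alpi kal] [rho00 d00 hnr]]]]] := nonresonance_constants k_gt0 c_gt0 theta_ok.
have [rf [Mf [cf [rf0 Mf0 hf hcf]]]] := expansion_at0 U_open U0 f_an.
have [q [wm [w [B [[q0 wm0 qrf wmrf wmw] [B0 wB nXB hB]]]]]] := weight_constants k_gt0 Xi_off Xi1 rf0 Mf0 d00.
pose res i j := (i, j) \in near_resonant c lam.
have w_gt0 i : 0 < w i by exact: lt_le_trans (wmw i).
have a_neq0 i j : ~~ res i j -> lam 0 i - dotm j lam != 0 by case/hnr.
have a_dlt i j : ~~ res i j -> 1 <= dlt d0 j * nm (lam 0 i - dotm j lam) by case/hnr.
have a_div i j : ~~ res i j -> forall y, bdom theta al rho0 y -> 1 <= dlt d0 j * nm (y ^+ k - (lam 0 i - dotm j lam)).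
  by case/hnr.
have qi0 : 0 < q^-1 by rewrite invr_gt0.
have dB0 i : 0 <= q^-1 * (d0 * B i) by rewrite !mulr_ge0 // ltW.
have nX_small i : q^-1 * (d0 * B i) <= w i / 2.
  by have := nXB i; have := wmw i; lra.
have hfc i : sbd (fun u : nat * mindex n => nm (cf i u) * q^-1 ^+ u.1 * wt (fun j => w j + q^-1 * (d0 * B j)) u.2) Mf.
  apply: sbd_le (lexx _) (hcf i) => u; rewrite -!mulrA; apply: ler_wpM2l; first exact: nm_ge0.
  apply: ler_pM; rewrite ?exprn_ge0 ?(ltW qi0) //.
  - by apply: wt_ge0 => j; rewrite addr_ge0 // ltW.
  - by apply: lerXn2r => //; rewrite nnegrE ltW.
  by apply: wt_le => j; rewrite wB andbT addr_ge0 // ltW.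
have [E hfix hE] := formal_solution k_gt0 rho00 q0 w_gt0 B0 d00 a_dlt a_div hfc hB.
pose sp := solphi k lam res d0 E; pose sg := solg res E.
have sP i : SN (@bnv R) (bgood k (bdom theta al rho0) (q ^+ k)) w (sp i) (d0 * B i).
  exact: (SN_solphi k_gt0 q0 w_gt0 d00 a_dlt a_div hE i).
have sG i : SN (@bnv R) (bgood k (bdom theta al rho0) (q ^+ k)) w (sg i) (B i).
  exact: (SN_solg k_gt0 q0 res w_gt0 hE i).
have gP i := (sP i).1; have mP i := (sP i).2; have gG i := (sG i).1; have mG i := (sG i).2.
have [Ps sI hI] := solution_inverse k_gt0 alpi rho00 q0 w_gt0 B0 d00 a_dlt a_div nX_small hE.
have gI i := (sI i).1; have mI i := (sI i).2.
pose sig := sin (k%:R * al / 16) : R.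
have sig0 : 0 < sig.
  by apply: sin_gt0_pi; rewrite !divr_gt0 ?mulr_gt0 ?ltr0n //=; have := pi_gt0 R; lra.
have mu0 : 0 < 2 * q by rewrite mulr_gt0.
(* [2 * q * nu] is [sig / 2 < 1], so its [k]-th power stays below the margin [sig] of
   [good_direction]. *)
pose nu := sig / 2 / (2 * q).
have nu0 : 0 < nu by rewrite !divr_gt0.
have nu_sig : (2 * q * nu) ^+ k < sig.
  have -> : 2 * q * nu = sig / 2 by rewrite /nu; field; rewrite gt_eqF.
  have s1 : sig <= 1 by exact: sin_le1.
  apply: le_lt_trans (_ : sig / 2 < _); last by clear -sig0; lra.
  by apply: ler_iXnr => //; clear -sig0 s1; lra.
have lip1 i : q^-1 * (d0 * B i / wm) <= 8^-1.
  by rewrite mulrA ler_pdivrMr // [leRHS]mulrC; exact: nXB.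
(* The map is used for [nm z < wm / 4] and its inverse for [nm y < wm / 2]; in both directions the
   displacement is at most [wm / 8]. *)
pose r := wm / 4; pose R' := wm / 2.
have r0 : 0 < r by rewrite divr_gt0.
have R'0 : 0 < R' by rewrite divr_gt0.
have rw i : r + R' <= w i by move: (wmw i); rewrite /r /R'; clear -wm0; lra.
have rw' i : r <= w i by apply: le_trans (rw i); rewrite lerDl ltW.
have Rw i : R' <= w i / 2 by rewrite ler_pM2r.
have R'rf : R' <= rf by move: wmrf; rewrite /R'; clear -wm0; lra.
(* Half of the opening is given up so that rays with a uniform margin reach even the closure of the
   domain. *)
exists r, nu, (al / 2); split; first by split=> //; rewrite divr_gt0.
pose phi := vecval k theta al q sp; pose g := vecval k theta al q sg.
exists phi, g => D.
have om_x x : omega k nu theta (al / 2) x -> xdom k theta al (2 * q) x.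
  exact: (omega_xdom k_gt0 al0 kal q0 nu0 nu_sig).
have BnP (z : 'cV[Cx R]_n) e : Bn e z <-> nm z < e by rewrite /Bn /= nm_lt.
have le_w (z : 'cV[Cx R]_n) e : nm z <= e -> (forall i, e <= w i) -> forall i, nm (z i 0) <= w i.
  by move=> ze ew i; apply: le_trans (nm_mx_entry _ _ _) (le_trans ze (ew i)).
have nmx x : xdom k theta al (2 * q) x -> nm x <= q^-1.
  move=> hx; rewrite -{1}(chixX k_gt0 alpi rho00 q0 (lexx _) hx).
  apply: (chix_le rho00 q0); exact: (bgoodX k_gt0 _ (exprn_gt0 _ q0) q0).
have bnd (F : 'I_n -> nat * mindex n -> bel R) a : xdom k theta al (2 * q) a.1 ->
    (forall i, nm (val k theta al q (F i) a) <= d0 * B i) -> nm (a.1 *: vecval k theta al q F a) <= wm / 8.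
  move=> hx hv; apply: nm_mx_le => [|i j]; first by rewrite divr_ge0 // ltW.
  rewrite !mxE nmM; apply: le_trans (nXB i).
  by apply: ler_pM; rewrite ?nm_ge0 // nmx.
have bphi x (z : 'cV[Cx R]_n) : xdom k theta al (2 * q) x -> (forall i, nm (z i 0) <= w i) -> nm (x *: phi (x, z)) <= wm / 8.
  move=> hx hz; apply: (bnd sp (x, z)) => // i.
  exact: (valP rho00 q0 (gP i) (mP i) x hz).2.
pose psi := vecval k theta al q Ps.
have bpsi x (y : 'cV[Cx R]_n) : xdom k theta al (2 * q) x -> (forall i, nm (y i 0) <= w i / 2) -> nm (x *: psi (x, y)) <= wm / 8.
  move=> hx hy; apply: (bnd Ps (x, y)) => // i.
  exact: (valP rho00 q0 (gI i) (mI i) x hy).2.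
have vks (F : 'I_n -> nat * mindex n -> bel R) M : (forall i t, bgood k (bdom theta al rho0) (q ^+ k) (F i t)) ->
    (forall i, sbd (fun t => bnv (F i t) * wt w t.2) (M i)) ->
    exists h, is_ksum_vec k r theta (omega k nu theta (al / 2)) h (vecval k theta al q F).
  move=> gF hM.
  have /choice[h hh] i := val_ksum k_gt0 al0 alpi kal rho00 q0 (gF i) (hM i) r0 rw' nu_sig.
  exists (fun l z => \col_i h i l z) => i; have := hh i.
  have -> : (fun l z => (\col_i h i l z) i 0) = h i.
    by apply/funext => l; apply/funext => z; rewrite mxE.
  have -> // : (fun a => vecval k theta al q F a i 0) = val k theta al q (F i).
  by apply/funext => a; rewrite mxE.
have nE (F : 'I_n -> nat * mindex n -> bel R) a i : vecval k theta al q F a i 0 = val k theta al q (F i) a by rewrite mxE.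
(* [y + x psi] is a right inverse of the fibered map, since [psi = - phi(x, y + x psi)] cancels the
   displacement. *)
have key1 x (y : 'cV[Cx R]_n) : xdom k theta al (2 * q) x -> nm y <= R' ->
    (forall i, nm ((y + x *: psi (x, y)) i 0) <= w i) /\
    fibered phi (x, y + x *: psi (x, y)) = (x, y).
  move=> hx hy; have hy' i : nm (y i 0) <= w i / 2.
    exact: le_trans (nm_mx_entry _ _ _) (le_trans hy (Rw i)).
  split.
    apply: (le_w _ wm _ wmw); apply: le_trans (nmD _ _) _.
    by move: (bpsi x y hx hy') hy; rewrite /R'; clear -wm0; lra.
  rewrite /fibered /=; congr pair; apply/matrixP => i j; rewrite (ord1 j) mxE [X in _ + X]mxE mxE [X in _ + X + _]mxE.
  by rewrite (nE Ps) (hI x y hx hy' i) mulrN (nE sp) subrK.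
(* Injectivity: [x phi] has Lipschitz constant at most [8^-1] in [z], so equal images force
   [nm (z - z') <= 8^-1 * nm (z - z')]. *)
have key2 x (z z' : 'cV[Cx R]_n) : xdom k theta al (2 * q) x -> (forall i, nm (z i 0) <= w i) -> (forall i, nm (z' i 0) <= w i) ->
    z + x *: phi (x, z) = z' + x *: phi (x, z') -> z = z'.
  move=> hx hz hz' e; have zz : z - z' = x *: (phi (x, z') - phi (x, z)).
    by apply/eqP; rewrite scalerBr -subr_eq0 opprB addrACA e addrACA !subrr addr0.
  have h : nm (z - z') <= 8^-1 * nm (z - z').
    rewrite {1}zz; apply: nm_mx_le => [|i j]; first by rewrite mulr_ge0 ?nm_ge0.
    rewrite !mxE nmM [nm (z - z')]nm_distC.
    have hL := solution_lipschitz k_gt0 rho00 q0 w_gt0 d00 a_dlt a_div hE x i wm0 wmw hz' hz.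
    apply: le_trans (ler_pM (nm_ge0 _) (nm_ge0 _) (nmx x hx) hL) _.
    rewrite mulrA; apply: ler_wpM2r; first exact: nm_ge0.
    exact: lip1.
  by apply/eqP; rewrite -subr_eq0; apply/eqP; apply: nm_eq0; move: h (nm_ge0 (z - z')); clear; lra.
have DP x (z : 'cV[Cx R]_n) : D (x, z) -> [/\ omega k nu theta (al / 2) x, nm z < r & forall i, nm (z i 0) <= w i].
  by case=> /= hx /BnP hz; split=> //; apply: (le_w z r) => //; exact: ltW.
have imP x (z : 'cV[Cx R]_n) : D (x, z) -> nm (z + x *: phi (x, z)) < R'.
  move=> /DP[hx hz hzw]; apply: le_lt_trans (nmD _ _) _.
  by move: (bphi x z (om_x x hx) hzw) hz; rewrite /r /R'; clear -wm0; lra.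
(* A right inverse of an injective map is also a left inverse. *)
have key3 x (z : 'cV[Cx R]_n) : D (x, z) -> fibered psi (fibered phi (x, z)) = (x, z).
  move=> hD; have [hx hz hzw] := DP x z hD; have hy := imP x z hD.
  have [h1 h2] := key1 x _ (om_x x hx) (ltW hy).
  rewrite /fibered /=; congr pair; apply: (key2 x _ _ (om_x x hx) h1 hzw).
  by have := congr1 snd h2.
(* The image is cut out by strict inequalities involving [psi]; openness of the image, analyticity
   of the inverse and the inclusion of a smaller domain are read from this description. *)
have imE x (y : 'cV[Cx R]_n) : (fibered phi @` D) (x, y) <-> [/\ omega k nu theta (al / 2) x, nm y < R' & nm (y + x *: psi (x, y)) < r].
  split=> [[[x1 z] hD [<- <-]]|[hx hy hz]].
    have [hx hz _] := DP x1 z hD; have hy := imP x1 z hD; split=> //.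
    by have := congr1 snd (key3 x1 z hD); rewrite /fibered /= => ->.
  exists (x, y + x *: psi (x, y)); first by split=> //; apply/BnP.
  by have [] := key1 x y (om_x x hx) (ltW hy).
have xI x (y : 'cV[Cx R]_n) : xdom k theta al (2 * q) x -> nm y < R' ->
    exists2 dl, 0 < dl & forall i, nm (y i 0) + dl <= w i / 2.
  move=> hx hy; exists (R' - nm y) => [|i]; first by rewrite subr_gt0.
  by apply: le_trans (Rw i); rewrite addrCA gerDl subr_le0; exact: nm_mx_entry.
split.
- split; first exact: (vecval_analytic k_gt0 alpi rho00 q0 gP mP om_x rw').
  exact: (vecval_analytic k_gt0 alpi rho00 q0 gG mG om_x rw').
- split; first exact: vks gP mP.
  exact: vks gG mG.
- split; first exact: (vec_extends k_gt0 al0 alpi kal rho00 q0 nu0 R'0 rw nu_sig gP mP).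
  exact: (vec_extends k_gt0 al0 alpi kal rho00 q0 nu0 R'0 rw nu_sig gG mG).
- have /choice[gc hgc] i := val_regroup rho00 q0 w_gt0 (gG i) (mG i).
  exists gc => x z hx /BnP hz i; apply/hs_has_sum.
  have hzw := le_w z r (ltW hz) rw'.
  rewrite [X in hs _ X](_ : _ = val k theta al q (sg i) (x, z)); last by rewrite mxE.
  apply: eq_hs ((hgc i).1 x z hzw) => j.
  (* Off the near-resonant set [resp] is zero in every epsilon-degree, so the regrouped coefficient
     vanishes. *)
  case: ifPn => // nr; rewrite (hgc i).2 ?mul0r // => m.
  by rewrite /sg /solg /resp /res /= (negPf nr).
split.
- split.
  + apply: (fibered_analytic k_gt0 alpi rho00 q0 gP mP) => -[x z] /DP[hx hz _] /=; split; first exact: om_x.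
    exists (r - nm z) => [|i]; first by rewrite subr_gt0.
    by apply: le_trans (rw' i); rewrite addrCA gerDl subr_le0; exact: nm_mx_entry.
  + rewrite openE => -[x0 y0] /imE[hx hy hz]; rewrite /interior.
    have hX0 := om_x x0 hx; have [dl dl0 hdl] := xI x0 y0 hX0 hy.
    have [Dp [rad rad0 hD] _] := vecval_xze k_gt0 alpi rho00 q0 gI mI dl0 hX0 hdl.
    have [h1 h2] := fibered_xze hD.
    have [d1 d10 hd1] := omega_nbhs hx.
    have [d2 d20 hd2] := xze_near rad0 (G := fun a => (fibered psi a).2) h2 hz.
    have dy : 0 < R' - nm y0 by rewrite subr_gt0.
    apply/(@nbhs_nmP R (Cx R * 'cV[Cx R]_n)%type); exists (Num.min d1 (Num.min d2 (R' - nm y0))) => [|[x y]].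
      by rewrite !lt_min d10 d20.
    rewrite !lt_min => /and3P[v1 v2 v3]; move: (v1); rewrite nm_pair gt_max => /andP[vx _].
    move: v3; rewrite nm_pair gt_max => /andP[_ vy].
    apply/imE; split; [exact: hd1|exact: nm_near vy|].
    exact: hd2 v2.
  exists (fibered psi); last by move=> [x z]; exact: key3.
  apply: (fibered_analytic k_gt0 alpi rho00 q0 gI mI) => -[x y] /imE[hx hy _] /=.
  by split; [exact: om_x|exact: xI x y (om_x x hx) hy].
- move=> [x y] /imE[hx hy _]; apply: (hf x y _ _).1.
    exact: le_trans (nmx x (om_x x hx)) qrf.
  by apply: le_trans (ltW hy) _; exact: R'rf.
(* A point with [nm y < wm / 8] is moved by at most [wm / 8], hence stays within [r = wm / 4]. *)
- exists nu, (wm / 8); split; rewrite ?divr_gt0 // => -[x y] [/= hx /BnP hy].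
  apply/imE; split=> //; first by move: hy; rewrite /R'; clear -wm0; lra.
  apply: le_lt_trans (nmD _ _) _.
  have hy' i : nm (y i 0) <= w i / 2.
    by apply: le_trans (nm_mx_entry _ _ _) _; move: (wmw i) hy; clear -wm0; lra.
  by move: (bpsi x y (om_x x hx) hy') hy; rewrite /r; clear -wm0; lra.
move=> [x z] hD; have [hx hz hzw] := DP x z hD.
have dl0 : 0 < r - nm z by rewrite subr_gt0.
have hdl i : nm (z i 0) + (r - nm z) <= w i.
  by apply: le_trans (rw' i); rewrite addrCA gerDl subr_le0; exact: nm_mx_entry.
have hX := om_x x hx.
have [Dp [rad rad0 hDp] hDq] := vecval_xze k_gt0 alpi rho00 q0 gP mP dl0 hX hdl.
have [h1 h2] := fibered_xze hDp.
(* The differential is read off the joint expansion, so the conjugacy reduces to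
   [conjugacy_identity] in each component. *)
have [dphi dE] := xze_diff rad0 h1 h2; split=> //; rewrite dE.
pose p i := val k theta al q (sp i) (x, z); pose gg i := val k theta al q (sg i) (x, z).
pose Fv i := f (x, z + x *: phi (x, z)) i 0.
have hF i : hs (fun u : nat * mindex n => cf i u * (x ^+ u.1 * \prod_(j < n) (z j 0 + x * p j) ^+ u.2 j)) (Fv i).
  have hxr := le_trans (nmx x hX) qrf.
  have hyr : nm (z + x *: phi (x, z)) <= rf.
    by apply: le_trans (ltW (imP x z hD)) _; exact: R'rf.
  apply: eq_hs ((hf x _ hxr hyr).2 i) => u; congr (_ * (_ * _)).
  by apply: eq_bigr => j _; rewrite !mxE.
have hDd i : hs (fun t => ldx k theta al q x (sp i t) * monom t.2 z) (k%:R^-1 * x ^+ k.+1 * Dp i (1%N, mzero n)) /\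
     forall s, hs (fun t => chix k theta al q x (sp i t) * ((t.2 s)%:R * (monom (msub t.2 (mone s)) z))) (Dp i (0%N, mone s)).
  by have [] := hDq i.
have trans := solution_transport k_gt0 alpi rho00 q0 w_gt0 d00 a_neq0 a_dlt a_div hfc hfix hE hX hzw hDd hF.
have AE (y : 'cV[Cx R]_n) i : (A *m y) i 0 = lam 0 i * y i 0 + \sum_j Xi i j * y j 0.
  by rewrite /A mulmxDl mul_diag_mx !mxE.
rewrite /xdiff /vfield xlin_fibc1 /=; congr pair.
apply/matrixP => i j; rewrite (ord1 j) mxE xlin_fibc2 /=.
have [_ _ ->] := hDq i.
rewrite [RHS]mxE AE [(x *: f _) i 0]mxE.
have pE l : (z + x *: phi (x, z)) l 0 = z l 0 + x * p l.
  by rewrite mxE [X in _ + X]mxE nE.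
have vE l : (A *m z + x *: g (x, z)) l 0 = lam 0 l * z l 0 + \sum_j Xi l j * z j 0 + x * gg l.
  by rewrite mxE AE [X in _ + X = _]mxE nE.
have -> : f (fibered phi (x, z)) i 0 = Fv i by [].
exact: (@conjugacy_identity (Cx R) n (lam 0) p gg (z^~ 0) (fun s => Dp i (0%N, mone s)) _ _ Xi x (Dp i (1%N, mzero n)) (Fv i) i k%:R^-1 k vE pE (trans i)).
Qed.
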